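(* Assume $F^1,\dots,F^k$ and $a$ are real-analytic. For every $\beta>0$ and every $u\in\mathcal{U}$ there exist $r>0$, $C>0$ and $\gamma\in(1,2]$ such that $$|\mathcal{F}^\beta(v)-\mathcal{F}^\beta(u)|\le C\,\|d_v\mathcal{F}^\beta\|_{\mathcal{U}^*}^\gamma$$ for every $v\in\mathcal{U}$ with $\|v-u\|_{L^2}<r$.
   Context: $F:\mathbb{R}^n\to\mathbb{R}^{n\times k}$ is globally Lipschitz with columns $F^1,\dots,F^k$; $x_0\in\mathbb{R}^n$ fixed; $\mathcal{U}=L^2([0,1],\mathbb{R}^k)$ with dual $\mathcal{U}^*$; $x_u$ solves $\dot x_u=F(x_u)u$, $x_u(0)=x_0$. $a:\mathbb{R}^n\to[0,\infty)$, $\mathcal{F}^\beta(u)=\frac12\|u\|_{L^2}^2+\beta a(x_u(1))$, and $d_v\mathcal{F}^\beta\in\mathcal{U}^*$ its differential at $v$. *)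

(* Defs.v *)
From HB Require Import structures.
From mathcomp Require Import all_boot all_order all_algebra.
From mathcomp Require Import all_classical all_reals all_analysis.
Set Implicit Arguments. Unset Strict Implicit. Unset Printing Implicit Defensive.
Import Order.TTheory GRing.Theory Num.Theory numFieldNormedType.Exports.
Local Open Scope classical_set_scope.
Local Open Scope ring_scope.

Section Defs.
Variable R : realType.
Local Notation mu := (@lebesgue_measure R).
Definition I01 : set R := `[0%R, 1%R].

(* Degree-d homogeneous part of the power series with coefficients c centred
   at x0, evaluated at y; [abs] selects the sum of absolute values. *)
Definition ps_term (n : nat) (c : {ffun 'I_n -> nat} -> R) (x0 y : 'rV[R]_n)
  (abs : bool) (d : nat) : R :=
  \sum_(al : {ffun 'I_n -> 'I_d.+1} | (\sum_i (al i : nat))%N == d)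
     (let t := c [ffun i => (al i : nat)] * \prod_i (y 0 i - x0 0 i) ^+ (al i)
      in if abs then `|t| else t).

Definition analytic_at (n : nat) (f : 'rV[R]_n -> R) (x0 : 'rV[R]_n) : Prop :=
  exists r : R, 0 < r /\ exists c : {ffun 'I_n -> nat} -> R,
    forall y : 'rV[R]_n, `|y - x0| < r ->
      cvgn (series (ps_term c x0 y true)) /\
      series (ps_term c x0 y false) @ \oo --> f y.

Definition real_analytic (n : nat) (f : 'rV[R]_n -> R) : Prop :=
  forall x0, analytic_at f x0.

Definition sqnorm_pt (k : nat) (u : R -> 'rV[R]_k) (t : R) : R :=
  \sum_(i < k) (u t 0 i) ^+ 2.

Definition inL2 (k : nat) (u : R -> 'rV[R]_k) : Prop :=
  (forall i, measurable_fun I01 (fun t => u t 0 i)) /\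
  (\int[mu]_(t in I01) (sqnorm_pt u t)%:E < +oo)%E.

Definition L2norm (k : nat) (u : R -> 'rV[R]_k) : R :=
  Num.sqrt (fine (\int[mu]_(t in I01) (sqnorm_pt u t)%:E)).

Definition is_solution (n k : nat) (F : 'rV[R]_n -> 'M[R]_(n, k))
  (x0 : 'rV[R]_n) (u : R -> 'rV[R]_k) (x : R -> 'rV[R]_n) : Prop :=
  {within I01, continuous x} /\
  forall i : 'I_n,
    mu.-integrable I01
      (fun s => (\sum_(j < k) F (x s) i j * u s 0 j)%:E) /\
    forall t, 0 <= t <= 1 ->
      x t 0 i = x0 0 i +
        Rintegral mu (`[0%R, t] : set R) (fun s => \sum_(j < k) F (x s) i j * u s 0 j).

Definition traj (n k : nat) (F : 'rV[R]_n -> 'M[R]_(n, k)) (x0 : 'rV[R]_n)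
  (u : R -> 'rV[R]_k) : R -> 'rV[R]_n :=
  xget (fun _ => x0) [set x | is_solution F x0 u x].

Definition cost (n k : nat) (F : 'rV[R]_n -> 'M[R]_(n, k)) (x0 : 'rV[R]_n)
  (a : 'rV[R]_n -> R) (beta : R) (u : R -> 'rV[R]_k) : R :=
  2^-1 * L2norm u ^+ 2 + beta * a (traj F x0 u 1).

Definition is_frechet_diff (k : nat) (J : (R -> 'rV[R]_k) -> R)
  (v : R -> 'rV[R]_k) (D : (R -> 'rV[R]_k) -> R) : Prop :=
  (forall (w1 w2 : R -> 'rV[R]_k) (a b : R), inL2 w1 -> inL2 w2 ->
     D (fun t => a *: w1 t + b *: w2 t) = a * D w1 + b * D w2) /\
  (exists M : R, forall w, inL2 w -> `|D w| <= M * L2norm w) /\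
  (forall eps : R, 0 < eps -> exists delta : R, 0 < delta /\
     forall w, inL2 w -> L2norm w < delta ->
       `|J (fun t => v t + w t) - J v - D w| <= eps * L2norm w).

Definition frechet_diff (k : nat) (J : (R -> 'rV[R]_k) -> R)
  (v : R -> 'rV[R]_k) : (R -> 'rV[R]_k) -> R :=
  xget (fun _ => 0) [set D | is_frechet_diff J v D].

Definition dual_norm (k : nat) (D : (R -> 'rV[R]_k) -> R) : R :=
  sup [set `|D w| | w in [set w | inL2 w /\ L2norm w <= 1]].

End Defs.

(* Main.v *)
(** Every function that occurs is handled through its convergent power series.
    A finite family of germs of analytic functions, pulled back along a
    sequence of local blow-ups, consists of monomials times units; following
    only the charts that contain a given sequence tending to 0 (along an
    ultrafilter) suffices to prove the Łojasiewicz inequality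
    |f - f(0)|^(N-1) <= C s^N, where s is a slope of f, i.e. a bound of its
    gradient that is expressed without derivatives.

    If d_u F <> 0, the norm of the differential is bounded below near u and the
    inequality is trivial.  If d_u F = 0, let p_v be the adjoint state of a
    nearby control v, so that the gradient is w = v + p_v F(x_v).  Up to a defect
    of order |w|, the pair (x_v, p_v) solves the Hamiltonian system with the
    initial condition (x_0, p_v(0)); let v' be the control of its exact
    solution.  Then |v - v'| <= C |w|, so the costs of v and v' differ by
    O(|w|^2), and the cost of v' is an analytic function g of the finitely many
    parameters p_v(0), whose slope is O(|w|) there.  The inequality for
    g yields gamma = N / (N - 1). *)
Require Import Defs.
From HB Require Import structures.
From mathcomp Require Import all_boot all_order all_algebra.
From mathcomp Require Import all_classical all_reals all_analysis.
From mathcomp Require Import measurable_realfun ring lra zify.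
Set Implicit Arguments. Unset Strict Implicit. Unset Printing Implicit Defensive.
Import Order.TTheory GRing.Theory Num.Theory numFieldNormedType.Exports.
Local Open Scope classical_set_scope.
Local Open Scope ring_scope.

(** * Convergent power series *)

(** The exponent in a Łojasiewicz inequality is not computed. If every exponent failed, some point
    [p j] would violate the exponent [j + 2] with constant [j + 1] within distance [1 / (j + 1)] of
    0; the monomial form of f gives one constant that serves all large exponents at once, which
    contradicts a single far index. Slopes are used instead of gradients because a chart is not
    invertible: a bound on increments is carried to the chart by its Lipschitz constant alone.

    In the control part the obstacle is that a control is unbounded in time. Lipschitz kernels of
    the trajectory and adjoint equations are merely square integrable, so every estimate is arranged
    to depend on the L2 norm of the control only. The finite-dimensional reduction comes from the
    critical equation u = - p F(x): it expresses u as a feedback in an autonomous analytic system,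
    whose initial state has p(0) as its only free part. The running cost is adjoined to that state,
    so that the cost becomes a function of the endpoint of one flow. Its error O(|w|^2) is absorbed
    because gamma <= 2 and |w| <= 1 near a critical control. *)

Section Analytic.
Variable R : realType.
Notation E := (nat -> R).

(* Points have infinitely many coordinates, which avoids dependent dimensions; a
   function of n variables is one that is analytic for a polyradius [wt n r]
   that vanishes beyond the first n coordinates. *)
Definition upd (x : E) (i : nat) (s : R) : E := fun j => if j == i then s else x j.

Lemma updE x i s j : upd x i s j = if j == i then s else x j. Proof. by []. Qed.

Lemma upd_id x i s : upd x i s i = s. Proof. by rewrite /upd eqxx. Qed.

Lemma upd_upd x i s t : upd (upd x i s) i t = upd x i t.
Proof. by apply/funext => j; rewrite /upd; case: eqP. Qed.

Lemma upd_same x i : upd x i (x i) = x.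
Proof. by apply/funext => j; rewrite /upd; case: eqP => [->|]. Qed.

Lemma upd0 i : upd (fun=> 0) i 0 = (fun=> 0).
Proof. by apply/funext => j; rewrite /upd; case: eqP. Qed.

Definition dom (rho : E) : set E := [set x | forall i, `|x i| <= rho i].

(* [An rho f M]: on the polydisc [dom rho] the function f is the sum of a power
   series whose coefficients, weighted by the polyradius, have l1-norm at most M. *)
Inductive An (rho : E) : (E -> R) -> R -> Prop :=
| An_cst c M : `|c| <= M -> An rho (fun=> c) M
| An_var i M : rho i <= M -> An rho (fun x => x i) M
| An_add f g M N : An rho f M -> An rho g N ->
    An rho (fun x => f x + g x) (M + N)
| An_mul f g M N : An rho f M -> An rho g N ->
    An rho (fun x => f x * g x) (M * N)
| An_lim (f_ : nat -> E -> R) (M_ : nat -> R) f M :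
    (forall k, An rho (f_ k) (M_ k)) -> (forall n, series M_ n <= M) ->
    (forall x, dom rho x -> series (f_ ^~ x) @ \oo --> f x) -> An rho f M.

Lemma dom0 rho : (forall i, 0 <= rho i) -> dom rho (fun=> 0).
Proof. by move=> h i; rewrite normr0. Qed.

Lemma dom_le rho sigma x : (forall i, rho i <= sigma i) -> dom rho x -> dom sigma x.
Proof. by move=> h dx i; apply: le_trans (h i). Qed.

Lemma dom_upd0 rho x i : (forall i, 0 <= rho i) -> dom rho x -> dom rho (upd x i 0).
Proof. by move=> r0 dx j; rewrite /upd; case: eqP; rewrite ?normr0. Qed.

Lemma series_le0 (M : R) (f M_ : nat -> R) l : (forall k, `|f k| <= M_ k) ->
  (forall n, series M_ n <= M) -> series f @ \oo --> l -> `|l| <= M.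
Proof.
move=> fM MM fl.
have nl : (fun n => `|series f n|) @ \oo --> `|l| by apply: cvg_norm.
rewrite -(cvg_lim _ nl)//; apply: limr_le; first by apply/cvg_ex; exists `|l|.
near=> n; apply: le_trans (MM n); rewrite /series /=.
by apply: le_trans (ler_norm_sum _ _ _) _; apply: ler_sum.
Unshelve. all: by end_near. Qed.

Lemma series_cvg_bound (f M_ : nat -> R) M : (forall k, `|f k| <= M_ k) ->
  (forall n, series M_ n <= M) -> cvgn (series f).
Proof.
move=> fM MM; apply: normed_cvg.
apply: (@series_le_cvg _ _ M_) => [n|n|n|]; [exact: normr_ge0| |exact: fM|].
  exact: le_trans (fM n).
apply: nondecreasing_is_cvgn.
  apply/nondecreasing_seqP => n; rewrite /series /= big_nat_recr//= lerDl.
  by apply: le_trans (fM n).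
by exists M => _ [n _ <-].
Qed.

Lemma series_lim_le (M_ : nat -> R) M : (forall k, 0 <= M_ k) ->
  (forall n, series M_ n <= M) ->
  limn (series M_) <= M /\ forall n, series M_ n <= limn (series M_).
Proof.
move=> M0 MM.
have c : cvgn (series M_) by apply: (@series_cvg_bound _ M_ M) => // k; rewrite ger0_norm.
split; first by apply: limr_le => //; near=> n.
move=> n; apply: nondecreasing_cvgn_le => //.
by apply/nondecreasing_seqP => k; rewrite /series /= big_nat_recr//= lerDl.
Unshelve. all: by end_near. Qed.

Section Weights.
Variable rho : E.
Hypothesis rho0 : forall i, 0 <= rho i.

Lemma An_bound f M : An rho f M -> forall x, dom rho x -> `|f x| <= M.
Proof.
elim=> {f M} [c M cM|i M iM|f g M N _ IHf _ IHg|f g M N _ IHf _ IHg|f_ M_ f M _ IH MM fl] x dx //.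
- by apply: le_trans iM.
- by apply: le_trans (ler_normD _ _) _; apply: lerD; [apply: IHf|apply: IHg].
- by rewrite normrM; apply: ler_pM => //; [apply: IHf|apply: IHg].
- by apply: (series_le0 (fun k => IH k x dx) MM); apply: fl.
Qed.

Lemma An_ge0 f M : An rho f M -> 0 <= M.
Proof. by move/An_bound/(_ _ (dom0 rho0)) => /(le_trans (normr_ge0 _)). Qed.

(** The limit constructor applied to the series f, 0, 0, ... does two things at once: it enlarges
    the bound, and it replaces f by any function that agrees with it on the polydisc. *)
Lemma An_eq f g M N : An rho f M -> M <= N -> (forall x, dom rho x -> f x = g x) -> An rho g N.
Proof.
move=> Af MN fg.
apply: (@An_lim _ (fun k => if k == 0%N then f else fun=> 0) (fun k => if k == 0%N then M else 0)).
- by case=> [|k] //=; apply: An_cst; rewrite normr0.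
- case=> [|n]; rewrite /series/=; first by rewrite big_geq//; apply: le_trans MN; apply: An_ge0 Af.
  by rewrite big_nat_recl//= big1 ?addr0.
- move=> x dx; rewrite -(fg x dx).
  apply: (@cvg_near_cst _ _ _ _ _); near=> n; rewrite /series/=.
  have [k ->] : exists k, n = k.+1 by exists n.-1; rewrite prednK//; near: n; exists 1%N.
  by rewrite big_nat_recl//= big1 ?addr0.
Unshelve. all: by end_near. Qed.

Lemma An_le f M N : An rho f M -> M <= N -> An rho f N.
Proof. by move=> Af MN; apply: (An_eq Af MN). Qed.

End Weights.

(** The weighted l1-norm is submultiplicative, so coordinates of weight [rho i] may be replaced by
    series of norm at most [rho i] without changing the bound. *)
Lemma An_comp rho sigma f M (g : nat -> E -> R) : (forall i, 0 <= rho i) ->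
  (forall i, 0 <= sigma i) -> An rho f M ->
  (forall i, An sigma (g i) (rho i)) -> An sigma (fun x => f (g^~ x)) M.
Proof.
move=> r0 s0 Af Ag.
elim: Af => {f M} [c M cM|i M iM|f g' M N _ IHf _ IHg|f g' M N _ IHf _ IHg|f_ M_ f M _ IH MM fl].
- exact: An_cst.
- exact: An_le iM.
- exact: An_add.
- exact: An_mul.
- apply: (@An_lim _ (fun k x => f_ k (g^~ x)) M_) => // x dx; apply: fl => i.
  exact: An_bound (Ag i) _ _.
Qed.

Lemma An_shrink rho sigma f M : (forall i, 0 <= sigma i) -> (forall i, sigma i <= rho i) ->
  An rho f M -> An sigma f M.
Proof.
move=> s0 sr Af; have := @An_comp rho sigma f M (fun i x => x i).
by apply=> // i; [apply: le_trans (sr i)|apply: An_var].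
Qed.

Lemma An_opp rho f M : An rho f M -> An rho (fun x => - f x) M.
Proof.
move=> Af; rewrite -[M]mul1r.
under eq_fun do rewrite -mulN1r.
by apply: An_mul => //; apply: An_cst; rewrite normrN normr1.
Qed.

Lemma An_scale rho c f M : An rho f M -> An rho (fun x => c * f x) (`|c| * M).
Proof. by move=> Af; apply: An_mul => //; apply: An_cst. Qed.

Lemma An_sum rho (I : Type) (r : seq I) (P : pred I) (f : I -> E -> R) (M : I -> R) :
  (forall i, P i -> An rho (f i) (M i)) ->
  An rho (fun x => \sum_(i <- r | P i) f i x) (\sum_(i <- r | P i) M i).
Proof.
move=> Af; elim: r => [|i r IH].
  under eq_fun do rewrite big_nil.
  by rewrite big_nil; apply: An_cst; rewrite normr0.
under eq_fun do rewrite big_cons; rewrite big_cons.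
by case: ifP => // Pi; apply: An_add => //; apply: Af.
Qed.

Lemma An_exp rho f M n : An rho f M -> An rho (fun x => f x ^+ n) (M ^+ n).
Proof.
move=> Af; elim: n => [|n IH].
  by under eq_fun do rewrite expr0; apply: An_cst; rewrite normr1.
by under eq_fun do rewrite exprS; rewrite exprS; apply: An_mul.
Qed.

Lemma An_prod rho (I : Type) (r : seq I) (P : pred I) (f : I -> E -> R) (M : I -> R) :
  (forall i, P i -> An rho (f i) (M i)) ->
  An rho (fun x => \prod_(i <- r | P i) f i x) (\prod_(i <- r | P i) M i).
Proof.
move=> Af; elim: r => [|i r IH].
  under eq_fun do rewrite big_nil.
  by rewrite big_nil; apply: An_cst; rewrite normr1.
under eq_fun do rewrite big_cons; rewrite big_cons.
by case: ifP => // Pi; apply: An_mul => //; apply: Af.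
Qed.

(* The bound [m0 + rho i * m1 <= M], rather than separate ones, is what makes
   the induction go through products. *)
Lemma hadamard rho i f M : (forall j, 0 <= rho j) -> 0 < rho i -> An rho f M ->
  exists (m0 m1 : R) (h : E -> R), [/\ m0 + rho i * m1 <= M, An rho (fun x => f (upd x i 0)) m0,
    An rho h m1 & forall x, dom rho x -> f x = f (upd x i 0) + x i * h x].
Proof.
move=> r0 ri Af.
elim: Af => {f M} [c M cM|j M jM|f g M N Af [f0 [f1 [hf [fb Af0 Ahf fE]]]] Ag [g0 [g1 [hg [gb Ag0 Ahg gE]]]]|f g M N Af [f0 [f1 [hf [fb Af0 Ahf fE]]]] Ag [g0 [g1 [hg [gb Ag0 Ahg gE]]]]|f_ M_ f M Af IH MM fl].
- exists M, 0, (fun=> 0); split.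
  + by rewrite mulr0 addr0.
  + exact: An_cst.
  + by apply: An_cst; rewrite normr0.
  + by move=> x _; rewrite mulr0 addr0.
- case: (eqVneq j i) => [ji|ji].
  + exists 0, 1, (fun=> 1); split.
    * by rewrite add0r mulr1 -ji.
    * under eq_fun do rewrite ji upd_id; by apply: An_cst; rewrite normr0.
    * by apply: An_cst; rewrite normr1.
    * by move=> x _; rewrite ji upd_id mulr1 add0r.
  + exists (rho j), 0, (fun=> 0); split.
    * by rewrite mulr0 addr0.
    * under eq_fun do rewrite updE (negbTE ji); exact: An_var.
    * by apply: An_cst; rewrite normr0.
    * by move=> x _; rewrite updE (negbTE ji) mulr0 addr0.
- exists (f0 + g0), (f1 + g1), (fun x => hf x + hg x); split.
  + by lra.
  + exact: An_add.
  + exact: An_add.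
  + by move=> x dx; rewrite {1}fE// {1}gE//; ring.
- exists (f0 * g0), (f1 * (g0 + rho i * g1) + f0 * g1),
    (fun x => hf x * (g (upd x i 0) + x i * hg x) + f (upd x i 0) * hg x); split.
  + have := An_ge0 r0 Af0; have := An_ge0 r0 Ag0; have := An_ge0 r0 Ahf; have := An_ge0 r0 Ahg.
    move=> ? ? ? ?.
    suff -> : f0 * g0 + rho i * (f1 * (g0 + rho i * g1) + f0 * g1) =
      (f0 + rho i * f1) * (g0 + rho i * g1).
      by apply: ler_pM => //; rewrite addr_ge0// mulr_ge0.
    by ring.
  + exact: An_mul.
  + apply: An_add; last exact: An_mul.
    by apply: An_mul => //; apply: An_add => //; apply: An_mul => //; apply: An_var.
  + by move=> x dx; rewrite {1}fE// {1}gE//; ring.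
- have /choice[m0 /choice[m1 /choice[h H]]] := IH.
  have m00 k : 0 <= m0 k by have [_ /(An_ge0 r0)] := H k.
  have m10 k : 0 <= m1 k by have [_ _ /(An_ge0 r0)] := H k.
  have mM n : series m0 n + rho i * series m1 n <= M.
    apply: le_trans (MM n); rewrite /series/= mulr_sumr -big_split/=.
    by apply: ler_sum => k _; have [] := H k.
  have s0 n : 0 <= series m0 n by rewrite /series/= sumr_ge0.
  have s1 n : 0 <= series m1 n by rewrite /series/= sumr_ge0.
  have m0M n : series m0 n <= M.
    by apply: le_trans (mM n); rewrite lerDl mulr_ge0.
  have m1M n : series m1 n <= M / rho i.
    by rewrite ler_pdivlMr// mulrC; apply: le_trans (mM n); rewrite lerDr.
  have c0 : cvgn (series m0) by apply: (series_cvg_bound _ m0M) => k; rewrite ger0_norm.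
  have c1 : cvgn (series m1) by apply: (series_cvg_bound _ m1M) => k; rewrite ger0_norm.
  have hc x : dom rho x -> cvgn (series (h ^~ x)).
    by move=> dx; apply: (series_cvg_bound _ m1M) => k; have [_ _ A _] := H k; exact: (An_bound A dx).
  exists (limn (series m0)), (limn (series m1)), (fun x => limn (series (h ^~ x))); split.
  + have c : (fun n => series m0 n + rho i * series m1 n) @ \oo -->
      limn (series m0) + rho i * limn (series m1).
      by apply: cvgD => //; apply: cvgMr.
    rewrite -(cvg_lim _ c)//; apply: limr_le; first by apply/cvg_ex; eexists; exact: c.
    by near=> n.
  + apply: (@An_lim _ (fun k x => f_ k (upd x i 0)) m0).
    * by move=> k; have [] := H k.
    * by have [] := series_lim_le m00 m0M.
    * by move=> x dx; apply: fl; apply: dom_upd0.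
  + apply: (@An_lim _ h m1) => //.
    * by move=> k; have [] := H k.
    * by have [] := series_lim_le m10 m1M.
  + move=> x dx; have fx := fl _ dx.
    have f0x := fl _ (dom_upd0 i r0 dx).
    have cc : (fun n => series (f_ ^~ (upd x i 0)) n + x i * series (h ^~ x) n) @ \oo -->
      f (upd x i 0) + x i * limn (series (h ^~ x)).
      by apply: cvgD => //; apply: cvgMr; apply: hc.
    rewrite -(cvg_lim _ cc)// -(cvg_lim _ fx)//; congr (lim (_ @ \oo)); apply/funext => n.
    rewrite /series/= mulr_sumr -big_split/=.
    by apply: eq_bigr => k _; have [_ _ _ ->] := H k.
Unshelve. all: by end_near. Qed.

End Analytic.

(** * Shrinking, difference estimates and a fixed point theorem for convergent power series *)

Section Analytic2.
Variable R : realType.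
Notation E := (nat -> R).

Definition scons (s : R) (x : E) : E := fun i => if i is j.+1 then x j else s.

(** A power series without constant term gains the factor t when the polyradius is scaled by t <= 1.
    This is how germs that vanish at 0 become small. The joint bound on [|f 0| + m] is what survives
    products. *)
Lemma An_center (rho : E) f M : (forall i, 0 <= rho i) -> An rho f M ->
  exists m : R, `|f (fun=> 0)| + m <= M /\
    forall t : R, 0 <= t <= 1 -> An (fun i => t * rho i) (fun x => f x - f (fun=> 0)) (t * m).
Proof.
move=> r0; set z : E := fun=> 0.
have tr0 (t : R) : 0 <= t <= 1 -> forall i, 0 <= t * rho i by move=> /andP[t0 _] i; rewrite mulr_ge0.
have base (t : R) g (c : R) : 0 <= t <= 1 -> An rho g c -> An (fun i => t * rho i) g c.
  move=> t01; apply: An_shrink; first exact: tr0.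
  by move=> i; case/andP: t01 => t0 t1; rewrite ler_piMl.
have pos g (c t : R) : 0 < t <= 1 -> An (fun i => t * rho i) g (t * c) -> 0 <= c.
  move=> /andP[t0 t1] /An_ge0 h; have := h (tr0 _ _); rewrite pmulr_rge0//; apply.
  by rewrite (ltW t0).
have t1 : 0 < (1:R) <= 1 by rewrite lexx andbT ltr01.
have t1' : 0 <= (1:R) <= 1 by rewrite lexx andbT ler01.
elim=> {f M} [c M cM|j M jM|f g M N Af [m [fb Hf]] Ag [k [gb Hg]]|f g M N Af [m [fb Hf]] Ag [k [gb Hg]]|f_ M_ f M Af IH MM fl].
- exists 0; rewrite addr0; split=> // t _; rewrite subrr mulr0.
  by apply: An_cst; rewrite normr0.
- exists M; rewrite /z normr0 add0r; split=> // t /andP[t0 _].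
  rewrite (_ : (fun x => _) = (fun x => x j)); last by apply/funext => x; rewrite subr0.
  by apply: An_var; apply: ler_wpM2l.
- exists (m + k); split.
    by apply: le_trans (lerD fb gb); have := ler_normD (f z) (g z); lra.
  move=> t t01; rewrite mulrDr.
  rewrite (_ : (fun x => _) = (fun x => (f x - f z) + (g x - g z))).
    by apply: An_add; [apply: Hf|apply: Hg].
  by apply/funext => x; ring.
- have m0 := pos _ _ _ t1 (Hf _ t1'); have k0 := pos _ _ _ t1 (Hg _ t1').
  exists (m * k + (`|f z| * k + `|g z| * m)); split.
    rewrite normrM; apply: le_trans (_ : (`|f z| + m) * (`|g z| + k) <= _); first by lra.
    by apply: ler_pM => //; rewrite addr_ge0.
  move=> t t01.
  have -> : (fun x => f x * g x - f z * g z) = (fun x => (f x - f z) * (g x - g z) +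
     (f z * (g x - g z) + g z * (f x - f z))).
    by apply/funext => x; ring.
  have tt := tr0 _ t01; case/andP: (t01) => tge0 tle1.
  apply: (@An_le _ _ tt _ ((t * m) * (t * k) + (`|f z| * (t * k) + `|g z| * (t * m)))).
    apply: An_add; first by apply: An_mul; [apply: Hf|apply: Hg].
    by apply: An_add; apply: An_scale; [apply: Hg|apply: Hf].
  suff : t * m * (t * k) <= t * (m * k) by lra.
  rewrite -mulrA; apply: ler_wpM2l => //; rewrite mulrCA.
  by apply: ler_piMl => //; rewrite mulr_ge0.
- have /choice[m H] := IH.
  have m0 k : 0 <= m k by have [_ h] := H k; apply: (pos _ _ _ t1 (h _ t1')).
  have mM n : series (fun k => `|f_ k z|) n + series m n <= M.
    apply: le_trans (MM n); rewrite /series/= -big_split/=.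
    by apply: ler_sum => k _; have [] := H k.
  have s0 n : 0 <= series m n by rewrite /series/= sumr_ge0.
  have s1 n : 0 <= series (fun k => `|f_ k z|) n by rewrite /series/= sumr_ge0.
  have mM' n : series m n <= M by apply: le_trans (mM n); rewrite lerDr.
  have fM' n : series (fun k => `|f_ k z|) n <= M by apply: le_trans (mM n); rewrite lerDl.
  have cm : cvgn (series m) by apply: (series_cvg_bound _ mM') => k; rewrite ger0_norm.
  have cf : cvgn (series (fun k => `|f_ k z|)).
    by apply: (series_cvg_bound _ fM') => k; rewrite normr_id.
  have [l1 l2] := series_lim_le m0 mM'.
  exists (limn (series m)); split.
    apply: (@le_trans _ _ (limn (series (fun k => `|f_ k z|)) + limn (series m))).
      rewrite lerD2r; apply: (@series_le0 _ _ (f_ ^~ z) (fun k => `|f_ k z|)) => //.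
        by have [] := @series_lim_le _ (fun k => `|f_ k z|) M (fun=> normr_ge0 _) fM'.
      by apply: fl; apply: dom0.
    have c : (fun n => series (fun k => `|f_ k z|) n + series m n) @ \oo -->
      limn (series (fun k => `|f_ k z|)) + limn (series m) by apply: cvgD.
    rewrite -(cvg_lim _ c)//; apply: limr_le; first by apply/cvg_ex; eexists; exact: c.
    by near=> n; apply: mM.
  move=> t t01; have [t0 _] := andP t01.
  apply: (@An_lim _ _ (fun k x => f_ k x - f_ k z) (fun k => t * m k)).
  + by move=> k; have [_] := H k; apply.
  + by move=> n; rewrite /series/= -mulr_sumr; apply: ler_wpM2l => //; apply: l2.
  + move=> x dx.
    have dx' : dom rho x.
      apply: dom_le dx => i; case/andP: t01 => _ tle; by rewrite ler_piMl.
    rewrite (_ : series _ = (fun n => series (f_ ^~ x) n - series (f_ ^~ z) n)).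
      by apply: cvgB; apply: fl => //; apply: dom0.
    by apply/funext => n; rewrite /series/= -sumrB.
Unshelve. all: by end_near. Qed.

(* Apply [hadamard] to s |-> f (Y' + s (Y - Y')), an analytic function on the disc of radius 1/d. *)
Lemma An_diff (rho omega sigma e : E) f M (d : R) (Y Y' : nat -> E -> R) :
  (forall i, 0 <= rho i) -> (forall i, 0 <= omega i) -> An rho f M -> 0 < d -> d <= 1 ->
  (forall i, An omega (Y i) (sigma i)) -> (forall i, An omega (Y' i) (sigma i)) ->
  (forall i, An omega (fun x => Y i x - Y' i x) (e i)) ->
  (forall i, sigma i + e i / d <= rho i) ->
  An omega (fun x => f (Y^~ x) - f (Y'^~ x)) (M * d).
Proof.
move=> r0 o0 Af d0 d1 AY AY' AD se.
pose om := scons d^-1 omega.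
have om0 i : 0 <= om i by case: i => [|i] //=; rewrite invr_ge0 ltW.
have shift g m : An omega g m -> An om (fun x => g (fun j => x j.+1)) m.
  move=> Ag; have := @An_comp _ omega om g m (fun j x => x j.+1) o0 om0 Ag; apply.
  by move=> i; apply: An_var.
pose Z i (x : E) := Y' i (fun j => x j.+1) + x 0%N * (Y i (fun j => x j.+1) - Y' i (fun j => x j.+1)).
have AZ i : An om (Z i) (rho i).
  apply: (An_le om0 _ (se i)); apply: An_add; first exact: shift.
  rewrite mulrC; apply: An_mul; first by apply: An_var.
  exact: (shift (fun x => Y i x - Y' i x)).
have AfZ : An om (fun x => f (Z^~ x)) M by apply: (An_comp r0).
have om00 : 0 < om 0%N by rewrite /= invr_gt0.
have [m0 [m1 [h [hM Am0 Ah hE]]]] := hadamard om0 om00 AfZ.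
have m00 := An_ge0 om0 Am0.
have m1M : m1 <= M * d.
  rewrite -ler_pdivrMr// mulrC; apply: le_trans hM; by rewrite lerDr.
have Ah1 : An omega (fun x => h (scons 1 x)) m1.
  have := @An_comp _ om omega h m1 (fun i x => scons 1 x i) om0 o0 Ah; apply.
  case=> [|i] /=; first by apply: An_cst; rewrite normr1 invf_ge1.
  exact: An_var.
apply: (An_eq o0 Ah1 m1M) => x dx.
have ds : dom om (scons 1 x).
  case=> [|i] /=; last exact: dx.
  by rewrite normr1 invf_ge1.
have ZY : Z^~ (scons 1 x) = Y^~ x.
  by apply/funext => i; rewrite /Z/= mul1r addrC subrK.
have ZY' : Z^~ (upd (scons 1 x) 0 0) = Y'^~ x.
  by apply/funext => i; rewrite /Z/= mul0r addr0.
by have := hE _ ds; rewrite ZY ZY' /= mul1r => ->; ring.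
Qed.

(** Points are constant functions, so this is [An_diff] over the zero polyradius. *)
Lemma An_lipschitz (rho sigma : E) f M d x y :
  (forall i, 0 <= rho i) -> An rho f M -> 0 < d -> d <= 1 ->
  dom sigma x -> dom sigma y -> (forall i, sigma i + `|x i - y i| / d <= rho i) ->
  `|f x - f y| <= M * d.
Proof.
move=> r0 Af d0 d1 dx dy h.
have o0 (i : nat) : 0 <= (fun=> 0 : R) i by [].
have := @An_diff rho (fun=> 0) sigma (fun i => `|x i - y i|) f M d (fun i _ => x i) (fun i _ => y i) r0 o0 Af d0 d1.
move=> H; have /(An_bound)/(_ (fun=> 0)) : An (fun=> 0) (fun=> f x - f y) (M * d).
  by apply: H => // i; apply: An_cst.
by apply; apply: dom0.
Qed.

(** Banach's fixed point theorem in the power series norm. The increments of the iteration are at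
    most [eta / 2 ^ k], for k = 1, 2, ..., so all iterates stay below [eta] and the limit is again a
    convergent power series. *)
Lemma An_fixpoint (omega : E) (Phi : (nat -> E -> R) -> nat -> E -> R) (eta : R) :
  (forall i, 0 <= omega i) -> 0 < eta ->
  (forall Y Y' (d : R), 0 < d -> d <= eta -> (forall i, An omega (Y i) eta) ->
     (forall i, An omega (Y' i) eta) -> (forall i, An omega (fun x => Y i x - Y' i x) d) ->
     forall i, An omega (fun x => Phi Y i x - Phi Y' i x) (d / 2)) ->
  (forall i, An omega (Phi (fun _ _ => 0) i) (eta / 2)) ->
  exists Z : nat -> E -> R, (forall i, An omega (Z i) eta) /\
    forall i x, dom omega x -> Z i x = Phi Z i x.
Proof.
move=> o0 e0 HPhi HPhi0.
pose Y k := iter k Phi (fun _ _ => 0).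
pose b k : R := eta / 2 ^+ k.
have b0 k : 0 < b k by rewrite divr_gt0// exprn_gt0.
have bS k : b k.+1 = b k / 2 by rewrite /b exprS; field.
have be k : b k <= eta.
  by rewrite ler_pdivrMr ?exprn_gt0// ler_peMr ?(ltW e0)// exprn_ege1// ler1n.
have HY k : (forall i, An omega (Y k i) (eta - b k)) /\
            (forall i, An omega (fun x => Y k.+1 i x - Y k i x) (b k.+1)).
  elim: k => [|k [IH1 IH2]].
    split=> i; first by apply: An_cst; rewrite normr0 /b expr0 divr1 subrr.
    rewrite /Y/= /b expr1; under eq_fun do rewrite subr0; exact: HPhi0.
  have IH1' i : An omega (Y k.+1 i) (eta - b k.+1).
    apply: (@An_eq _ _ o0 (fun x => Y k i x + (Y k.+1 i x - Y k i x)) _ (eta - b k + b k.+1)).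
    - exact: An_add.
    - by rewrite bS; lra.
    - by move=> x _; rewrite addrC subrK.
  split=> // i; rewrite bS.
  have h j l : An omega (Y l j) (eta - b l) -> An omega (Y l j) eta.
    by move=> A; apply: (An_le o0 A); have := b0 l; lra.
  by apply: (HPhi (Y k.+1) (Y k)) => // j; [apply: (h _ k.+1)|apply: (h _ k)].
have sS (u : nat -> R) n : series u n.+1 = series u n + u n by rewrite /series/= big_nat_recr.
have sO (u : nat -> R) : series u 0%N = 0 by rewrite /series/= big_geq.
have serD i x k : series (fun k => Y k.+1 i x - Y k i x) k = Y k i x.
  by elim: k => [|k IH]; rewrite ?sO// sS IH addrC subrK.
have serb k n : series (fun l => b (k + l)%N.+1) n = b k - b (k + n)%N.
  elim: n => [|n IH]; first by rewrite sO addn0 subrr.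
  by rewrite sS IH addnS bS; lra.
pose Z i x := limn (fun k => Y k i x).
have cY i x : dom omega x -> (fun k => Y k i x) @ \oo --> Z i x.
  move=> dx; rewrite /Z; suff : cvgn (series (fun k => Y k.+1 i x - Y k i x)).
    by rewrite (_ : series _ = (fun k => Y k i x))//; apply/funext => k.
  apply: (@series_cvg_bound _ _ (fun l => b (0 + l)%N.+1) eta).
    by move=> k; have [_ /(_ i)/An_bound] := HY k; apply.
  by move=> n; rewrite serb; have := b0 n; rewrite /b expr0 divr1 add0n; lra.
have AZY k i : An omega (fun x => Z i x - Y k i x) (b k).
  apply: (@An_lim _ _ (fun l x => Y (k + l)%N.+1 i x - Y (k + l)%N i x) (fun l => b (k + l)%N.+1)).
  - by move=> l; have [_] := HY (k + l)%N.
  - by move=> n; rewrite serb; have := b0 (k + n)%N; lra.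
  - move=> x dx.
    rewrite (_ : series _ = (fun n => Y (n + k)%N i x - Y k i x)).
      apply: cvgB; last exact: cvg_cst.
      by have := cY i x dx; rewrite -(cvg_shiftn k).
    apply/funext => n; elim: n => [|n IH].
      by rewrite sO add0n subrr.
    by rewrite sS IH (addnC k n) addSn; ring.
have AZ i : An omega (Z i) eta.
  have := AZY 0%N i; rewrite /b expr0 divr1 /Y/=.
  by under eq_fun do rewrite subr0.
exists Z; split=> // i x dx.
apply/eqP; rewrite -subr_eq0 -normr_le0; apply/ler_addgt0Pr => eps eps0; rewrite add0r.
have [k kP] : exists k, b k <= eps.
  have : b @ \oo --> eta * 0.
    apply: cvgM; first exact: cvg_cst.
    rewrite (_ : (fun k => _) = (fun k => (2^-1) ^+ k)).
      by apply: cvg_expr; rewrite ger0_norm ?invr_ge0// invf_lt1// ltr1n.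
    by apply/funext => k; rewrite exprVn.
  rewrite mulr0 => /cvgrPdist_le/(_ _ eps0)[k _ /(_ k (leqnn k))] /=.
  by rewrite sub0r normrN ger0_norm ?(ltW (b0 k))// => ?; exists k.
apply: le_trans kP.
have AY j : An omega (Y k j) eta.
  by have [/(_ j) A _] := HY k; apply: (An_le o0 A); have := b0 k; lra.
have /(_ i)/An_bound/(_ x dx) h1 := HPhi _ _ _ (b0 k) (be k) AZ AY (AZY k).
have /An_bound/(_ x dx) h2 := AZY k.+1 i.
have -> : Z i x - Phi Z i x = (Z i x - Y k.+1 i x) - (Phi Z i x - Phi (Y k) i x).
  by rewrite /Y/=; ring.
apply: le_trans (ler_normB _ _) _; apply: le_trans (lerD h2 h1) _.
by rewrite bS; lra.
Qed.

End Analytic2.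

(** * Germs of analytic functions at 0, substitution and Taylor expansion *)

Section Germs.
Variable R : realType.
Notation E := (nat -> R).

Definition wt (n : nat) (r : R) : E := fun i => if (i < n)%N then r else 0.

Definition germ (n : nat) (f : E -> R) : Prop :=
  exists r M : R, 0 < r /\ An (wt n r) f M.

(** Neighbourhoods of 0 in the space of the first n coordinates: since [wt n r] vanishes beyond n,
    near points have all other coordinates equal to 0. *)
Definition nb (n : nat) : set_system E :=
  [set P | exists2 r : R, 0 < r & dom (wt n r) `<=` P].

Lemma wt_ge0 n r : 0 <= r -> forall i, 0 <= wt n r i.
Proof. by move=> r0 i; rewrite /wt; case: ifP. Qed.

Lemma wt_le n r s : r <= s -> forall i, wt n r i <= wt n s i.
Proof. by move=> rs i; rewrite /wt; case: ifP. Qed.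

Lemma dom_wt_le n r s x : r <= s -> dom (wt n r) x -> dom (wt n s) x.
Proof. by move=> rs; apply: dom_le; apply: wt_le. Qed.

Global Instance nb_filter n : ProperFilter (nb n).
Proof.
split.
  by case=> r r0 /(_ (fun=> 0)); apply; apply: dom0; apply/wt_ge0/ltW.
split.
- by exists 1.
- move=> P Q [r r0 rP] [s s0 sQ]; exists (Num.min r s); first by rewrite lt_min r0 s0.
  move=> x dx; split; [apply: rP|apply: sQ]; apply: dom_wt_le dx.
    by rewrite ge_min lexx.
  by rewrite ge_min lexx orbT.
- by move=> P Q PQ [r r0 rP]; exists r => // x /rP /PQ.
Qed.

Lemma nb0 n (P : set E) : nb n P -> P (fun=> 0).
Proof. by case=> r r0; apply; apply: dom0; apply/wt_ge0/ltW. Qed.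

Lemma near_supp n : \forall x \near nb n, forall i, (n <= i)%N -> x i = 0.
Proof.
exists 1 => // x dx i ni; apply/eqP; rewrite -normr_le0.
by have := dx i; rewrite /wt ltnNge ni.
Qed.

Lemma near_small n (e : R) : 0 < e -> \forall x \near nb n, forall i, `|x i| <= e.
Proof.
move=> e0; exists e => // x dx i; apply: le_trans (dx i) _.
by rewrite /wt; case: ifP => // _; apply: ltW.
Qed.

Lemma germP n f : germ n f ->
  exists r M : R, 0 < r /\ forall s : R, 0 <= s <= r -> An (wt n s) f M.
Proof.
move=> [r [M [r0 A]]]; exists r, M; split=> // s /andP[s0 sr].
by apply: An_shrink A; [apply: wt_ge0|apply: wt_le].
Qed.

Lemma germ2 n f g : germ n f -> germ n g ->
  exists r M N : R, [/\ 0 < r, An (wt n r) f M & An (wt n r) g N].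
Proof.
move=> /germP[r [M [r0 Af]]] /germP[s [N [s0 Ag]]].
have m0 : 0 < Num.min r s by rewrite lt_min r0 s0.
exists (Num.min r s), M, N; split=> //.
  by apply: Af; rewrite (ltW m0) ge_min lexx.
by apply: Ag; rewrite (ltW m0) ge_min lexx orbT.
Qed.

Lemma germ_cst n c : germ n (fun=> c).
Proof. by exists 1, `|c|; split=> //; apply: An_cst. Qed.

Lemma germ_var n i : germ n (fun x => x i).
Proof. by exists 1, (wt n 1 i); split=> //; apply: An_var. Qed.

Lemma germ_add n f g : germ n f -> germ n g -> germ n (fun x => f x + g x).
Proof.
by move=> gf gg; have [r [M [N [r0 A B]]]] := germ2 gf gg; exists r, (M + N); split=> //; apply: An_add.
Qed.

Lemma germ_mul n f g : germ n f -> germ n g -> germ n (fun x => f x * g x).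
Proof.
by move=> gf gg; have [r [M [N [r0 A B]]]] := germ2 gf gg; exists r, (M * N); split=> //; apply: An_mul.
Qed.

Lemma germ_opp n f : germ n f -> germ n (fun x => - f x).
Proof. by move=> [r [M [r0 A]]]; exists r, M; split=> //; apply: An_opp. Qed.

Lemma germ_sub n f g : germ n f -> germ n g -> germ n (fun x => f x - g x).
Proof. by move=> gf gg; apply: germ_add => //; apply: germ_opp. Qed.

Lemma germ_exp n f k : germ n f -> germ n (fun x => f x ^+ k).
Proof. by move=> [r [M [r0 A]]]; exists r, (M ^+ k); split=> //; apply: An_exp. Qed.

Lemma germ_sum n (I : Type) (r : seq I) (P : pred I) (f : I -> E -> R) :
  (forall i, P i -> germ n (f i)) -> germ n (fun x => \sum_(i <- r | P i) f i x).
Proof.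
move=> gf; elim: r => [|i r IH].
  by under eq_fun do rewrite big_nil; apply: germ_cst.
under eq_fun do rewrite big_cons.
by case Pi: (P i) => //; apply: germ_add => //; apply: gf.
Qed.

Lemma germ_prod n (I : Type) (r : seq I) (P : pred I) (f : I -> E -> R) :
  (forall i, P i -> germ n (f i)) -> germ n (fun x => \prod_(i <- r | P i) f i x).
Proof.
move=> gf; elim: r => [|i r IH].
  by under eq_fun do rewrite big_nil; apply: germ_cst.
under eq_fun do rewrite big_cons.
by case Pi: (P i) => //; apply: germ_mul => //; apply: gf.
Qed.

Lemma germ_eq n f g : germ n f -> (\forall x \near nb n, f x = g x) -> germ n g.
Proof.
move=> /germP[r [M [r0 Af]]] [s s0 fg].
have m0 : 0 < Num.min r s by rewrite lt_min r0 s0.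
exists (Num.min r s), M; split=> //.
apply: (An_eq (wt_ge0 n (ltW m0)) _ (lexx M)).
  by apply: Af; rewrite (ltW m0) ge_min lexx.
by move=> x dx; apply: fg; apply: dom_wt_le dx; rewrite ge_min lexx orbT.
Qed.

Lemma germ_small n f (e : R) : germ n f -> 0 < e -> exists r : R, 0 < r /\
  forall s : R, 0 <= s <= r -> An (wt n s) (fun x => f x - f (fun=> 0)) e.
Proof.
move=> [r [M [r0 A]]] e0.
have [m [_ H]] := An_center (wt_ge0 n (ltW r0)) A.
pose t := Num.min 1 (e / (`|m| + 1)).
have m1 : 0 < `|m| + 1 by rewrite ltr_wpDl.
have t0 : 0 < t by rewrite lt_min ltr01/= divr_gt0.
have t1 : 0 <= t <= 1 by rewrite (ltW t0)/= ge_min lexx.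
have wE : (fun i => t * wt n r i) = wt n (t * r).
  by apply/funext => i; rewrite /wt; case: ifP; rewrite ?mulr0.
have := H _ t1; rewrite wE => At.
exists (t * r); split; first by rewrite mulr_gt0.
move=> s /andP[s0 sr].
have s0' := wt_ge0 n s0.
apply: (@An_le _ _ s0' _ (t * m)).
  by apply: An_shrink At => //; apply: wt_le.
apply: le_trans (_ : t * (`|m| + 1) <= _).
  by rewrite ler_wpM2l ?(ltW t0)//; have := ler_norm m; lra.
by rewrite -ler_pdivlMr// ge_min lexx orbT.
Qed.

Lemma germ_small0 n f (e : R) : germ n f -> f (fun=> 0) = 0 -> 0 < e ->
  exists r : R, 0 < r /\ forall s : R, 0 <= s <= r -> An (wt n s) f e.
Proof.
move=> gf f0 e0; have [r [r0 H]] := germ_small gf e0; exists r; split=> // s /H.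
by rewrite f0; congr (An _ _ _); apply/funext => x; rewrite subr0.
Qed.

Lemma germ_cvg n f : germ n f -> f @ nb n --> f (fun=> 0).
Proof.
move=> gf; apply/cvgrPdist_le => e e0.
have [r [r0 H]] := germ_small gf e0.
exists r => // x dx; rewrite distrC.
have rr : 0 <= r <= r by rewrite (ltW r0) lexx.
have := An_bound (H _ rr) dx.
by [].
Qed.

Lemma germ_bounded n f : germ n f -> exists M : R, 0 < M /\ \forall x \near nb n, `|f x| <= M.
Proof.
move=> [r [M [r0 A]]]; exists (`|M| + 1); split; first by rewrite ltr_wpDl.
exists r => // x dx; have := An_bound A dx.
by have := ler_norm M; lra.
Qed.

Lemma germ_near_neq0 n f : germ n f -> f (fun=> 0) != 0 ->
  exists c : R, 0 < c /\ \forall x \near nb n, c <= `|f x|.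
Proof.
move=> gf f0; exists (`|f (fun=> 0)| / 2); split; first by rewrite divr_gt0// normr_gt0.
have /cvgrPdist_le /(_ (`|f (fun=> 0)| / 2)) := germ_cvg gf.
have h : 0 < `|f (fun=> 0)| / 2 by rewrite divr_gt0// normr_gt0.
move=> /(_ h); apply: filterS => x hx.
have := lerB_dist (f (fun=> 0)) (f x); lra.
Qed.

Lemma common_radius (n : nat) (P : nat -> R -> Prop) :
  (forall i, (i < n)%N -> exists r : R, 0 < r /\ forall s : R, 0 <= s <= r -> P i s) ->
  exists r : R, 0 < r /\ forall s : R, 0 <= s <= r -> forall i, (i < n)%N -> P i s.
Proof.
elim: n => [|n IH] H; first by exists 1; split.
have [r [r0 Hr]] : exists r : R, 0 < r /\ forall s : R, 0 <= s <= r -> forall i, (i < n)%N -> P i s.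
  by apply: IH => i ni; apply: H; rewrite ltnS ltnW.
have [s [s0 Hs]] := H n (ltnSn n).
exists (Num.min r s); split; first by rewrite lt_min r0 s0.
move=> t /andP[t0]; rewrite le_min => /andP[tr ts] i; rewrite ltnS leq_eqVlt => /orP[/eqP->|].
  by apply: Hs; rewrite t0 ts.
by apply: Hr; rewrite t0 tr.
Qed.

(** The truncation puts the image into the n-dimensional space, where a germ in n variables is
    controlled. *)
Definition sub (n : nat) (pi : nat -> E -> R) (x : E) : E :=
  fun i => if (i < n)%N then pi i x else 0.

(** Germ of an analytic map from m-space to n-space that fixes 0; the target dimension comes
    first. *)
Definition gmap (n m : nat) (pi : nat -> E -> R) : Prop :=
  forall i, (i < n)%N -> germ m (pi i) /\ pi i (fun=> 0) = 0.

Lemma sub0 n m pi : gmap n m pi -> sub n pi (fun=> 0) = (fun=> 0).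
Proof. by move=> g; apply/funext => i; rewrite /sub; case: ifP => // /g[]. Qed.

Lemma sub_dom n m pi (e : R) : gmap n m pi -> 0 < e -> exists r : R, 0 < r /\
  forall s : R, 0 <= s <= r -> forall i, An (wt m s) (fun x => sub n pi x i) (wt n e i).
Proof.
move=> g e0.
have [r [r0 H]] := @common_radius n (fun i s => An (wt m s) (pi i) e)
  (fun i ni => germ_small0 (g i ni).1 (g i ni).2 e0).
exists r; split=> // s sr i; rewrite /sub /wt; case: ifP => ni; first exact: H.
by apply: An_cst; rewrite normr0.
Qed.

Lemma germ_comp n m pi f : germ n f -> gmap n m pi -> germ m (fun x => f (sub n pi x)).
Proof.
move=> [e [M [e0 Af]]] g; have [r [r0 H]] := sub_dom g e0.
exists r, M; split=> //.
have rr : 0 <= r <= r by rewrite (ltW r0) lexx.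
apply: (An_comp (wt_ge0 n (ltW e0)) (wt_ge0 m (ltW r0)) Af).
exact: H.
Qed.

Lemma sub_near n m pi (P : set E) : gmap n m pi -> nb n P -> nb m (fun x => P (sub n pi x)).
Proof.
move=> g [e e0 eP]; have [r [r0 H]] := sub_dom g e0.
exists r => // x dx; apply: eP => i.
have rr : 0 <= r <= r by rewrite (ltW r0) lexx.
exact: (An_bound (H _ rr i) dx).
Qed.

Lemma gmap_comp n m l pi pi' : gmap n m pi -> gmap m l pi' ->
  gmap n l (fun i x => pi i (sub m pi' x)).
Proof.
move=> g g' i ni; have [gi g0] := g i ni; split; first exact: germ_comp.
by rewrite (sub0 g').
Qed.

Definition res (n : nat) (x : E) : E := fun i => if (i < n)%N then x i else 0.

Lemma res_id n x : (forall i, (n <= i)%N -> x i = 0) -> res n x = x.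
Proof. by move=> h; apply/funext => i; rewrite /res; case: ltnP => // /h. Qed.

Lemma res_res n m x : (n <= m)%N -> res n (res m x) = res n x.
Proof.
move=> nm; apply/funext => i; rewrite /res; case: ltnP => // ni.
by rewrite (leq_trans ni nm).
Qed.

Lemma gmap_res n m : gmap n m (fun i x => x i).
Proof. by move=> i _; split=> //; apply: germ_var. Qed.

Lemma germ_res n m f : germ n f -> germ m (fun x => f (res n x)).
Proof. by move=> gf; exact: (@germ_comp n m (fun i x => x i) f gf (@gmap_res n m)). Qed.

Lemma res_near n m (P : set E) : nb n P -> nb m (fun x => P (res n x)).
Proof. by move=> nP; exact: (@sub_near n m (fun i x => x i) P (@gmap_res n m) nP). Qed.

Lemma germ_down n m f : (n <= m)%N -> germ m f -> germ n f.
Proof.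
move=> nm [r [M [r0 A]]]; exists r, M; split=> //.
apply: An_shrink A; first exact/wt_ge0/ltW.
move=> i; rewrite /wt; case: ltnP => ni; first by rewrite (leq_trans ni nm).
by case: ifP => // _; apply: ltW.
Qed.

Lemma germ_upd0 n f i : germ n f -> germ n (fun x => f (upd x i 0)).
Proof.
move=> gf; apply: (@germ_eq _ (fun x => f (sub n (fun j x => if j == i then 0 else x j) x))).
  apply: germ_comp gf _ => j _; case: (j == i); split=> //; [exact: germ_cst|exact: germ_var].
near=> x; congr f; apply/funext => j; rewrite /sub /upd; case: ltnP => // nj.
by case: ifP => // _; rewrite (near (near_supp n) x).
Unshelve. all: by end_near. Qed.

Lemma germ_hadamard n i f : (i < n)%N -> germ n f -> exists h, germ n h /\
  \forall x \near nb n, f x = f (upd x i 0) + x i * h x.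
Proof.
move=> ni [r [M [r0 A]]].
have ri : 0 < wt n r i by rewrite /wt ni.
have [m0 [m1 [h [_ _ Ah H]]]] := hadamard (wt_ge0 n (ltW r0)) ri A.
by exists h; split; [exists r, m1|exists r].
Qed.

Lemma nb_upd n i (P : set E) : nb n P -> nb n (fun x => P (upd x i 0)).
Proof.
move=> [r r0 rP]; exists r => // x dx; apply: rP; apply: dom_upd0 => //.
exact/wt_ge0/ltW.
Qed.

(** Repeated division by [x i]: each coefficient is the value at [x i = 0] of the previous quotient,
    hence it does not involve [x i]. *)
Lemma germ_taylor n i f d : (i < n)%N -> germ n f ->
  exists (a : nat -> E -> R) (w : E -> R), [/\ forall k, germ n (a k),
    forall k x s, a k (upd x i s) = a k x, germ n w &
    \forall x \near nb n, f x = \sum_(k < d) a k x * x i ^+ k + x i ^+ d * w x].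
Proof.
move=> ni gf; elim: d => [|d [a [w [ga ai gw H]]]].
  exists (fun _ _ => 0), f; split=> //; first by move=> k; apply: germ_cst.
  by near=> x; rewrite big_ord0 expr0 mul1r add0r.
have [h [gh Hh]] := germ_hadamard ni gw.
exists (fun k x => if k == d then w (upd x i 0) else a k x), h; split=> //.
- by move=> k; case: (k == d) => //; apply: germ_upd0.
- by move=> k x s; case: (k == d) => //; rewrite upd_upd.
- near=> x; rewrite big_ord_recr/= eqxx.
  rewrite (eq_bigr (fun k : 'I_d => a k x * x i ^+ k)); last first.
    by move=> k _; rewrite ltn_eqF.
  rewrite (near H x)// {1}(near Hh x)// exprS; ring.
Unshelve. all: by end_near. Qed.

(** Let s tend to 0, divide by s, and repeat. A bound on the remainder is enough for the limit, and
    punctured discs suffice. *)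
Lemma taylor_unique (d : nat) (c : nat -> R) (w : R -> R) (K r : R) : 0 < r ->
  (forall s, 0 < `|s| <= r -> \sum_(k < d) c k * s ^+ k + s ^+ d * w s = 0) ->
  (forall s, 0 < `|s| <= r -> `|w s| <= K) -> forall k, (k < d)%N -> c k = 0.
Proof.
move=> r0; elim: d c => [//|d IH] c H wK.
have H' s : 0 < `|s| <= r -> c 0%N + s * (\sum_(k < d) c k.+1 * s ^+ k + s ^+ d * w s) = 0.
  move=> hs; rewrite -[RHS](H s hs) big_ord_recl/= expr0 mulr1 -addrA; congr (_ + _).
  rewrite mulrDr mulr_sumr exprS mulrA; congr (_ + _); apply: eq_bigr => k _.
  by rewrite /bump/= add1n exprS; ring.
pose S := \sum_(k < d) `|c k.+1| + `|K|.
have S0 : 0 <= S by rewrite addr_ge0// sumr_ge0.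
have bS s : 0 < `|s| <= r -> `|s| <= 1 -> `|\sum_(k < d) c k.+1 * s ^+ k + s ^+ d * w s| <= S.
  move=> hs s1; apply: le_trans (ler_normD _ _) _; apply: lerD.
    apply: le_trans (ler_norm_sum _ _ _) _; apply: ler_sum => k _.
    by rewrite normrM normrX ler_piMr// exprn_ile1.
  rewrite normrM normrX; apply: le_trans (_ : `|w s| <= _).
    by rewrite ler_piMl// exprn_ile1.
  by apply: le_trans (wK s hs) (ler_norm K).
have c0 : c 0%N = 0.
  apply/eqP; rewrite -normr_le0; apply/ler_addgt0Pr => e e0; rewrite add0r.
  pose s := Num.min (Num.min 1 r) (e / (S + 1)).
  have S1 : 0 < S + 1 by rewrite ltr_wpDl.
  have s0 : 0 < s by rewrite !lt_min ltr01 r0 divr_gt0.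
  have sn : `|s| = s by rewrite gtr0_norm.
  have s1 : s <= 1 by rewrite !ge_min lexx.
  have sr : s <= r by rewrite !ge_min lexx orbT.
  have se : s <= e / (S + 1) by rewrite !ge_min lexx !orbT.
  have hs : 0 < `|s| <= r by rewrite sn s0 sr.
  have /eqP := H' s hs; rewrite addr_eq0 => /eqP ->; rewrite normrN normrM sn.
  apply: le_trans (_ : s * S <= _).
    by apply: ler_wpM2l; [apply: ltW|apply: bS => //; rewrite sn].
  apply: le_trans (_ : s * (S + 1) <= _); first by apply: ler_wpM2l; [exact: ltW|lra].
  by rewrite -ler_pdivlMr.
case=> [//|k] kd; apply: (IH (fun k => c k.+1)) => // s hs.
have := H' s hs; rewrite c0 add0r => /eqP; rewrite mulf_eq0 => /orP[|/eqP//].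
by case/andP: hs => s0 _; rewrite -normr_eq0 gt_eqF.
Qed.

End Germs.

(** * Local normal forms of analytic germs *)

Section Tschirnhausen.
Variable R : realType.
Notation E := (nat -> R).

(** The implicit function theorem in fixed point form. As [H] vanishes at 0, the right-hand side is
    a contraction in phi on a small polydisc. *)
Lemma germ_fix n (g0 H : E -> R) : germ n g0 -> g0 (fun=> 0) = 0 ->
  germ n.+1 H -> H (fun=> 0) = 0 ->
  exists phi, [/\ germ n phi, phi (fun=> 0) = 0 &
    \forall x \near nb n, phi x = g0 x + phi x * H (upd x n (phi x))].
Proof.
move=> gg g00 gH H0.
(* The eighths bound [G] by r0 / 4 where the last radius is r0. With |phi| <= r0 / 2, [An_diff] at
   parameter 2 d / r0 turns a distance d into (r0 / 4)(2 d / r0) = d / 2. *)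
have e8 : 0 < (8%:R^-1 : R) by rewrite invr_gt0.
have [r0 [r00 AH]] := germ_small0 gH H0 e8.
have e8' : 0 < r0 / 8%:R by rewrite divr_gt0.
have [r1 [r10 Ag]] := germ_small0 gg g00 e8'.
pose r := Num.min r0 r1.
have rp : 0 < r by rewrite lt_min r00 r10.
have rr0 : r <= r0 by rewrite ge_min lexx.
have rr1 : r <= r1 by rewrite ge_min lexx orbT.
pose rho : E := upd (wt n r) n r0; pose om : E := wt n r.
have om0 : forall i, 0 <= om i by apply/wt_ge0/ltW.
have rho0 i : 0 <= rho i by rewrite /rho /upd; case: ifP => // _; apply: ltW.
have Ag' : An om g0 (r0 / 8%:R) by apply: Ag; rewrite (ltW rp) rr1.
pose G (x : E) := g0 (res n x) + x n * H x.
have AG : An rho G (r0 / 8%:R + r0 * 8%:R^-1).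
  apply: An_add.
    apply: (@An_comp _ om rho g0 _ (fun i x => res n x i)) => // i.
    rewrite /res /om /wt; case: ltnP => ni; last by apply: An_cst; rewrite normr0.
    by apply: An_var; rewrite /rho /upd ltn_eqF// /wt ni.
  apply: An_mul; first by apply: An_var; rewrite /rho upd_id.
  apply: (@An_shrink _ (wt n.+1 r0)) => //; last by apply: AH; rewrite lexx ltW.
  move=> i; rewrite /rho /upd /wt; case: eqP => [->|/eqP ni]; first by rewrite ltnSn.
  rewrite (ltnS i n) (leq_eqVlt i n) (negbTE ni)/=; case: ifP => // _; exact: ltW.
pose eta := r0 / 2.
have eta0 : 0 < eta by rewrite divr_gt0.
pose Phi (Y : nat -> E -> R) (i : nat) (x : E) := if i == 0%N then G (upd x n (Y 0%N x)) else 0.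
have [| |Z [AZ ZE]] := @An_fixpoint R om Phi eta om0 eta0.
- move=> Y Y' d d0 de AY AY' AD i; rewrite /Phi; case: (i == 0%N); last first.
    by apply: An_cst; rewrite subrr normr0 divr_ge0// ltW.
  pose dd := 2 * d / r0.
  have dd0 : 0 < dd by rewrite divr_gt0// mulr_gt0.
  have dd1 : dd <= 1 by rewrite ler_pdivrMr// mul1r; move: de; rewrite /eta; lra.
  have -> : d / 2 = (r0 / 8%:R + r0 * 8%:R^-1) * dd.
    by rewrite /dd; field; rewrite gt_eqF.
  apply: (@An_diff _ rho om (fun j => if j == n then eta else wt n r j)
     (fun j => if j == n then d else 0) G _ dd
     (fun j x => if j == n then Y 0%N x else x j) (fun j x => if j == n then Y' 0%N x else x j)) => //.
  + by move=> j; case: (j == n) => //; apply: An_var.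
  + by move=> j; case: (j == n) => //; apply: An_var.
  + move=> j; case: (j == n) => //.
    rewrite (_ : (fun x : E => x j - x j) = (fun=> 0)); first by apply: An_cst; rewrite normr0.
    by apply/funext => x; rewrite subrr.
  + move=> j; rewrite /rho /upd; case: (j == n); last by rewrite mul0r addr0.
    by rewrite /dd /eta le_eqVlt; apply/orP; left; apply/eqP; field; rewrite !gt_eqF.
- move=> i; rewrite /Phi; case: (i == 0%N); last by apply: An_cst; rewrite normr0 divr_ge0// ltW.
  apply: (An_eq om0 Ag'); first by rewrite /eta; lra.
  move=> x dx; rewrite /G upd_id mul0r addr0; congr g0; apply/funext => j.
  rewrite /res /upd; case: ltnP => nj; first by rewrite ltn_eqF.
  by apply/eqP; rewrite -normr_le0; have := dx j; rewrite /om /wt ltnNge nj.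
have gphi : germ n (Z 0%N) by exists r, eta; split.
have resE x s : dom om x -> res n (upd x n s) = x.
  move=> dx; apply/funext => j; rewrite /res /upd; case: ltnP => nj; first by rewrite ltn_eqF.
  by apply/esym/eqP; rewrite -normr_le0; have := dx j; rewrite /om /wt ltnNge nj.
have fixE x : dom om x -> Z 0%N x = g0 x + Z 0%N x * H (upd x n (Z 0%N x)).
  by move=> dx; rewrite {1}ZE// /Phi/= /G upd_id resE.
exists (Z 0%N); split=> //; last by exists r.
have d0 : dom om (fun=> 0) by apply: dom0.
have := fixE _ d0; rewrite g00 add0r; set z := Z 0%N _.
have zb : `|z| <= eta by exact: (An_bound (AZ 0%N) d0).
have r00' : 0 <= r0 <= r0 by rewrite lexx ltW.
have : `|H (upd (fun=> 0) n z)| <= 8%:R^-1.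
  apply: (An_bound (AH _ r00')) => j; rewrite /upd; case: eqP => [->|_].
    by rewrite /wt ltnSn; apply: le_trans zb _; rewrite /eta; lra.
  by rewrite normr0; apply: wt_ge0; apply: ltW.
move=> Hb zE; apply/eqP; rewrite -normr_le0.
have : `|z| <= `|z| * 8%:R^-1 by rewrite {1}zE normrM; apply: ler_wpM2l.
by have := normr_ge0 z; lra.
Qed.

Definition ax (n : nat) (y : R) : E := upd (fun=> 0) n y.

Lemma near_ax n (P : set E) : nb n.+1 P -> exists2 r : R, 0 < r & forall y, `|y| <= r -> P (ax n y).
Proof.
move=> [r r0 rP]; exists r => // y yr; apply: rP => i; rewrite /ax /upd /wt.
case: eqP => [->|_]; first by rewrite ltnSn.
by rewrite normr0; case: ifP => // _; apply: ltW.
Qed.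

Lemma germ_ax_eq n f g (r : R) : germ n.+1 f -> germ n.+1 g -> 0 < r ->
  (forall y, 0 < `|y| <= r -> f (ax n y) = g (ax n y)) -> f (fun=> 0) = g (fun=> 0).
Proof.
move=> gf gg r0 fg; apply/eqP; rewrite -subr_eq0; apply/negPn/negP => h.
have [c [c0 /near_ax[s s0 H]]] := germ_near_neq0 (germ_sub gf gg) h.
pose y := Num.min r s.
have y0 : 0 < y by rewrite lt_min r0 s0.
have yn : `|y| = y by rewrite gtr0_norm.
have := H y; rewrite yn ge_min lexx orbT => /(_ isT).
rewrite fg ?subrr ?normr0; first by rewrite leNgt c0.
by rewrite yn y0/= ge_min lexx.
Qed.

(** Regularity of order exactly d in the last of n + 1 variables, in the sense of Weierstrass. *)
Definition reg (n d : nat) (g : E -> R) : Prop :=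
  exists W, [/\ germ n.+1 W, W (fun=> 0) != 0 &
    exists2 r : R, 0 < r & forall y, `|y| <= r -> g (ax n y) = y ^+ d * W (ax n y)].

Lemma horner_bounded (p : {poly R}) (r : R) : exists K : R, forall s : R, `|s| <= r -> `|p.[s]| <= K.
Proof.
exists (\sum_(i < size p) `|p`_i| * r ^+ i) => s sr.
rewrite horner_coef; apply: le_trans (ler_norm_sum _ _ _) _; apply: ler_sum => i _.
rewrite normrM normrX; apply: ler_wpM2l => //; apply: lerXn2r; rewrite ?nnegrE//.
by apply: le_trans sr.
Qed.

Lemma tschirnhausen n e g : germ n.+1 g -> reg n e.+1 g ->
  exists phi (a : nat -> E -> R) w, [/\ germ n phi /\ phi (fun=> 0) = 0,
    forall k, germ n (a k) /\ ((k < e.+1)%N -> a k (fun=> 0) = 0), germ n.+1 w /\ w (fun=> 0) != 0 &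
    \forall x \near nb n.+1, g (upd x n (x n + phi (res n x))) =
      \sum_(k < e) a k (res n x) * x n ^+ k + x n ^+ e.+1 * w x].
(* The coefficient of h^e in g(x, y + h), with e + 1 the order of g on the axis, has a simple zero
   in y at the origin. The implicit function theorem gives the point y = phi(x) where it vanishes,
   and translation by phi removes the term of degree e. *)
Proof.
move=> gg [W [gW W0 [rW rW0 gWE]]].
set d := e.+1.
(* The extra variable n + 1 is the increment h added to the last coordinate. *)
pose pi (i : nat) (x : E) := if i == n then x n + x n.+1 else x i.
have gpi : gmap n.+1 n.+2 pi.
  move=> i _; rewrite /pi; case: (i == n); rewrite ?addr0; split=> //.
    by apply: germ_add; apply: germ_var.
  exact: germ_var.
have n2 : (n.+1 < n.+2)%N by [].
have [A [r [gA Ai gr AE]]] := germ_taylor d n2 (germ_comp gg gpi).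
have [w [r' [gw wi gr' wE]]] := germ_taylor d n2 (germ_comp gW gpi).
have [K [K0 rK]] := germ_bounded gr.
have [K' [K'0 rK']] := germ_bounded gr'.
pose X (y h : R) : E := upd (ax n y) n.+1 h.
have nX (P : set E) : nb n.+2 P -> exists2 s : R, 0 < s & forall y h, `|y| <= s -> `|h| <= s -> P (X y h).
  move=> [s s0 sP]; exists s => // y h ys hs; apply: sP => i.
  rewrite /X /ax /upd /wt; case: eqP => [->|_]; first by rewrite ltnSn.
  case: eqP => [->|_]; first by rewrite ltnS leqnSn.
  by rewrite normr0; case: ifP => // _; apply: ltW.
have piX y h : sub n.+1 pi (X y h) = ax n (y + h).
  apply/funext => i; rewrite /sub /pi /X /ax /upd.
  have [->|ni] := eqVneq i n.
    by rewrite ltnSn ltn_eqF// !eqxx.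
  case: ifP => // h1; by rewrite ltn_eqF.
have XA k y h : A k (X y h) = A k (ax n y) by rewrite /X Ai.
have Xw k y h : w k (X y h) = w k (ax n y) by rewrite /X wi.
have [s1 s10 H1] := nX _ (filterI (filterI AE wE) (filterI rK rK')).
pose s := Num.min s1 (rW / 2).
have s0 : 0 < s by rewrite lt_min s10 divr_gt0.
have ss1 : s <= s1 by rewrite ge_min lexx.
have ssW : s <= rW / 2 by rewrite ge_min lexx orbT.
have mainA y h : `|y| <= s -> `|h| <= s ->
  \sum_(k < d) A k (ax n y) * h ^+ k + h ^+ d * r (X y h) = (y + h) ^+ d * W (ax n (y + h)).
  move=> ys hs; have [[E1 _] _] := H1 y h (le_trans ys ss1) (le_trans hs ss1).
  move: E1; rewrite piX.
  have Xh : X y h n.+1 = h by rewrite /X upd_id.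
  rewrite Xh (eq_bigr (fun k : 'I_d => A k (ax n y) * h ^+ k)); last by move=> k _; rewrite XA.
  move=> <-; apply: gWE.
  by apply: le_trans (ler_normD _ _) _; lra.
have main y h : `|y| <= s -> `|h| <= s ->
  [/\ \sum_(k < d) A k (ax n y) * h ^+ k + h ^+ d * r (X y h) =
   (y + h) ^+ d * (\sum_(k < d) w k (ax n y) * h ^+ k + h ^+ d * r' (X y h)),
   `|r (X y h)| <= K & `|r' (X y h)| <= K'].
  move=> ys hs; have [[E1 E2] [E3 E4]] := H1 y h (le_trans ys ss1) (le_trans hs ss1).
  split=> //.
  rewrite (mainA y h ys hs); move: E2; rewrite piX => ->.
  have Xh : X y h n.+1 = h by rewrite /X upd_id.
  by rewrite Xh (eq_bigr (fun k : 'I_d => w k (ax n y) * h ^+ k)) // => k _; rewrite Xw.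
(* The coefficient of h^e in (y + h)^(e+1) W(y + h) is a sum of terms C(e+1, j) y^(e+1-j) w_(e-j);
   [beta] is this sum divided by y. At 0 only j = e survives and gives (e + 1) W(0). *)
pose beta (x : E) := \sum_(j < e.+1) (x n ^+ (e - j) *+ 'C(d, j)) * w (e - j)%N x.
have Ae y : `|y| <= s -> A e (ax n y) = y * beta (ax n y).
  move=> ys.
  pose P := \poly_(i < d.+1) (y ^+ (d - i) *+ 'C(d, i)).
  pose Q := \poly_(i < d) (w i (ax n y)).
  have PE h : P.[h] = (y + h) ^+ d.
    by rewrite horner_poly exprDn; apply: eq_bigr => i _; rewrite mulrnAl.
  have QE h : Q.[h] = \sum_(k < d) w k (ax n y) * h ^+ k by rewrite horner_poly.
  have PQE t : (P * Q).[t] = \sum_(k < d) (P * Q)`_k * t ^+ k + t ^+ d * (drop_poly d (P * Q)).[t].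
    rewrite -{1}(poly_take_drop d (P * Q)) hornerD (hornerM (drop_poly _ _)) hornerXn [X in _ + X]mulrC; congr (_ + _).
    by rewrite /take_poly horner_poly.
  have [K2 K2P] := horner_bounded (drop_poly d (P * Q)) s.
  (* Comparing two expansions of g in powers of h on the axis identifies [A e] with that
     coefficient. *)
  have := @taylor_unique R d (fun k => A k (ax n y) - (P * Q)`_k)
    (fun h => r (X y h) - (drop_poly d (P * Q)).[h] - (y + h) ^+ d * r' (X y h))
    (K + K2 + (s + s) ^+ d * K') s s0.
  move=> /(_ _ _ e (ltnSn e)) H.
  have /eqP : A e (ax n y) - (P * Q)`_e = 0.
    apply: H => t tt.
      have ts : `|t| <= s by case/andP: tt.
      have [E1 _ _] := main y t ys ts.
      rewrite mulrDr in E1.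
      rewrite -PE -QE -hornerM PQE in E1.
      under eq_bigr => i _ do rewrite mulrBl.
      rewrite sumrB; move: E1; set S1 := \sum_(k < d) _; set S2 := \sum_(k < d) _.
      set D := (drop_poly _ _).[t]; rewrite -PE => E1.
      have -> : S1 - S2 + t ^+ d * (r (X y t) - D - P.[t] * r' (X y t)) =
        (S1 + t ^+ d * r (X y t)) - (S2 + t ^+ d * D + P.[t] * (t ^+ d * r' (X y t))) by ring.
      by rewrite E1 subrr.
    have ts : `|t| <= s by case/andP: tt.
    have [_ rb r'b] := main y t ys ts.
    apply: le_trans (ler_normB _ _) _; apply: lerD.
      by apply: le_trans (ler_normB _ _) _; apply: lerD => //; apply: K2P.
    rewrite normrM normrX; apply: ler_pM => //.
    apply: lerXn2r; rewrite ?nnegrE ?normr_ge0 ?addr_ge0 ?(ltW s0)//.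
    by apply: le_trans (ler_normD _ _) _; apply: lerD.
  rewrite subr_eq0 => /eqP ->; rewrite coefM mulr_sumr; apply: eq_bigr => j _.
  rewrite /P /Q !coef_poly ltnS (leq_trans (ltnW (ltn_ord j)))// ltnS leq_subr.
  rewrite /ax upd_id mulrA; congr (_ * _).
  by rewrite mulrnAr; congr (_ *+ _); rewrite /d subSn ?exprS// -ltnS.
have gbeta : germ n.+1 beta.
  apply: germ_sum => j _; apply: germ_mul; last exact: germ_down (gw _).
  rewrite (_ : (fun x => _) = (fun x => x n ^+ (e - j) * 'C(d, j)%:R)).
    by apply: germ_mul; [apply: germ_exp; apply: germ_var|apply: germ_cst].
  by apply/funext => x; rewrite mulr_natr.
have w00 : w 0%N (fun=> 0) = W (fun=> 0).
  have := nb0 wE; rewrite (sub0 gpi) => ->.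
  by rewrite big_ord_recl/= expr0 mulr1 big1 ?exprS ?mul0r ?addr0// => i _; rewrite exprS mul0r mulr0.
have beta0 : beta (fun=> 0) = d%:R * W (fun=> 0).
  rewrite /beta big_ord_recr/= subnn expr0 big1 => [|j _].
    by rewrite add0r w00 binSn.
  have -> : (e - j)%N = (e - j).-1.+1 by rewrite prednK// subn_gt0.
  by rewrite exprS mul0r mul0rn mul0r.
have gAe : germ n.+1 (A e) by apply: germ_down (gA e).
have ax0 : ax n 0 = (fun=> 0) by rewrite /ax upd0.
have Ae0 : A e (fun=> 0) = 0 by have := Ae 0; rewrite normr0 ax0 mul0r; apply; apply: ltW.
have [B [gB BE]] := germ_hadamard (ltnSn n) gAe.
set b := d%:R * W (fun=> 0) in beta0.
have b0 : b != 0 by rewrite mulf_neq0// pnatr_eq0.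
have B0 : B (fun=> 0) = b.
  rewrite -beta0; have [s2 s20 H2] := near_ax BE.
  have m0 : 0 < Num.min s s2 by rewrite lt_min s0 s20.
  apply: (germ_ax_eq gB gbeta m0) => y /andP[y0]; rewrite le_min => /andP[ys ys2].
  have := H2 y ys2; rewrite Ae// /ax upd_upd upd0 Ae0 add0r upd_id.
  by move/mulfI => <- //; rewrite -normr_gt0.
(* With A_e = A_e(x, 0) + y B and B(0) = b, the equation A_e(x, phi) = 0 reads phi = - A_e(x, 0) / b
   + phi (1 - B / b), and 1 - B / b vanishes at 0. *)
have [||||phi [gphi phi0 phiE]] := @germ_fix n (fun x => - A e (upd x n 0) / b) (fun x => 1 - B x / b).
- apply: germ_mul; last exact: germ_cst.
  by apply: germ_opp; apply: germ_down (germ_upd0 n gAe).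
- by rewrite upd0 Ae0 oppr0 mul0r.
- apply: germ_sub; first exact: germ_cst.
  by apply: germ_mul; [exact: gB|exact: germ_cst].
- by rewrite B0 divff// subrr.
(* The base point is set to phi and the increment to [x n], so that [pi] after [tau] is translation
   of the last coordinate by phi. *)
pose tau (i : nat) (x : E) := if i == n then phi (res n x) else if i == n.+1 then x n else x i.
have gtau : gmap n.+2 n.+1 tau.
  move=> i _; rewrite /tau; case: (i == n).
    split; first exact: germ_res.
    by rewrite res_id.
  by case: (i == n.+1); split=> //; apply: germ_var.
pose tau0 (i : nat) (x : E) := if i == n then phi x else x i.
have gtau0 : gmap n.+1 n tau0.
  by move=> i _; rewrite /tau0; case: (i == n); split=> //; apply: germ_var.
have Aphi : \forall x \near nb n, A e (sub n.+1 tau0 x) = 0.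
  have h1 := sub_near gtau0 BE.
  near=> x.
  have subE : sub n.+1 tau0 x = upd x n (phi x).
    apply/funext => i; rewrite /sub /tau0 /upd; case: ltnP => [ni|]; first by [].
    by move=> ni; rewrite gtn_eqF// (near (near_supp R n) x)// ltnW.
  have := near h1 x; rewrite subE => ->//; rewrite upd_upd upd_id.
  have := near phiE x; move/(_ _) => pE.
  have {}pE : phi x = - A e (upd x n 0) / b + phi x * (1 - B (upd x n (phi x)) / b) by apply: pE.
  have : A e (upd x n 0) / b + phi x * B (upd x n (phi x)) / b = 0 by move: pE; lra.
  by rewrite -mulrDl => /eqP; rewrite mulf_eq0 invr_eq0 (negbTE b0) orbF => /eqP.
have [K3 [K30 /near_ax[s3 s30 H3]]] := germ_bounded gW.
have m0 : 0 < Num.min s s3 by rewrite lt_min s0 s30.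
have mE h : `|h| <= Num.min s s3 ->
  \sum_(k < d) A k (fun=> 0) * h ^+ k + h ^+ d * (r (X 0 h) - W (ax n h)) = 0.
  rewrite le_min => /andP[hs _]; have := mainA 0 h; rewrite normr0 ltW// => /(_ isT hs).
  by rewrite ax0 add0r mulrBr addrA => ->; rewrite subrr.
have A0 k : (k < d)%N -> A k (fun=> 0) = 0.
  apply: (@taylor_unique R d (fun k => A k (fun=> 0)) (fun h => r (X 0 h) - W (ax n h)) (K + K3) _ m0).
    by move=> h /andP[_ /mE].
  move=> h /andP[_]; rewrite le_min => /andP[hs hs3].
  apply: le_trans (ler_normB _ _) _; apply: lerD; last exact: H3.
  by have [] := main 0 h _ hs => //; rewrite normr0 ltW.
exists phi, (fun k x => A k (sub n.+1 tau0 x)), (fun x => r (sub n.+2 tau x)); split=> //.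
- move=> k; split; first by apply: germ_comp gtau0; apply: germ_down (gA k).
  by move=> kd; rewrite (sub0 gtau0) A0.
- split; first exact: germ_comp gr gtau.
  rewrite (sub0 gtau).
  pose ta (i : nat) (x : E) := if i == n.+1 then x n else 0.
  have gta : gmap n.+2 n.+1 ta.
    by move=> i _; rewrite /ta; case: (i == n.+1); split=> //; [exact: germ_var|exact: germ_cst].
  (* At y = 0 the lower coefficients vanish, so both functions equal g / h^d for h different from 0;
     the values at 0 agree by continuity. *)
  have -> : r (fun=> 0) = W (fun=> 0).
    have := @germ_ax_eq n (fun x => r (sub n.+2 ta x)) W _ (germ_comp gr gta) gW m0.
    rewrite (sub0 gta); apply => y /andP[y0 ym].
    have -> : sub n.+2 ta (ax n y) = X 0 y.
      apply/funext => i; rewrite /sub /ta /X ax0 /ax upd_id /upd.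
      by case: ifP => //; case: eqP => // ->; rewrite ltnSn.
    have := mE y ym; rewrite big1 ?add0r => [/eqP|k _]; last by rewrite A0 ?mul0r.
    rewrite mulf_eq0 expf_eq0/= -normr_eq0 gt_eqF//= subr_eq0 => /eqP //.
  exact: W0.
- have h1 := sub_near gtau AE; have h2 := res_near n.+1 Aphi.
  near=> x.
  have xs := near (near_supp R n.+1) x.
  have {}xs : forall i, (n.+1 <= i)%N -> x i = 0 by apply: xs.
  have r1 : sub n.+2 tau x n.+1 = x n by rewrite /sub ltnSn /tau gtn_eqF// eqxx.
  have Ak k : A k (sub n.+2 tau x) = A k (sub n.+1 tau0 (res n x)).
    rewrite -(Ai k _ 0); congr (A k _); apply/funext => i.
    rewrite /upd /sub /tau /tau0 /res.
    case: (eqVneq i n.+1) => [->|i1]; first by rewrite ltnn.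
    rewrite (ltnS i n.+1) leq_eqVlt (negbTE i1)/=.
    case: ifP => // i2; case: (eqVneq i n) => // i3.
    by move: i2; rewrite ltnS leq_eqVlt (negbTE i3)/= => ->.
  have -> : upd x n (x n + phi (res n x)) = sub n.+1 pi (sub n.+2 tau x).
    apply/funext => i; rewrite /upd /sub /pi /tau.
    case: (eqVneq i n) => [->|i1].
      by rewrite ltnSn !eqxx leqnSn ltnSn (gtn_eqF (ltnSn n)) addrC.
    case: ltnP => [i2|/xs//].
    by rewrite (ltnW (i2 : (i.+1 < n.+2)%N)) (ltn_eqF i2).
  have := near h1 x => h1x; rewrite h1x//.
  rewrite r1 big_ord_recr/= Ak.
  have := near h2 x => h2x; rewrite h2x// mul0r addr0.
  by congr (_ + _); apply: eq_bigr => k _; rewrite Ak.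
Unshelve. all: by end_near. Qed.
End Tschirnhausen.

(** * The ring of germs is an integral domain *)

Section Domain.
Variable R : realType.
Notation E := (nat -> R).
Local Notation nb := (@nb R).

Lemma dom_wt1 (r : R) x : dom (wt 1 r) x -> upd x 0 0 = (fun=> 0).
Proof.
move=> dx; apply/funext => i; rewrite /upd; case: eqP => // /eqP i0.
by apply/eqP; rewrite -normr_le0; have := dx i; rewrite /wt ltnS leqNgt lt0n i0.
Qed.

Lemma dom_ax n (r s : R) : `|s| <= r -> dom (wt n.+1 r) (ax n s).
Proof.
move=> sr i; rewrite /ax /upd /wt; case: eqP => [->|_]; first by rewrite ltnSn.
by rewrite normr0; case: ifP => // _; apply: le_trans sr.
Qed.

Lemma geometric_small (M q e : R) : 0 <= q < 1 -> 0 < e -> exists d, M * q ^+ d <= e.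
Proof.
move=> /andP[q0 q1] e0.
have : (fun d => M * q ^+ d) @ \oo --> M * 0.
  by apply: cvgMr; apply: cvg_expr; rewrite ger0_norm.
rewrite mulr0 => /cvgrPdist_le/(_ _ e0)[d _ /(_ d (leqnn d))] /= h; exists d.
by apply: le_trans h; rewrite sub0r normrN ler_norm.
Qed.

(** If every quotient by a power of the variable vanished at 0, the Schwarz-type bound |u(s)| <= M
    (|s| / rho)^d would hold for all d and force u(s) = 0. *)
Lemma order1 (rho : R) u M s : 0 < rho -> An (wt 1 rho) u M -> `|s| < rho ->
  u (ax 0 s) != 0 -> exists d v (M' : R), [/\ An (wt 1 rho) v M', v (fun=> 0) != 0 &
  forall x, dom (wt 1 rho) x -> u x = x 0%N ^+ d * v x].
Proof.
move=> r0 Au sr u0; apply: contrapT => H.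
have w0 := wt_ge0 1 (ltW r0).
have st d : exists v (M' : R), [/\ An (wt 1 rho) v M', rho ^+ d * M' <= M &
   forall x, dom (wt 1 rho) x -> u x = x 0%N ^+ d * v x].
  elim: d => [|d [v [M' [Av vM uE]]]].
    by exists u, M; split=> // [|x _]; rewrite expr0 mul1r.
  have v0 : v (fun=> 0) = 0.
    by apply/eqP/negPn/negP => v0; apply: H; exists d, v, M'.
  have [m0 [m1 [h [hM A0 Ah hE]]]] := hadamard (i := 0%N) w0 r0 Av.
  exists h, m1; split=> //.
    rewrite exprSr -mulrA; apply: le_trans vM; apply: ler_wpM2l; first exact/exprn_ge0/ltW.
    by apply: le_trans hM; rewrite lerDr; apply: An_ge0 A0.
  by move=> x dx; rewrite uE// hE// (dom_wt1 dx) v0 add0r exprSr mulrA.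
have q01 : 0 <= `|s| / rho < 1 by rewrite divr_ge0 ?(ltW r0)//= ltr_pdivrMr// mul1r.
have e0 : 0 < `|u (ax 0 s)| / 2 by rewrite divr_gt0// normr_gt0.
have [d dP] := geometric_small M q01 e0.
have [v [M' [Av vM uE]]] := st d.
have ds := dom_ax 0 (ltW sr).
have := An_bound Av ds => vb.
have : `|u (ax 0 s)| <= M * (`|s| / rho) ^+ d.
  rewrite uE// normrM normrX /ax upd_id.
  have -> : M * (`|s| / rho) ^+ d = `|s| ^+ d * (M / rho ^+ d).
    by rewrite expr_div_n; ring.
  apply: ler_wpM2l; first exact: exprn_ge0.
  rewrite ler_pdivlMr ?exprn_gt0// mulrC.
  by apply: le_trans vM; apply: ler_wpM2l => //; apply/exprn_ge0/ltW.
by move=> /le_trans/(_ dP); lra.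
Qed.

Lemma reg_of_line n (rho : R) u M s g : 0 < rho -> An (wt 1 rho) u M -> `|s| < rho ->
  u (ax 0 s) != 0 -> (exists2 r : R, 0 < r & forall y, `|y| <= r -> g (ax n y) = u (ax 0 y)) ->
  exists d, reg n d g.
Proof.
move=> r0 Au sr us [r r00 gu].
have [d [v [M' [Av v0 vE]]]] := order1 r0 Au sr us.
exists d, (fun x => v (sub 1 (fun i x => x n) x)).
have g1 : gmap 1 n.+1 (fun i (x : E) => x n) by move=> i _; split=> //; apply: germ_var.
split.
- by apply: germ_comp g1; exists rho, M'.
- by rewrite (sub0 g1).
- exists (Num.min r rho); first by rewrite lt_min r00 r0.
  move=> y; rewrite le_min => /andP[yr yrho]; rewrite gu// (vE _ (dom_ax 0 yrho)).
  rewrite /ax upd_id; congr (_ * v _); apply/funext => i.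
  by rewrite /sub /upd eqxx; case: i.
Qed.

(** Restrict to the line through a point z with f(z) nonzero and a point w with g(w) nonzero. Both
    restrictions are nonzero series in one variable, hence of finite order at z, so their product
    cannot vanish near z on that line. *)
Lemma germ_domain n f g : germ n f -> germ n g -> (\forall x \near nb n, f x * g x = 0) ->
  (\forall x \near nb n, f x = 0) \/ (\forall x \near nb n, g x = 0).
Proof.
move=> gf gg fg; have [r0 [M [N [r00 Af Ag]]]] := germ2 gf gg.
case: fg => r1 r10 fg0.
pose r := Num.min r0 r1.
have rp : 0 < r by rewrite lt_min r00 r10.
have rr0 : r <= r0 by rewrite ge_min lexx.
have rr1 : r <= r1 by rewrite ge_min lexx orbT.
have w0 := wt_ge0 n (ltW rp).
have {}Af : An (wt n r) f M by apply: An_shrink Af => //; apply: wt_le.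
have {}Ag : An (wt n r) g N by apply: An_shrink Ag => //; apply: wt_le.
have {}fg x : dom (wt n r) x -> f x * g x = 0 by move=> dx; apply: fg0; apply: dom_wt_le dx.
apply: contrapT => /not_orP[nf ng].
(* The line parameter runs through the disc of radius 2, which contains both 0 and 1 in its
   interior: r/8 + 2 (r/8 + r/8) <= r keeps the line in the polydisc. *)
have r8 : 0 < r / 8%:R by rewrite divr_gt0.
have [z dz fz] : exists2 z, dom (wt n (r / 8%:R)) z & f z != 0.
  apply: contrapT => h; apply: nf; exists (r / 8%:R) => // x dx.
  by apply/eqP/negPn/negP => ?; apply: h; exists x.
have [w dw gw] : exists2 z, dom (wt n (r / 8%:R)) z & g z != 0.
  apply: contrapT => h; apply: ng; exists (r / 8%:R) => // x dx.
  by apply/eqP/negPn/negP => ?; apply: h; exists x.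
pose pi (i : nat) (x : E) := z i + x 0%N * (w i - z i).
have Api i : An (wt 1 2) (pi i) (wt n r i).
  have zi := dz i; have wi := dw i.
  apply: (@An_le _ _ (wt_ge0 1 _) _ (`|z i| + 2 * `|w i - z i|)) => //.
    by apply: An_add; [apply: An_cst|apply: An_mul; [apply: An_var|apply: An_cst]].
  have := ler_normB (w i) (z i); move: zi wi; rewrite /wt; case: ifP => _; lra.
have w2 : forall i, 0 <= wt 1 2 i :> R by apply: wt_ge0.
have Afp := An_comp w0 w2 Af Api; have Agp := An_comp w0 w2 Ag Api.
have lt12 : `|1 : R| < 2 by rewrite normr1 ltr1n.
have lt02 : `|0 : R| < 2 by rewrite normr0.
have pi0 : pi^~ (ax 0 0) = z by apply/funext => i; rewrite /pi /ax upd_id mul0r addr0.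
have pi1 : pi^~ (ax 0 1) = w by apply/funext => i; rewrite /pi /ax upd_id mul1r addrC subrK.
have fz' : f (pi^~ (ax 0 0)) != 0 by rewrite pi0.
have gw' : g (pi^~ (ax 0 1)) != 0 by rewrite pi1.
have [d [v [M1 [Av v0 vE]]]] := order1 (ltr0Sn R 1) Afp lt02 fz'.
have [d' [v' [M2 [Av' v'0 v'E]]]] := order1 (ltr0Sn R 1) Agp lt12 gw'.
have gv : germ 1 v by exists 2, M1.
have gv' : germ 1 v' by exists 2, M2.
have v00 : v (fun=> 0) * v' (fun=> 0) != 0 by rewrite mulf_neq0.
have [c [c0 /near_ax[s s0 H]]] := germ_near_neq0 (germ_mul gv gv') v00.
pose t := Num.min s 2.
have t0 : 0 < t by rewrite lt_min s0 ltr0n.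
have tn : `|t| = t by rewrite gtr0_norm.
have t2 : `|t| <= 2 by rewrite tn ge_min lexx orbT.
have dt := dom_ax 0 t2.
have := fg (pi^~ (ax 0 t)).
rewrite vE// v'E// /ax upd_id => /(_ _)/eqP; rewrite mulrACA mulf_eq0 -exprD expf_eq0.
rewrite (gt_eqF t0) andbF/= => h.
have := H t; rewrite tn ge_min lexx => /(_ isT); rewrite (eqP (h _)) ?normr0; first by rewrite leNgt c0.
by move=> i; apply: An_bound (Api i) _ dt.
Qed.

Lemma germ_domain_prod n (I : finType) (S : {set I}) (f : I -> E -> R) :
  (forall i, germ n (f i)) -> (\forall x \near nb n, \prod_(i in S) f i x = 0) ->
  exists2 i, i \in S & \forall x \near nb n, f i x = 0.
Proof.
move=> gf; have [k] := ubnP #|S|; elim: k S => // k IH S Sk H.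
have [S0|[i iS]] := set_0Vmem S.
  have := nb0 H; rewrite S0 big_set0 => /eqP; by rewrite oner_eq0.
have {}H : \forall x \near nb n, f i x * \prod_(j in S :\ i) f j x = 0.
  by apply: filterS H => x; rewrite (big_setD1 i).
have [h|h] := germ_domain (gf i) (@germ_prod R n I (index_enum I) (fun j => j \in S :\ i) f (fun j _ => gf j)) H; first by exists i.
have [|j jS fj] := IH (S :\ i) _ h.
  by move: Sk; rewrite (cardsD1 i) iS.
by exists j => //; move: jS; rewrite in_setD1 => /andP[].
Qed.

End Domain.

(** * Monomials times units: factors and comparison *)

Section Monomial.
Variable R : realType.
Notation E := (nat -> R).
Local Notation nb := (@nb R).

Lemma nbI n (P Q : set E) : nb n P -> nb n Q -> nb n (P `&` Q).
Proof. exact: filterI. Qed.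

Definition mon (m : nat) (al : nat -> nat) (x : E) : R := \prod_(i < m) x i ^+ al i.

Definition monu (m : nat) (f : E -> R) : Prop :=
  exists (al : nat -> nat) u, [/\ germ m u, u (fun=> 0) != 0 &
    \forall x \near nb m, f x = mon m al x * u x].

Definition mz (m : nat) (f : E -> R) : Prop :=
  (\forall x \near nb m, f x = 0) \/ monu m f.

Lemma monD m al be x : mon m (fun i => al i + be i)%N x = mon m al x * mon m be x.
Proof. by rewrite /mon -big_split/=; apply: eq_bigr => i _; rewrite exprD. Qed.

Lemma monX m al k x : mon m (fun i => k * al i)%N x = mon m al x ^+ k.
Proof. by rewrite /mon -prodrXl; apply: eq_bigr => i _; rewrite mulnC exprM. Qed.

Lemma mon_pos m al x : (forall i, (i < m)%N -> 0 < x i) -> 0 < mon m al x.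
Proof. by move=> x0; apply: prodr_gt0 => i _; rewrite exprn_gt0// x0. Qed.

Lemma germ_mon m n al : germ n (mon m al : E -> R).
Proof. by apply: germ_prod => i _; apply: germ_exp; apply: germ_var. Qed.

Lemma mon0 m x : mon m (fun=> 0%N) x = 1.
Proof. by rewrite /mon big1. Qed.

Lemma mon1 m (i : nat) x : (i < m)%N -> mon m (fun j => (j == i) : nat) x = x i.
Proof.
move=> im; rewrite /mon (bigD1 (Ordinal im))//= eqxx expr1 big1 ?mulr1// => j jn.
rewrite (_ : (nat_of_ord j == i) = false) ?expr0//.
by apply/eqP => ji; move/eqP: jn; apply; apply: val_inj.
Qed.

Lemma mz_eq m f g : mz m f -> (\forall x \near nb m, f x = g x) -> mz m g.
Proof.
move=> [f0|[al [u [gu u0 fE]]]] fg; [left|right; exists al, u; split=> //].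
  by near=> x; rewrite -(near fg x)//; near: x.
by near=> x; rewrite -(near fg x)//; near: x.
Unshelve. all: by end_near. Qed.

Lemma mz_unit m u : germ m u -> u (fun=> 0) != 0 -> mz m u.
Proof.
move=> gu u0; right; exists (fun=> 0%N), u; split=> //.
by near=> x; rewrite mon0 mul1r.
Unshelve. all: by end_near. Qed.

Lemma mz0 m : mz m (fun=> 0). Proof. by left; near=> x. Unshelve. all: by end_near. Qed.

Lemma mz_mon m al : mz m (mon m al).
Proof.
right; exists al, (fun=> 1); split; [exact: germ_cst|exact: oner_neq0|].
by near=> x; rewrite mulr1.
Unshelve. all: by end_near. Qed.

Lemma mz_var m i : (i < m)%N -> mz m (fun x => x i).
Proof.
move=> im; apply: (mz_eq (mz_mon m (fun j => (j == i) : nat))).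
by near=> x; rewrite mon1.
Unshelve. all: by end_near. Qed.

Lemma mz_mul m f g : mz m f -> mz m g -> mz m (fun x => f x * g x).
Proof.
move=> [f0|[al [u [gu u0 fE]]]].
  by move=> _; left; near=> x; rewrite (near f0 x)// mul0r.
move=> [g0|[be [v [gv v0 gE]]]].
  by left; near=> x; rewrite (near g0 x)// mulr0.
right; exists (fun i => al i + be i)%N, (fun x => u x * v x); split.
- exact: germ_mul.
- by rewrite mulf_neq0.
- by near=> x; rewrite monD (near fE x)// (near gE x)//; ring.
Unshelve. all: by end_near. Qed.

Lemma mz_exp m f k : mz m f -> mz m (fun x => f x ^+ k).
Proof.
move=> mf; elim: k => [|k IH].
  by under eq_fun do rewrite expr0; apply: mz_unit; [exact: germ_cst|exact: oner_neq0].
by under eq_fun do rewrite exprS; apply: mz_mul.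
Qed.

Lemma mz_prod m (I : Type) (r : seq I) (P : pred I) (f : I -> E -> R) :
  (forall i, P i -> mz m (f i)) -> mz m (fun x => \prod_(i <- r | P i) f i x).
Proof.
move=> mf; elim: r => [|i r IH].
  under eq_fun do rewrite big_nil; apply: mz_unit; [exact: germ_cst|exact: oner_neq0].
under eq_fun do rewrite big_cons.
by case Pi: (P i) => //; apply: mz_mul => //; apply: mf.
Qed.

Lemma mz_comp n m f pi : gmap n m pi -> (forall i, (i < n)%N -> mz m (pi i)) ->
  mz n f -> mz m (fun x => f (sub n pi x)).
Proof.
move=> g mpi [f0|[al [u [gu u0 fE]]]]; first by left; exact: (sub_near g f0).
apply: (@mz_eq _ (fun x => (\prod_(i < n) pi i x ^+ al i) * u (sub n pi x))).
  apply: mz_mul.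
    by apply: mz_prod => i _; apply: mz_exp; apply: mpi.
  by apply: mz_unit; [exact: germ_comp gu g|rewrite (sub0 g)].
have := sub_near g fE; apply: filterS => x ->; congr (_ * _).
by apply: eq_bigr => i _; rewrite /sub ltn_ord.
Qed.

Lemma near_divr n i f g : (i < n)%N -> germ n f -> germ n g ->
  (\forall x \near nb n, x i * f x = x i * g x) -> \forall x \near nb n, f x = g x.
Proof.
move=> ni gf gg H.
have H' : \forall x \near nb n, x i * (f x - g x) = 0.
  by apply: filterS H => x E; rewrite mulrBr E subrr.
have [h|h] := germ_domain (germ_var R n i) (germ_sub gf gg) H'; last first.
  by apply: filterS h => x /eqP; rewrite subr_eq0 => /eqP.
exfalso; case: h => r r0 h; have := h (upd (fun=> 0) i r).
rewrite upd_id => E; have r00 : r = 0.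
  apply: E => j; rewrite /upd /wt.
  case: eqP => [->|_]; first by rewrite ni ger0_norm// ltW.
  by rewrite normr0; case: ifP => // _; apply: ltW.
by rewrite r00 ltxx in r0.
Qed.

(** Induction on the degree of the monomial. If [x i] divides f g then one of the two factors
    vanishes on the hyperplane [x i = 0], because germs form a domain, and can be divided by [x i].
    Hence several functions are monomialized together by monomializing their product. *)
Lemma mz_factor n f g : germ n f -> germ n g -> monu n (fun x => f x * g x) -> monu n f.
Proof.
move=> gf gg [al [u [gu u0 fgE]]].
have [k] := ubnP (\sum_(i < n) al i); elim: k al f g gf gg fgE => // k IH al f g gf gg fgE alk.
have [/forallP al0|/forallPn[/= i ali]] := boolP [forall i : 'I_n, al i == 0%N].
  exists (fun=> 0%N), f; split=> //; last by near=> x; rewrite mon0 mul1r.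
  have := nb0 fgE; rewrite /mon big1 ?mul1r => [E|i _]; last by rewrite (eqP (al0 i)).
  by apply/eqP => f0; move/eqP: u0; apply; rewrite -E f0 mul0r.
have fg0 : \forall x \near nb n, f (upd x i 0) * g (upd x i 0) = 0.
  apply: filterS (nb_upd i fgE) => x ->.
  by rewrite /mon (bigD1 i)//= upd_id expr0n (negbTE ali) !mul0r.
pose al' j := if j == i :> nat then (al i).-1 else al j.
have alE x : mon n al x = x i * mon n al' x.
  rewrite /mon (bigD1 i)//= [in RHS](bigD1 i)//= /al' eqxx mulrA -exprS prednK ?lt0n//.
  congr (_ * _); apply: eq_bigr => j ji; rewrite ifN//.
have al'k : (\sum_(i < n) al' i < k)%N.
  move: alk; rewrite (bigD1 i)//= [X in (X < k)%N](bigD1 i)//= /al' eqxx.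
  rewrite [X in (_ + X < k)%N](eq_bigr (fun j : 'I_n => al j)); last first.
    by move=> j ji; rewrite (negbTE (ji : (j : nat) != i)).
  by move: ali; lia.
have [f0|g0] := germ_domain (germ_upd0 i gf) (germ_upd0 i gg) fg0.
- have [h [gh hE]] := germ_hadamard (ltn_ord i) gf.
  have fE : \forall x \near nb n, f x = x i * h x.
    by apply: filterS (filterI hE f0) => x [-> ->]; rewrite add0r.
  have hgE : \forall x \near nb n, h x * g x = mon n al' x * u x.
    apply: (near_divr (ltn_ord i)); [exact: germ_mul|exact: germ_mul (germ_mon _ _ _) gu|].
    by apply: filterS (filterI fE fgE) => x [E1 E2]; rewrite mulrA -E1 E2 alE mulrA.
  have [be [v [gv v0 vE]]] := IH al' h g gh gg hgE al'k.
  exists (fun j => (j == i :> nat) + be j)%N, v; split=> //.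
  by apply: filterS (filterI fE vE) => x [-> ->]; rewrite monD mon1// mulrA.
- have [h [gh hE]] := germ_hadamard (ltn_ord i) gg.
  have gE : \forall x \near nb n, g x = x i * h x.
    by apply: filterS (filterI hE g0) => x [-> ->]; rewrite add0r.
  have fhE : \forall x \near nb n, f x * h x = mon n al' x * u x.
    apply: (near_divr (ltn_ord i)); [exact: germ_mul|exact: germ_mul (germ_mon _ _ _) gu|].
    by apply: filterS (filterI gE fgE) => x [E1 E2]; rewrite mulrCA -E1 E2 alE mulrA.
  exact: IH gf gh fhE al'k.
Unshelve. all: by end_near. Qed.

Lemma mz_factor_prod n (I : finType) (S : {set I}) (f : I -> E -> R) :
  (forall i, germ n (f i)) -> monu n (fun x => \prod_(i in S) f i x) ->
  forall i, i \in S -> monu n (f i).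
Proof.
move=> gf H i iS; apply: (@mz_factor _ (f i) (fun x => \prod_(j in S :\ i) f j x)) => //.
  by apply: germ_prod => j _.
rewrite (_ : (fun x => _) = (fun x => \prod_(i in S) f i x))//.
by apply/funext => x; rewrite [RHS](big_setD1 i).
Qed.

Lemma germ_near_gt n f (b : R) : germ n f -> b < f (fun=> 0) -> \forall x \near nb n, b < f x.
Proof.
move=> gf f0; have e0 : 0 < (f (fun=> 0) - b) / 2 by rewrite divr_gt0// subr_gt0.
have /cvgrPdist_le/(_ _ e0) := germ_cvg gf; apply: filterS => x.
by rewrite ler_distl => /andP[h1 h2]; move: e0; lra.
Qed.

(** Keep all coordinates but the k-th at a fixed radius and let the k-th tend to 0: the monomial
    with the larger k-th exponent becomes the smaller one. *)
Lemma mon_lt_point n al be k u v (P : set E) : germ n u -> germ n v ->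
  0 < u (fun=> 0) -> 0 < v (fun=> 0) -> (k < n)%N -> (al k < be k)%N -> nb n P ->
  exists x, [/\ P x, (forall i, (i < n)%N -> 0 < x i) & mon n be x * v x < mon n al x * u x].
Proof.
move=> gu gv u0 v0 kn ab nP.
have c0 : u (fun=> 0) / 2 < u (fun=> 0) by lra.
have [C [C0 vC]] := germ_bounded gv.
have [r r0 H] := filterI (filterI nP (germ_near_gt gu c0)) vC.
set c := u (fun=> 0) / 2 in c0 H.
have cp : 0 < c by rewrite divr_gt0.
pose C1 := \prod_(j < n | j != k :> nat) r ^+ al j.
pose C2 := \prod_(j < n | j != k :> nat) r ^+ be j.
have C10 : 0 < C1 by apply: prodr_gt0 => j _; rewrite exprn_gt0.
have C20 : 0 < C2 by apply: prodr_gt0 => j _; rewrite exprn_gt0.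
pose s := Num.min (Num.min 1 r) (C1 * c / (C2 * C) / 2).
have q0 : 0 < C1 * c / (C2 * C) by rewrite divr_gt0 ?mulr_gt0.
have s0 : 0 < s by rewrite !lt_min ltr01 r0 divr_gt0.
have s1 : s <= 1 by rewrite !ge_min lexx.
have sr : s <= r by rewrite !ge_min lexx orbT.
have sq : s < C1 * c / (C2 * C).
  apply: le_lt_trans (_ : C1 * c / (C2 * C) / 2 < _); last by lra.
  by rewrite !ge_min lexx !orbT.
pose x : E := upd (wt n r) k s.
have monE (ga : nat -> nat) : mon n ga x = (\prod_(j < n | j != k :> nat) r ^+ ga j) * s ^+ ga k.
  rewrite /mon (bigD1 (Ordinal kn))//= /x upd_id mulrC; congr (_ * _).
  by apply: eq_big => // j jk; rewrite /upd (negbTE (jk : (j : nat) != k)) /wt ltn_ord.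
have dx : dom (wt n r) x.
  move=> j; rewrite /x /upd; case: eqP => [->|_].
    by rewrite /wt kn ger0_norm// ltW.
  by rewrite ger0_norm// wt_ge0// ltW.
have [[Px ux] vx] := H x dx.
exists x; split=> //.
  by move=> i ni; rewrite /x /upd; case: eqP => // _; rewrite /wt ni.
rewrite !monE -/C1 -/C2.
apply: (@le_lt_trans _ _ (C2 * s ^+ be k * C)).
  apply: ler_wpM2l; first by rewrite mulr_ge0 ?exprn_ge0// ltW.
  exact: le_trans (ler_norm _) vx.
apply: (@le_lt_trans _ _ (C2 * (s * s ^+ al k) * C)).
  rewrite ler_wpM2r ?(ltW C0)// ler_wpM2l ?(ltW C20)// -exprS.
  by apply: ler_wiXn2l => //; apply: ltW.
apply: (@lt_trans _ _ (C1 * s ^+ al k * c)); last first.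
  by rewrite ltr_pM2l// mulr_gt0// exprn_gt0.
have -> : C2 * (s * s ^+ al k) * C = s ^+ al k * (s * (C2 * C)) by ring.
have -> : C1 * s ^+ al k * c = s ^+ al k * (C1 * c) by ring.
by rewrite ltr_pM2l ?exprn_gt0// -ltr_pdivlMr// mulr_gt0.
Qed.

(* On the positive orthant the quotient of two incomparable monomials takes
   values both above and below 1, so the difference cannot have constant sign. *)
Lemma mon_comparable n al be u v f : germ n u -> germ n v -> 0 < u (fun=> 0) -> 0 < v (fun=> 0) ->
  mz n f -> (\forall x \near nb n, f x = mon n al x * u x - mon n be x * v x) ->
  (forall i, (i < n)%N -> (al i <= be i)%N) \/ (forall i, (i < n)%N -> (be i <= al i)%N).
Proof.
move=> gu gv u0 v0 mf fE; apply: contrapT => /not_orP[/existsNP[i /not_implyP[ni /negP iab]]].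
move=> /existsNP[k /not_implyP[nk /negP kab]].
rewrite -ltnNge in iab; rewrite -ltnNge in kab.
have key P : nb n P -> exists x y, [/\ P x, P y, (forall i, (i < n)%N -> 0 < x i),
   (forall i, (i < n)%N -> 0 < y i) & f x < 0 < f y].
  move=> nP; have nP' := nbI nP fE.
  have [x [[Px fx] x0 xl]] := mon_lt_point gv gu v0 u0 ni iab nP'.
  have [y [[Py fy] y0 yl]] := mon_lt_point gu gv u0 v0 nk kab nP'.
  by exists x, y; split=> //; rewrite fx fy subr_lt0 subr_gt0 xl yl.
case: mf => [f0|[ga [w [gw w0 wE]]]].
  by have [x [y [fx _ _ _]]] := key _ f0; rewrite fx ltxx.
(* On the positive orthant a monomial times a unit w has the constant sign of w(0), whereas [key]
   produces both signs. *)
pose c := w (fun=> 0).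
have cw : \forall x \near nb n, 0 < w x * c.
  by apply: germ_near_gt; [exact: germ_mul gw (germ_cst _ _)|rewrite -/c -expr2 exprn_even_gt0].
have [x [y [[wx cx] [wy cy] x0 y0 /andP[fx fy]]]] := key _ (nbI wE cw).
have hx : 0 < f x * c by rewrite wx -mulrA mulr_gt0// mon_pos.
have hy : 0 < f y * c by rewrite wy -mulrA mulr_gt0// mon_pos.
by move: hx hy; rewrite nmulr_rgt0// pmulr_rgt0// => /ltW; rewrite leNgt => /negP.
Qed.

End Monomial.

(** * Monomialization along an ultrafilter *)

Section Charts.
Variable R : realType.
Notation E := (nat -> R).
Local Notation nb := (@nb R).
Variables (U : set_system nat) (UU : UltraFilter U).

Lemma ultraP (P : set nat) : U P \/ U (~` P).
Proof. exact: in_ultra_setVsetC. Qed.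

Lemma ultraI (P Q : set nat) : U P -> U Q -> U (P `&` Q).
Proof. exact: filterI. Qed.

Lemma ultra_ex (P : set nat) : U P -> exists j, P j.
Proof. by move=> /filter_ex. Qed.

Lemma ultra_forall (n : nat) (P : nat -> nat -> Prop) :
  (forall i, (i < n)%N -> U [set j | P i j]) -> U [set j | forall i, (i < n)%N -> P i j].
Proof.
elim: n => [|n IH] H; first by apply: filterS filterT => j _ i.
have h : U [set j | forall i, (i < n)%N -> P i j].
  by apply: IH => i ni; apply: H; rewrite ltnS ltnW.
apply: filterS (ultraI h (H n (ltnSn n))) => j [h1 h2] i.
by rewrite ltnS leq_eqVlt => /orP[/eqP->//|/h1].
Qed.

(** If the sequence is bounded for almost all indices, its limit is the supremum of the numbers that
    are below almost all terms. The finite and infinite alternatives are the two affine charts of a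
    blow-up. *)
Lemma ultra_lim (t : nat -> R) :
  (exists c, forall e, 0 < e -> U [set j | `|t j - c| <= e]) \/ (forall B, U [set j | B < `|t j|]).
Proof.
have [|/existsNP[B HB]] := pselect (forall B, U [set j | B < `|t j|]); first by right.
left; have tB : U [set j | `|t j| <= B].
  have [//|h] := ultraP [set j | B < `|t j|].
  by apply: filterS h => j /= /negP; rewrite -leNgt.
pose S : set R := [set s | U [set j | s <= t j]].
have Sub s : S s -> s <= B.
  move=> Ss; rewrite leNgt; apply/negP => Bs.
  have [j [/= h1 h2]] := ultra_ex (ultraI Ss tB).
  by have := ler_norm (t j); lra.
have S0 : S (- B) by apply: filterS tB => j /=; rewrite ler_norml => /andP[].
have hS : has_sup S by split; [exists (- B)|exists B].
exists (sup S) => e e0.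
have h1 : U [set j | t j <= sup S + e].
  have [//|h] := ultraP [set j | t j <= sup S + e].
  have : S (sup S + e) by apply: filterS h => j /= /negP; rewrite -ltNge => /ltW.
  by move/(ub_le_sup hS.2); rewrite gerDl leNgt e0.
have [s Ss sS] := sup_adherent e0 hS.
apply: filterS (ultraI h1 Ss) => j [/= a b]; rewrite ler_distl; lra.
Qed.

(* Points [p j] tend to 0 along the ultrafilter U.  Among the charts of a
   blow-up, one contains U-almost all of them, and only that one is followed. *)
Definition infl (m : nat) (p : nat -> E) : Prop := forall P, nb m P -> U [set j | P (p j)].

Lemma inf_coord m p i (e : R) : infl m p -> 0 < e -> U [set j | `|p j i| <= e].
Proof.
move=> ip e0; apply: (ip [set x : E | `|x i| <= e]); exists e => // x dx; apply: le_trans (dx i) _.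
by rewrite /wt; case: ifP => // _; apply: ltW.
Qed.

Lemma inf_supp m p : infl m p -> U [set j | forall i, (m <= i)%N -> p j i = 0].
Proof. by move=> ip; apply: ip (near_supp R m). Qed.

Lemma infP m p : (forall i e, (i < m)%N -> 0 < e -> U [set j | `|p j i| <= e]) ->
  U [set j | forall i, (m <= i)%N -> p j i = 0] -> infl m p.
Proof.
move=> H S P [r r0 rP].
have h : U [set j | forall i, (i < m)%N -> `|p j i| <= r].
  by apply: ultra_forall => i im; apply: H.
apply: filterS (ultraI h S) => j [h1 h2]; apply: rP => i; rewrite /wt.
by case: ltnP => im; [apply: h1|rewrite h2// normr0].
Qed.

(** The points [q j] are lifts of almost all [p j] to the chart, and they again tend to 0. *)
Definition chart (n m : nat) (pi : nat -> E -> R) (p q : nat -> E) : Prop :=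
  [/\ gmap n m pi, infl m q & U [set j | p j = sub n pi (q j)]].

(** Positivity permits real roots to be extracted and monomials to be compared by size. *)
Definition upos (m : nat) (q : nat -> E) := U [set j | forall i, (i < m)%N -> 0 < q j i].

(** Simultaneous monomialization along p. The dimension m may drop, since coordinates that vanish at
    almost all points are discarded. *)
Definition Good (n : nat) (p : nat -> E) (I : finType) (fs : I -> E -> R) : Prop :=
  exists m pi q, [/\ (m <= n)%N, chart n m pi p q, upos m q &
    forall k, mz m (fun x => fs k (sub n pi x))].

Lemma chart_comp n m l pi pi' p q q' : chart n m pi p q -> chart m l pi' q q' ->
  chart n l (fun i x => pi i (sub m pi' x)) p q'.
Proof.
move=> [g iq pq] [g' iq' qq']; split=> //; first exact: gmap_comp.
by apply: filterS (ultraI pq qq') => j [/= e1 e2]; rewrite e1 e2.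
Qed.

Lemma Good_chart n m pi p q (I : finType) (fs : I -> E -> R) : (m <= n)%N ->
  chart n m pi p q -> Good m q (fun k x => fs k (sub n pi x)) -> Good n p fs.
Proof.
move=> mn c [l [pi' [q' [lm c' pq' H]]]].
exists l, (fun i x => pi i (sub m pi' x)), q'; split=> //.
- exact: leq_trans mn.
- exact: chart_comp c c'.
Qed.

Lemma chart_id n p : infl n p -> chart n n (fun i x => x i) p p.
Proof.
move=> ip; split=> //; first exact: gmap_res.
by apply: filterS (inf_supp ip) => j h; exact: (esym (res_id h)).
Qed.

Lemma inf_res n p : infl n.+1 p -> infl n (fun j => res n (p j)).
Proof.
move=> ip; apply: infP => [i e ni e0|].
  by apply: filterS (inf_coord i ip e0) => j /=; rewrite /res ni.
by apply: filterS filterT => j _ i ni; rewrite /res ltnNge ni.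
Qed.

(** A chart of the first n coordinates, extended by the identity on the last one, which moves from
    place n to place m when the dimension drops. *)
Definition ext (n m : nat) (pi : nat -> E -> R) : nat -> E -> R :=
  fun i x => if i == n then x m else pi i (res m x).

Lemma chart_ext n m pi p q : infl n.+1 p -> chart n m pi (fun j => res n (p j)) q ->
  chart n.+1 m.+1 (ext n m pi) p (fun j => upd (q j) m (p j n)).
Proof.
move=> ip [g iq pq]; split.
- move=> i; rewrite ltnS leq_eqVlt /ext; case: eqP => [_ _|_ /= /g[gi g0]].
    by split=> //; apply: germ_var.
  by split; [apply: germ_res|rewrite res_id].
- apply: infP => [i e mi e0|].
    rewrite /upd; case: (i == m); first exact: inf_coord ip e0.
    exact: inf_coord iq e0.
  apply: filterS (inf_supp iq) => j h i mi; rewrite /upd gtn_eqF//.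
  by apply: h; apply: ltnW.
- apply: filterS (ultraI (ultraI (inf_supp ip) (inf_supp iq)) pq) => j [[/= s1 s2] e].
  have rE : res m (upd (q j) m (p j n)) = q j.
    apply/funext => i; rewrite /res /upd; case: ltnP => [im|im]; first by rewrite ltn_eqF.
    by rewrite s2.
  apply/funext => i; rewrite /sub ltnS leq_eqVlt /ext rE /upd eqxx.
  have [->//|ni/=] := eqVneq i n.
  case: ltnP => ni'; last by apply: s1; rewrite ltn_neqAle eq_sym ni.
  by have := congr1 (fun x => x i) e; rewrite /res /sub ni'.
Qed.

Lemma chart_last n (h : E -> R) p (t : nat -> R) : germ n.+1 h -> h (fun=> 0) = 0 -> infl n.+1 p ->
  (forall e, 0 < e -> U [set j | `|t j| <= e]) ->
  U [set j | p j n = h (upd (p j) n (t j))] ->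
  chart n.+1 n.+1 (fun i x => if i == n then h x else x i) p (fun j => upd (p j) n (t j)).
Proof.
move=> gh h0 ip tt ph; split.
- by move=> i _; case: (i == n); split=> //; apply: germ_var.
- apply: infP => [i e ni e0|].
    rewrite /upd; case: (i == n); [exact: tt|exact: inf_coord ip e0].
  apply: filterS (inf_supp ip) => j s i ni; rewrite /upd gtn_eqF//.
  exact: s.
- apply: filterS (ultraI ph (inf_supp ip)) => j [/= e s]; apply/funext => i.
  rewrite /sub; case: ltnP => ni; last by rewrite s.
  by have [->//|ni'] := eqVneq i n; rewrite /upd (negbTE ni').
Qed.

Lemma chart_drop n p : infl n.+1 p -> U [set j | p j n = 0] ->
  chart n.+1 n (fun i x => if i == n then 0 else x i) p (fun j => res n (p j)).
Proof.
move=> ip p0; split.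
- by move=> i _; case: (i == n); split=> //; [apply: germ_cst|apply: germ_var].
- exact: inf_res.
- apply: filterS (ultraI p0 (inf_supp ip)) => j [/= e s]; apply/funext => i.
  rewrite /sub; case: ltnP => ni; last by rewrite s.
  have [->//|ni'] := eqVneq i n; rewrite /res.
  by rewrite ltnS leq_eqVlt (negbTE ni')/= in ni; rewrite ni.
Qed.

Lemma mz_res n m (f : E -> R) : (n <= m)%N -> mz n f -> mz m (fun x => f (res n x)).
Proof.
move=> nm mf; apply: (mz_comp (@gmap_res R n m) _ mf) => i ni.
by apply: mz_var; apply: leq_trans nm.
Qed.

(** The ultrafilter decides for each coordinate whether it is zero, positive or negative; it is then
    dropped, kept or reflected. *)
Lemma Good_coords n p : infl n p -> Good n p (fun (k : 'I_n) x => x k).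
Proof.
elim: n p => [|n IH] p ip.
  exists 0%N, (fun i x => x i), p; split=> //; [exact: chart_id|by apply: filterS filterT|by case].
have [m [pi [q [mn c qpos H]]]] := IH _ (inf_res ip).
have ce := chart_ext ip c.
set q' := fun j => upd (q j) m (p j n) in ce.
have q'n j : q' j m = p j n by rewrite /q' upd_id.
have [_ iq' _] := ce.
have mce i : (i < n.+1)%N -> mz m.+1 (ext n m pi i).
  rewrite ltnS leq_eqVlt /ext; have [_ _|_ /= ni] := eqVneq i n; first exact: mz_var.
  apply: mz_res => //; apply: (mz_eq (H (Ordinal ni))).
  by apply: filterS filterT => x _ /=; rewrite /sub ni.
have fin l pi' q'' : (l <= n.+1)%N -> chart m.+1 l pi' q' q'' -> upos l q'' ->
    (forall i, (i < m.+1)%N -> mz l (pi' i)) -> Good n.+1 p (fun (k : 'I_n.+1) x => x k).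
  move=> ln c' p' H'; exists l, (fun i x => ext n m pi i (sub m.+1 pi' x)), q''; split=> //.
    exact: chart_comp ce c'.
  move=> k; have [g' _ _] := c'.
  apply: (mz_eq (mz_comp g' H' (mce k (ltn_ord k)))).
  by apply: filterS filterT => x _; rewrite /sub ltn_ord.
(* Used with c0 = 1 and c0 = -1, according to the sign of the last coordinate. *)
have sgn (c0 : R) : c0 != 0 -> U [set j | 0 < p j n / c0] -> Good n.+1 p (fun (k : 'I_n.+1) x => x k).
  move=> c00 pc; have ch : chart m.+1 m.+1 (fun i x => if i == m then c0 * x m else x i) q'
      (fun j => upd (q' j) m (p j n / c0)).
    apply: chart_last => //.
    - by apply: germ_mul; [exact: germ_cst|exact: germ_var].
    - by rewrite mulr0.
    - move=> e e0; have ce0 : 0 < e * `|c0| by rewrite mulr_gt0// normr_gt0.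
      apply: filterS (inf_coord n ip ce0) => j /=.
      by rewrite normrM normfV ler_pdivrMr// normr_gt0.
    - by apply: filterS filterT => j _; rewrite /= upd_id q'n mulrC divfK.
  apply: (fin _ _ _ _ ch) => //.
    apply: filterS (ultraI qpos pc) => j [/= h1 h2] i; rewrite ltnS leq_eqVlt /upd /q'.
    have [->//|ni/= im] := eqVneq i m.
    by rewrite /upd (negbTE ni); apply: h1.
  move=> i im; have [_|ni] := eqVneq i m; last exact: mz_var.
  by apply: mz_mul; [apply: mz_unit => //; exact: germ_cst|exact: mz_var].
have [p0|np0] := ultraP [set j | p j n = 0].
  apply: (fin _ _ _ _ (chart_drop iq' _)) => //.
  - exact: leqW.
  - by apply: filterS p0 => j; rewrite /= q'n.
  - apply: filterS qpos => j h i im; rewrite /res im /q' /upd ltn_eqF//; exact: h.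
  - move=> i im; have [_|ni] := eqVneq i m; first exact: mz0.
    by apply: mz_var; rewrite ltnS leq_eqVlt (negbTE ni) in im.
have [pp|pn] := ultraP [set j | 0 < p j n].
  by apply: (sgn 1); [exact: oner_neq0|apply: filterS pp => j /=; rewrite divr1].
apply: (sgn (-1)); first by rewrite oppr_eq0 oner_neq0.
apply: filterS (ultraI np0 pn) => j [/= /eqP h1 /negP h2].
by rewrite invrN invr1 mulrN1 oppr_gt0 lt_neqAle h1 leNgt.
Qed.

Lemma Good_of_mz n m pi p q (I : finType) (fs : I -> E -> R) : (m <= n)%N ->
  chart n m pi p q -> (forall k, mz m (fun x => fs k (sub n pi x))) -> Good n p fs.
Proof.
move=> mn c H; apply: (Good_chart mn c); have [g iq _] := c.
have [l [pi' [q' [lm c' qp H']]]] := Good_coords iq.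
exists l, pi', q'; split=> // k; have [g' _ _] := c'.
apply: (mz_comp g' _ (H k)) => i im.
apply: (mz_eq (H' (Ordinal im))).
by apply: filterS filterT => x _; rewrite /sub im.
Qed.

Lemma germ_ultra_lim n f q : germ n f -> infl n q ->
  forall e, 0 < e -> U [set j | `|f (q j) - f (fun=> 0)| <= e].
Proof.
move=> gf iq e e0; apply: (iq [set x | `|f x - f (fun=> 0)| <= e]).
have /cvgrPdist_le/(_ _ e0) := germ_cvg gf; apply: filterS => x.
by rewrite distrC.
Qed.

Lemma ultra_lim_unique (t : nat -> R) a b : (forall e, 0 < e -> U [set j | `|t j - a| <= e]) ->
  (forall e, 0 < e -> U [set j | `|t j - b| <= e]) -> a = b.
Proof.
move=> ta tb; apply/eqP; rewrite -subr_eq0 -normr_le0; apply/ler_addgt0Pr => e e0; rewrite add0r.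
have e2 : 0 < e / 2 by rewrite divr_gt0.
have [j [/= h1 h2]] := ultra_ex (ultraI (ta _ e2) (tb _ e2)).
have -> : a - b = (t j - b) - (t j - a) by ring.
by apply: le_trans (ler_normB _ _) _; lra.
Qed.

End Charts.

(** * Ramification, blow-ups and the decrease of the order *)

Section Charts2.
Variable R : realType.
Notation E := (nat -> R).
Local Notation nb := (@nb R).
Variables (U : set_system nat) (UU : UltraFilter U).
Local Notation chart := (@chart R U).
Local Notation infl := (@infl R U).
Local Notation upos := (@upos R U).

Lemma root_exists (D : nat) (s : R) : (0 < D)%N -> 0 < s -> {r : R | 0 < r & r ^+ D = s}.
Proof.
move=> D0 s0; exists (s `^ (D%:R^-1)); first by rewrite powR_gt0.
by rewrite -powR_mulrn ?powR_ge0// -powRrM mulVf ?pnatr_eq0 -?lt0n// powRr1// ltW.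
Qed.

(** Ramification as in Puiseux expansions: positive coordinates are replaced by their D-th roots,
    which makes fractional exponents with denominator D integral. *)
Lemma chart_pow n m D p : (0 < D)%N -> (m <= n)%N -> infl n p ->
  U [set j | forall i, (i < m)%N -> 0 < p j i] ->
  exists q, [/\ chart n n (fun i x => if (i < m)%N then x i ^+ D else x i) p q,
     forall j i, (m <= i)%N -> q j i = p j i &
     U [set j | forall i, (i < m)%N -> 0 < q j i /\ q j i ^+ D = p j i]].
Proof.
move=> D0 mn ip pos.
pose q j i := if (i < m)%N then
  (if pselect (0 < p j i) is left h then s2val (root_exists D0 h) else 0) else p j i.
have qP : U [set j | forall i, (i < m)%N -> 0 < q j i /\ q j i ^+ D = p j i].
  apply: filterS pos => j h i im; rewrite /q im.
  by case: pselect => [h'|/(_ (h i im))//]; case: (root_exists D0 h').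
have qm j i : (m <= i)%N -> q j i = p j i by rewrite /q ltnNge => ->.
exists q; split=> //; split.
- move=> i ni; case: ifP => im; split; rewrite ?expr0n ?gtn_eqF//; last exact: germ_var.
  by apply: germ_exp; apply: germ_var.
- apply: infP => [i e ni e0|].
    case: (ltnP i m) => im; last first.
      by apply: filterS (inf_coord i ip e0) => j /=; rewrite qm.
    have eD : 0 < e ^+ D by rewrite exprn_gt0.
    apply: filterS (ultraI UU (inf_coord i ip eD) qP) => j [/= h1 h2].
    have [q0 qD] := h2 i im; move: h1; rewrite -qD normrX gtr0_norm//.
    by rewrite ler_pXn2r// ?nnegrE ?ltW.
  apply: filterS (inf_supp ip) => j h i ni; rewrite qm ?h//.
  exact: leq_trans ni.
- apply: filterS (ultraI UU (inf_supp ip) qP) => j [/= s h]; apply/funext => i; rewrite /sub.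
  case: ltnP => ni; last by rewrite s.
  by case: ltnP => im; [have [_ ->] := h i im|rewrite qm].
Qed.

Lemma mon_sub m n al (pi : nat -> E -> R) x : (m <= n)%N -> mon m al (sub n pi x) = \prod_(i < m) pi i x ^+ al i.
Proof. by move=> mn; apply: eq_bigr => i _; rewrite /sub (leq_trans (ltn_ord i) mn). Qed.

Lemma res_sub m n pi x : (m <= n)%N -> res m (@sub R n pi x) = sub m pi x.
Proof.
move=> mn; apply/funext => i; rewrite /res /sub; case: ltnP => // im.
by rewrite (leq_trans im mn).
Qed.

Lemma mon_dec m (al : nat -> nat) i (x : E) : (i < m)%N -> (0 < al i)%N ->
  mon m al x = x i * mon m (fun j => if j == i then (al i).-1 else al j) x.
Proof.
move=> im ali; rewrite /mon (bigD1 (Ordinal im))//= [in RHS](bigD1 (Ordinal im))//= eqxx.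
rewrite mulrA -exprS prednK//; congr (_ * _); apply: eq_bigr => j ji.
by rewrite (negbTE (ji : (j : nat) != i)).
Qed.

Lemma sum_dec m (al : nat -> nat) i : (i < m)%N -> (0 < al i)%N ->
  (\sum_(j < m) (if j == i :> nat then (al i).-1 else al j)).+1 = \sum_(j < m) al j.
Proof.
move=> im ali; rewrite (bigD1 (Ordinal im))//= [in RHS](bigD1 (Ordinal im))//= eqxx.
rewrite -addSn prednK//; congr (_ + _)%N; apply: eq_bigr => j ji.
by rewrite (negbTE (ji : (j : nat) != i)).
Qed.

(** After blow-ups, one of the monomial and the last coordinate divides the other up to a unit. The
    induction is on the degree: one variable [x i] of the monomial is compared with the last
    coordinate through the limit of their quotient. *)
Lemma monomial_comparison n (ga : nat -> nat) p : infl n.+1 p -> upos n.+1 p ->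
  exists pi q, [/\ chart n.+1 n.+1 pi p q, forall i, (i < n.+1)%N -> mz n.+1 (pi i) &
   exists u h, [/\ germ n.+1 u, u (fun=> 0) != 0, germ n.+1 h &
   (\forall x \near nb n.+1, u x * mon n ga (sub n.+1 pi x) = pi n x * h x) \/
   (\forall x \near nb n.+1, u x * pi n x = mon n ga (sub n.+1 pi x) * h x)]].
Proof.
have [k] := ubnP (\sum_(i < n) ga i); elim: k ga p => // k IH ga p gak ip pp.
have [/forallP ga0|/forallPn[/= i0 gai]] := boolP [forall i : 'I_n, ga i == 0%N].
  exists (fun i x => x i), p; split; [exact: chart_id|by move=> i ni; apply: mz_var|].
  exists (fun=> 1), (fun x => x n); split; [exact: germ_cst|exact: oner_neq0|exact: germ_var|right].
  apply: filterS filterT => x _; rewrite mon_sub ?leqnSn// big1 ?mul1r// => i _.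
  by rewrite (eqP (ga0 i)).
have [i ni ga0] : exists2 i, (i < n)%N & (0 < ga i)%N by exists i0 => //; rewrite lt0n.
pose ga' j := if j == i then (ga i).-1 else ga j.
have monE (x : E) : mon n ga x = x i * mon n ga' x by apply: mon_dec.
have i_n : (i < n.+1)%N := leqW ni.
have nin : (i == n) = false by rewrite ltn_eqF.
pose t j := p j n / p j i.
case: (ultra_lim UU t) => [[c ct]|tB].
  (* Limit 0: put x_n = x_i x_n'. The factor [x i] cancels on both sides and the degree drops. *)
  have [c0|c0] := eqVneq c 0.
    have tc e : 0 < e -> U [set j | `|t j| <= e].
      by move=> e0; apply: filterS (ct e e0) => j /=; rewrite c0 subr0.
    have ch : chart n.+1 n.+1 (fun j x => if j == n then x i * x n else x j) p (fun j => upd (p j) n (t j)).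
      apply: chart_last => //.
      - by apply: germ_mul; apply: germ_var.
      - by rewrite mulr0.
      - apply: filterS pp => j h /=; rewrite upd_id /upd nin /t mulrC divfK//.
        by rewrite gt_eqF// h.
    set pi1 := (fun _ => _) in ch.
    have [g1 iq _] := ch.
    have pq : upos n.+1 (fun j => upd (p j) n (t j)).
      apply: filterS pp => j h l ln; rewrite /upd; case: eqP => _; last exact: h.
      by rewrite divr_gt0// h.
    have [|pi [q [c' mpi [u [h [gu u0 gh uh]]]]]] := IH ga' _ _ iq pq.
      by move: gak; rewrite -(sum_dec ni ga0).
    exists (fun i x => pi1 i (sub n.+1 pi x)), q; split; first exact: (chart_comp UU ch c').
      move=> j jn; rewrite /pi1; case: (j == n).
        apply: (mz_eq (mz_mul (mpi i i_n) (mpi n (ltnSn n)))).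
        by apply: filterS filterT => x _; rewrite /sub i_n ltnSn.
      apply: (mz_eq (mpi j jn)).
      by apply: filterS filterT => x _; rewrite /sub jn.
    have mE x : mon n ga (sub n.+1 (fun i x => pi1 i (sub n.+1 pi x)) x) =
        pi i x * mon n ga' (sub n.+1 pi x).
      rewrite monE /sub i_n {1}/pi1 nin; congr (_ * _).
        by rewrite /sub i_n.
      apply: eq_bigr => j _; rewrite (leqW (ltn_ord j)) /pi1 ltn_eqF//.
      by rewrite /sub (leqW (ltn_ord j)).
    have pE x : pi1 n (sub n.+1 pi x) = pi i x * pi n x.
      by rewrite /pi1 eqxx /sub i_n ltnSn.
    exists u, h; split=> //; case: uh => uh; [left|right]; apply: filterS uh => x e.
      by rewrite mE pE mulrCA e mulrA.
    by rewrite mE pE mulrCA e mulrA.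
  (* Finite nonzero limit: x_n = x_i (c + x_n') is [x i] times a unit, so it divides the monomial up
     to that unit. *)
  have ch : chart n.+1 n.+1 (fun j x => if j == n then x i * (c + x n) else x j) p (fun j => upd (p j) n (t j - c)).
    apply: chart_last => //.
    - apply: germ_mul; first exact: germ_var.
      by apply: germ_add; [exact: germ_cst|exact: germ_var].
    - by rewrite mul0r.
    - apply: filterS pp => j h /=; rewrite upd_id /upd nin /t addrC subrK mulrC divfK//.
      by rewrite gt_eqF// h.
  set pi1 := (fun _ => _) in ch.
  eexists; eexists; split; first exact: ch.
    move=> j jn; rewrite /pi1; case: (j == n); last exact: mz_var.
    apply: mz_mul; first exact: mz_var.
    by apply: mz_unit; [apply: germ_add; [exact: germ_cst|exact: germ_var]|rewrite addr0].
  exists (fun x => c + x n), (mon n ga'); split.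
  - by apply: germ_add; [exact: germ_cst|exact: germ_var].
  - by rewrite addr0.
  - exact: germ_mon.
  - left; apply: filterS filterT => x _.
    have -> : mon n ga (sub n.+1 pi1 x) = mon n ga x.
      rewrite mon_sub//; apply: eq_bigr => j _; by rewrite /pi1 ltn_eqF.
    by rewrite /pi1 eqxx monE; ring.
(* Infinite limit: put x_i = x_n x_i', so that the last coordinate divides [x i] and with it the
   monomial. *)
pose pi1 j (x : E) := if j == i then x n * x i else x j.
have ch : chart n.+1 n.+1 pi1 p (fun j => upd (p j) i (p j i / p j n)).
  split.
  - move=> j _; rewrite /pi1; case: (j == i); rewrite ?mulr0; split=> //; last exact: germ_var.
    by apply: germ_mul; apply: germ_var.
  - apply: infP => [j e jn e0|].
      have [->|ji] := eqVneq j i; last first.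
        by apply: filterS (inf_coord j ip e0) => l; rewrite /= /upd (negbTE ji).
      apply: filterS (ultraI UU pp (tB e^-1)) => l [/= h1]; rewrite upd_id /t => h2.
      have pn := h1 n (ltnSn n); have pi' := h1 i i_n.
      move: h2; rewrite !gtr0_norm ?divr_gt0// => h2.
      rewrite ler_pdivrMr// mulrC -ler_pdivrMr// .
      move/ltW: h2; rewrite ler_pdivlMr// mulrC => h2; rewrite ler_pdivrMr//.
      by move: h2; rewrite -ler_pdivlMr ?invr_gt0// invrK.
    apply: filterS (inf_supp ip) => l h j jn; rewrite /upd gtn_eqF ?h//.
    exact: leq_trans jn.
  - apply: filterS (ultraI UU pp (inf_supp ip)) => l [/= h1 h2]; apply/funext => j.
    rewrite /sub; case: ltnP => jn; last by rewrite h2.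
    rewrite /pi1 /upd; have [->|//] := eqVneq j i.
    by rewrite (gtn_eqF ni) eqxx mulrC divfK// gt_eqF// h1.
eexists; eexists; split; first exact: ch.
  move=> j jn; rewrite /pi1; case: (j == i); last exact: mz_var.
  by apply: mz_mul; apply: mz_var.
exists (fun=> 1), (fun x => x i * mon n ga' (sub n.+1 pi1 x)); split.
- exact: germ_cst.
- exact: oner_neq0.
- apply: germ_mul; first exact: germ_var.
  by have [g1 _ _] := ch; apply: (germ_comp (germ_mon R n n.+1 ga') g1).
- left; apply: filterS filterT => x _.
  by rewrite monE {1}/sub i_n /pi1 eqxx gtn_eqF// mul1r mulrA.
Qed.

Lemma mz_cancel n (u f : E -> R) : germ n u -> u (fun=> 0) != 0 -> germ n f ->
  mz n (fun x => u x * f x) -> mz n f.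
Proof.
move=> gu u0 gf [h|h]; last first.
  right; apply: (@mz_factor _ n f u) => //.
  by under eq_fun do rewrite mulrC.
by case: (germ_domain gu gf h) => [/nb0 z|]; [rewrite z eqxx in u0|left].
Qed.

(** One function is monomialized, and so are the first m coordinates of the chart: a monomial in
    these coordinates is going to be factored out of f and must itself pull back to a monomial times
    a unit. *)
Definition goodMap m p (f : E -> R) : Prop := exists l pi q, [/\ (l <= m.+1)%N,
  chart m.+1 l pi p q, forall i, (i < m)%N -> mz l (pi i) & mz l (fun x => f (sub m.+1 pi x))].

(** When the last coordinate dominates the monomial, the term x_m^(e+1) w dominates all others, and
    g becomes x_m^(e+1) times a unit in a chart where the last coordinate divides the monomial. *)
Lemma infinite_case m p (ga : nat -> nat) e (b : nat -> E -> R) w g :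
  infl m.+1 p -> upos m.+1 p -> (forall k, germ m (b k)) -> germ m.+1 w -> w (fun=> 0) != 0 ->
  germ m.+1 g ->
  (\forall x \near nb m.+1, g x = \sum_(k < e) b k (res m x) * mon m ga x ^+ (e.+1 - k) * x m ^+ k
     + x m ^+ e.+1 * w x) ->
  (forall B, U [set j | B < `|p j m / mon m ga (p j)|]) ->
  goodMap m p g.
Proof.
move=> ip pp gb gw w0 gg gE tB.
have [pi [q [ch mpi [u [h [gu u0 gh uh]]]]]] := monomial_comparison ga ip pp.
have [g1 iq pq] := ch.
exists m.+1, pi, q; split=> //; first by move=> i im; apply: mpi; apply: leqW.
have ppos : U [set j | 0 < mon m ga (p j) /\ 0 < p j m].
  by apply: filterS pp => j hj; split; [apply: mon_pos => i im; apply/hj/leqW|exact: hj].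
(* If the monomial divided the last coordinate, their quotient would stay bounded along the
   points. *)
case: uh => uh; last first.
  exfalso.
  have [C [C0 hC]] := germ_bounded gh.
  have [c [c0 uc]] := germ_near_neq0 gu u0.
  have h1 := iq _ (nbI uh (nbI hC uc)).
  have [j [[[/= e1 [e2 e3]] e4] [e5 [e6 e7]]]] :=
    ultra_ex UU (ultraI UU (ultraI UU h1 (tB (C / c))) (ultraI UU pq ppos)).
  have pjm : p j m = pi m (q j) by rewrite e5 /sub ltnSn.
  rewrite -pjm -e5 in e1.
  have : p j m / mon m ga (p j) = h (q j) / u (q j).
    have u0' : u (q j) != 0 by rewrite -normr_gt0; apply: lt_le_trans e3.
    have M0 : mon m ga (p j) != 0 by rewrite gt_eqF.
    have -> : h (q j) = u (q j) * p j m / mon m ga (p j) by rewrite e1 mulrC mulKf.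
    by field; rewrite u0' M0.
  move=> te; move: e4; rewrite te normrM normfV ltNge => /negP; apply.
  by apply: ler_pM => //; rewrite ?invr_ge0// lef_pV2// posrE//; apply: lt_le_trans e3.
(* Along the points h equals u times monomial / coordinate, which tends to 0. *)
have h0 : h (fun=> 0) = 0.
  apply: (ultra_lim_unique UU (germ_ultra_lim gh iq)) => r r0.
  have [C [C0 uC]] := germ_bounded gu.
  have h1 := iq _ (nbI uh uC).
  apply: filterS (ultraI UU (ultraI UU h1 (tB (C / r))) (ultraI UU pq ppos)).
  move=> j [[[/= e1 e2] e4] [e5 [e6 e7]]].
  have pjm : p j m = pi m (q j) by rewrite e5 /sub ltnSn.
  rewrite -pjm -e5 in e1; rewrite subr0.
  have -> : h (q j) = u (q j) / (p j m / mon m ga (p j)).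
    by rewrite invf_div mulrA e1 mulrC mulKf// gt_eqF.
  rewrite normrM normfV ler_pdivrMr; last by rewrite normr_gt0 mulf_neq0 ?invr_neq0 ?gt_eqF.
  apply: le_trans e2 _; rewrite mulrC -ler_pdivrMr//; exact: ltW.
have gbs k : germ m.+1 (fun x => b k (sub m pi x)).
  by apply: germ_comp (gb k) _ => i im; apply: g1; apply: leqW.
(* The quotient of u^(e+1) g by the (e+1)-st power of the last coordinate. At 0 only its first term
   survives, because h(0) = 0. *)
pose V x := u x ^+ e.+1 * w (sub m.+1 pi x) +
  \sum_(k < e) b k (sub m pi x) * h x ^+ (e.+1 - k) * u x ^+ k.
have gV : germ m.+1 V.
  apply: germ_add.
    by apply: germ_mul; [exact: germ_exp|exact: germ_comp gw g1].
  apply: germ_sum => k _; apply: germ_mul; last exact: germ_exp.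
  by apply: germ_mul; [exact: gbs|exact: germ_exp].
have V0 : V (fun=> 0) != 0.
  rewrite /V (sub0 g1) h0 big1 ?addr0 => [|k _]; first by rewrite mulf_neq0// expf_neq0.
  by rewrite expr0n subn_eq0 leqNgt (leqW (ltn_ord k))/= mulr0 mul0r.
apply: (@mz_cancel _ (fun x => u x ^+ e.+1)).
- exact: germ_exp.
- by rewrite expf_neq0.
- exact: germ_comp gg g1.
apply: (@mz_eq _ _ (fun x => pi m x ^+ e.+1 * V x)).
  by apply: mz_mul; [apply: mz_exp; apply: mpi|apply: mz_unit].
apply: filterS (nbI uh (sub_near g1 gE)) => x [e1 e2].
rewrite e2 res_sub//.
have -> : sub m.+1 pi x m = pi m x by rewrite /sub ltnSn.
rewrite /V 2!mulrDr addrC; congr (_ + _); last by ring.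
rewrite !mulr_sumr; apply: eq_bigr => k _.
have ke : (k <= e.+1)%N := leqW (ltnW (ltn_ord k)).
have uk : u x ^+ e.+1 = u x ^+ (e.+1 - k) * u x ^+ k by rewrite -exprD subnK.
have pk : pi m x ^+ e.+1 = pi m x ^+ (e.+1 - k) * pi m x ^+ k by rewrite -exprD subnK.
have := congr1 (fun z => z ^+ (e.+1 - k)) e1; rewrite /= !exprMn => e3.
rewrite uk pk [LHS](_ : _ = b k (sub m pi x) * u x ^+ k * pi m x ^+ k *
  (pi m x ^+ (e.+1 - k) * h x ^+ (e.+1 - k))); last by ring.
by rewrite -e3; ring.
Qed.

Lemma germ_poly n (p : {poly R}) (f : E -> R) : germ n f -> germ n (fun x => p.[f x]).
Proof.
move=> gf; rewrite (_ : (fun x => _) = (fun x => \sum_(i < size p) p`_i * f x ^+ i)).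
  by apply: germ_sum => i _; apply: germ_mul; [exact: germ_cst|exact: germ_exp].
by apply/funext => x; rewrite horner_coef.
Qed.

(* The Tschirnhausen normalisation excludes a root of full multiplicity. *)
Lemma multiplicity_lt e (b : nat -> R) (w c : R) k0 : w != 0 -> (k0 < e)%N -> b k0 != 0 ->
  exists k (q : {poly R}), [/\ (k <= e)%N, q.[c] != 0 &
    forall y, \sum_(k < e) b k * (c + y) ^+ k + (c + y) ^+ e.+1 * w = y ^+ k * q.[c + y]].
Proof.
move=> w0 k0e bk0.
(* The coefficient of degree e is 0 by the normalisation; the leading coefficient is w. *)
pose a k := if (k < e)%N then b k else if k == e.+1 then w else 0.
pose P := \poly_(k < e.+2) a k.
have ae1 : a e.+1 = w by rewrite /a ltnNge leqnSn eqxx.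
have ae : a e = 0 by rewrite /a ltnn ltn_eqF.
have sP : size P = e.+2 by rewrite size_poly_eq// ae1.
have P0 : P != 0 by rewrite -size_poly_eq0 sP.
have PE y : P.[y] = \sum_(k < e) b k * y ^+ k + y ^+ e.+1 * w.
  rewrite horner_poly !big_ord_recr/= ae ae1 mul0r addr0 [w * _]mulrC; congr (_ + _).
  by apply: eq_bigr => k _; rewrite /a ltn_ord.
have [k [q q0 Pq]] := multiplicity_XsubC P c.
rewrite P0/= in q0.
exists k, q; split; last first.
- by move=> y; rewrite -PE Pq hornerM horner_exp hornerXsubC addrAC subrr add0r mulrC.
- exact: q0.
have q00 : q != 0 by apply: contra_neq P0 => q0'; rewrite Pq q0' mul0r.
have := sP; rewrite Pq size_Mmonic// ?monic_exp ?monicXsubC// size_exp_XsubC addnS/= => sq.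
rewrite leqNgt; apply/negP => ke.
have sq1 : size q = 1%N.
  have : (0 < size q)%N by rewrite size_poly_gt0.
  by move: (size q) sq => s; move: ke; clear; lia.
have kE : k = e.+1 by move: sq; rewrite sq1; clear; lia.
have [d d0 qE] := size_poly1P q (introT eqP sq1).
have XE : ('X - c%:P) ^+ e.+1 = \prod_(z <- nseq e.+1 c) ('X - z%:P).
  by rewrite big_nseq -/(iterop _ _ _ _) exprS; elim: (e) => [|i IH] /=; rewrite ?expr0// exprS IH.
(* For P = d (X - c)^(e+1) the vanishing coefficient of degree e gives (e + 1) c = 0. Then P is a
   multiple of X^(e+1), contrary to [b k0 != 0]. *)
have c0 : c = 0.
  have := ae; rewrite -[a e](_ : P`_e = _); last by rewrite coef_poly ltnW.
  rewrite Pq kE qE coefCM XE.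
  have := @coefPn_prod_XsubC R (nseq e.+1 c); rewrite size_nseq => /(_ isT) /= ->.
  rewrite -[_ :: _]/(nseq e.+1 c) big_nseq iter_addr_0 => /eqP; rewrite mulf_eq0 (negbTE d0)/= oppr_eq0 mulrn_eq0/= => /eqP //.
have : P`_k0 = b k0 by rewrite coef_poly /a k0e ifT// (ltn_trans k0e)// ltnW.
rewrite Pq kE qE coefCM c0 subr0 coefXn ltn_eqF ?mulr0 => [z|]; first by rewrite -z eqxx in bk0.
exact: ltnW.
Qed.

Lemma goodMap_comp m m' pi0 p q g : (m' <= m)%N -> chart m.+1 m'.+1 pi0 p q ->
  (forall i, (i < m)%N -> exists2 f, mz m' f & forall x, pi0 i x = f (res m' x)) ->
  goodMap m' q (fun x => g (sub m.+1 pi0 x)) -> goodMap m p g.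
Proof.
move=> m'm c H [l [pi [q' [lm' c' mpi mg]]]].
exists l, (fun i x => pi0 i (sub m'.+1 pi x)), q'; split=> //.
- exact: leq_trans lm' _.
- exact: chart_comp c c'.
- move=> i im; have [f mf fE] := H i im; have [g' _ _] := c'.
  have g'm : gmap m' l pi by move=> j jm; apply: g'; apply: leqW.
  apply: (mz_eq (mz_comp g'm mpi mf)).
  by apply: filterS filterT => x _; rewrite fE res_sub.
Qed.

(** Put x_m = mon (c + x_m') and factor out mon^(e+1). On the last axis the cofactor [g'] is a
    polynomial in c + y whose root at y = 0 has multiplicity at most e, so the order has dropped and
    the induction hypothesis applies. *)
Lemma finite_case m p (ga : nat -> nat) e (b : nat -> E -> R) w g c k0 i0 :
  infl m.+1 p -> upos m.+1 p -> (forall k, germ m (b k)) -> germ m.+1 w -> w (fun=> 0) != 0 ->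
  germ m.+1 g ->
  (\forall x \near nb m.+1, g x = \sum_(k < e) b k (res m x) * mon m ga x ^+ (e.+1 - k) * x m ^+ k
     + x m ^+ e.+1 * w x) ->
  (i0 < m)%N -> (0 < ga i0)%N -> (k0 < e)%N -> b k0 (fun=> 0) != 0 ->
  (forall r, 0 < r -> U [set j | `|p j m / mon m ga (p j) - c| <= r]) ->
  (forall d g' p', (d <= e)%N -> germ m.+1 g' -> reg m d g' -> infl m.+1 p' -> goodMap m p' g') ->
  goodMap m p g.
Proof.
move=> ip pp gb gw w0 gg gE i0m gi0 k0e bk0 tc IH.
pose h (x : E) := mon m ga x * (c + x m).
(* The exponent at [i0] is positive, so the monomial vanishes on this hyperplane; in particular the
   chart fixes 0, and on the last axis the arguments of [b] and [w] are frozen at 0. *)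
have monz (x : E) : x i0 = 0 -> mon m ga x = 0.
  by move=> xi; rewrite /mon (bigD1 (Ordinal i0m))//= xi expr0n gtn_eqF// mul0r.
have gh : germ m.+1 h.
  apply: germ_mul; first exact: germ_mon.
  by apply: germ_add; [exact: germ_cst|exact: germ_var].
have h0 : h (fun=> 0) = 0 by rewrite /h monz ?mul0r.
pose pi i (x : E) := if i == m then h x else x i.
pose q j := upd (p j) m (p j m / mon m ga (p j) - c).
have ch : chart m.+1 m.+1 pi p q.
  apply: chart_last => //; apply: filterS pp => j hj.
  have monE : mon m ga (upd (p j) m (p j m / mon m ga (p j) - c)) = mon m ga (p j).
    by apply: eq_bigr => i _; rewrite /upd ltn_eqF.
  rewrite /= /h monE upd_id addrC subrK mulrC divfK// gt_eqF//.
  by apply: mon_pos => i im; apply: hj; apply: leqW.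
have [g1 iq _] := ch.
have monpi x : mon m ga (sub m.+1 pi x) = mon m ga x.
  by rewrite mon_sub//; apply: eq_bigr => i _; rewrite /pi ltn_eqF.
have respi x : res m (sub m.+1 pi x) = res m x.
  rewrite res_sub//; apply/funext => i; rewrite /sub /res /pi; case: ltnP => // im.
  by rewrite ltn_eqF.
have pim x : sub m.+1 pi x m = mon m ga x * (c + x m) by rewrite /sub ltnSn /pi eqxx.
pose g' (x : E) := \sum_(k < e) b k (res m x) * (c + x m) ^+ k + (c + x m) ^+ e.+1 * w (sub m.+1 pi x).
have gcx : germ m.+1 (fun x : E => c + x m) by apply: germ_add; [exact: germ_cst|exact: germ_var].
have gg' : germ m.+1 g'.
  apply: germ_add; last by apply: germ_mul; [exact: germ_exp|exact: germ_comp gw g1].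
  by apply: germ_sum => k _; apply: germ_mul; [exact: germ_res|exact: germ_exp].
have gg'E : \forall x \near nb m.+1, mon m ga x ^+ e.+1 * g' x = g (sub m.+1 pi x).
  apply: filterS (sub_near g1 gE) => x ->; rewrite monpi respi pim /g' mulrDr exprMn.
  rewrite mulr_sumr mulrA; congr (_ + _); apply: eq_bigr => k _.
  have ke : (k <= e.+1)%N := leqW (ltnW (ltn_ord k)).
  have -> : mon m ga x ^+ e.+1 = mon m ga x ^+ (e.+1 - k) * mon m ga x ^+ k by rewrite -exprD subnK.
  by rewrite exprMn; ring.
have [k [Q [ke Qc QE]]] := @multiplicity_lt e (fun k => b k (fun=> 0)) _ c k0 w0 k0e bk0.
have rg' : reg m k g'.
  exists (fun x => Q.[c + x m]); split; [exact: germ_poly gcx|by rewrite addr0|].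
  exists 1 => // y _; rewrite /ax upd_id -QE /g' upd_id -/(ax m y); congr (_ + _ * _).
    apply: eq_bigr => l _; congr (b l _ * _); apply/funext => i.
    by rewrite /res /ax /upd; case: ltnP => // im; rewrite ltn_eqF.
  congr w; apply/funext => i; rewrite /sub /pi; case: ltnP => // im.
  have [_|ni] := eqVneq i m; last by rewrite /ax /upd (negbTE ni).
  by rewrite /h monz ?mul0r// /ax /upd ltn_eqF.
have [l [pi' [q' [lm c' mpi mg']]]] := IH k g' q ke gg' rg' iq.
exists l, (fun i x => pi i (sub m.+1 pi' x)), q'; split=> //.
- exact: (chart_comp UU ch c').
- move=> i im; apply: (mz_eq (mpi i im)).
  by apply: filterS filterT => x _; rewrite /pi ltn_eqF// /sub leqW.
have [gpi' _ _] := c'.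
apply: (@mz_eq _ _ (fun x => (mon m ga (sub m.+1 pi' x)) ^+ e.+1 * g' (sub m.+1 pi' x))).
  apply: mz_mul => //; apply: mz_exp.
  rewrite (_ : (fun x => _) = (fun x => \prod_(i < m) pi' i x ^+ ga i)).
    by apply: mz_prod => i _; apply: mz_exp; apply: mpi.
  by apply/funext => x; rewrite mon_sub.
by apply: filterS (sub_near gpi' gg'E) => x ->.
Qed.

End Charts2.

(** * Induction on the number of variables and on the order *)

Section Monomialization.
Variable R : realType.
Notation E := (nat -> R).
Local Notation nb := (@nb R).
Variables (U : set_system nat) (UU : UltraFilter U).
Local Notation chart := (@chart R U).
Local Notation infl := (@infl R U).
Local Notation upos := (@upos R U).
Local Notation Good := (@Good R U).
Local Notation goodMap := (@goodMap R U).

Lemma near_forall m e (P : nat -> E -> Prop) : (forall k, (k < e)%N -> \forall x \near nb m, P k x) ->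
  \forall x \near nb m, forall k, (k < e)%N -> P k x.
Proof.
elim: e => [|e IH] H; first by apply: filterS filterT.
have h : \forall x \near nb m, forall k, (k < e)%N -> P k x.
  by apply: IH => k ke; apply: H; apply: leqW.
apply: filterS (nbI h (H e (ltnSn e))) => x [h1 h2] k.
by rewrite ltnS leq_eqVlt => /orP[/eqP->//|/h1].
Qed.

(** The coefficients are to be compared by the sizes of a_k^(1/(e+1-k)), as on a Newton polygon. The
    power (e+1)! clears the denominators. *)
Definition newtN (e k : nat) : nat := (e.+1)`! %/ (e.+1 - k).

Lemma newtN_mul e k : (k < e)%N -> (newtN e k * (e.+1 - k) = (e.+1)`!)%N.
Proof.
move=> ke; rewrite /newtN divnK// dvdn_fact//; apply/andP; split; last exact: leq_subr.
by rewrite subn_gt0 leqW.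
Qed.

(** Differences of powers of the coefficients are monomials times units, so the exponent vectors are
    totally ordered by [mon_comparable]; the smallest one is attained at some [k0] and is divided
    out of every coefficient. The factor 2 in the powers makes the units positive at 0. *)
Lemma newton_data m e (a : nat -> E -> R) : (forall k, germ m (a k)) ->
  (forall k, (k < e)%N -> a k (fun=> 0) = 0) ->
  (forall k, (k < e)%N -> mz m (a k)) ->
  (forall k l, (k < e)%N -> (l < e)%N -> mz m (fun x => a k x ^+ (2 * newtN e k) - a l x ^+ (2 * newtN e l))) ->
  (forall k, (k < e)%N -> \forall x \near nb m, a k x = 0) \/
  exists k0 D (ga : nat -> nat) i0 (b : nat -> E -> R), [/\ (k0 < e)%N /\ (0 < D)%N,
    (i0 < m)%N /\ (0 < ga i0)%N, forall k, germ m (b k), b k0 (fun=> 0) != 0 &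
    forall k, (k < e)%N -> \forall x \near nb m,
      a k (sub m (fun i x => x i ^+ D) x) = b k x * mon m ga x ^+ (e.+1 - k)].
Proof.
move=> ga0 a0 ma mal.
pose z k := `[< \forall x \near nb m, a k x = 0 >].
have [/forallP zz|/forallPn[/= k1 zk1]] := boolP [forall k : 'I_e, z k].
  by left => k ke; apply/asboolP; apply: (zz (Ordinal ke)).
right.
have H k : exists (al : nat -> nat) u, (k < e)%N -> ~~ z k -> [/\ germ m u, u (fun=> 0) != 0 &
    \forall x \near nb m, a k x = mon m al x * u x].
  have [ke|ke] := boolP (k < e)%N; last by exists (fun=> 0%N), (fun=> 0).
  have [h|[al [u h]]] := ma k ke; last by exists al, u.
  by exists (fun=> 0%N), (fun=> 0) => _ /asboolPn.
have /choice[al /choice[u {}H]] := H.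
(* Exponent vectors being comparable, one of minimal total degree is minimal in each entry. *)
pose F k := (\sum_(i < m) newtN e k * al k i)%N.
have [k0 zk0 k0min] := @arg_minnP _ k1 (fun k : 'I_e => ~~ z k) (fun k => F k) zk1.
have cmp k : (k < e)%N -> ~~ z k -> forall i, (i < m)%N -> (newtN e k0 * al k0 i <= newtN e k * al k i)%N.
  move=> ke zk; have [gu u0 aE] := H k ke zk; have [gu' u0' aE'] := H k0 (ltn_ord k0) zk0.
  have sq (v : R) N : v != 0 -> 0 < v ^+ (2 * N).
    by move=> v0; rewrite exprM exprn_gt0// exprn_even_gt0.
  have := @mon_comparable R m (fun i => (2 * newtN e k0) * al k0 i)%N (fun i => (2 * newtN e k) * al k i)%N
    (fun x => u k0 x ^+ (2 * newtN e k0)) (fun x => u k x ^+ (2 * newtN e k))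
    _ (germ_exp _ gu') (germ_exp _ gu) (sq _ _ u0') (sq _ _ u0) (mal _ _ (ltn_ord k0) ke).
  case.
  - by apply: filterS (nbI aE aE') => x [-> ->]; rewrite !monX !exprMn.
  - by move=> h i im; have := h i im; rewrite -!mulnA leq_mul2l.
  - move=> h i im; rewrite leqNgt; apply/negP => lt.
    have := k0min (Ordinal ke) zk; rewrite /F /= leqNgt => /negP; apply.
    rewrite (bigD1 (Ordinal im))//= [X in (_ < X)%N](bigD1 (Ordinal im))//=.
    rewrite -addSn; apply: leq_add => //; apply: leq_sum => l _.
    by have := h l (ltn_ord l); rewrite -!mulnA leq_mul2l.
(* Once x_i is replaced by x_i^D, the exponents of [a k] become D al_k and dominate (e+1-k) al_k0,
   with equality for k = k0. So [ga = al k0] is an integral exponent and [b k0] does not vanish at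
   0. *)
pose D := (e.+1 - k0)%N.
have D0 : (0 < D)%N by rewrite subn_gt0 leqW.
pose ga := al k0.
have cmp' k : (k < e)%N -> ~~ z k -> forall i, (i < m)%N -> ((e.+1 - k) * ga i <= D * al k i)%N.
  move=> ke zk i im.
  have f0 := fact_gt0 e.+1.
  rewrite -(leq_pmul2l f0).
  have e1 := newtN_mul (ltn_ord k0); have e2 := newtN_mul ke.
  have : ((e.+1)`! * (e.+1 - k) * al k0 i <= (e.+1)`! * D * al k i)%N.
    rewrite -{1}e1 -{1}e2.
    have := cmp k ke zk i im; rewrite -/D.
    move: (newtN e k0) (newtN e k) (e.+1 - k)%N => A B C.
    rewrite -(leq_pmul2l D0) => h1.
    have -> : (A * D * C * al k0 i = C * (D * (A * al k0 i)))%N by ring.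
    have -> : (B * C * D * al k i = C * (D * (B * al k i)))%N by ring.
    by rewrite leq_mul2l h1 orbT.
  by rewrite !mulnA.
have pw : gmap m m (fun i (x : E) => x i ^+ D).
  by move=> i _; split; [apply: germ_exp; apply: germ_var|rewrite expr0n gtn_eqF].
pose b k (x : E) := if (k < e)%N && ~~ z k then
   mon m (fun i => D * al k i - (e.+1 - k) * ga i)%N x * u k (sub m (fun i x => x i ^+ D) x) else 0.
have [gu0 u00 a0E] := H k0 (ltn_ord k0) zk0.
have [i0 i0m gi0] : exists2 i0, (i0 < m)%N & (0 < ga i0)%N.
  apply: contrapT => h; have := nb0 a0E; rewrite a0// /mon big1 ?mul1r => [/esym/eqP|i _].
    by rewrite (negbTE u00).
  rewrite -/ga; have [->|gi] := posnP (ga i); first by rewrite expr0.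
  by exfalso; apply: h; exists i.
exists k0, D, ga, i0, b; split=> //.
- move=> k; rewrite /b; case kk: ((k < e)%N && ~~ z k); last exact: germ_cst.
  case/andP: kk => ke zk.
  have [gu _ _] := H k ke zk; apply: germ_mul; first exact: germ_mon.
  exact: germ_comp gu pw.
- rewrite /b ltn_ord zk0/= (sub0 pw) mulf_neq0//.
  rewrite /mon big1 ?oner_neq0// => i _.
  by rewrite -/ga /D subnn expr0.
- move=> k ke; rewrite /b ke/=; case: (boolP (z k)) => [/asboolP zk|zk].
    by have := sub_near pw zk; apply: filterS => x ->; rewrite mul0r.
  have [gu u0 aE] := H k ke zk.
  have := sub_near pw aE; apply: filterS => x ->.
  rewrite mulrAC; congr (_ * _); rewrite mon_sub// -monX -monD.
  apply: eq_bigr => i _; rewrite -exprM subnK//; exact: cmp'.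
Qed.

Lemma good_of_pos m p (ga : nat -> nat) e (b : nat -> E -> R) w g k0 i0 :
  infl m.+1 p -> upos m.+1 p -> (forall k, germ m (b k)) -> germ m.+1 w -> w (fun=> 0) != 0 ->
  germ m.+1 g ->
  (\forall x \near nb m.+1, g x = \sum_(k < e) b k (res m x) * mon m ga x ^+ (e.+1 - k) * x m ^+ k
     + x m ^+ e.+1 * w x) ->
  (i0 < m)%N -> (0 < ga i0)%N -> (k0 < e)%N -> b k0 (fun=> 0) != 0 ->
  (forall d g' p', (d <= e)%N -> germ m.+1 g' -> reg m d g' -> infl m.+1 p' -> goodMap m p' g') ->
  goodMap m p g.
Proof.
move=> ip pp gb gw w0 gg gE i0m gi0 k0e bk0 IH.
have [[c tc]|tB] := ultra_lim UU (fun j => p j m / mon m ga (p j)).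
  exact: (finite_case UU ip pp gb gw w0 gg gE i0m gi0 k0e bk0 tc IH).
exact: (infinite_case UU ip pp gb gw w0 gg gE tB).
Qed.

(** The remaining alternatives are: last coordinate zero, where g reduces to [a 0] (to 0 if e = 0);
    all coefficients zero, where g is x_m^(e+1) times a unit; and the generic case, which is
    prepared for [good_of_pos] by ramification and by a change of sign of the last coordinate. *)
Lemma good_normal_form m p e (a : nat -> E -> R) w g :
  infl m.+1 p -> U [set j | forall i, (i < m)%N -> 0 < p j i] ->
  (forall k, germ m (a k)) -> (forall k, (k < e)%N -> a k (fun=> 0) = 0) ->
  (forall k, (k < e)%N -> mz m (a k)) ->
  (forall k l, (k < e)%N -> (l < e)%N -> mz m (fun x => a k x ^+ (2 * newtN e k) - a l x ^+ (2 * newtN e l))) ->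
  germ m.+1 w -> w (fun=> 0) != 0 -> germ m.+1 g ->
  (\forall x \near nb m.+1, g x = \sum_(k < e) a k (res m x) * x m ^+ k + x m ^+ e.+1 * w x) ->
  (forall d g' p', (d <= e)%N -> germ m.+1 g' -> reg m d g' -> infl m.+1 p' -> goodMap m p' g') ->
  goodMap m p g.
Proof.
move=> ip pp gea a0 ma mal gw w0 gg gE IH.
have [y0|y0] := ultraP UU [set j | p j m = 0].
  have ch := chart_drop UU ip y0; have [g1 _ _] := ch.
  exists m, (fun i x => if i == m then 0 else x i), (fun j => res m (p j)); split=> //.
    by move=> i im; rewrite ltn_eqF//; apply: mz_var.
  have resE : \forall x \near nb m, res m (sub m.+1 (fun i x => if i == m then 0 else x i) x) = x.
    apply: filterS (near_supp R m) => x s; rewrite res_sub//; apply/funext => i.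
    by rewrite /sub; case: ltnP => im; [rewrite ltn_eqF|rewrite s].
  have gE1 := nbI (sub_near g1 gE) resE.
  case: e a0 ma {mal IH gE} gE1 => [|e] a0 ma gE1.
    apply: (mz_eq (mz0 R m)); apply: filterS gE1 => x [-> _].
    by rewrite big_ord0 add0r {1}/sub ltnSn eqxx expr1 mul0r.
  apply: (mz_eq (ma 0%N isT)); apply: filterS gE1 => x [-> xE].
  rewrite {2 3}/sub ltnSn eqxx big_ord_recl/= expr0 mulr1 big1 ?addr0 => [|k _]; last by rewrite exprS mul0r mulr0.
  by rewrite exprS !mul0r addr0 xE.
have [az|[k0 [D [ga [i0 [b [[k0e D0] [i0m gi0] gb bk0 aE]]]]]]] := newton_data gea a0 ma mal.
  exists m.+1, (fun i x => x i), p; split=> //; first exact: chart_id.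
    by move=> i im; apply: mz_var; apply: leqW.
  apply: (@mz_eq _ _ (fun x => x m ^+ e.+1 * w x)).
    by apply: mz_mul; [apply: mz_exp; apply: mz_var|apply: mz_unit].
  have az' := near_forall az.
  apply: filterS (nbI (nbI gE (res_near m.+1 az')) (near_supp R m.+1)) => x [[e1 e2] s].
  have -> : sub m.+1 (fun i x => x i) x = x by exact: (res_id s).
  by rewrite e1 big1 ?add0r// => k _; rewrite e2 ?mul0r.
have [q [ch qm qpos]] := chart_pow UU D0 (leqnSn m) ip pp.
set pw := (fun _ => _) in ch.
have [g1 iq _] := ch.
(* s is the sign of the last coordinate at almost all points. *)
have [s [s1 s0 sn spos]] : exists s : R, [/\ s * s = 1, s != 0, `|s| = 1 & U [set j | 0 < s * p j m]].
  have [h|h'] := ultraP UU [set j | 0 < p j m].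
    exists 1; split; rewrite ?mulr1 ?oner_neq0 ?normr1//.
    by apply: filterS h => j /=; rewrite mul1r.
  exists (-1); split; rewrite ?mulrNN ?mulr1 ?oppr_eq0 ?oner_neq0 ?normrN ?normr1//.
  apply: filterS (ultraI UU y0 h') => j [/= /eqP h1 /negP h2].
  by rewrite mulN1r oppr_gt0 lt_neqAle h1 leNgt.
pose sg (i : nat) (x : E) := if i == m then s * x m else x i.
pose q' j := upd (q j) m (s * p j m).
have ch' : chart m.+1 m.+1 sg q q'.
  apply: chart_last => //.
  - by apply: germ_mul; [exact: germ_cst|exact: germ_var].
  - by rewrite mulr0.
  - move=> r r0; apply: filterS (inf_coord m ip r0) => j /=.
    by rewrite normrM sn mul1r.
  - by apply: filterS filterT => j _; rewrite /= upd_id mulrA s1 mul1r qm.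
have [g2 iq' _] := ch'.
have pq' : upos m.+1 q'.
  apply: filterS (ultraI UU spos qpos) => j [/= h1 h2] i; rewrite ltnS leq_eqVlt /q' /upd.
  by have [//|ni/= /h2[]] := eqVneq i m.
apply: (goodMap_comp UU (leqnn m) (chart_comp UU ch ch')).
  move=> i im; exists (fun x => x i ^+ D); first by apply: mz_exp; apply: mz_var.
  by move=> x; rewrite /pw im /sub (leqW im) /sg ltn_eqF// /res im.
pose w' x := s ^+ e.+1 * w (sub m.+1 pw (sub m.+1 sg x)).
have gw' : germ m.+1 w'.
  by apply: germ_mul; [exact: germ_cst|exact: (germ_comp (germ_comp gw g1) g2)].
apply: (@good_of_pos m q' ga e (fun k x => s ^+ k * b k x) w' _ k0 i0) => //.
- by move=> k; apply: germ_mul; [exact: germ_cst|].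
- by rewrite /w' (sub0 g2) (sub0 g1) mulf_neq0// expf_neq0.
- exact: (germ_comp (germ_comp gg g1) g2).
- have aE' := near_forall aE.
  have := nbI (sub_near g2 (sub_near g1 gE)) (res_near m.+1 aE').
  apply: filterS => x [e1 e2].
  rewrite [LHS]e1.
  have rE : res m (sub m.+1 pw (sub m.+1 sg x)) = sub m (fun i x => x i ^+ D) (res m x).
    rewrite res_sub//; apply/funext => i; rewrite /sub; case: ltnP => // im.
    by rewrite /pw im /sub (leqW im) /sg ltn_eqF// /res im.
  have mE : sub m.+1 pw (sub m.+1 sg x) m = s * x m.
    by rewrite {1}/sub ltnSn /pw ltnn /sub ltnSn /sg eqxx.
  rewrite rE mE /w' exprMn; congr (_ + _); last by ring.
  apply: eq_bigr => k _; rewrite e2// exprMn.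
  have -> : mon m ga (res m x) = mon m ga x.
    by apply: eq_bigr => i _; rewrite /res ltn_ord.
  by ring.
- by rewrite mulf_neq0// expf_neq0.
Qed.

Definition Mono m := forall p (I : finType) (fs : I -> E -> R), infl m p ->
  (forall k, germ m (fs k)) -> Good m p fs.

(** Induction on the order d. For d = 0 the function is a unit. Otherwise the Tschirnhausen form has
    coefficients in one variable less; these are monomialized by hypothesis, and every further
    blow-up leaves a function of order below d. *)
Lemma reg_good N : (forall m, (m <= N)%N -> Mono m) -> forall d m, (m <= N)%N ->
  forall g p, germ m.+1 g -> reg m d g -> infl m.+1 p -> goodMap m p g.
Proof.
move=> MN d; have [D] := ubnP d; elim: D d => // D IH d dD m mN g p gg rg ip.
case: d dD rg => [|e] dD rg.
  have g0 : g (fun=> 0) != 0.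
    have [W [gW W0 [r r0 gE]]] := rg.
    have := gE 0; rewrite normr0 expr0 mul1r /ax upd0 => ->//; exact: ltW.
  exists m.+1, (fun i x => x i), p; split=> //; first exact: chart_id.
    by move=> i im; apply: mz_var; apply: leqW.
  by apply: mz_unit; [exact: (germ_comp gg (@gmap_res R m.+1 m.+1))|rewrite (sub0 (@gmap_res R m.+1 m.+1))].
have [phi [a [w [[gphi phi0] ga [gw w0] gE]]]] := tschirnhausen gg rg.
pose h (x : E) := x m + phi (res m x).
pose pi i (x : E) := if i == m then h x else x i.
pose q j := upd (p j) m (p j m - phi (res m (p j))).
have gh : germ m.+1 h by apply: germ_add; [exact: germ_var|exact: germ_res].
have res_updm (x : E) s : res m (upd x m s) = res m x.
  by apply/funext => i; rewrite /res /upd; case: ltnP => // im; rewrite ltn_eqF.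
have ch : chart m.+1 m.+1 pi p q.
  apply: chart_last => //.
  - by rewrite /h res_id// phi0 addr0.
  - move=> r r0; have r2 : 0 < r / 2 by rewrite divr_gt0.
    have := germ_ultra_lim (germ_res m.+1 gphi) ip r2.
    move=> hh; apply: filterS (ultraI UU (inf_coord m ip r2) hh) => j [/= h1].
    rewrite (_ : res m (fun=> 0) = fun=> 0) ?phi0 ?subr0; last by rewrite res_id.
    by move=> h2; apply: le_trans (ler_normB _ _) _; lra.
  - by apply: filterS filterT => j _; rewrite /= /h upd_id res_updm subrK.
have [g1 iq _] := ch.
apply: (goodMap_comp UU (leqnn m) ch).
  move=> i im; exists (fun x => x i); first exact: mz_var.
  by move=> x; rewrite /pi ltn_eqF// /res im.
(* Three kinds of functions are monomialized together: the coefficients, the coordinates (so that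
   monomials pull back to monomials) and the differences that make the exponents comparable. *)
pose fs (k : 'I_e + 'I_m + 'I_e * 'I_e) (x : E) : R := match k with
  | inl (inl k) => a k x | inl (inr i) => x i
  | inr (k, l) => a k x ^+ (2 * newtN e k) - a l x ^+ (2 * newtN e l) end.
have gea k : germ m (a k) by case: (ga k).
have gfs k : germ m (fs k).
  case: k => [[k|i]|[k l]] /=; [exact: gea|exact: germ_var|].
  by apply: germ_sub; apply: germ_exp.
have [m' [rho [q1 [m'm c1 pos1 mfs]]]] := MN m mN _ _ fs (inf_res UU iq) gfs.
have ce := chart_ext UU iq c1; have [ge ie _] := ce; have [grho _ _] := c1.
apply: (goodMap_comp UU m'm ce).
  move=> i im; exists (rho i); last by move=> x; rewrite /ext ltn_eqF.
  apply: (mz_eq (mfs (inl (inr (Ordinal im))))).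
  by apply: filterS filterT => x _; rewrite /= /sub im.
apply: (@good_normal_form m' _ e (fun k x => a k (sub m rho x)) (fun x => w (sub m.+1 (ext m m' rho) x))) => //.
- apply: filterS pos1 => j hj i im; rewrite /upd ltn_eqF//; exact: hj.
- by move=> k; apply: germ_comp grho.
- by move=> k ke; rewrite (sub0 grho); have [_ ->] := ga k; rewrite ?leqW.
- by move=> k ke; apply: (mfs (inl (inl (Ordinal ke)))).
- by move=> k l ke le; apply: (mfs (inr (Ordinal ke, Ordinal le))).
- exact: germ_comp gw ge.
- by rewrite (sub0 ge).
- exact: (germ_comp (germ_comp gg g1) ge).
- apply: filterS (nbI (sub_near ge gE) (sub_near ge (near_supp R m.+1))) => x [e1 s].
  have -> : sub m.+1 pi (sub m.+1 (ext m m' rho) x) =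
      upd (sub m.+1 (ext m m' rho) x) m (h (sub m.+1 (ext m m' rho) x)).
    apply/funext => i; rewrite {1}/sub /pi /upd; have [->|ni] := eqVneq i m; first by rewrite ltnSn.
    by case: ltnP => // im; rewrite s.
  rewrite [LHS]e1.
  have -> : res m (sub m.+1 (ext m m' rho) x) = sub m rho (res m' x).
    rewrite res_sub//; apply/funext => i; rewrite /sub /ext; case: ltnP => // im.
    by rewrite ltn_eqF.
  have -> // : sub m.+1 (ext m m' rho) x m = x m' by rewrite /sub ltnSn /ext eqxx.
- move=> d g' p' de gg' rg' ip'; apply: (IH d) => //; last exact: leq_trans m'm mN.
  exact: leq_ltn_trans de _.
Qed.

(** The product of the functions is monomialized, and [mz_factor] returns the factors. A nonzero
    product becomes regular in the last variable after a linear change that turns the last axis into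
    a line on which it does not vanish identically. *)
Lemma MonoS n : (forall m, (m <= n)%N -> Mono m) -> Mono n.+1.
Proof.
move=> Mn.
(* S holds the functions still to be treated, the others being replaced by 1; its size is the
   induction parameter. *)
suff H s : forall m (I : finType) (S : {set I}) (fs : I -> E -> R) p, (#|S| < s)%N -> (m <= n.+1)%N ->
    infl m p -> (forall k, germ m (fs k)) -> Good m p (fun k => if k \in S then fs k else fun=> 1).
  move=> p I fs ip gfs; have := H #|I|.+1 n.+1 I [set: I]%SET fs p.
  rewrite cardsT ltnSn leqnn => /(_ isT isT ip gfs)[m [pi [q [mn c qp mfs]]]].
  by exists m, pi, q; split=> // k; have := mfs k; rewrite inE.
elim: s => // s IH m I S fs p Ss mn ip gfs.
have gfs' k : germ m (if k \in S then fs k else fun=> 1).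
  by case: ifP => _ //; apply: germ_cst.
rewrite leq_eqVlt in mn; case/orP: mn => [/eqP mn|mn]; last exact: Mn.
subst m.
pose f x := \prod_(k in S) fs k x.
have gf : germ n.+1 f by apply: germ_prod.
(* once some factor vanishes after a change of coordinates, recurse on the others *)
have rec m pi q i : (m <= n.+1)%N -> chart n.+1 m pi p q -> i \in S ->
    (\forall x \near nb m, fs i (sub n.+1 pi x) = 0) ->
    Good n.+1 p (fun k => if k \in S then fs k else fun=> 1).
  move=> mn c iS fi0; have [g1 iq _] := c.
  have [||l [pi' [q' [lm c' qp mfs]]]] := IH m I (S :\ i)%SET (fun k x => fs k (sub n.+1 pi x)) q _ mn iq.
  - by move: Ss; rewrite (cardsD1 i) iS.
  - by move=> k; apply: germ_comp g1.
  have [g2 _ _] := c'.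
  exists l, (fun i x => pi i (sub m pi' x)), q'; split=> //.
  - exact: leq_trans mn.
  - exact: chart_comp c c'.
  - move=> k; have := mfs k; rewrite in_setD1; have [->|ki] := eqVneq k i; last first.
      by case: (k \in S).
    by rewrite iS => _; left; exact: (sub_near g2 fi0).
have fin m pi q : (m <= n.+1)%N -> chart n.+1 m pi p q -> mz m (fun x => f (sub n.+1 pi x)) ->
    Good n.+1 p (fun k => if k \in S then fs k else fun=> 1).
  move=> mn c; have [g1 iq _] := c => -[f0|mf].
    have [i iS fi0] := @germ_domain_prod R m I S (fun k x => fs k (sub n.+1 pi x)) (fun k => germ_comp (gfs k) g1) f0.
    exact: rec mn c iS fi0.
  apply: (Good_of_mz UU mn c) => k; case: ifP => kS; last first.
    by apply: mz_unit; [exact: germ_cst|exact: oner_neq0].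
  right; exact: (@mz_factor_prod R m I S (fun k x => fs k (sub n.+1 pi x)) (fun k => germ_comp (gfs k) g1) mf).
have [f0|nf0] := pselect (\forall x \near nb n.+1, f x = 0).
  have [i iS fi0] := germ_domain_prod gfs f0.
  have cid := chart_id UU ip.
  by apply: (rec _ _ _ i (leqnn _) cid iS); exact: (sub_near (@gmap_res R n.+1 n.+1) fi0).
have [r [M [r0 Af]]] := gf.
(* The restriction s |-> f(s v) is then a power series on the disc of radius 2, with s = 1 in its
   interior. *)
have r2 : 0 < r / 2 by rewrite divr_gt0.
have [v dv fv] : exists2 v, dom (wt n.+1 (r / 2)) v & f v != 0.
  apply: contrapT => h; apply: nf0; exists (r / 2) => // x dx.
  by apply/eqP/negPn/negP => ?; apply: h; exists x.
have vs i : (n < i)%N -> v i = 0.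
  by move=> ni; apply/eqP; rewrite -normr_le0; have := dv i; rewrite /wt ltnNge ni.
(* If v = 0 then f(0) is nonzero and f is already a unit. *)
have [[k kn vk]|v0] := pselect (exists2 k, (k < n.+1)%N & v k != 0); last first.
  have vE : v = fun=> 0.
    apply/funext => i; case: (ltnP i n.+1) => [ni|/vs//].
    by apply/eqP/negPn/negP => vi; apply: v0; exists i.
  apply: (fin _ _ _ (leqnn _) (chart_id UU ip)); rewrite vE in fv; apply: mz_unit.
    exact: (germ_comp gf (@gmap_res R n.+1 n.+1)).
  by rewrite (sub0 (@gmap_res R n.+1 n.+1)).
(* The last axis is sent to the line of v. The old coordinate n, if different from k, is stored in
   the vacated place k. *)
pose pi i (x : E) := if i == k then v k * x n else x (if i == n then k else i) + v i * x n.
pose q j : E := fun i => if i == n then p j k / v k else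
  if (i < n)%N then p j (if i == k then n else i) - v (if i == k then n else i) * (p j k / v k) else 0.
have gpi : gmap n.+1 n.+1 pi.
  move=> i _; rewrite /pi; case: (i == k); split; rewrite ?mulr0 ?addr0//.
    by apply: germ_mul; [exact: germ_cst|exact: germ_var].
  apply: germ_add; first exact: germ_var.
  by apply: germ_mul; [exact: germ_cst|exact: germ_var].
have vk0 : 0 < `|v k| by rewrite normr_gt0.
have sm e : 0 < e -> U [set j | `|p j k / v k| <= e].
  move=> e0; have e1 : 0 < e * `|v k| by rewrite mulr_gt0.
  by apply: filterS (inf_coord k ip e1) => j /=; rewrite normrM normfV ler_pdivrMr.
have c : chart n.+1 n.+1 pi p q.
  split=> //.
  - apply: infP => [i e ni e0|]; last first.
      by apply: filterS filterT => j _ i ni; rewrite /q gtn_eqF// ltnNge (ltnW ni).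
    rewrite /q; case: (eqVneq i n) => [_|i_n]; first exact: sm.
    rewrite ltnS leq_eqVlt (negbTE i_n)/= in ni; rewrite ni.
    set l := if _ then _ else _.
    have e2 : 0 < e / 2 by rewrite divr_gt0.
    have e3 : 0 < e / 2 / (`|v l| + 1) by rewrite divr_gt0// ltr_wpDl.
    apply: filterS (ultraI UU (inf_coord l ip e2) (sm _ e3)) => j [/= h1 h2].
    apply: le_trans (ler_normB _ _) _; rewrite normrM.
    have : `|v l| * `|p j k / v k| <= e / 2.
      apply: le_trans (_ : (`|v l| + 1) * `|p j k / v k| <= _).
        by apply: ler_wpM2r => //; rewrite lerDl.
      by rewrite mulrC -ler_pdivlMr// ltr_wpDl.
    by move: h1; lra.
  - apply: filterS (inf_supp ip) => j s'; apply/funext => i.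
    rewrite /sub; case: ltnP => ni; last by rewrite s'.
    rewrite /pi /q eqxx; have [->|ik] := eqVneq i k; first by rewrite mulrC divfK.
    have [i_n|i_n] := eqVneq i n.
      have kn' : (k == n) = false by rewrite -i_n eq_sym (negbTE ik).
      rewrite kn'; rewrite ltnS leq_eqVlt kn'/= in kn; rewrite kn eqxx i_n.
      by rewrite subrK.
    rewrite (negbTE i_n) (negbTE ik); rewrite ltnS leq_eqVlt (negbTE i_n)/= in ni; rewrite ni.
    by rewrite subrK.
have axE y : sub n.+1 pi (ax n y) = fun i => y * v i.
  apply/funext => i; rewrite /sub; case: ltnP => ni; last by rewrite vs// mulr0.
  rewrite /pi /ax upd_id; have [->|ik] := eqVneq i k; first by rewrite mulrC.
  rewrite /upd ifN ?add0r 1?mulrC//.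
  by have [i_n|//] := eqVneq i n; rewrite -i_n eq_sym.
have Au : An (wt 1 2) (fun x => f (fun i => x 0%N * v i)) M.
  apply: (An_comp (rho := wt n.+1 r)) Af _; try by apply: wt_ge0 => //; exact: ltW.
  move=> i; have := dv i; rewrite /wt; case: ltnP => ni di.
    apply: (@An_le _ _ (wt_ge0 1 _) _ (2 * `|v i|)) => //; last by lra.
    by apply: An_mul; [exact: An_var|exact: An_cst].
  rewrite (_ : (fun x : E => _) = fun=> 0); first by apply: An_cst; rewrite normr0.
  by apply/funext => x; rewrite vs// mulr0.
have lt12 : `|1 : R| < 2 by rewrite normr1 ltr1n.
have u1 : f (fun i => ax 0 1 0%N * v i) != 0.
  by rewrite (_ : (fun i => _) = v)//; apply/funext => i; rewrite /ax upd_id mul1r.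
have [|d rg] := @reg_of_line R n 2 _ M 1 (fun x => f (sub n.+1 pi x)) (ltr0Sn R 1) Au lt12 u1.
  by exists 1 => // y _; rewrite axE /ax upd_id.
have [_ iq _] := c.
have [l [pi' [q' [ln c' _ mf]]]] := reg_good Mn (leqnn n) (germ_comp gf gpi) rg iq.
exact: (fin _ _ _ ln (chart_comp UU c c') mf).
Qed.

Theorem monomialization n : Mono n.
Proof.
have [k] := ubnP n; elim: k n => // k IH [|n] nk; last first.
  by apply: MonoS => m mn; apply: IH; apply: leq_ltn_trans mn _.
move=> p I fs ip gfs; exists 0%N, (fun i x => x i), p; split=> //; first exact: chart_id.
  by apply: filterS filterT.
move=> i; have gi := germ_comp (gfs i) (@gmap_res R 0 0).
have [f0|f0] := eqVneq (fs i (fun=> 0)) 0; last first.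
  by apply: mz_unit => //; rewrite (sub0 (@gmap_res R 0 0)).
left; apply: filterS filterT => x _; rewrite -[RHS]f0; congr fs.
Qed.

End Monomialization.

(** * The finite-dimensional gradient inequality *)

Section Lojasiewicz.
Variable R : realType.
Notation E := (nat -> R).
Local Notation nb := (@nb R).

(** For m up to half the radius r0 this is the difference estimate at parameter d = 2 m / r0; for
    larger m a bound on f suffices. *)
Lemma germ_lipschitz n (f : E -> R) : germ n f -> exists L r : R, [/\ 0 < L, 0 < r &
  forall x y m, dom (wt n r) x -> dom (wt n r) y -> 0 <= m ->
    (forall i, `|x i - y i| <= m) -> `|f x - f y| <= L * m].
Proof.
move=> [r0 [M [r00 A]]].
have w0 := wt_ge0 n (ltW r00); have M0 := An_ge0 w0 A.
exists (4 * M / r0 + 1), (r0 / 2); split.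
- by rewrite ltr_wpDl// divr_ge0 ?(ltW r00)// mulr_ge0.
- by rewrite divr_gt0.
move=> x y m dx dy m0 xy.
have dx' : dom (wt n r0) x by apply: dom_wt_le dx; lra.
have dy' : dom (wt n r0) y by apply: dom_wt_le dy; lra.
have Lm : 4 * M / r0 * m <= (4 * M / r0 + 1) * m by rewrite ler_wpM2r// lerDl.
apply: le_trans Lm.
have [mr|mr] := lerP m (r0 / 2); last first.
  apply: (@le_trans _ _ (M + M)).
    apply: le_trans (ler_normB _ _) _; apply: lerD; [exact: (An_bound A dx')|exact: (An_bound A dy')].
  have : 4 * M / r0 * (r0 / 2) <= 4 * M / r0 * m.
    by apply: ler_wpM2l; [rewrite divr_ge0 ?mulr_ge0// ltW|exact: ltW].
  have -> : 4 * M / r0 * (r0 / 2) = M + M by field; rewrite gt_eqF.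
  by [].
have [m00|mn0] := eqVneq m 0.
  have -> : x = y.
    by apply/funext => i; apply/eqP; rewrite -subr_eq0 -normr_le0 -m00.
  by rewrite subrr normr0 m00 mulr0.
have mp : 0 < m by rewrite lt_neqAle eq_sym mn0.
pose d := 2 * m / r0.
have d0 : 0 < d by rewrite divr_gt0// mulr_gt0.
have d1 : d <= 1 by rewrite ler_pdivrMr// mul1r; lra.
have := @An_lipschitz R (wt n r0) (wt n (r0 / 2)) f M d x y w0 A d0 d1 dx dy.
move=> h; apply: le_trans (h _) _; last first.
  have -> : 4 * M / r0 * m = M * d + M * d by rewrite /d; field; rewrite gt_eqF.
  by rewrite lerDl mulr_ge0// ltW.
move=> i; rewrite /wt; case: ltnP => ni.
  have : `|x i - y i| / d <= r0 / 2.
    rewrite ler_pdivrMr//; apply: le_trans (xy i) _.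
    by rewrite /d le_eqVlt; apply/orP; left; apply/eqP; field; rewrite gt_eqF.
  by lra.
have := dx i; have := dy i; rewrite /wt ltnNge ni/= !normr_le0 => /eqP-> /eqP->.
by rewrite subrr normr0 mul0r addr0.
Qed.

Lemma limit0_le (a b K : R) (d : R) : 0 < d -> (forall t, 0 < t <= d -> a <= b + K * t) -> a <= b.
Proof.
move=> d0 H; apply/ler_addgt0Pr => e e0.
pose t := Num.min d (e / (`|K| + 1)).
have K1 : 0 < `|K| + 1 by rewrite ltr_wpDl.
have t0 : 0 < t by rewrite lt_min d0 divr_gt0.
have := H t; rewrite t0 ge_min lexx => /(_ isT) h.
apply: le_trans h _; rewrite lerD2l.
apply: le_trans (_ : (`|K| + 1) * t <= _).
  by rewrite ler_pM2r//; have := ler_norm K; lra.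
by rewrite mulrC -ler_pdivlMr// ge_min lexx orbT.
Qed.

Lemma bernoulli_le (t : R) a : 0 <= t -> 1 + a%:R * t <= (1 + t) ^+ a.
Proof.
move=> t0; elim: a => [|a IH]; first by rewrite mul0r addr0 expr0.
rewrite exprS; apply: (@le_trans _ _ ((1 + t) * (1 + a%:R * t))).
  rewrite -natr1; have : 0 <= a%:R * t * t by rewrite !mulr_ge0.
  by lra.
by apply: ler_wpM2l => //; rewrite addr_ge0.
Qed.

(** Near 0, x_i times the i-th derivative of a monomial times a unit is about al_i times the
    function, so |h| <= C s x_i whenever al_i > 0. Among these i the one with the smallest x_i also
    satisfies x_i^A <= C |h|, with A the total degree. *)
Lemma monu_slope m (al : nat -> nat) u h : germ m u -> u (fun=> 0) != 0 ->
  (\forall x \near nb m, h x = mon m al x * u x) -> (0 < \sum_(i < m) al i)%N ->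
  exists C r : R, [/\ 0 < C, 0 < r & forall x, dom (wt m r) x -> (forall i, (i < m)%N -> 0 < x i) ->
   forall s K d, 0 < d ->
   (forall i t, (i < m)%N -> 0 < t <= d -> `|h (upd x i (x i + t)) - h x| <= s * t + K * t ^+ 2) ->
   exists i, [/\ (i < m)%N, `|h x| <= C * s * x i & x i ^+ (\sum_(i < m) al i) <= C * `|h x|]].
Proof.
move=> gu u0 [r1 r10 hE] A0.
set A := (\sum_(i < m) al i)%N in A0 *.
have [i1 ali1] : exists i : 'I_m, (0 < al i)%N.
  apply: contrapT => H; move: A0; rewrite /A big1 ?ltnn// => i _.
  by apply/eqP; rewrite -leqn0 leqNgt; apply/negP => ?; apply: H; exists i.
have [c [c0 [r2 r20 uc]]] := germ_near_neq0 gu u0.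
have [Cu [Cu0 [r3 r30 uC]]] := germ_bounded gu.
have [L [r4 [L0 r40 uL]]] := germ_lipschitz gu.
(* The last entry makes the variation of the unit at most half of the variation of the monomial. The
   halves leave room for doubling [x i]. *)
pose r := Num.min (Num.min (Num.min (r1 / 2) (r2 / 2)) (Num.min (r3 / 2) (r4 / 2)))
  (Num.min 1 (c / 2 / (2 ^+ A * L))).
have P0 : 0 < 2 ^+ A * L by rewrite mulr_gt0// exprn_gt0.
have rp : 0 < r by rewrite !lt_min ltr01 !divr_gt0.
have rr1 : 2 * r <= r1.
  have h0 : r <= r1 / 2 by rewrite !ge_min lexx ?orbT.
  by lra.
have rr2 : 2 * r <= r2.
  have h0 : r <= r2 / 2 by rewrite !ge_min lexx ?orbT.
  by lra.
have rr3 : 2 * r <= r3.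
  have h0 : r <= r3 / 2 by rewrite !ge_min lexx ?orbT.
  by lra.
have rr4 : 2 * r <= r4.
  have h0 : r <= r4 / 2 by rewrite !ge_min lexx ?orbT.
  by lra.
have r_1 : r <= 1 by rewrite !ge_min lexx ?orbT.
have rc : r <= c / 2 / (2 ^+ A * L) by rewrite !ge_min lexx ?orbT.
pose C := 2 * Cu / c + c^-1 + 1.
have C0 : 0 < C by rewrite /C !addr_gt0// ?divr_gt0 ?mulr_gt0 ?invr_gt0.
exists C, r; split=> // x dx xp s K d d0 H.
have x1 i : (i < m)%N -> x i <= 1.
  by move=> im; have := dx i; rewrite /wt im gtr0_norm ?xp// => h1; apply: le_trans r_1.
have d2 : dom (wt m (2 * r)) x by apply: dom_wt_le dx; lra.
have hx : h x = mon m al x * u x by apply: hE; apply: dom_wt_le d2.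
have monp : 0 < mon m al x by apply: mon_pos.
have ux1 : c <= `|u x| by apply: uc; apply: dom_wt_le d2.
have ux2 : `|u x| <= Cu by apply: uC; apply: dom_wt_le d2.
have [i ali imin] := @arg_minP _ _ _ i1 (fun i : 'I_m => (0 < al i)%N) (fun i => x i) ali1.
have xi0 : 0 < x i by apply: xp.
exists i; split=> //; last first.
  apply: (@le_trans _ _ (mon m al x)).
    rewrite /mon /A -prodrXr; apply: ler_prod => k _; rewrite exprn_ge0 ?(ltW xi0)//=.
    have [->|ak] := posnP (al k); first by rewrite !expr0.
    apply: lerXn2r; rewrite ?nnegrE ?(ltW xi0) ?(ltW (xp _ _))//.
    exact: imin.
  rewrite hx normrM gtr0_norm// mulrCA ler_peMr ?(ltW monp)//.
  apply: (@le_trans _ _ (C * c)); last by rewrite ler_pM2l.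
  rewrite /C !mulrDl mulVf ?gt_eqF// mul1r.
  have : 0 <= Cu / c * c by rewrite mulfVK ?gt_eqF// ltW.
  by lra.
(* The increment is t x_i, relative to x_i: it multiplies the monomial by (1 + t)^(al i), which is
   at least 1 + t. The bound follows as t tends to 0. *)
have key t : 0 < t <= Num.min (Num.min 1 (r / x i)) (d / x i) ->
    mon m al x * (c / 2) <= s * x i + K * x i ^+ 2 * t.
  rewrite !le_min => /andP[t0 /andP[/andP[t1 tr]]]; rewrite ler_pdivlMr// => td.
  pose y := upd x i (x i + t * x i).
  have txr : t * x i <= r by rewrite -ler_pdivlMr.
  have tx0 : 0 < t * x i by rewrite mulr_gt0.
  have dy : dom (wt m (2 * r)) y.
    move=> j; rewrite /y /upd; case: eqP => [->|_]; last exact: d2.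
    have := dx i; rewrite /wt ltn_ord gtr0_norm// => h1.
    by rewrite gtr0_norm ?addr_gt0//; lra.
  have hy : h y = mon m al y * u y by apply: hE; apply: dom_wt_le dy.
  have mony : mon m al y = mon m al x * (1 + t) ^+ al i.
    rewrite /mon (bigD1 i)//= [in RHS](bigD1 i)//= /y upd_id.
    rewrite -{1}[x i]mul1r -mulrDl exprMn.
    rewrite [X in _ * _ * X = _](eq_bigr (fun j : 'I_m => x j ^+ al j)); first by ring.
    by move=> j ji; rewrite /upd (negbTE (ji : (j : nat) != i)).
  have uyx : `|u y - u x| <= L * (t * x i).
    apply: uL; [exact: dom_wt_le dy|exact: dom_wt_le d2|exact: ltW|].
    move=> j; rewrite /y /upd; case: eqP => [->|_].
      by rewrite addrC addKr ger0_norm// ltW.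
    by rewrite subrr normr0 ltW.
  have := H i (t * x i) (ltn_ord i); rewrite tx0 td => /(_ isT).
  rewrite -/y hx hy mony => Hi.
  have p1 : 1 + t <= (1 + t) ^+ al i.
    apply: le_trans (bernoulli_le _ (ltW t0)).
    by rewrite lerD2l ler_peMl ?(ltW t0)// ler1n.
  have p2 : (1 + t) ^+ al i <= 2 ^+ A.
    apply: (@le_trans _ _ (2 ^+ al i)).
      by apply: lerXn2r; clear -t0 t1; rewrite ?nnegrE; lra.
    by apply: ler_weXn2l; rewrite ?ler1n// /A (bigD1 i)//= leq_addr.
  set P := (1 + t) ^+ al i in Hi p1 p2.
  have P1 : 1 <= P by apply: le_trans p1; rewrite lerDl (ltW t0).
  have low : t * (c / 2) <= `|P * u y - u x|.
    have -> : P * u y - u x = (P - 1) * u x - - (P * (u y - u x)) by ring.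
    apply: le_trans (lerB_dist _ _).
    have P0' : 0 <= P := le_trans ler01 P1; have P2 : 0 <= P - 1 by rewrite subr_ge0.
    rewrite normrN !normrM (ger0_norm P0') (ger0_norm P2).
    have q1 : t * c <= (P - 1) * `|u x|.
      by apply: ler_pM ux1; [exact: ltW|exact: ltW|clear -p1; lra].
    have q2 : P * `|u y - u x| <= t * (c / 2).
      apply: (@le_trans _ _ (2 ^+ A * (L * (t * x i)))).
        by apply: ler_pM p2 uyx; [exact: P0'|exact: normr_ge0].
      have -> : 2 ^+ A * (L * (t * x i)) = t * (x i * (2 ^+ A * L)) by ring.
      rewrite ler_pM2l// -ler_pdivlMr//; apply: le_trans rc.
      by have := dx i; rewrite /wt ltn_ord gtr0_norm.
    by clear -q1 q2; lra.
  have : mon m al x * (t * (c / 2)) <= s * (t * x i) + K * (t * x i) ^+ 2.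
    apply: le_trans Hi; rewrite -mulrA -mulrBr normrM gtr0_norm//.
    by rewrite ler_pM2l.
  have -> : mon m al x * (t * (c / 2)) = t * (mon m al x * (c / 2)) by ring.
  have -> : s * (t * x i) + K * (t * x i) ^+ 2 = t * (s * x i + K * x i ^+ 2 * t) by ring.
  by rewrite ler_pM2l.
have t0 : 0 < Num.min (Num.min 1 (r / x i)) (d / x i) by rewrite !lt_min ltr01 !divr_gt0.
have := limit0_le t0 key => main.
have sx : 0 <= s * x i by apply: le_trans main; rewrite mulr_ge0 ?(ltW monp)// divr_ge0// ltW.
rewrite hx normrM gtr0_norm//.
apply: (@le_trans _ _ (2 * Cu / c * (s * x i))); last first.
  rewrite -[leRHS]mulrA; apply: ler_wpM2r => //; rewrite /C -[leRHS]addrA lerDl.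
  by rewrite addr_ge0// invr_ge0 ltW.
apply: (@le_trans _ _ (mon m al x * Cu)); first by rewrite ler_pM2l.
have -> : mon m al x * Cu = 2 * Cu / c * (mon m al x * (c / 2)) by field; rewrite gt_eqF.
by apply: ler_wpM2l => //; rewrite divr_ge0 ?mulr_ge0// ltW.
Qed.

Lemma gmap_lipschitz n m pi : (forall k, (k < n)%N -> germ m (pi k)) -> exists L r : R, [/\ 0 < L, 0 < r &
  forall x y t, dom (wt m r) x -> dom (wt m r) y -> 0 <= t -> (forall i, `|x i - y i| <= t) ->
    forall k, (k < n)%N -> `|pi k x - pi k y| <= L * t].
Proof.
elim: n => [|n IH] H; first by exists 1, 1.
have [L [r [L0 r0 HL]]] : exists L r : R, [/\ 0 < L, 0 < r &
  forall x y t, dom (wt m r) x -> dom (wt m r) y -> 0 <= t -> (forall i, `|x i - y i| <= t) ->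
    forall k, (k < n)%N -> `|pi k x - pi k y| <= L * t].
  by apply: IH => k kn; apply: H; apply: leqW.
have [L' [r' [L'0 r'0 HL']]] := germ_lipschitz (H n (ltnSn n)).
exists (L + L'), (Num.min r r'); split; [exact: addr_gt0|by rewrite lt_min r0|].
move=> x y t dx dy t0 xy k; rewrite ltnS leq_eqVlt => /orP[/eqP->|kn].
  apply: le_trans (HL' x y t _ _ t0 xy) _.
  - by apply: dom_wt_le dx; rewrite ge_min lexx orbT.
  - by apply: dom_wt_le dy; rewrite ge_min lexx orbT.
  - by rewrite ler_wpM2r// lerDr ltW.
apply: le_trans (HL x y t _ _ t0 xy k kn) _.
- by apply: dom_wt_le dx; rewrite ge_min lexx.
- by apply: dom_wt_le dy; rewrite ge_min lexx.
- by rewrite ler_wpM2r// lerDl ltW.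
Qed.

(* A derivative-free substitute for |grad f(x)| <= s. *)
Definition slope_le (n : nat) (f : E -> R) (x : E) (s : R) : Prop :=
  exists K d : R, 0 < d /\ forall y m, 0 <= m <= d -> dom (wt n m) y ->
    `|f (fun i => x i + y i) - f x| <= s * m + K * m ^+ 2.

(** In the chart that follows the bad points, F <= C1 s x_i and x_i^A <= C F with C1 x_i <= 1. For N
    >= A this gives F^(N-1) x_i^A <= C (C1 s x_i)^N <= C C1^A x_i^A s^N, a constant that does not
    depend on N. *)
Theorem lojasiewicz n f : germ n f -> exists (N : nat) (C r : R), [/\ (2 <= N)%N, 0 < C, 0 < r &
  forall x s, dom (wt n r) x -> 0 <= s -> slope_le n f x s ->
    `|f x - f (fun=> 0)| ^+ N.-1 <= C * s ^+ N].
Proof.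
move=> gf; apply: contrapT => H.
have bad (j : nat) : exists (x : E) (s : R), [/\ dom (wt n j.+1%:R^-1) x, 0 <= s, slope_le n f x s &
    j.+1%:R * s ^+ j.+2 < `|f x - f (fun=> 0)| ^+ j.+1].
  apply: contrapT => G; apply: H; exists j.+2, j.+1%:R, j.+1%:R^-1; split=> //.
  move=> x s dx s0 sl; rewrite leNgt; apply/negP => h; apply: G; by exists x, s.
have /choice[p /choice[s {}bad]] := bad.
have [U [UU oU]] := ultraFilterLemma (eventually_filter).
have big (k : nat) : U [set j | (k <= j)%N] by apply: oU; exists k.
have bigR (B : R) : U [set j | B <= j.+1%:R].
  have [k Bk] : exists k, B <= k%:R.
    by have [k] := archi_boundP (normr_ge0 B); exists (Num.bound `|B|); apply: le_trans (ler_norm _) (ltW _); apply: archi_boundP.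
  by apply: filterS (big k) => j /= kj; apply: le_trans Bk _; rewrite ler_nat leqW.
have ip : infl U n p.
  move=> P [r r0 rP]; apply: filterS (bigR r^-1) => j /= h; apply: rP.
  have [dx _ _ _] := bad j; apply: dom_wt_le dx.
  by rewrite -[r]invrK lef_pV2// ?posrE ?invr_gt0.
pose f0 x := f x - f (fun=> 0).
have gf0 : germ n f0 by apply: germ_sub => //; apply: germ_cst.
have [m [pi [q [mn [gpi iq pq] qpos mf]]]] := monomialization UU (I := unit) (fs := fun=> f0) ip (fun=> gf0).
have {mf}mf := mf tt.
case: mf => [f00|[al [u [gu u0 hE]]]].
  have [j [/= e1 e2]] := ultra_ex UU (ultraI UU pq (iq _ f00)).
  have [_ s0 _] := bad j; rewrite -/(f0 _) e1 e2 normr0 expr0n /= ltNge.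
  by rewrite mulr_ge0// exprn_ge0.
have [A0|A0] := posnP (\sum_(i < m) al i)%N.
  have := nb0 hE; rewrite (sub0 gpi) /f0 subrr => /esym/eqP; rewrite mulf_eq0 (negbTE u0) orbF.
  rewrite /mon big1 ?oner_eq0// => i _.
  by move/eqP: A0; rewrite sum_nat_eq0 => /forallP/(_ i)/= /eqP ->; rewrite expr0.
have [C [r [C0 r0 HC]]] := monu_slope gu u0 hE A0.
set A := (\sum_(i < m) al i)%N in A0 HC.
have [Lam [r1 [Lam0 r10 lip]]] := gmap_lipschitz (fun k kn => (gpi k kn).1).
pose C1 := C * Lam.
have C10 : 0 < C1 by rewrite mulr_gt0.
have e0 : 0 < Num.min (Num.min r (r1 / 2)) (Num.min 1 C1^-1) by rewrite !lt_min r0 ltr01 divr_gt0// invr_gt0.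
set e := Num.min _ _ in e0.
have near_e : nb m (dom (wt m e)) by exists e.
have h1 := ultraI UU (ultraI UU pq qpos) (ultraI UU (iq _ near_e) (ultraI UU (big A) (bigR (C1 ^+ A * C + 1)))).
have [j [[/= e1 e2] [e3 [e4 e5]]]] := ultra_ex UU h1.
have [_ s0 [K [d [d0 sl]]] bd] := bad j.
pose x := q j; have pjE : p j = sub n pi x by exact: e1.
have er1 : e <= r1 / 2 by rewrite !ge_min lexx ?orbT.
have eC1 : e <= C1^-1 by rewrite !ge_min lexx ?orbT.
have dxr : dom (wt m r) x by apply: dom_wt_le e3; rewrite !ge_min lexx.
have dx1 : dom (wt m r1) x by apply: dom_wt_le e3; lra.
(* A chart with Lipschitz constant [Lam] multiplies the slope by [Lam] and the quadratic term by its
   square. *)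
have [||i [im F1 F2]] := HC x dxr e2 (s j * Lam) (K * Lam ^+ 2) (Num.min (d / Lam) (r1 / 2)).
  by rewrite lt_min !divr_gt0.
  move=> i t im /andP[t0]; rewrite le_min => /andP[td tr].
  have dy : dom (wt m r1) (upd x i (x i + t)).
    move=> k; rewrite /upd; case: eqP => [->|_]; last exact: dx1.
    have := e3 i; rewrite /wt im => xie; apply: le_trans (ler_normD _ _) _.
    by rewrite (gtr0_norm t0); lra.
  have xy k : `|upd x i (x i + t) k - x k| <= t.
    rewrite /upd; case: eqP => [->|_]; first by rewrite addrC addKr gtr0_norm.
    by rewrite subrr normr0 ltW.
  have lipk := lip _ _ _ dy dx1 (ltW t0) xy.
  have dd : dom (wt n (Lam * t)) (fun k => sub n pi (upd x i (x i + t)) k - sub n pi x k).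
    move=> k; rewrite /sub /wt; case: ltnP => kn; first exact: lipk.
    by rewrite subrr normr0.
  have Lt : 0 <= Lam * t <= d.
    by rewrite mulr_ge0 ?(ltW Lam0) ?(ltW t0)//= mulrC -ler_pdivlMr.
  have := sl _ _ Lt dd; rewrite pjE.
  rewrite (_ : (fun i0 => _ + (_ - _)) = sub n pi (upd x i (x i + t))); last first.
    by apply/funext => k; rewrite addrC subrK.
  rewrite /f0 => h; rewrite opprB addrA subrK.
  by apply: le_trans h _; rewrite exprMn -!mulrA.
have fE : f0 (sub n pi x) = f (p j) - f (fun=> 0) by rewrite /f0 pjE.
rewrite fE in F1 F2; set F := `|_| in F1 F2 bd.
have F0 : 0 <= F by exact: normr_ge0.
have xi0 : 0 < x i by apply: e2.
have xie : C1 * x i <= 1.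
  rewrite -ler_pdivlMl// mulr1; apply: le_trans eC1.
  by have := e3 i; rewrite /wt im gtr0_norm.
have F1' : F <= C1 * x i * s j by apply: le_trans F1 _; rewrite /C1 le_eqVlt; apply/orP; left; apply/eqP; ring.
have Aj : (j.+2 = (j.+2 - A) + A)%N by rewrite subnK// (leq_trans e4)// !leqW.
(* Multiply by x_i^A; then spend A of the j + 2 factors C1 x_i on it and bound the others by 1. *)
have : F ^+ j.+1 <= C1 ^+ A * C * s j ^+ j.+2.
  rewrite -(@ler_pM2r _ (x i ^+ A)) ?exprn_gt0//.
  apply: (@le_trans _ _ (F ^+ j.+1 * (C * F))); first by rewrite ler_wpM2l// exprn_ge0.
  rewrite mulrCA -exprSr.
  apply: (@le_trans _ _ (C * (C1 * x i * s j) ^+ j.+2)).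
    by rewrite ler_pM2l//; apply: lerXn2r => //; rewrite nnegrE !mulr_ge0// ltW.
  rewrite exprMn Aj exprD -Aj.
  have -> : C1 ^+ A * C * s j ^+ j.+2 * x i ^+ A = C * (1 * (C1 * x i) ^+ A * s j ^+ j.+2).
    rewrite [(C1 * x i) ^+ A]exprMn; move: (s j ^+ j.+2) (C1 ^+ A) (x i ^+ A) => S1 S2 S3; ring.
  rewrite ler_pM2l//; apply: ler_wpM2r; first exact: exprn_ge0.
  apply: ler_wpM2r; first by rewrite exprn_ge0// mulr_ge0// ltW.
  by apply: exprn_ile1 => //; rewrite mulr_ge0// ltW.
move/(lt_le_trans bd); rewrite ltNge => /negP; apply.
by apply: ler_wpM2r; [exact: exprn_ge0|lra].
Qed.

End Lojasiewicz.

(** * Analytic flows and globally analytic functions *)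

Section LocalFlow.
Variable R : realType.
Notation E := (nat -> R).

Lemma hadamard_upd (rho : E) i f M : (forall j, 0 <= rho j) -> 0 < rho i -> An rho f M ->
  exists (m0 m1 : R) (h : E -> R), [/\ m0 + rho i * m1 <= M, An rho (fun x => f (upd x i 0)) m0,
    An rho h m1, 0 <= m0 /\ 0 <= m1 & forall x, dom rho x -> f x = f (upd x i 0) + x i * h x].
Proof.
move=> r0 ri Af; have [m0 [m1 [h [H1 H2 H3 H4]]]] := hadamard r0 ri Af.
by exists m0, m1, h; split=> //; split; [exact: An_ge0 H2|exact: An_ge0 H3].
Qed.

(** Iterated division by [x j]; the bounds m0 + rho_j m1 <= M telescope to a bound for the whole
    weighted sum of coefficients. *)
Lemma An_expand (rho : E) j f M : (forall i, 0 <= rho i) -> 0 < rho j -> An rho f M ->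
  exists (g : nat -> E -> R) (m : nat -> R), [/\ forall k, An rho (g k) (m k),
    forall k, 0 <= m k, forall k x s, g k (upd x j s) = g k x,
    forall n, series (fun k => m k * rho j ^+ k) n <= M &
    forall x d, dom rho x -> `|f x - \sum_(k < d) g k x * x j ^+ k| <= (`|x j| / rho j) ^+ d * M].
Proof.
move=> r0 rj Af.
have st (p : (E -> R) * R) : exists q : (E -> R) * R * R, An rho p.1 p.2 ->
   [/\ q.2 + rho j * q.1.2 <= p.2, An rho (fun x => p.1 (upd x j 0)) q.2, An rho q.1.1 q.1.2,
    0 <= q.2 /\ 0 <= q.1.2 & forall x, dom rho x -> p.1 x = p.1 (upd x j 0) + x j * q.1.1 x].
  have [A|nA] := pselect (An rho p.1 p.2); last by exists (p, 0).
  by have [m0 [m1 [h H]]] := hadamard_upd r0 rj A; exists ((h, m1), m0).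
have /choice[nx {}st] := st.
pose p k := iter k (fun p => (nx p).1) (f, M).
have Ap k : An rho (p k).1 (p k).2.
  by elim: k => [|k IH] //=; have [_ _] := st _ IH.
pose g k x := (p k).1 (upd x j 0).
pose m k := (nx (p k)).2.
have sumM n : series (fun k => m k * rho j ^+ k) n + rho j ^+ n * (p n).2 <= M.
  elim: n => [|n IH]; first by rewrite /series/= big_geq// add0r expr0 mul1r.
  apply: le_trans IH; rewrite /series/= big_nat_recr//= -addrA lerD2l.
  have [h _ _ _ _] := st _ (Ap n).
  have := ler_wpM2l (exprn_ge0 n (ltW rj)) h; rewrite -/(m n) mulrDr mulrA -exprSr.
  by rewrite [m n * _]mulrC.
have p0 k : 0 <= (p k).2 := An_ge0 r0 (Ap k).
exists g, m; split.
- by move=> k; have [_ h _ _ _] := st _ (Ap k).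
- by move=> k; have [_ _ _ [h _] _] := st _ (Ap k).
- by move=> k x s; rewrite /g upd_upd.
- by move=> n; apply: le_trans (sumM n); rewrite lerDl mulr_ge0// exprn_ge0// ltW.
- move=> x d dx.
  have -> : f x - \sum_(k < d) g k x * x j ^+ k = x j ^+ d * (p d).1 x.
    elim: d => [|d IH]; first by rewrite big_ord0 subr0 expr0 mul1r.
    rewrite big_ord_recr/= opprD addrA IH.
    have [_ _ _ _ /(_ x dx) h] := st _ (Ap d); rewrite {1}h /g exprSr /=; ring.
  rewrite normrM normrX expr_div_n -mulrA; apply: ler_wpM2l; first exact: exprn_ge0.
  apply: le_trans (An_bound (Ap d) dx) _.
  rewrite ler_pdivlMl ?exprn_gt0//; apply: le_trans (sumM d).
  rewrite lerDr /series/= sumr_ge0// => k _; rewrite mulr_ge0 ?exprn_ge0 ?(ltW rj)//.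
  by have [_ _ _ [h _] _] := st _ (Ap k).
Qed.

(** Integration term by term costs one factor [rho j] in the norm. The derivative is that of a power
    series in the single variable [x j]. *)
Lemma An_primitive (rho : E) j f M : (forall i, 0 <= rho i) -> 0 < rho j -> An rho f M ->
  exists G, [/\ An rho G (rho j * M), forall x, G (upd x j 0) = 0 &
    forall x, dom rho x -> `|x j| < rho j -> is_derive (x j) (1 : R) (fun s => G (upd x j s)) (f x)].
Proof.
move=> r0 rj Af; have [g [m [Ag m0 gi sM gE]]] := An_expand r0 rj Af.
set tau := rho j in rj sM gE *.
pose c (x : E) (k : nat) : R := if k is l.+1 then g l x / l.+1%:R else 0.
have gb x k : dom rho x -> `|g k x| <= m k by exact: (An_bound (Ag k)).
have cb x k : dom rho x -> `|c x k.+1| <= m k.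
  move=> dx; rewrite /= normrM [X in _ * X]ger0_norm ?invr_ge0//.
  by rewrite ler_pdivrMr// -[leLHS]mulr1; apply: ler_pM; rewrite ?gb ?ler1n.
pose G x := limn (pseries (c x) (x j)).
have sM' n : series (fun k => if k is l.+1 then m l * tau ^+ k else 0) n <= tau * M.
  case: n => [|n]; first by rewrite /series/= big_geq// mulr_ge0// ?(ltW rj)//; exact: An_ge0 Af.
  rewrite /series/= big_nat_recl//= add0r.
  rewrite (eq_bigr (fun i => tau * (m i * tau ^+ i))); last by move=> i _; rewrite exprS mulrCA.
  by rewrite -mulr_sumr; apply: ler_wpM2l; [exact: ltW|exact: sM].
have xtau x : dom rho x -> `|x j| <= tau by move=> /(_ j).
have termb x k s : dom rho x -> `|s| <= tau -> `|c x k * s ^+ k| <= (if k is l.+1 then m l * tau ^+ k else 0).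
  case: k => [|k] dx st; first by rewrite mul0r normr0.
  rewrite normrM normrX; apply: ler_pM => //; first exact: cb.
  by apply: lerXn2r; rewrite ?nnegrE ?(ltW rj).
have cvc x s : dom rho x -> `|s| <= tau -> cvgn (pseries (c x) s).
  by move=> dx st; apply: (@series_cvg_bound _ _ (fun k => if k is l.+1 then m l * tau ^+ k else 0) (tau * M)) => // k; apply: termb.
have cupd x s : c (upd x j s) = c x by apply/funext => -[|k] //=; rewrite gi.
exists G; split.
- apply: (@An_lim _ _ (fun k x => c x k * x j ^+ k) (fun k => if k is l.+1 then m l * tau ^+ k else 0)) => //.
    case=> [|k]; first by rewrite /c; under eq_fun do rewrite mul0r; apply: An_cst; rewrite normr0.
    apply: An_mul; last by apply: An_exp; apply: An_var.
    apply: (@An_le _ _ r0 _ (m k * k.+1%:R^-1)).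
      by apply: An_mul => //; apply: An_cst; rewrite ger0_norm// invr_ge0.
    by rewrite ler_piMr// invf_le1// ler1n.
  by move=> x dx; apply: cvc => //; exact: xtau.
- move=> x; rewrite /G upd_id.
  apply: cvg_lim => //; apply: cvg_near_cst; near=> n.
  rewrite /pseries /series/= big1// => -[|k] _; first by rewrite /c mul0r.
  by rewrite exprS mul0r mulr0.
- move=> x dx xj.
  have dE : pseries_diffs (c x) = g^~ x.
    by apply/funext => k; rewrite /pseries_diffs/= mulrC divfK// pnatr_eq0.
  (* Differentiation at [x j] requires the twice differentiated series to converge at a larger
     radius, here the midpoint. *)
  pose K := (`|x j| + tau) / 2.
  have xK : `|x j| < K by rewrite /K; lra.
  have Kt : K < tau by rewrite /K; lra.
  have K0 : 0 < K by apply: le_lt_trans xK.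
  have Kn : `|K| = K by rewrite gtr0_norm.
  have -> : f x = limn (pseries (pseries_diffs (c x)) (x j)).
    apply/esym/cvg_lim => //; rewrite dE; apply/cvgrPdist_le => e e0.
    have q01 : 0 <= `|x j| / tau < 1 by rewrite divr_ge0 ?(ltW rj)//= ltr_pdivrMr// mul1r.
    have [d dP] := geometric_small M q01 e0.
    exists d => // n /= dn; rewrite /pseries /series /= big_mkord.
    apply: le_trans (gE x n dx) _; apply: le_trans dP; rewrite mulrC.
    by apply: ler_wpM2l; [exact: An_ge0 Af|case/andP: q01 => ? ?; apply: ler_wiXn2l => //; exact: ltW].
  have GE : (fun s => G (upd x j s)) = (fun s => limn (pseries (c x) s)).
    by apply/funext => s; rewrite /G upd_id cupd.
  rewrite GE; apply: (@pseries_snd_diffs R (c x) K (x j)).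
  + by apply: cvc => //; rewrite Kn ltW.
  + rewrite dE; apply: (@series_cvg_bound _ _ (fun k => m k * tau ^+ k) M) => // k.
    rewrite normrM normrX Kn; apply: ler_pM; rewrite ?exprn_ge0 ?(ltW K0) ?gb//.
    by apply: lerXn2r; rewrite ?nnegrE ?(ltW K0) ?(ltW rj) ?(ltW Kt).
  (* By Bernoulli's inequality for (tau / K)^(k+1), (k+1) K^k (tau - K) <= tau^(k+1), which compares
     with the weights of [An_expand]. *)
  + rewrite dE; apply: (@series_cvg_bound _ _ (fun k => m k.+1 * tau ^+ k.+1 / (tau - K)) (M / (tau - K))).
      move=> k; rewrite /pseries_diffs !normrM normrX Kn ger0_norm//.
      have tK : 0 < tau - K by rewrite subr_gt0.
      rewrite ler_pdivlMr//.
      apply: (@le_trans _ _ (m k.+1 * (k.+1%:R * K ^+ k * (tau - K)))).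
        have -> : k.+1%:R * `|g k.+1 x| * K ^+ k * (tau - K) = `|g k.+1 x| * (k.+1%:R * K ^+ k * (tau - K)) by ring.
        apply: ler_wpM2r; last exact: gb.
        by rewrite !mulr_ge0// ?exprn_ge0// ltW.
      apply: ler_wpM2l => //.
      have -> : tau ^+ k.+1 = K ^+ k.+1 * (1 + (tau - K) / K) ^+ k.+1.
        by rewrite -exprMn; congr (_ ^+ _); field; rewrite gt_eqF.
      apply: (@le_trans _ _ (K ^+ k.+1 * (1 + k.+1%:R * ((tau - K) / K)))); last first.
        apply: ler_wpM2l; first by rewrite exprn_ge0// ltW.
        by apply: bernoulli_le; rewrite divr_ge0// ltW.
      have -> : K ^+ k.+1 * (1 + k.+1%:R * ((tau - K) / K)) = K ^+ k.+1 + k.+1%:R * K ^+ k * (tau - K).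
        by rewrite exprS; field; rewrite gt_eqF.
      by rewrite lerDr exprn_ge0// ltW.
    move=> n; rewrite /series/= -mulr_suml; apply: ler_wpM2r.
      by rewrite invr_ge0 subr_ge0 ltW.
    apply: le_trans (sM n.+1); rewrite /series/= [leRHS]big_nat_recl//= lerDr.
    by rewrite mulr_ge0// exprn_ge0// ltW.
  + by rewrite Kn.
Unshelve. all: by end_near. Qed.

Lemma derive_bound (D D' : R -> R) (tau e : R) :
  (forall s, `|s| < tau -> is_derive s (1 : R) D (D' s)) ->
  (forall s, 0 <= s < tau -> `|D' s| <= e) ->
  forall t, 0 <= t < tau -> `|D t - D 0| <= e * t.
Proof.
move=> dD bD t /andP[t0 tt]; have [->|tn0] := eqVneq t 0; first by rewrite subrr normr0 mulr0.
have tp : 0 < t by rewrite lt_neqAle eq_sym tn0.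
have [|| x xin ->] := @MVT R D D' 0 t tp.
- move=> x; rewrite in_itv/= => /andP[x0 xt]; apply: dD; rewrite gtr0_norm//.
  exact: lt_trans tt.
- apply: derivable_within_continuous => x; rewrite in_itv/= => /andP[x0 xt].
  have /dD h : `|x| < tau by rewrite ger0_norm//; apply: le_lt_trans tt.
  exact: ex_derive.
- move: xin; rewrite in_itv/= => /andP[x0 xt].
  rewrite subr0 normrM (ger0_norm t0); apply: ler_wpM2r => //; apply: bD.
  by rewrite ltW//=; apply: lt_trans tt.
Qed.

Lemma germ_common m n (f : nat -> E -> R) : (forall i, (i < n)%N -> germ m (f i)) ->
  exists r M : R, [/\ 0 < r, 0 < M & forall i, (i < n)%N -> An (wt m r) (f i) M].
Proof.
elim: n => [|n IH] H; first by exists 1, 1.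
have [r [M [r0 M0 HA]]] : exists r M : R, [/\ 0 < r, 0 < M & forall i, (i < n)%N -> An (wt m r) (f i) M].
  by apply: IH => i ni; apply: H; apply: leqW.
have [r' [M' [r'0 HA']]] := germP (H n (ltnSn n)).
pose s := Num.min r r'.
have s0 : 0 < s by rewrite lt_min r0.
have M'0 : 0 <= M'.
  by apply: (An_ge0 (wt_ge0 m (ltW r'0)) (HA' r' _)); rewrite lexx ltW.
exists s, (M + M'); split=> //; first by rewrite ltr_wpDr.
have w0 := wt_ge0 m (ltW s0).
move=> i; rewrite ltnS leq_eqVlt => /orP[/eqP->|ni].
  apply: (@An_le _ _ w0 _ M'); last by rewrite lerDr ltW.
  by apply: HA'; rewrite (ltW s0) ge_min lexx orbT.
apply: (@An_le _ _ w0 _ M); last by rewrite lerDl.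
by apply: An_shrink (HA i ni) => //; apply: wt_le; rewrite ge_min lexx.
Qed.

(** Picard iteration in the power series norm: coordinates below m are initial values, coordinate m
    is time. A short time interval makes integration a contraction. *)
Lemma local_flow m (f : nat -> E -> R) : (forall i, (i < m)%N -> germ m (f i)) ->
  exists (tau eta rho : R) (Psi : nat -> E -> R), [/\ 0 < tau, 0 < eta /\ 0 < rho,
    (forall i, An (upd (wt m eta) m tau) (Psi i) (wt m rho i)) /\
      (exists M, forall i, (i < m)%N -> An (wt m (2 * rho)) (f i) M),
    forall h i, dom (wt m eta) h -> (i < m)%N -> Psi i (upd h m 0) = h i &
    forall h s i, dom (wt m eta) h -> 0 <= s < tau -> (i < m)%N ->
      is_derive s (1 : R) (fun s => Psi i (upd h m s)) (f i (fun j => Psi j (upd h m s)))].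
Proof.
move=> gf; have [r0 [M [r00 M0 Af]]] := germ_common gf.
(* A primitive over radius [tau] of a function bounded by M has norm r0 / 8, so iterates started
   from |x| <= r0 / 8 stay below r0 / 2, half the radius of the field. *)
pose tau := r0 / (8%:R * M); pose eta := r0 / 8%:R.
have t0 : 0 < tau by rewrite divr_gt0// mulr_gt0.
have e0 : 0 < eta by rewrite divr_gt0.
have tM : tau * M = r0 / 8%:R by rewrite /tau; field; rewrite gt_eqF.
pose om : E := upd (wt m eta) m tau.
have om0 i : 0 <= om i.
  by rewrite /om /upd; case: ifP => _; [exact: ltW|exact/wt_ge0/ltW].
have omm : om m = tau by rewrite /om upd_id.
have w0 : forall i, 0 <= wt m r0 i by apply/wt_ge0/ltW.
have fdiff Y Y' d : 0 < d -> d <= r0 / 2 -> (forall i, (i < m)%N -> An om (Y i) (r0 / 2)) ->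
    (forall i, (i < m)%N -> An om (Y' i) (r0 / 2)) ->
    (forall i, (i < m)%N -> An om (fun x => Y i x - Y' i x) d) ->
    forall i, (i < m)%N -> An om (fun x => f i (sub m Y x) - f i (sub m Y' x)) (M * (2 * d / r0)).
  move=> d0 dr AY AY' AD i im.
  apply: (@An_diff _ (wt m r0) om (wt m (r0 / 2)) (wt m d) (f i) M (2 * d / r0)
    (fun i x => sub m Y x i) (fun i x => sub m Y' x i)) => //.
  - exact: Af.
  - by rewrite divr_gt0// mulr_gt0.
  - by rewrite ler_pdivrMr// mul1r; lra.
  - by move=> j; rewrite /sub /wt; case: ltnP => jm; [exact: AY|apply: An_cst; rewrite normr0].
  - by move=> j; rewrite /sub /wt; case: ltnP => jm; [exact: AY'|apply: An_cst; rewrite normr0].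
  - move=> j; rewrite /sub /wt; case: ltnP => jm; first exact: AD.
    by rewrite subrr; apply: An_cst; rewrite normr0.
  - move=> j; rewrite /wt; case: ltnP => jm; last by rewrite mul0r addr0.
    by rewrite le_eqVlt; apply/orP; left; apply/eqP; field; rewrite !gt_eqF.
have dupd (x : E) s : dom om x -> `|s| <= tau -> dom om (upd x m s).
  by move=> dx st j; rewrite /upd; case: eqP => [->|_]; [rewrite omm|exact: dx].
(* The step is stated for all arguments, with its conclusion guarded by hypotheses, so that a choice
   function exists. *)
have st (p : (nat -> E -> R) * (nat -> E -> R) * R) : exists G : nat -> E -> R,
    0 < p.2 -> p.2 <= r0 / 2 -> (forall i, (i < m)%N -> An om (p.1.1 i) (r0 / 2)) ->
    (forall i, (i < m)%N -> An om (p.1.2 i) (r0 / 2)) ->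
    (forall i, (i < m)%N -> An om (fun x => p.1.1 i x - p.1.2 i x) p.2) ->
    forall i, (i < m)%N -> [/\ An om (G i) (p.2 / 2), forall x, G i (upd x m 0) = 0 &
      forall x, dom om x -> `|x m| < tau -> is_derive (x m) (1 : R) (fun s => G i (upd x m s))
        (f i (sub m p.1.1 x) - f i (sub m p.1.2 x))].
  case: p => [[Y Y'] d] /=.
  have [H|H] := pselect (0 < d /\ d <= r0 / 2 /\ (forall i, (i < m)%N -> An om (Y i) (r0 / 2)) /\
    (forall i, (i < m)%N -> An om (Y' i) (r0 / 2)) /\ (forall i, (i < m)%N -> An om (fun x => Y i x - Y' i x) d)); last first.
    by exists Y => *; exfalso; apply: H.
  have [d0 [dr [AY [AY' AD]]]] := H.
  have ex i : exists G : E -> R, (i < m)%N -> [/\ An om G (d / 2), forall x, G (upd x m 0) = 0 &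
      forall x, dom om x -> `|x m| < tau -> is_derive (x m) (1 : R) (fun s => G (upd x m s))
        (f i (sub m Y x) - f i (sub m Y' x))].
    have [im|im] := boolP (i < m)%N; last by exists (fun=> 0).
    have omm0 : 0 < om m by rewrite omm.
    have [G [AG G0 dG]] := An_primitive om0 omm0 (fdiff Y Y' d d0 dr AY AY' AD i im).
    exists G => _; split=> //; last by move=> x dx xt; apply: dG => //; rewrite omm.
    apply: (An_le om0 AG); rewrite omm mulrA tM.
    have -> : r0 / 8%:R * (2 * d / r0) = d / 4 by field; rewrite gt_eqF.
    by lra.
  by have /choice[G HG] := ex; exists G.
have {st}/choice[nx nxP] := st.
pose d k : R := r0 / 8%:R / 2 ^+ k.
have dpos k : 0 < d k by rewrite divr_gt0// ?exprn_gt0// divr_gt0.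
have dS k : d k.+1 = d k / 2 by rewrite /d exprS; field; rewrite expf_neq0.
have d0E : d 0%N = r0 / 8%:R by rewrite /d expr0 divr1.
have dle k : d k <= r0 / 8%:R.
  elim: k => [|k IH]; first by rewrite d0E.
  by rewrite dS; have := dpos k; lra.
pose Y0 (i : nat) (x : E) := x i.
have AY0 i : (i < m)%N -> An om (Y0 i) (r0 / 8%:R).
  by move=> im; apply: An_var; rewrite /om /upd ltn_eqF// /wt im.
have omm0 : 0 < om m by rewrite omm.
have prim (Y : nat -> E -> R) : (forall i, (i < m)%N -> An om (Y i) (r0 / 2)) ->
    exists G : nat -> E -> R, forall i, (i < m)%N -> [/\ An om (G i) (r0 / 8%:R), forall x, G i (upd x m 0) = 0 &
      forall x, dom om x -> `|x m| < tau -> is_derive (x m) (1 : R) (fun s => G i (upd x m s)) (f i (sub m Y x))].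
  move=> AY.
  have ex i : exists G : E -> R, (i < m)%N -> [/\ An om G (r0 / 8%:R), forall x, G (upd x m 0) = 0 &
      forall x, dom om x -> `|x m| < tau -> is_derive (x m) (1 : R) (fun s => G (upd x m s)) (f i (sub m Y x))].
    have [im|im] := boolP (i < m)%N; last by exists (fun=> 0).
    have AfY : An om (fun x => f i (sub m Y x)) M.
      apply: (@An_comp _ (wt m r0) om (f i) M (fun i x => sub m Y x i)) => //; first exact: Af.
      move=> j; rewrite /sub /wt; case: ltnP => jm; last by apply: An_cst; rewrite normr0.
      by apply: (An_le om0 (AY j jm)); lra.
    have [G [AG G0 dG]] := An_primitive om0 omm0 AfY.
    exists G => _; split=> //; last by move=> x dx xt; apply: dG => //; rewrite omm.
    by apply: (An_le om0 AG); rewrite omm tM.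
  by have /choice[G HG] := ex; exists G.
have AY0' i : (i < m)%N -> An om (Y0 i) (r0 / 2).
  by move=> im; apply: (An_le om0 (AY0 i im)); lra.
have [G0 G0P] := prim Y0 AY0'.
pose Y1 i x := Y0 i x + G0 i x.
(* Each iterate adds a primitive of the difference f(Z_(k+1)) - f(Z_k) to the previous one. A
   primitive chosen afresh for f(Z_(k+1)) would carry no norm bound for the increment. *)
pose stp k := iteri k (fun k (p : (nat -> E -> R) * (nat -> E -> R)) =>
   (fun i x => p.1 i x + nx (p, d k) i x, p.1)) (Y1, Y0).
pose Z k := (stp k).2.
have Z1 k : Z k.+1 = (stp k).1 by [].
pose b k : R := 3 * r0 / 8%:R - 2 * d k.
have br k : b k <= r0 / 2 by rewrite /b; have := dpos k; lra.
have inv k : [/\ forall i, (i < m)%N -> An om (Z k i) (b k),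
    forall i, (i < m)%N -> An om (fun x => Z k.+1 i x - Z k i x) (d k),
    forall i x, (i < m)%N -> Z k i (upd x m 0) = x i /\ Z k.+1 i (upd x m 0) = x i &
    forall i x, (i < m)%N -> dom om x -> `|x m| < tau ->
      is_derive (x m) (1 : R) (fun s => Z k.+1 i (upd x m s)) (f i (sub m (Z k) x))].
  elim: k => [|k [IH1 IH2 IH3 IH4]].
    split.
    - by move=> i im; apply: (An_le om0 (AY0 i im)); rewrite /b d0E; lra.
    - move=> i im; have [A _ _] := G0P i im.
      by apply: (An_eq om0 A); [rewrite d0E|move=> x _; rewrite Z1 /= /Y1 /Z/=; ring].
    - move=> i x im; have [_ G00 _] := G0P i im.
      by rewrite Z1 /Z/= /Y1 G00 addr0 /Y0 /upd ltn_eqF.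
    - move=> i x im dx xt; have [_ _ dG] := G0P i im.
      rewrite Z1 /Z /= /Y1.
      have -> : (fun s => Y0 i (upd x m s) + G0 i (upd x m s)) = cst (x i) + (fun s => G0 i (upd x m s)).
        by apply/funext => s; rewrite /Y0 /upd ltn_eqF.
      have dd := dG x dx xt.
      by apply: is_derive_eq; rewrite add0r.
  have IH1' i : (i < m)%N -> An om (Z k.+1 i) (b k.+1).
    move=> im; apply: (@An_eq _ _ om0 (fun x => Z k i x + (Z k.+1 i x - Z k i x)) _ (b k + d k)).
    - by apply: An_add; [exact: IH1|exact: IH2].
    - by rewrite /b dS; lra.
    - by move=> x _; rewrite addrC subrK.
  have hb i : (i < m)%N -> An om (Z k.+1 i) (r0 / 2) by move=> im; exact: (An_le om0 (IH1' i im) (br _)).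
  have hb' i : (i < m)%N -> An om (Z k i) (r0 / 2) by move=> im; exact: (An_le om0 (IH1 i im) (br _)).
  have dr : d k <= r0 / 2 by have := dle k; lra.
  have := nxP ((stp k), d k) (dpos k) dr hb hb' IH2 => NX.
  have Z2 i x : Z k.+2 i x = Z k.+1 i x + nx (stp k, d k) i x by [].
  split=> //.
  - move=> i im; have [A _ _] := NX i im.
    by apply: (An_eq om0 A); [rewrite dS|move=> x _; rewrite Z2; ring].
  - move=> i x im; have [_ N0 _] := NX i im; have [_ e1] := IH3 i x im.
    by rewrite Z2 e1 N0 addr0.
  - move=> i x im dx xt; have [_ _ dN] := NX i im.
    have d1 := IH4 i x im dx xt; have d2 := dN x dx xt.
    have -> : (fun s => Z k.+2 i (upd x m s)) = (fun s => Z k.+1 i (upd x m s)) + (fun s => nx (stp k, d k) i (upd x m s)) by [].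
    by apply: is_derive_eq; rewrite /= addrC subrK.
pose Yi i x := limn (fun k => Z k i x).
have serd k n : series (fun l => d (k + l)%N) n = 2 * d k - 2 * d (k + n)%N.
  elim: n => [|n IH]; first by rewrite /series/= big_geq// addn0 subrr.
  by rewrite /series/= big_nat_recr//= -[X in X + _]/(series (fun l => d (k + l)%N) n) IH addnS dS; lra.
have serZ k i x n : series (fun l => Z (k + l)%N.+1 i x - Z (k + l)%N i x) n = Z (n + k)%N i x - Z k i x.
  elim: n => [|n IH]; first by rewrite /series/= big_geq// add0n subrr.
  rewrite /series/= big_nat_recr//= -[X in X + _]/(series (fun l => Z (k + l)%N.+1 i x - Z (k + l)%N i x) n) IH.
  by rewrite (addnC k n) addSn; ring.
have cZ i x : (i < m)%N -> dom om x -> (fun k => Z k i x) @ \oo --> Yi i x.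
  move=> im dx; rewrite /Yi; suff : cvgn (fun n => Z (n + 0)%N i x - Z 0%N i x).
    move=> c; have : cvgn (fun n => (Z (n + 0)%N i x - Z 0%N i x) + Z 0%N i x) by apply: is_cvgD => //; exact: is_cvg_cst.
    by rewrite (_ : (fun n => _) = (fun k => Z k i x))//; apply/funext => n; rewrite subrK addn0.
  have := @series_cvg_bound R (fun l => Z (0 + l)%N.+1 i x - Z (0 + l)%N i x) (fun l => d (0 + l)%N) (2 * d 0%N).
  rewrite (_ : series (fun l => Z (0 + l)%N.+1 i x - _) = (fun n => Z (n + 0)%N i x - Z 0%N i x)); last by apply/funext => n; rewrite serZ.
  apply.
    by move=> k; have [_ A _ _] := inv k; rewrite add0n; exact: (An_bound (A i im) dx).
  by move=> n; rewrite serd; have := dpos (0 + n)%N; lra.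
have AYZ k i : (i < m)%N -> An om (fun x => Yi i x - Z k i x) (2 * d k).
  move=> im; apply: (@An_lim _ _ (fun l x => Z (k + l)%N.+1 i x - Z (k + l)%N i x) (fun l => d (k + l)%N)).
  - by move=> l; have [_ A _ _] := inv (k + l)%N; apply: A.
  - by move=> n; rewrite serd; have := dpos (k + n)%N; lra.
  - move=> x dx; rewrite (_ : series _ = (fun n => Z (n + k)%N i x - Z k i x)); last by apply/funext => n; rewrite serZ.
    by apply: cvgB; [have := cZ i x im dx; rewrite -(cvg_shiftn k)|exact: cvg_cst].
have AYi i : (i < m)%N -> An om (Yi i) (r0 / 2).
  move=> im; have [A _ _ _] := inv 0%N.
  apply: (@An_eq _ _ om0 (fun x => Z 0%N i x + (Yi i x - Z 0%N i x)) _ (b 0%N + 2 * d 0%N)).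
  - by apply: An_add; [exact: A|exact: AYZ].
  - by rewrite /b; lra.
  - by move=> x _; rewrite addrC subrK.
(* The limit [Yi] is not visibly differentiable in time. One more integration gives [W], which is,
   and [WY] identifies both by the mean value theorem. *)
have [G GP] := prim Yi AYi.
pose W i (x : E) := x i + G i x.
have W0 i x : (i < m)%N -> W i (upd x m 0) = x i.
  by move=> im; have [_ e1 _] := GP i im; rewrite /W e1 addr0 /upd ltn_eqF.
have dW i x : (i < m)%N -> dom om x -> `|x m| < tau ->
    is_derive (x m) (1 : R) (fun s => W i (upd x m s)) (f i (sub m Yi x)).
  move=> im dx xt; have [_ _ dG] := GP i im; have dd := dG x dx xt.
  have -> : (fun s => W i (upd x m s)) = cst (x i) + (fun s => G i (upd x m s)).
    by apply/funext => s; rewrite /W /upd ltn_eqF.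
  by apply: is_derive_eq; rewrite add0r.
have WY i x : (i < m)%N -> dom om x -> 0 <= x m < tau -> W i x = Yi i x.
  move=> im dx xt; apply/eqP; rewrite -subr_eq0 -normr_le0; apply/ler_addgt0Pr => e ep; rewrite add0r.
  have key k : `|W i x - Yi i x| <= r0 * (2^-1) ^+ k.
    have [_ _ Z0 dZ] := inv k.
    have D1 s : `|s| < tau -> is_derive s (1 : R) (fun s => W i (upd x m s) - Z k.+1 i (upd x m s))
        (f i (sub m Yi (upd x m s)) - f i (sub m (Z k) (upd x m s))).
      move=> sx; have dux := dupd x s dx (ltW sx).
      have us : `|upd x m s m| < tau by rewrite upd_id.
      have := dW i _ im dux us; have := dZ i _ im dux us; rewrite upd_id.
      under eq_fun do rewrite upd_upd.
      move=> h1; under eq_fun do rewrite upd_upd.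
      move=> h2.
      exact: (is_deriveB h2 h1).
    have h2d : 2 * d k <= r0 / 2 by have := dle k; lra.
    have h2p : 0 < 2 * d k by rewrite mulr_gt0.
    have hb' j : (j < m)%N -> An om (Z k j) (r0 / 2).
      by move=> jm; have [A _ _ _] := inv k; exact: (An_le om0 (A j jm) (br _)).
    have AD := fdiff Yi (Z k) (2 * d k) h2p h2d AYi hb' (AYZ k) i im.
    have := derive_bound D1 _ xt => /(_ (M * (2 * (2 * d k) / r0))) DB.
    have {DB} : `|W i x - Z k.+1 i x| <= M * (2 * (2 * d k) / r0) * x m.
      have := DB _; rewrite upd_same W0// (Z0 i x im).2 subrr subr0; apply.
      move=> s /andP[s0 st]; apply: (An_bound AD); apply: dupd => //.
      by rewrite ger0_norm// ltW.
    have h2 := An_bound (AYZ k.+1 i im) dx.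
    move=> h1; have -> : W i x - Yi i x = (W i x - Z k.+1 i x) - (Yi i x - Z k.+1 i x) by ring.
    apply: le_trans (ler_normB _ _) _; apply: le_trans (lerD h1 h2) _.
    case/andP: xt => x0 xt.
    have : M * (2 * (2 * d k) / r0) * x m <= M * (2 * (2 * d k) / r0) * tau.
      by apply: ler_wpM2l; [rewrite mulr_ge0 ?(ltW M0)// divr_ge0 ?mulr_ge0 ?(ltW r00) ?(ltW (dpos k))|exact: ltW].
    have -> : M * (2 * (2 * d k) / r0) * tau = d k / 2 by rewrite /tau; field; rewrite !gt_eqF.
    have -> : r0 * 2^-1 ^+ k = 8%:R * d k by rewrite /d exprVn; field; rewrite expf_neq0.
    by rewrite dS; have := dpos k; lra.
  have q01 : 0 <= (2^-1 : R) < 1 by rewrite invr_ge0 ler0n/= invf_lt1// ltr1n.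
  have [k kP] := geometric_small r0 q01 ep.
  exact: le_trans (key k) kP.
exists tau, eta, (r0 / 2), (fun i => if (i < m)%N then W i else fun=> 0); split=> //.
- by split=> //; rewrite divr_gt0.
- split; last first.
    exists M => i im; rewrite mulrC divfK//; exact: Af.
  move=> i; rewrite /wt -/om; case: ltnP => im; last by apply: An_cst; rewrite normr0.
  apply: (@An_le _ _ om0 _ (r0 / 8%:R + r0 / 8%:R)); last by lra.
  by apply: An_add; [exact: AY0|have [] := GP i im].
- by move=> h i dh im; rewrite im W0.
- move=> h s i dh s0t im; rewrite im.
  have dx : dom om (upd h m s).
    case/andP: s0t => s0 st j; rewrite /om /upd; case: eqP => [_|_]; last exact: dh.
    by rewrite ger0_norm// ltW.
  have st : `|upd h m s m| < tau by case/andP: s0t => s0 st; rewrite upd_id ger0_norm.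
  have := dW i _ im dx st; rewrite upd_id; under eq_fun do rewrite upd_upd.
  congr (is_derive _ _ _ (f i _)); apply/funext => j; rewrite /sub; case: ltnP => // jm.
  by rewrite WY// upd_id.
Qed.

End LocalFlow.

(** * Row vectors, germs and the second-order Taylor estimate *)

Section Analytic.
Variable R : realType.
Notation E := (nat -> R).
Local Notation nb := (@nb R).

Definition rv (n : nat) (x : E) : 'rV[R]_n := \row_(i < n) x i.

Definition vr (n : nat) (v : 'rV[R]_n) : E := fun i => if insub i is Some j then v 0 j else 0.

Definition l1 (n : nat) (x : E) : R := \sum_(i < n) `|x i|.

Lemma vrE n (v : 'rV[R]_n) (i : 'I_n) : vr v i = v 0 i.
Proof. by rewrite /vr valK. Qed.

Lemma vr_out n (v : 'rV[R]_n) i : (n <= i)%N -> vr v i = 0.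
Proof. by move=> ni; rewrite /vr insubF// ltnNge ni. Qed.

Lemma vrK n (v : 'rV[R]_n) : rv n (vr v) = v.
Proof. by apply/rowP => i; rewrite mxE vrE. Qed.

Lemma rvK n (x : E) : vr (rv n x) = res n x.
Proof.
apply/funext => i; rewrite /res; case: ltnP => ni; last by rewrite vr_out.
by rewrite (vrE (rv n x) (Ordinal ni)) mxE.
Qed.

Lemma rv_norm_le n (x : E) (r : R) : 0 <= r -> (forall i, (i < n)%N -> `|x i| <= r) -> `|rv n x| <= r.
Proof.
move=> r0 h; rewrite [leLHS]/Num.norm/= mx_normrE; apply: bigmax_le => // -[i j] _ /=.
by rewrite mxE; apply: h.
Qed.

Lemma rV_coord_le n (v : 'rV[R]_n) i : `|v 0 i| <= `|v|.
Proof.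
by rewrite [leRHS]/Num.norm/= mx_normrE; apply/bigmax_geP; right => /=; exists (0, i).
Qed.

Lemma l1_ge0 n x : 0 <= l1 n x.
Proof. by rewrite /l1 sumr_ge0. Qed.

Lemma l1_coord n x i : (i < n)%N -> `|x i| <= l1 n x.
Proof. by move=> ni; rewrite /l1 (bigD1 (Ordinal ni))//= lerDl sumr_ge0. Qed.

Lemma l1_le n x (r : R) : (forall i, (i < n)%N -> `|x i| <= r) -> l1 n x <= n%:R * r.
Proof.
move=> h; rewrite /l1 -[n in leRHS]card_ord mulr_natl -sumr_const.
by apply: ler_sum => i _; apply: h.
Qed.

(** The series of absolute values, taken at the corner (e, ..., e) of a polydisc inside the domain
    of convergence, is the required norm bound. *)
Lemma analytic_at_germ n (f : 'rV[R]_n -> R) (z : E) : analytic_at f (rv n z) ->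
  germ n (fun h => f (rv n (fun i => z i + h i))).
Proof.
move=> [r [r0 [c H]]]; pose e := r / 2.
have e0 : 0 < e by rewrite divr_gt0.
have er : e < r by rewrite /e; lra.
have yE h : rv n (fun i => z i + h i) - rv n z = rv n h.
  by apply/rowP => i; rewrite !mxE addrC addKr.
have yn h : dom (wt n e) h -> `|rv n (fun i => z i + h i) - rv n z| < r.
  move=> dh; rewrite yE; apply: le_lt_trans er; apply: rv_norm_le; first exact: ltW.
  by move=> i ni; have := dh i; rewrite /wt ni.
have dw : dom (wt n e) (wt n e) by move=> i; rewrite ger0_norm// wt_ge0// ltW.
have psE h b d : ps_term c (rv n z) (rv n (fun i => z i + h i)) b d =
   \sum_(al : {ffun 'I_n -> 'I_d.+1} | (\sum_i (al i : nat))%N == d)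
     (let t := c [ffun i => (al i : nat)] * \prod_(i < n) h i ^+ (al i) in if b then `|t| else t).
  apply: eq_bigr => al _; rewrite /=; congr (if _ then `|_ * _| else _ * _);
  by apply: eq_bigr => i _; rewrite !mxE addrC addKr.
pose M := limn (series (ps_term c (rv n z) (rv n (fun i => z i + wt n e i)) true)).
exists e, M; split=> //.
apply: (@An_lim _ _ (fun d h => ps_term c (rv n z) (rv n (fun i => z i + h i)) false d)
  (ps_term c (rv n z) (rv n (fun i => z i + wt n e i)) true)).
- move=> d; under eq_fun do rewrite psE; rewrite psE; apply: An_sum => al _ /=.
  rewrite normrM normr_prod; apply: An_mul; first exact: An_cst.
  apply: An_prod => i _; rewrite normrX; apply: An_exp; apply: An_var.
  exact: ler_norm.
- apply: nondecreasing_cvgn_le; last by have [] := H _ (yn _ dw).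
  apply/nondecreasing_series => d _ _; rewrite psE; apply: sumr_ge0 => al _ /=.
  exact: normr_ge0.
- by move=> h dh; have [] := H _ (yn _ dh).
Qed.

Lemma germ_hadamard_multi n m d (f : E -> R) : (n + d <= m)%N -> germ m f ->
  exists H : nat -> E -> R, (forall i, germ m (H i)) /\
  \forall x \near nb m, f x = f (fun i => if (n <= i < n + d)%N then 0 else x i)
     + \sum_(i < d) x (n + i)%N * H i x.
Proof.
move=> + gf; elim: d => [|d IH] dm.
  exists (fun _ _ => 0); split; first by move=> i; apply: germ_cst.
  near=> x; rewrite big_ord0 addr0; congr f; apply/funext => i.
  by case: ifP => //; lia.
have [H [gH HE]] := IH ltac:(lia).
pose g x := f (fun i => if (n <= i < n + d)%N then 0 else x i).
have gg : germ m g.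
  have gp : gmap m m (fun i (x : E) => if (n <= i < n + d)%N then 0 else x i).
    by move=> i _; case: ifP => _; split=> //; [exact: germ_cst|exact: germ_var].
  apply: germ_eq (germ_comp gf gp) _.
  apply: filterS (near_supp R m) => x sx; congr f; apply/funext => i; rewrite /sub.
  by case: ltnP => // mi; rewrite sx//; case: ifP.
have [h [gh hE]] := @germ_hadamard _ m (n + d) g ltac:(lia) gg.
exists (fun i => if i == d then h else H i); split.
  by move=> i; case: eqP.
near=> x; rewrite big_ord_recr/= eqxx.
rewrite (eq_bigr (fun i : 'I_d => x (n + i)%N * H i x)); last first.
  by move=> i _; rewrite ltn_eqF.
rewrite (near HE x)// -/(g x) (near hE x)//.
rewrite -addrA; congr (_ + _); last exact: addrC.
rewrite /g; congr f.
apply/funext => i; rewrite /upd; case: eqP => [->|ne]; first by case: ifP; case: ifP => //; lia.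
by case: ifP; case: ifP => //; lia.
Unshelve. all: by end_near. Qed.

(** Consider f(h + k) as a germ in 2 n variables and divide twice by the coordinates of k. The first
    quotient at k = 0 is the derivative; the bounded second quotients give the quadratic
    remainder. *)
Lemma germ_taylor2 n (f : E -> R) : germ n f -> exists (D : nat -> E -> R) (K r : R),
  [/\ 0 < r, 0 <= K, forall i, germ n (D i) &
    forall h k, dom (wt n r) h -> dom (wt n r) k ->
      `|f (fun i => h i + k i) - f h - \sum_(i < n) k i * D i h| <= K * l1 n k ^+ 2].
Proof.
move=> gf; pose pi i (x : E) := x i + x (n + i)%N.
have gp : gmap n (n + n) pi.
  by move=> i _; split; [apply: germ_add; exact: germ_var|rewrite /pi addr0].
have [H [gH HE]] := @germ_hadamard_multi n (n + n) n _ (leqnn _) (germ_comp gf gp).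
have st i : exists H' : nat -> E -> R, (forall j, germ (n + n) (H' j)) /\
  \forall x \near nb (n + n), H i x = H i (fun j => if (n <= j < n + n)%N then 0 else x j)
     + \sum_(j < n) x (n + j)%N * H' j x.
  exact: germ_hadamard_multi.
have /choice[H' {}st] := st.
pose cat (h k : E) : E := fun i => if (i < n)%N then h i else if (i < n + n)%N then k (i - n)%N else 0.
have [B [B0 BH]] : exists B : R, 0 <= B /\ \forall x \near nb (n + n),
   forall i j, (i < n)%N -> (j < n)%N -> `|H' i j x| <= B.
  suff U d : (d <= n)%N -> exists B : R, 0 <= B /\ \forall x \near nb (n + n),
     forall i j, (i < d)%N -> (j < n)%N -> `|H' i j x| <= B by exact: U.
  elim: d => [|d IH] dn; first by exists 0; split=> //; near=> x.
  have [B [B0 BH]] := IH (ltnW dn).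
  have [B' [B'0 BH']] : exists B : R, 0 <= B /\ \forall x \near nb (n + n),
     forall j, (j < n)%N -> `|H' d j x| <= B.
    suff U e : (e <= n)%N -> exists B : R, 0 <= B /\ \forall x \near nb (n + n),
     forall j, (j < e)%N -> `|H' d j x| <= B by exact: U.
    elim: e => [|e IH'] en; first by exists 0; split=> //; near=> x.
    have [C [C0 CH]] := IH' (ltnW en).
    have [C' [C'0 CH']] := germ_bounded ((st d).1 e).
    exists (C + C'); split; first by rewrite addr_ge0// ltW.
    apply: filterS (nbI CH CH') => x [e1 e2] j; rewrite ltnS leq_eqVlt => /orP[/eqP->|je].
      by apply: le_trans e2 _; rewrite lerDr.
    by apply: le_trans (e1 _ je) _; rewrite lerDl ltW.
  exists (B + B'); split; first by rewrite addr_ge0.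
  apply: filterS (nbI BH BH') => x [e1 e2] i j; rewrite ltnS leq_eqVlt => /orP[/eqP->|ie] jn.
    by apply: le_trans (e2 _ jn) _; rewrite lerDr.
  by apply: le_trans (e1 _ _ ie jn) _; rewrite lerDl.
have NH : \forall x \near nb (n + n), forall i, (i < n)%N ->
   H i x = H i (fun j => if (n <= j < n + n)%N then 0 else x j) + \sum_(j < n) x (n + j)%N * H' i j x.
  suff U d : (d <= n)%N -> \forall x \near nb (n + n), forall i, (i < d)%N ->
   H i x = H i (fun j => if (n <= j < n + n)%N then 0 else x j) + \sum_(j < n) x (n + j)%N * H' i j x by exact: U.
  elim: d => [|d IH] dn; first by near=> x.
  apply: filterS (nbI (IH (ltnW dn)) (st d).2) => x [e1 e2] i.
  by rewrite ltnS leq_eqVlt => /orP[/eqP->|id]; [exact: e2|exact: e1].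
have [r r0 rP] := nbI (nbI HE NH) BH.
exists H, B, r; split=> //.
  by move=> i; apply: germ_down (gH i); rewrite leq_addr.
move=> h k dh dk.
have dc : dom (wt (n + n) r) (cat h k).
  move=> i; rewrite /cat /wt; case: (ltnP i n) => ni.
    by have := dh i; rewrite /wt ni (leq_trans ni (leq_addr _ _)).
  case: ltnP => nni; last by rewrite normr0.
  by have := dk (i - n)%N; rewrite /wt ifT//; lia.
have [[/= E1 E2] E3] := rP _ dc.
have sh i : (n <= i)%N -> h i = 0.
  by move=> ni; apply/eqP; rewrite -normr_le0; have := dh i; rewrite /wt ltnNge ni.
have sk i : (n <= i)%N -> k i = 0.
  by move=> ni; apply/eqP; rewrite -normr_le0; have := dk i; rewrite /wt ltnNge ni.
have zc : (fun i => if (n <= i < n + n)%N then 0 else cat h k i) = h.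
  apply/funext => i; rewrite /cat; case: (ltnP i n) => ni /=; first by [].
  by case: (ltnP i (n + n)) => // nni; rewrite sh.
have ck (i : 'I_n) : cat h k (n + i)%N = k i.
  by rewrite /cat ltnNge leq_addr/= ltn_add2l ltn_ord addKn.
have s1 : sub n pi (cat h k) = (fun i => h i + k i).
  apply/funext => i; rewrite /sub /pi /cat; case: (ltnP i n) => ni.
    by rewrite ltnNge leq_addr/= ltn_add2l ni addKn.
  by rewrite sh// sk// addr0.
have s0 : sub n pi h = h.
  apply/funext => i; rewrite /sub /pi; case: (ltnP i n) => ni; last by rewrite sh.
  by rewrite [h (n + i)%N]sh ?leq_addr// addr0.
move: E1; rewrite s1 zc s0 => ->.
rewrite [f h + _]addrC addrK -sumrB.
rewrite (eq_bigr (fun i : 'I_n => k i * \sum_(j < n) k j * H' i j (cat h k))); last first.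
  move=> i _; rewrite ck -mulrBr (E2 _ (ltn_ord i)) zc addrAC subrr add0r.
  by congr (_ * _); apply: eq_bigr => j _; rewrite ck.
apply: le_trans (ler_norm_sum _ _ _) _.
rewrite expr2 mulrA [B * _]mulrC {1}/l1 !mulr_suml; apply: ler_sum => i _.
rewrite normrM -mulrA; apply: ler_wpM2l => //.
apply: le_trans (ler_norm_sum _ _ _) _.
rewrite /l1 mulr_sumr; apply: ler_sum => j _; rewrite normrM mulrC.
by apply: ler_wpM2r => //; apply: E3.
Unshelve. all: by end_near. Qed.

End Analytic.

(** * Functions analytic at every point and their bounds on balls *)

Section GlobalAnalytic.
Variable R : realType.
Notation E := (nat -> R).

Definition gan (n : nat) (f : E -> R) := forall z : E, germ n (fun h => f (fun i => z i + h i)).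

Lemma real_analytic_gan n (f : 'rV[R]_n -> R) : real_analytic f -> gan n (fun z => f (rv n z)).
Proof. by move=> af z; apply: analytic_at_germ. Qed.

Lemma gan_cst n c : gan n (fun=> c).
Proof. by move=> z; apply: germ_cst. Qed.

Lemma gan_var n i : gan n (fun z => z i).
Proof. by move=> z; apply: germ_add; [exact: germ_cst|exact: germ_var]. Qed.

Lemma gan_mul n f g : gan n f -> gan n g -> gan n (fun z => f z * g z).
Proof. by move=> af ag z; apply: germ_mul. Qed.

Lemma gan_opp n f : gan n f -> gan n (fun z => - f z).
Proof. by move=> af z; apply: germ_opp. Qed.

Lemma gan_sum n (I : Type) (r : seq I) (P : pred I) (f : I -> E -> R) :
  (forall i, P i -> gan n (f i)) -> gan n (fun z => \sum_(i <- r | P i) f i z).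
Proof. by move=> af z; apply: germ_sum => i Pi; apply: af. Qed.

Lemma gan_res n m f : gan n f -> gan m (fun z => f (res n z)).
Proof.
move=> af z; have -> : (fun h => f (res n (fun i => z i + h i))) =
    (fun h => (fun h => f (fun i => res n z i + h i)) (res n h)).
  by apply/funext => h; congr f; apply/funext => i; rewrite /res; case: ifP; rewrite ?addr0.
exact: germ_res (af _).
Qed.

Lemma dom_ei n i (t r : R) : 0 <= t <= r -> (i < n)%N ->
  dom (wt n r) (fun j => if j == i then t else 0).
Proof.
move=> /andP[t0 tr] ni j; rewrite /wt; case: eqP => [->|_]; first by rewrite ni ger0_norm.
by rewrite normr0; case: ifP => // _; apply: le_trans tr.
Qed.

(** The local expansions around different centres have the same linear part at common points, by
    letting the increment tend to 0; hence the derivatives glue to functions that are again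
    analytic. *)
Lemma gan_derive n f : gan n f -> exists Df : nat -> E -> R, (forall i, (i < n)%N -> gan n (Df i)) /\
  forall z, exists K r : R, [/\ 0 < r, 0 <= K & forall h k, dom (wt n r) h -> dom (wt n r) k ->
    `|f (fun i => z i + h i + k i) - f (fun i => z i + h i) -
      \sum_(i < n) k i * Df i (fun i => z i + h i)| <= K * l1 n k ^+ 2].
Proof.
move=> af.
have st z : exists D : nat -> E -> R, (forall i, germ n (D i)) /\ exists K r : R,
  [/\ 0 < r, 0 <= K & forall h k, dom (wt n r) h -> dom (wt n r) k ->
      `|f (fun i => z i + h i + k i) - f (fun i => z i + h i) - \sum_(i < n) k i * D i h| <= K * l1 n k ^+ 2].
  have [D [K [r [r0 K0 gD H]]]] := germ_taylor2 (af z).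
  exists D; split=> //; exists K, r; split=> // h k dh dk.
  have -> : (fun i => z i + h i + k i) = (fun i => z i + (h i + k i)) by apply/funext => i; rewrite addrA.
  exact: H.
have /choice[D {}st] := st.
have DE z : exists r : R, 0 < r /\ forall h i, (i < n)%N -> dom (wt n r) h ->
    D (fun i => z i + h i) i (fun=> 0) = D z i h.
  have [_ [K [r [r0 K0 H]]]] := st z; exists r; split=> // h i ni dh.
  have [_ [K' [r' [r'0 K'0 H']]]] := st (fun i => z i + h i).
  set a := LHS; set b := RHS.
  have m0 : 0 < Num.min r r' by rewrite lt_min r0.
  apply/eqP; rewrite -subr_eq0 -normr_le0.
  apply: (@limit0_le _ _ _ (K + K') _ m0) => t /andP[t0 tr].
  rewrite add0r; have tr1 : t <= r by apply: le_trans tr _; rewrite ge_min lexx.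
  have tr2 : t <= r' by apply: le_trans tr _; rewrite ge_min lexx orbT.
  pose k : E := fun j => if j == i then t else 0.
  have d1 : dom (wt n r) k by apply: dom_ei; rewrite ?(ltW t0).
  have d2 : dom (wt n r') k by apply: dom_ei; rewrite ?(ltW t0).
  have ks (g : nat -> R) : \sum_(j < n) k j * g j = t * g i.
    rewrite (bigD1 (Ordinal ni))//= big1 ?addr0 /k ?eqxx// => j ji.
    by rewrite ifF ?mul0r//; apply/negP => /eqP ji'; case/eqP: ji; apply/val_inj.
  have kl : l1 n k = t.
    rewrite /l1 (bigD1 (Ordinal ni))//= big1 ?addr0 /k ?eqxx ?gtr0_norm// => j ji.
    by rewrite ifF ?normr0//; apply/negP => /eqP ji'; case/eqP: ji; apply/val_inj.
  have := H h k dh d1; rewrite (ks (fun j => D z j h)) kl -/b => h1.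
  have := H' (fun=> 0) k (dom0 (wt_ge0 n (ltW r'0))) d2.
  under eq_fun do rewrite addr0; under [X in _ - f X]eq_fun do rewrite addr0.
  rewrite (ks (fun j => D (fun i => z i + h i) j (fun=> 0))) kl -/a => h2.
  rewrite -(ler_pM2l t0); have -> : t * ((K + K') * t) = K' * t ^+ 2 + K * t ^+ 2 by ring.
  rewrite -[X in X * _](gtr0_norm t0) -normrM.
  set fa := (X in `|X - _ - _|) in h1 h2.
  have -> : t * (a - b) = (fa - f (fun i => z i + h i) - t * b) - (fa - f (fun i => z i + h i) - t * a) by ring.
  by rewrite [leRHS]addrC; apply: le_trans (ler_normB _ _) _; apply: lerD.
exists (fun i z => D z i (fun=> 0)); split.
  move=> i ni z; have [r [r0 H]] := DE z.
  apply: germ_eq ((st z).1 i) _; exists r => // h dh; exact/esym/H.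
move=> z; have [r [r0 H]] := DE z; have [_ [K [r' [r'0 K0 H']]]] := st z.
exists K, (Num.min r r'); split=> //; first by rewrite lt_min r0.
move=> h k dh dk; rewrite (eq_bigr (fun i : 'I_n => k i * D z i h)).
  by apply: H'; [apply: dom_wt_le dh|apply: dom_wt_le dk]; rewrite ge_min lexx orbT.
move=> i _; rewrite H//; apply: dom_wt_le dh.
by rewrite ge_min lexx.
Qed.

Lemma vrB n (v w : 'rV[R]_n) i : vr (v - w) i = vr v i - vr w i.
Proof.
case: (ltnP i n) => ni; last by rewrite !vr_out// subrr.
by rewrite -[i]/(nat_of_ord (Ordinal ni)) !vrE !mxE.
Qed.

(** Compactness of the cube, with K tending to infinity as the parameter of the covering. *)
Lemma unif_on_ball n (rho : R) (Q : R -> E -> Prop) :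
  (forall z, dom (wt n rho) z -> exists r K0 : R, 0 < r /\ forall h K, dom (wt n r) h -> K0 <= K ->
     Q K (fun i => z i + h i)) ->
  exists K : R, 0 < K /\ forall z, dom (wt n rho) z -> Q K z.
Proof.
move=> HQ.
pose A := [set v : 'rV[R]_n | forall i, `[- rho, rho]%classic (v ord0 i)].
have cA : compact A by exact: (@rV_compact R n (fun=> `[- rho, rho]%classic) (fun=> @segment_compact R _ _)).
have dA v : A v -> dom (wt n rho) (vr v).
  move=> Av i; rewrite /wt; case: ltnP => ni; last by rewrite vr_out// normr0.
  by have := Av (Ordinal ni); rewrite /= -(vrE v) /= in_itv/= -ler_norml.
have /compact_near_coveringP/(_ R (pinfty_nbhs R) (fun K v => Q K (vr v)) _) := cA.
case=> [v Av|M [Mr HM]].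
  have [r [K0 [r0 H]]] := HQ _ (dA _ Av).
  exists (ball v r, [set K | K0 < K]); first split => /=.
  - exact: nbhsx_ballx.
  - by exists K0; split=> //; exact: num_real.
  - case=> v' K [/= bv KK].
    have -> : vr v' = (fun i => vr v i + vr (v' - v) i).
      by apply/funext => i; rewrite vrB addrC subrK.
    apply: H; last exact: ltW.
    move=> i; rewrite /wt; case: ltnP => ni; last by rewrite vr_out// normr0.
    rewrite (vrE _ (Ordinal ni)); apply: le_trans (rV_coord_le _ _) _.
    by rewrite distrC; move: bv; rewrite -ball_normE => /ltW.
exists (Num.max 1 (M + 1)); split; first by rewrite lt_max ltr01.
move=> z dz.
have -> : z = vr (rv n z).
  rewrite rvK res_id// => i ni; apply/eqP; rewrite -normr_le0.
  by have := dz i; rewrite /wt ltnNge ni.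
apply: HM; first by rewrite lt_max ltrDl ltr01 orbT.
by move=> i /=; rewrite mxE in_itv/= -ler_norml; have := dz i; rewrite /wt ltn_ord.
Qed.

(** Increments inside the polydisc of radius 1 / K1 are covered by the local Taylor estimate. Any
    other increment satisfies 1 <= K1 |k|, so crude bounds on f and its derivatives are already
    multiples of |k| and |k|^2. *)
Lemma gan_unif n f (Df : nat -> E -> R) : gan n f -> (forall i, (i < n)%N -> gan n (Df i)) ->
  (forall z, exists K r : R, [/\ 0 < r, 0 <= K & forall h k, dom (wt n r) h -> dom (wt n r) k ->
    `|f (fun i => z i + h i + k i) - f (fun i => z i + h i) -
      \sum_(i < n) k i * Df i (fun i => z i + h i)| <= K * l1 n k ^+ 2]) ->
  forall rho, exists K : R, 0 < K /\ forall z k, dom (wt n rho) z -> dom (wt n rho) (fun i => z i + k i) ->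
    [/\ `|f z| <= K, forall i, (i < n)%N -> `|Df i z| <= K,
      `|f (fun i => z i + k i) - f z| <= K * l1 n k &
      `|f (fun i => z i + k i) - f z - \sum_(i < n) k i * Df i z| <= K * l1 n k ^+ 2].
Proof.
move=> af aD HD rho.
have lb (g : E -> R) : gan n g -> forall z, exists r M : R, [/\ 0 < r, 0 <= M &
    forall h, dom (wt n r) h -> `|g (fun i => z i + h i)| <= M].
  move=> ag z; have [M [M0 [r r0 H]]] := germ_bounded (ag z).
  by exists r, M; split=> //; exact: ltW.
have lbD z : exists r M : R, [/\ 0 < r, 0 <= M &
    forall h i, dom (wt n r) h -> (i < n)%N -> `|Df i (fun i => z i + h i)| <= M].
  suff U d : (d <= n)%N -> exists r M : R, [/\ 0 < r, 0 <= M &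
    forall h i, dom (wt n r) h -> (i < d)%N -> `|Df i (fun i => z i + h i)| <= M] by exact: U.
  elim: d => [|d IH] dn; first by exists 1, 0.
  have [r [M [r0 M0 H]]] := IH (ltnW dn); have [r' [M' [r'0 M'0 H']]] := lb _ (aD _ dn) z.
  exists (Num.min r r'), (M + M'); split; [by rewrite lt_min r0|by rewrite addr_ge0|].
  move=> h i dh; rewrite ltnS leq_eqVlt => /orP[/eqP->|id].
    apply: le_trans (H' _ _) _; last by rewrite lerDr.
    by apply: dom_wt_le dh; rewrite ge_min lexx orbT.
  apply: le_trans (H _ _ _ id) _; last by rewrite lerDl.
  by apply: dom_wt_le dh; rewrite ge_min lexx.
have [K1 [K10 H1]] := @unif_on_ball n rho (fun K z => [/\ `|f z| <= K, forall i, (i < n)%N -> `|Df i z| <= K &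
   forall k, dom (wt n K^-1) k -> `|f (fun i => z i + k i) - f z - \sum_(i < n) k i * Df i z| <= K * l1 n k ^+ 2])
   ltac:(move=> z dz; have [r [M [r0 M0 e1]]] := lb _ af z; have [r' [M' [r'0 M'0 e2]]] := lbD z;
     have [K [r'' [r''0 K0 e3]]] := HD z;
     exists (Num.min r (Num.min r' r'')), (M + M' + K + r''^-1); split; first (by rewrite !lt_min r0 r'0);
     move=> h L dh KL; have ri : 0 < r''^-1 by [rewrite invr_gt0];
     split; [apply: le_trans (e1 _ _) _; [apply: dom_wt_le dh; rewrite ge_min lexx//|lra]
       |move=> i ni; apply: le_trans (e2 _ _ _ ni) _; [apply: dom_wt_le dh; rewrite !ge_min lexx ?orbT//|lra]
       |move=> k dk; apply: le_trans (e3 _ _ _ _) _; [apply: dom_wt_le dh; rewrite !ge_min lexx ?orbT//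
         |apply: dom_wt_le dk; rewrite -[leRHS]invrK lef_pV2 ?posrE//; lra
         |apply: ler_wpM2r; [exact: sqr_ge0|lra]]]).
have bk z k : dom (wt n rho) z -> dom (wt n rho) (fun i => z i + k i) -> ~ dom (wt n K1^-1) k -> 1 <= K1 * l1 n k.
  move=> dz dk nk; rewrite leNgt; apply/negP => h; apply: nk => i; rewrite /wt; case: ltnP => ni.
    by apply: le_trans (l1_coord _ ni) _; rewrite -[leRHS]mulr1 ler_pdivlMl// ltW.
  have := dk i; have := dz i; rewrite /wt ltnNge ni/= !normr_le0 => /eqP->.
  by rewrite add0r.
have K1s := sqr_ge0 K1.
pose K2 := K1 * (1 + 2 * K1 ^+ 2 + K1 ^+ 2).
have Dsum z (k : E) : dom (wt n rho) z -> `|\sum_(i < n) k i * Df i z| <= K1 * l1 n k.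
  move=> dz; have [_ h _] := H1 z dz; apply: le_trans (ler_norm_sum _ _ _) _.
  rewrite /l1 mulr_sumr; apply: ler_sum => i _; rewrite normrM mulrC; apply: ler_wpM2r => //.
  exact: h.
have T2 z k : dom (wt n rho) z -> dom (wt n rho) (fun i => z i + k i) ->
   `|f (fun i => z i + k i) - f z - \sum_(i < n) k i * Df i z| <= K2 * l1 n k ^+ 2.
  move=> dz dk; have [dk1|/(bk z k dz dk) h1] := pselect (dom (wt n K1^-1) k).
    have [_ _ h] := H1 z dz; apply: le_trans (h _ dk1) _; apply: ler_wpM2r; first exact: sqr_ge0.
    by rewrite /K2 ler_peMr ?(ltW K10)//; lra.
  have [fz _ _] := H1 z dz; have [fk _ _] := H1 _ dk; have ds := Dsum z k dz.
  have l0 := l1_ge0 n k; set l := l1 n k in h1 ds l0 *.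
  apply: le_trans (ler_normB _ _) _; apply: le_trans (lerD (ler_normB _ _) (lexx _)) _.
  apply: (@le_trans _ _ (K1 + K1 + K1 * l)); first by rewrite !lerD.
  have p1 : 1 <= (K1 * l) ^+ 2 by rewrite exprn_ege1.
  have p2 : K1 <= K1 * (K1 * l) ^+ 2 by rewrite ler_peMr// ltW.
  have p3 : K1 * l <= K1 * l * (K1 * l) by rewrite ler_peMr// mulr_ge0// ltW.
  have p4 : 0 <= K1 ^+ 3 * l ^+ 2 by rewrite mulr_ge0 ?exprn_ge0// ltW.
  have p5 : K1 * (K1 * l ^+ 2) * (K1 * l) = K1 ^+ 3 * l ^+ 2 * l by ring.
  have p6 : K1 * l * (K1 * l) <= K1 * K1 ^+ 2 * l ^+ 2 + K1 * l ^+ 2.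
    have : 0 <= K1 * l ^+ 2 * (K1 ^+ 2 - K1 + 1).
      by rewrite mulr_ge0 ?mulr_ge0 ?sqr_ge0 ?(ltW K10)//; nra.
    by lra.
  have -> : K2 * l ^+ 2 = K1 * (K1 * l) ^+ 2 + K1 * (K1 * l) ^+ 2 + (K1 * K1 ^+ 2 * l ^+ 2 + K1 * l ^+ 2) by rewrite /K2; ring.
  by lra.
have T1 z k : dom (wt n rho) z -> dom (wt n rho) (fun i => z i + k i) ->
   `|f (fun i => z i + k i) - f z| <= (K1 + n%:R + 2 * K1 ^+ 2) * l1 n k.
  move=> dz dk; have ds := Dsum z k dz.
  have l0 := l1_ge0 n k; have [fz _ h] := H1 z dz; have [fk _ _] := H1 _ dk.
  have [dk1|/(bk z k dz dk) h1] := pselect (dom (wt n K1^-1) k); last first.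
    apply: le_trans (ler_normB _ _) _; set l := l1 n k in h1 ds l0 *.
    apply: (@le_trans _ _ (K1 + K1)); first exact: lerD.
    have p2 : K1 <= K1 * (K1 * l) by rewrite ler_peMr// ltW.
    have p3 : 0 <= K1 * l by rewrite mulr_ge0// ltW.
    have p4 : 0 <= n%:R * l by rewrite mulr_ge0.
    have -> : (K1 + n%:R + 2 * K1 ^+ 2) * l = K1 * l + n%:R * l + 2 * (K1 * (K1 * l)) by ring.
    by lra.
  set l := l1 n k in ds l0 h *.
  have ll : l <= n%:R * K1^-1.
    by apply: l1_le => i ni; have := dk1 i; rewrite /wt ni.
  have -> : f (fun i => z i + k i) - f z = (f (fun i => z i + k i) - f z - \sum_(i < n) k i * Df i z)
     + \sum_(i < n) k i * Df i z by rewrite subrK.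
  apply: le_trans (ler_normD _ _) _; apply: le_trans (lerD (h _ dk1) ds) _.
  have p1 : K1 * l ^+ 2 <= n%:R * l.
    by rewrite expr2 mulrA; apply: ler_wpM2r => //; rewrite mulrC -ler_pdivlMr.
  have p3 : 0 <= K1 ^+ 2 * l by rewrite mulr_ge0// sqr_ge0.
  have -> : (K1 + n%:R + 2 * K1 ^+ 2) * l = K1 * l + n%:R * l + 2 * (K1 ^+ 2 * l) by ring.
  by rewrite -/l; lra.
have K20 : 0 <= K2 by rewrite mulr_ge0 ?(ltW K10)//; lra.
exists (K1 + n%:R + 2 * K1 ^+ 2 + K2); split.
  by rewrite -!addrA ltr_pwDl// !addr_ge0// mulr_ge0// sqr_ge0.
have n0 : 0 <= n%:R :> R by [].
move=> z k dz dk; have [h1 h2 _] := H1 z dz; have l0 := l1_ge0 n k; split.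
- by apply: le_trans h1 _; lra.
- by move=> i ni; apply: le_trans (h2 i ni) _; lra.
- by apply: le_trans (T1 z k dz dk) _; apply: ler_wpM2r => //; lra.
- by apply: le_trans (T2 z k dz dk) _; apply: ler_wpM2r; rewrite ?sqr_ge0//; lra.
Qed.

End GlobalAnalytic.

(** * Controls, trajectories and adjoint states *)

Section Integrals.
Variable R : realType.
Notation E := (nat -> R).
Local Notation mu := (@lebesgue_measure R).
Local Notation I01 := (@I01 R).

Definition L1 (f : R -> R) : Prop := mu.-integrable I01 (EFin \o f).
Definition sq (f : R -> R) : Prop := measurable_fun I01 f /\ L1 (fun t => f t ^+ 2).
Definition Int (f : R -> R) : R := Rintegral mu I01 f.
Definition cont (f : R -> R) : Prop := {within I01, continuous f}.

Implicit Types f g : R -> R.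

Lemma mI01 : measurable I01.
Proof. exact: measurable_itv. Qed.

Lemma I01P t : I01 t <-> 0 <= t <= 1.
Proof. by rewrite /I01 /= in_itv. Qed.

Lemma L1_meas f : L1 f -> measurable_fun I01 f.
Proof. by move=> /measurable_int/measurable_EFinP. Qed.

Lemma L1_dom f g : measurable_fun I01 f -> (forall t, I01 t -> `|f t| <= g t) -> L1 g -> L1 f.
Proof.
move=> mf fg Lg; apply: le_integrable Lg; [exact: mI01|exact/measurable_EFinP|].
by move=> t It /=; rewrite lee_fin (le_trans (fg t It))// ler_norm.
Qed.

Lemma L1_eq f g : (forall t, I01 t -> f t = g t) -> L1 f -> L1 g.
Proof. by move=> fg; apply: eq_integrable; [exact: mI01|move=> t /set_mem It /=; rewrite fg]. Qed.

Lemma L1D f g : L1 f -> L1 g -> L1 (fun t => f t + g t).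
Proof. by move=> Lf Lg; exact: (@integrableD _ _ _ mu _ mI01 _ _ Lf Lg). Qed.

Lemma L1B f g : L1 f -> L1 g -> L1 (fun t => f t - g t).
Proof. by move=> Lf Lg; exact: (@integrableB _ _ _ mu _ mI01 _ _ Lf Lg). Qed.

Lemma L1Z c f : L1 f -> L1 (fun t => c * f t).
Proof. by move=> Lf; exact: (@integrableZl _ _ _ mu _ mI01 c _ Lf). Qed.

Lemma L1_abs f : L1 f -> L1 (fun t => `|f t|).
Proof. by move=> Lf; exact: (@integrable_abse _ _ _ mu _ _ Lf). Qed.

Lemma L1_cst c : L1 (fun=> c).
Proof.
apply: continuous_compact_integrable; first exact: segment_compact.
by apply: continuous_subspaceT => x; exact: cvg_cst.
Qed.

Lemma L1_sum (I : Type) (r : seq I) (P : pred I) (f : I -> R -> R) :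
  (forall i, P i -> L1 (f i)) -> L1 (fun t => \sum_(i <- r | P i) f i t).
Proof.
move=> Lf; elim: r => [|i r IH]; first by under eq_fun do rewrite big_nil; exact: L1_cst.
under eq_fun do rewrite big_cons; case Pi: (P i) => //.
by apply: L1D => //; exact: Lf.
Qed.

Lemma L1_cont f : cont f -> L1 f.
Proof. by move=> cf; apply: continuous_compact_integrable => //; exact: segment_compact. Qed.

Lemma cont_bounded f : cont f -> exists M, 0 <= M /\ forall t, I01 t -> `|f t| <= M.
Proof.
move=> cf; have cn : {within `[0, 1]%classic, continuous (fun t => `|f t|)}.
  by move=> x; exact: cvg_norm (cf x).
have [c _ H] := EVT_max ler01 cn.
by exists `|f c|; split=> // t; rewrite /I01/=; exact: H.
Qed.

Lemma sq_mul f g : sq f -> sq g -> L1 (fun t => f t * g t).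
Proof.
move=> [mf Lf] [mg Lg]; apply: (L1_dom _ _ (L1D Lf Lg)); first exact: measurable_funM.
move=> t _; rewrite normrM -real_normK ?num_real// -[g t ^+ 2]real_normK ?num_real//.
by have := sqr_ge0 (`|f t| - `|g t|); have := mulr_ge0 (normr_ge0 (f t)) (normr_ge0 (g t)); nra.
Qed.

Lemma sq_cst c : sq (fun=> c).
Proof. by split; [exact: measurable_cst|exact: L1_cst]. Qed.

Lemma sq_L1 f : sq f -> L1 f.
Proof. by move=> sf; apply: (L1_eq _ (sq_mul sf (sq_cst 1))) => t _; rewrite mulr1. Qed.

Lemma sqD f g : sq f -> sq g -> sq (fun t => f t + g t).
Proof.
move=> sf sg; split; first exact: (measurable_funD sf.1 sg.1).
apply: (L1_eq _ (L1D (L1D sf.2 (L1Z 2 (sq_mul sf sg))) sg.2)) => t _ /=; ring.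
Qed.

Lemma sqZ c f : sq f -> sq (fun t => c * f t).
Proof.
move=> sf; split; first by apply: measurable_funM; [exact: measurable_cst|exact: sf.1].
by apply: (L1_eq _ (L1Z (c ^+ 2) sf.2)) => t _ /=; rewrite exprMn.
Qed.

Lemma sqB f g : sq f -> sq g -> sq (fun t => f t - g t).
Proof.
move=> sf sg; have := sqD sf (sqZ (-1) sg).
by congr sq; apply/funext => t; rewrite mulN1r.
Qed.

Lemma sq_abs f : sq f -> sq (fun t => `|f t|).
Proof.
move=> [mf Lf]; split; first exact: measurableT_comp.
by apply: (L1_eq _ Lf) => t _; rewrite real_normK ?num_real.
Qed.

Lemma sq_sum (I : Type) (r : seq I) (P : pred I) (f : I -> R -> R) :
  (forall i, P i -> sq (f i)) -> sq (fun t => \sum_(i <- r | P i) f i t).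
Proof.
move=> Lf; elim: r => [|i r IH]; first by under eq_fun do rewrite big_nil; exact: sq_cst.
under eq_fun do rewrite big_cons; case Pi: (P i) => //.
by apply: sqD => //; exact: Lf.
Qed.

Lemma sq_bmul f g M : measurable_fun I01 f -> (forall t, I01 t -> `|f t| <= M) -> sq g -> sq (fun t => f t * g t).
Proof.
move=> mf fM [mg Lg]; split; first exact: measurable_funM.
apply: (L1_dom _ _ (L1Z (M ^+ 2) Lg)).
  by under eq_fun do rewrite expr2; do 2 apply: measurable_funM => //; exact: measurable_funM.
move=> t It; rewrite ger0_norm ?sqr_ge0// exprMn; apply: ler_wpM2r; first exact: sqr_ge0.
have := fM t It; rewrite -[f t ^+ 2]real_normK ?num_real// => h.
by apply: lerXn2r => //; rewrite nnegrE// (le_trans _ h).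
Qed.

Lemma meas_cont f : cont f -> measurable_fun I01 f.
Proof. by move=> /L1_cont/L1_meas. Qed.

Lemma sq_cmul f g : cont f -> sq g -> sq (fun t => f t * g t).
Proof. by move=> cf; have [M [_ HM]] := cont_bounded cf; apply: sq_bmul HM; exact: meas_cont. Qed.

Lemma sq_cont f : cont f -> sq f.
Proof. by move=> cf; have := sq_cmul cf (sq_cst 1); congr sq; apply/funext => t; rewrite mulr1. Qed.

Lemma cont_cst c : cont (fun=> c).
Proof. by move=> x; exact: cvg_cst. Qed.

Lemma contD f g : cont f -> cont g -> cont (fun t => f t + g t).
Proof. by move=> cf cg x; apply: continuousD; [exact: cf|exact: cg]. Qed.

Lemma contB f g : cont f -> cont g -> cont (fun t => f t - g t).
Proof. by move=> cf cg x; apply: continuousB; [exact: cf|exact: cg]. Qed.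

Lemma contM f g : cont f -> cont g -> cont (fun t => f t * g t).
Proof. by move=> cf cg x; apply: continuousM; [exact: cf|exact: cg]. Qed.

Lemma cont_abs f : cont f -> cont (fun t => `|f t|).
Proof. by move=> cf x; exact: cvg_norm (cf x). Qed.

Lemma cont_sum (I : Type) (r : seq I) (P : pred I) (f : I -> R -> R) :
  (forall i, P i -> cont (f i)) -> cont (fun t => \sum_(i <- r | P i) f i t).
Proof.
move=> Lf; elim: r => [|i r IH]; first by under eq_fun do rewrite big_nil; exact: cont_cst.
under eq_fun do rewrite big_cons; case Pi: (P i) => //.
by apply: contD => //; exact: Lf.
Qed.

(* [b = true] is the backward orientation, from the final time 1, of the adjoint equation. *)
Definition seg (b : bool) (t : R) : set R := if b then `[t, 1%R]%classic else `[0%R, t]%classic.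
Definition vol (b : bool) (f : R -> R) (t : R) : R := Rintegral mu (seg b t) f.

Lemma mseg b t : measurable (seg b t).
Proof. by case: b; exact: measurable_itv. Qed.

Lemma seg_sub b t : 0 <= t <= 1 -> seg b t `<=` I01.
Proof.
move=> /andP[t0 t1] s; case: b; rewrite /seg /= !in_itv/= => /andP[h1 h2]; apply/andP; split=> //.
  exact: le_trans h1.
exact: le_trans h2 _.
Qed.

Lemma L1seg b t f : 0 <= t <= 1 -> L1 f -> mu.-integrable (seg b t) (EFin \o f).
Proof. by move=> t01; apply: integrableS; [exact: mI01|exact: mseg|exact: seg_sub]. Qed.

Lemma volD b t f g : 0 <= t <= 1 -> L1 f -> L1 g -> vol b (fun s => f s + g s) t = vol b f t + vol b g t.
Proof. by move=> t01 Lf Lg; apply: RintegralD; [exact: mseg|exact: L1seg|exact: L1seg]. Qed.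

Lemma volB b t f g : 0 <= t <= 1 -> L1 f -> L1 g -> vol b (fun s => f s - g s) t = vol b f t - vol b g t.
Proof. by move=> t01 Lf Lg; apply: RintegralB; [exact: mseg|exact: L1seg|exact: L1seg]. Qed.

Lemma volZ b t c f : 0 <= t <= 1 -> L1 f -> vol b (fun s => c * f s) t = c * vol b f t.
Proof. by move=> t01 Lf; apply: RintegralZl; [exact: mseg|exact: L1seg]. Qed.

Lemma vol_le b t f g : 0 <= t <= 1 -> L1 f -> L1 g -> (forall s, seg b t s -> f s <= g s) -> vol b f t <= vol b g t.
Proof. by move=> t01 Lf Lg fg; exact: (@le_Rintegral _ _ _ mu _ _ _ (mseg b t) (L1seg b t01 Lf) (L1seg b t01 Lg) fg). Qed.

Lemma vol_abs b t f : 0 <= t <= 1 -> L1 f -> `|vol b f t| <= vol b (fun s => `|f s|) t.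
Proof. by move=> t01 Lf; exact: (@le_normr_Rintegral _ _ _ mu _ _ (mseg b t) (L1seg b t01 Lf)). Qed.

Lemma vol_eq b t f g : (forall s, seg b t s -> f s = g s) -> vol b f t = vol b g t.
Proof. by move=> fg; apply: eq_Rintegral => s /set_mem; exact: fg. Qed.

Lemma vol_full b f : vol b f (if b then 0 else 1) = Int f.
Proof. by case: b. Qed.

Lemma vol0 b f : vol b f (if b then 1 else 0) = 0.
Proof. by case: b; rewrite /vol /seg set_itv1 Rintegral_set1. Qed.

Lemma vol_split f t : 0 <= t <= 1 -> L1 f -> Int f = vol false f t + vol true f t.
Proof.
move=> t01 Lf; have /andP[t0 t1] := t01; apply/eqP; rewrite addrC -subr_eq; apply/eqP.
rewrite /Int /vol /seg -Rintegral_itv_obnd_cbnd; last first.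
  apply: (@integrableS _ _ _ mu I01 _ _ mI01 _ _ Lf) => // s; rewrite /Defs.I01/= !in_itv/= => /andP[h ->].
  by rewrite (ltW (le_lt_trans t0 h)).
by apply: Rintegral_itvB => //; rewrite bnd_simp.
Qed.

Lemma vol_ge0 b t f : (forall s, seg b t s -> 0 <= f s) -> 0 <= vol b f t.
Proof. exact: (@Rintegral_ge0 _ _ _ mu). Qed.

Lemma vol_le_Int b t f : 0 <= t <= 1 -> L1 f -> (forall s, I01 s -> 0 <= f s) -> vol b f t <= Int f.
Proof.
move=> t01 Lf f0; rewrite (vol_split t01 Lf); have h c : 0 <= vol c f t.
  by apply: vol_ge0 => s /(seg_sub t01); exact: f0.
by case: b; rewrite ?lerDl ?lerDr.
Qed.

Lemma vol_cont b f : L1 f -> cont (vol b f).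
Proof.
move=> Lf; have h : cont (vol false f) by exact: (@parameterized_integral_continuous R 0 1 f ler01 Lf).
case: b => //; have c : cont (fun t => Int f - vol false f t) by apply: contB => //; exact: cont_cst.
have e t : I01 t -> Int f - vol false f t = vol true f t.
  by move=> /I01P t01; rewrite (vol_split t01 Lf) addrC addKr.
by apply: (@subspace_eq_continuous _ _ _ (fun t => Int f - vol false f t)) => // t /set_mem/e.
Qed.

Lemma IntD f g : L1 f -> L1 g -> Int (fun t => f t + g t) = Int f + Int g.
Proof. by move=> Lf Lg; exact: (@RintegralD _ _ _ mu _ _ _ mI01 Lf Lg). Qed.

Lemma IntB f g : L1 f -> L1 g -> Int (fun t => f t - g t) = Int f - Int g.
Proof. by move=> Lf Lg; exact: (@RintegralB _ _ _ mu _ _ _ mI01 Lf Lg). Qed.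

Lemma IntZ c f : L1 f -> Int (fun t => c * f t) = c * Int f.
Proof. by move=> Lf; exact: (@RintegralZl _ _ _ mu _ _ c mI01 Lf). Qed.

Lemma Int_le f g : L1 f -> L1 g -> (forall s, I01 s -> f s <= g s) -> Int f <= Int g.
Proof. by move=> Lf Lg; exact: (@le_Rintegral _ _ _ mu _ _ _ mI01 Lf Lg). Qed.

Lemma Int_abs f : L1 f -> `|Int f| <= Int (fun t => `|f t|).
Proof. by move=> Lf; exact: (@le_normr_Rintegral _ _ _ mu _ _ mI01 Lf). Qed.

Lemma Int_ge0 f : (forall s, I01 s -> 0 <= f s) -> 0 <= Int f.
Proof. exact: (@Rintegral_ge0 _ _ _ mu). Qed.

Lemma Int_eq f g : (forall s, I01 s -> f s = g s) -> Int f = Int g.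
Proof. by move=> fg; apply: eq_Rintegral => s /set_mem; exact: fg. Qed.

Lemma Int_cst c : Int (fun=> c) = c.
Proof.
have e : mu I01 = 1%E by rewrite (lebesgue_measure_itv `[0, 1])/= lte_fin ltr01 oppr0 adde0.
have := @Rintegral_cst _ _ _ mu _ mI01 c; move=> h; apply: etrans h _.
by rewrite -[RHS]mulr1; congr (_ * _); exact: (congr1 fine e).
Qed.

Lemma Int_sum (I : Type) (r : seq I) (P : pred I) (f : I -> R -> R) :
  (forall i, P i -> L1 (f i)) -> Int (fun t => \sum_(i <- r | P i) f i t) = \sum_(i <- r | P i) Int (f i).
Proof.
move=> Lf; elim: r => [|i r IH].
  by rewrite big_nil -[RHS](Int_cst 0); congr Int; apply/funext => t; rewrite big_nil.
rewrite big_cons; under [in LHS]eq_fun do rewrite big_cons.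
case Pi: (P i) => //; rewrite IntD ?IH//; first exact: Lf.
exact: L1_sum.
Qed.

(* Variance: the integral of [(f - Int f)^2] is nonnegative. *)
Lemma Int_sqr_le f : sq f -> Int f ^+ 2 <= Int (fun t => f t ^+ 2).
Proof.
move=> sf; set m := Int f; have L := sq_L1 sf.
have : 0 <= Int (fun t => (f t ^+ 2 - (2 * m) * f t) + m ^+ 2).
  apply: Int_ge0 => t _; have -> : f t ^+ 2 - 2 * m * f t + m ^+ 2 = (f t - m) ^+ 2 by ring.
  exact: sqr_ge0.
rewrite IntD; [|by apply: L1B; [exact: sf.2|exact: L1Z]|exact: L1_cst].
rewrite IntB; [|exact: sf.2|exact: L1Z]; rewrite IntZ// Int_cst -/m; nra.
Qed.

End Integrals.

(** * Weighted sup norms and a Gronwall inequality with square integrable kernel *)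

Section Volterra.
Variable R : realType.
Notation E := (nat -> R).
Local Notation mu := (@lebesgue_measure R).
Local Notation I01 := (@I01 R).
Implicit Types f g : R -> R.

Lemma exp_integral (a b c d : R) : a <= b -> c != 0 ->
  Rintegral mu `[a, b] (fun s => expR (c * s + d)) = (expR (c * b + d) - expR (c * a + d)) / c.
Proof.
rewrite le_eqVlt => /predU1P[->|ab] c0; first by rewrite set_itv1 Rintegral_set1 subrr mul0r.
have dE (x : R) : is_derive x (1 : R) (fun s => c^-1 * expR (c * s + d)) (expR (c * x + d)).
  have h : is_derive x (1 : R) (fun s => c * s + d) c.
    by apply: is_derive_eq; rewrite /GRing.scale/= ?mulr0 ?mulr1 ?addr0 ?add0r.
  apply: is_derive_eq; rewrite /GRing.scale/= ?mulr0 ?addr0.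
  by rewrite mulrCA mulVf// mulr1.
have cE : continuous (fun s : R => expR (c * s + d)).
  move=> x; apply: (@continuous_comp _ _ _ (fun s => c * s + d) expR); last exact: continuous_expR.
  by apply: cvgD; [apply: cvgMr; exact: cvg_id|exact: cvg_cst].
have dc x : {for x, continuous (fun s => c^-1 * expR (c * s + d))}.
  by apply: cvgMr; exact: cE.
rewrite /Rintegral (@continuous_FTC2 _ _ (fun s => c^-1 * expR (c * s + d)) _ _ ab).
- by rewrite /= -mulrBr mulrC.
- exact: continuous_subspaceT.
- split; first by move=> x _; have [] := dE x.
  + by apply: cvg_at_right_filter; exact: dc.
  + by apply: cvg_at_left_filter; exact: dc.
- by move=> x _; rewrite derive1E; apply: derive_val.
Qed.

(* Volterra operators become contractions in the sup norm divided by this weight. *)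
Definition ew (b : bool) (l t : R) : R := expR (l * (if b then 1 - t else t)).

Lemma ew_ge1 b l t : 0 <= l -> 0 <= t <= 1 -> 1 <= ew b l t.
Proof.
move=> l0 /andP[t0 t1]; rewrite /ew -[leLHS]expR0 ler_expR mulr_ge0//.
by case: b; rewrite ?subr_ge0.
Qed.

Lemma ew_le b l t : 0 <= l -> 0 <= t <= 1 -> ew b l t <= expR l.
Proof.
move=> l0 /andP[t0 t1]; rewrite /ew ler_expR ler_piMr//.
by case: b => //; rewrite gerBl.
Qed.

Lemma ew_gt0 b l t : 0 < ew b l t.
Proof. exact: expR_gt0. Qed.

Lemma cont_ew b l : cont (ew b l).
Proof.
apply: continuous_subspaceT => x.
have h : {for x, continuous (fun s : R => l * (if b then 1 - s else s))}; last first.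
  exact: (continuous_comp h (@continuous_expR _ _)).
apply: cvgMr; case: b; last exact: cvg_id.
by apply: cvgB; [exact: cvg_cst|exact: cvg_id].
Qed.

Lemma ew_sqr_vol b l t : 0 < l -> 0 <= t <= 1 ->
  vol b (fun s => ew b l s ^+ 2) t <= ew b l t ^+ 2 / (2 * l).
Proof.
move=> l0 /andP[t0 t1]; have l2 : 0 < 2 * l by rewrite mulr_gt0.
have e2 s : ew b l s ^+ 2 = expR ((if b then - (2 * l) else 2 * l) * s + (if b then 2 * l else 0)).
  by rewrite /ew -expRM_natl; congr expR; case: b; rewrite -mulr_natl; ring.
rewrite /vol /seg; under eq_Rintegral do rewrite e2.
rewrite (e2 t); case: b {e2}.
  rewrite exp_integral// ?oppr_eq0 ?gt_eqF//.
  rewrite invrN mulrN -mulNr opprB; apply: ler_wpM2r; first by rewrite invr_ge0 ltW.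
  by rewrite gerBl expR_ge0.
rewrite exp_integral// ?gt_eqF//; apply: ler_wpM2r; first by rewrite invr_ge0 ltW.
by rewrite gerBl expR_ge0.
Qed.

(* [kappa (s) e(s) / e(t) <= kappa(s)^2 / (4 A) + A (e(s) / e(t))^2], whose
   integral is at most [1/4 + A / (2 lambda) = 1/2] for [lambda = 2 A]. *)
Lemma kernel_bound b (k : R -> R) A t : sq k -> 0 < A -> Int (fun s => k s ^+ 2) <= A ->
  0 <= t <= 1 -> vol b (fun s => k s * ew b (2 * A) s) t <= ew b (2 * A) t / 2.
Proof.
move=> sk A0 kA t01; set l := 2 * A; have l0 : 0 < l by rewrite mulr_gt0.
have et := ew_gt0 b l t; set c := ew b l t in et *.
have se : sq (ew b l) by apply: sq_cont; exact: cont_ew.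
have Lk := L1Z (c / (4%:R * A)) sk.2; have Le := L1Z (A / c) se.2.
apply: (@le_trans _ _ (vol b (fun s => c / (4%:R * A) * k s ^+ 2 + A / c * ew b l s ^+ 2) t)).
  apply: vol_le => //; [exact: sq_mul|exact: L1D|move=> s _].
  rewrite -subr_ge0.
  have -> : c / (4%:R * A) * k s ^+ 2 + A / c * ew b l s ^+ 2 - k s * ew b l s =
    (A / c) * (ew b l s - c * k s / (2 * A)) ^+ 2 by field; rewrite !gt_eqF.
  by rewrite mulr_ge0 ?sqr_ge0// divr_ge0 ?ltW.
rewrite volD// (volZ _ _ t01 sk.2) (volZ _ _ t01 se.2).
have h1 : vol b (fun s => k s ^+ 2) t <= A.
  by apply: le_trans kA; apply: vol_le_Int => // [|s _]; [exact: sk.2|exact: sqr_ge0].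
have h2 := ew_sqr_vol b l0 t01; rewrite -/c in h2.
have -> : c / 2 = c / (4%:R * A) * A + A / c * (c ^+ 2 / (2 * l)).
  by rewrite /l; field; rewrite !gt_eqF.
by apply: lerD; apply: ler_wpM2l => //; rewrite divr_ge0 ?ltW// mulr_gt0.
Qed.

(** With M the supremum of D divided by the weight, [kernel_bound] gives M <= C0 + M / 2; the bound
    B on D ensures that M is finite. *)
Lemma gronwall b (k : R -> R) (A : R) (D : R -> R) (C0 B : R) : sq k -> (forall s, I01 s -> 0 <= k s) -> 0 < A -> Int (fun s => k s ^+ 2) <= A ->
  measurable_fun I01 D -> (forall t, I01 t -> 0 <= D t <= B) ->
  (forall t, 0 <= t <= 1 -> D t <= C0 + vol b (fun s => k s * D s) t) ->
  forall t, 0 <= t <= 1 -> D t <= 2 * C0 * expR (2 * A).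
Proof.
move=> sk k0 A0 kA mD DB HD.
have l0 : 0 <= 2 * A by rewrite mulr_ge0// ltW.
set e := ew b (2 * A).
have e0 t : 0 < e t by exact: ew_gt0.
have C00 : 0 <= C0.
  have h : 0 <= (if b then 1 else 0 : R) <= 1 by case: b {HD e e0}; rewrite ?lexx ?ler01.
  have := HD _ h; rewrite vol0 addr0; apply: le_trans.
  by have /DB/andP[] : I01 (if b then 1 else 0) by apply/I01P.
have sD : sq D.
  have := @sq_bmul _ D (fun=> 1) B mD _ (sq_cst 1).
  have -> : (fun t => D t * 1) = D by apply/funext => t; rewrite mulr1.
  by apply => t /DB/andP[d0 dB]; rewrite ger0_norm.
have se : sq e by apply: sq_cont; exact: cont_ew.
pose X := [set D t / e t | t in I01].
have X0 : X !=set0 by exists (D 0 / e 0), 0 => //; apply/I01P; rewrite lexx ler01.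
have XB : ubound X B.
  move=> _ [t It <-]; have /DB/andP[d0 dB] := It; rewrite ler_pdivrMr//.
  have B0 := le_trans d0 dB; apply: le_trans dB _; rewrite ler_peMr//.
  by apply: ew_ge1 => //; apply/I01P.
have hs : has_sup X by split=> //; exists B.
set M := sup X.
have DM s : I01 s -> D s <= M * e s.
  by move=> Is; rewrite -ler_pdivrMr//; apply: ub_le_sup; [exists B|exists s].
have M0 : 0 <= M.
  have I0 : I01 0 by apply/I01P; rewrite lexx ler01.
  have := DM _ I0; have /DB/andP[d0 _] := I0 => /(le_trans d0).
  by rewrite pmulr_lge0.
have : M <= C0 + M / 2.
  apply: ge_sup => // _ [t It <-]; have t01 : 0 <= t <= 1 by apply/I01P.
  rewrite ler_pdivrMr//; apply: le_trans (HD _ t01) _.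
  have : vol b (fun s => k s * D s) t <= vol b (fun s => M * (k s * e s)) t.
    apply: vol_le => //; [exact: sq_mul|by apply: L1Z; exact: sq_mul|move=> s /(seg_sub t01) Is].
    by rewrite mulrCA; apply: ler_wpM2l; [exact: k0|exact: DM].
  rewrite volZ//; last exact: sq_mul.
  have := kernel_bound b sk A0 kA t01; rewrite -/e => kb h.
  have := ler_wpM2l M0 kb => h2.
  have h3 : C0 <= C0 * e t by rewrite ler_peMr//; apply: ew_ge1.
  rewrite mulrDl; lra.
move=> hM t t01; have It : I01 t by apply/I01P.
apply: le_trans (DM _ It) _; apply: ler_pM; rewrite ?(ltW (e0 t))//; first by lra.
exact: ew_le.
Qed.

End Volterra.

(** * Integral equations: stability and existence *)

Section Curves.
Variable R : realType.
Notation E := (nat -> R).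
Local Notation I01 := (@I01 R).

Lemma contP (f : R -> R) : cont f <-> forall x, I01 x -> forall e : R, 0 < e -> exists d : R, 0 < d /\
  forall y, I01 y -> `|x - y| < d -> `|f x - f y| <= e.
Proof.
rewrite /cont subspace_continuousP; split=> H x Ix.
  move=> e e0; have /cvgrPdist_le/(_ e e0) := H x Ix.
  by move=> [d d0 dP]; exists d; split=> // y Iy xy; exact: (dP y xy Iy).
apply/cvgrPdist_le => e e0; have [d [d0 dP]] := H x Ix e e0.
by exists d => // y xy Iy; exact: dP.
Qed.

Lemma geometric_cauchy (u : nat -> R) (C : R) : (forall m, `|u m.+1 - u m| <= C / 2 ^+ m) ->
  exists l, forall m, `|u m - l| <= 2 * C / 2 ^+ m.
Proof.
move=> H; have C0 : 0 <= C by have := H 0%N; rewrite expr0 divr1; apply: le_trans.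
have p2 m : 0 < 2 ^+ m :> R by rewrite exprn_gt0.
have tl m k : `|u m - u (m + k)%N| <= 2 * C / 2 ^+ m - 2 * C / 2 ^+ (m + k).
  elim: k => [|k IH]; first by rewrite addn0 !subrr normr0.
  have := H (m + k)%N; rewrite addnS exprS invfM.
  have -> : u m - u (m + k).+1 = (u m - u (m + k)%N) - (u (m + k).+1 - u (m + k)%N) by ring.
  move=> h; apply: le_trans (ler_normB _ _) _; apply: le_trans (lerD IH h) _.
  by set X := (2 ^+ (m + k))^-1; lra.
have cu : cvgn u.
  apply: cauchy_cvg; apply/cauchy_exP => e e0.
  have q01 : 0 <= (2^-1 : R) < 1 by lra.
  have [m mP] := geometric_small (2 * C) q01 (divr_gt0 e0 (ltr0Sn R 1)).
  exists (u m); exists m => // k /= mk; rewrite -ball_normE /=.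
  have := tl m (k - m)%N; rewrite subnKC// => h; apply: le_lt_trans h _.
  apply: (@le_lt_trans _ _ (e / 2)); last by lra.
  apply: le_trans mP; rewrite exprVn lerBlDr lerDl; apply: divr_ge0; rewrite ?mulr_ge0// ltW//.
exists (limn u) => m.
have nl : (fun n => `|u m - u n|) @ \oo --> `|u m - limn u|.
  by apply: cvg_norm; apply: cvgB; [exact: cvg_cst|exact: cu].
rewrite -(cvg_lim _ nl)//; apply: limr_le; first by apply/cvg_ex; exists `|u m - limn u|.
exists m => // n /= mn; have := tl m (n - m)%N; rewrite subnKC// => h; apply: le_trans h _.
by rewrite lerBlDr lerDl divr_ge0 ?mulr_ge0// ltW.
Qed.

Lemma gan_cont n (f : E -> R) (x : R -> E) : gan n f -> (forall z, f (res n z) = f z) ->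
  (forall i, (i < n)%N -> cont (fun s => x s i)) -> cont (fun s => f (x s)).
Proof.
move=> af fr cx; apply/contP => s0 Is e e0.
have /cvgrPdist_le/(_ e e0) [r /= r0 rP] := germ_cvg (af (res n (x s0))).
have hx i : exists d : R, 0 < d /\ ((i < n)%N -> forall y, I01 y -> `|s0 - y| < d -> `|x s0 i - x y i| <= r).
  case: (ltnP i n) => ni; last by exists 1.
  by have /contP/(_ _ Is r r0) [d [d0 dP]] := cx i ni; exists d.
have [d [d0 dP]] : exists d : R, 0 < d /\ forall i, (i < n)%N -> forall y, I01 y -> `|s0 - y| < d -> `|x s0 i - x y i| <= r.
  suff U m : (m <= n)%N -> exists d : R, 0 < d /\ forall i, (i < m)%N -> forall y, I01 y -> `|s0 - y| < d -> `|x s0 i - x y i| <= r by exact: U.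
  elim: m => [|m IH] mn; first by exists 1.
  have [d [d0 dP]] := IH (ltnW mn); have [d' [d'0 dP']] := hx m.
  exists (Num.min d d'); split=> [|i]; first by rewrite lt_min d0.
  rewrite ltnS leq_eqVlt => /orP[/eqP->|im] y Iy; rewrite lt_min => /andP[h1 h2]; first exact: dP'.
  exact: dP.
exists d; split=> // y Iy ys.
have := rP (fun i => res n (x y) i - res n (x s0) i).
have -> : (fun i => res n (x s0) i + (fun=> 0 : R) i) = res n (x s0) by apply/funext => i; rewrite addr0.
have -> : (fun i => res n (x s0) i + (res n (x y) i - res n (x s0) i)) = res n (x y).
  by apply/funext => i; rewrite addrC subrK.
rewrite !fr; apply=> i; rewrite /res /wt; case: ltnP => ni; last by rewrite subr0 normr0.
by rewrite distrC; exact: dP.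
Qed.

Definition solves (b : bool) (d : nat) (c : E) (g : R -> E) (y : R -> E) :=
  (forall i, (i < d)%N -> L1 (fun s => g s i)) /\
  forall t i, 0 <= t <= 1 -> (i < d)%N -> y t i = c i + vol b (fun s => g s i) t.

Lemma solves_cont b d c g (y : R -> E) : solves b d c g y -> forall i, (i < d)%N -> cont (fun s => y s i).
Proof.
move=> [Lg yE] i id; apply: (@subspace_eq_continuous _ _ _ (fun t => c i + vol b (fun s => g s i) t)).
  by move=> t /set_mem/I01P It; apply/esym/yE.
by apply: contD; [exact: cont_cst|apply: vol_cont; exact: Lg].
Qed.

Lemma cont_l1 d (y : R -> E) : (forall i, (i < d)%N -> cont (fun s => y s i)) -> cont (fun s => l1 d (y s)).
Proof. by move=> cy; apply: cont_sum => i _; apply: cont_abs; exact: cy. Qed.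

Lemma vol_sum b t (I : Type) (r : seq I) (P : pred I) (f : I -> R -> R) : 0 <= t <= 1 ->
  (forall i, P i -> L1 (f i)) -> vol b (fun t => \sum_(i <- r | P i) f i t) t = \sum_(i <- r | P i) vol b (f i) t.
Proof.
move=> t01 Lf; elim: r => [|i r IH].
  rewrite big_nil; under [X in vol b X]eq_fun do rewrite big_nil.
  by have := @volZ _ b t 0 (fun=> 0) t01 (L1_cst 0); rewrite !mul0r.
rewrite big_cons; under [X in vol b X]eq_fun do rewrite big_cons.
case Pi: (P i) => //; rewrite volD ?IH//; first exact: Lf.
exact: L1_sum.
Qed.

Lemma l1_vol b d t (g : R -> E) : 0 <= t <= 1 -> (forall i, (i < d)%N -> L1 (fun s => g s i)) ->
  l1 d (fun i => vol b (fun s => g s i) t) <= vol b (fun s => l1 d (g s)) t.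
Proof.
move=> t01 Lg; rewrite /l1 vol_sum//; last by move=> i _; apply: L1_abs; exact: Lg.
by apply: ler_sum => i _; apply: vol_abs => //; exact: Lg.
Qed.

Lemma L1_l1 d (g : R -> E) : (forall i, (i < d)%N -> L1 (fun s => g s i)) -> L1 (fun s => l1 d (g s)).
Proof. by move=> Lg; apply: L1_sum => i _; apply: L1_abs; exact: Lg. Qed.

(** The difference of the solutions satisfies the Gronwall inequality with the integrated defect as
    constant. The result depends on the kernel only through the bound A of its squared norm, hence
    is uniform over bounded sets of controls. *)
Lemma stability b d c c' (g g' y y' : R -> E) (k eta : R -> R) (A : R) :
  solves b d c g y -> solves b d c' g' y' -> sq k -> (forall s, I01 s -> 0 <= k s) -> 0 < A ->
  Int (fun s => k s ^+ 2) <= A -> L1 eta -> (forall s, I01 s -> 0 <= eta s) ->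
  (forall s, I01 s -> l1 d (fun i => g s i - g' s i) <= k s * l1 d (fun i => y s i - y' s i) + eta s) ->
  forall t, 0 <= t <= 1 -> l1 d (fun i => y t i - y' t i) <=
    2 * (l1 d (fun i => c i - c' i) + Int eta) * expR (2 * A).
Proof.
move=> sy sy' sk k0 A0 kA Le e0 H.
have cD : cont (fun t => l1 d (fun i => y t i - y' t i)).
  by apply: (@cont_l1 d (fun t i => y t i - y' t i)) => i id; apply: contB; [exact: (solves_cont sy)|exact: (solves_cont sy')].
have [B [B0 HB]] := cont_bounded cD.
have Lg i : (i < d)%N -> L1 (fun s => g s i - g' s i).
  by move=> id; apply: L1B; [exact: sy.1|exact: sy'.1].
apply: (@gronwall _ b k A _ _ B sk k0 A0 kA) => //; first exact: meas_cont.
  by move=> t /HB; rewrite ger0_norm ?l1_ge0// => ->; rewrite l1_ge0.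
move=> t t01.
have kD := sq_mul sk (sq_cont cD).
apply: (@le_trans _ _ (l1 d (fun i => c i - c' i) + l1 d (fun i => vol b (fun s => g s i - g' s i) t))).
  rewrite /l1 -big_split/=; apply: ler_sum => i _.
  rewrite (sy.2 t i t01)// (sy'.2 t i t01)// volB//; [|exact: sy.1|exact: sy'.1].
  by rewrite opprD addrACA; exact: ler_normD.
rewrite -addrA; apply: lerD => //; apply: le_trans (@l1_vol b d t (fun s i => g s i - g' s i) t01 Lg) _.
apply: (@le_trans _ _ (vol b (fun s => k s * l1 d (fun i => y s i - y' s i) + eta s) t)).
  apply: vol_le => //; [exact: (@L1_l1 d (fun s i => g s i - g' s i))|exact: L1D|].
  by move=> s /(seg_sub t01); exact: H.
by rewrite volD// addrC; apply: lerD => //; exact: vol_le_Int.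
Qed.

(** In the weighted sup norm each iteration halves the distance, on the whole interval at once,
    although the Lipschitz kernel is only square integrable. *)
Lemma picard b d (c : E) (G : R -> E -> E) (k : R -> R) (A : R) :
  sq k -> (forall s, I01 s -> 0 <= k s) -> 0 < A -> Int (fun s => k s ^+ 2) <= A ->
  (forall s y y', I01 s -> l1 d (fun i => G s y i - G s y' i) <= k s * l1 d (fun i => y i - y' i)) ->
  (forall y : R -> E, (forall i, (i < d)%N -> cont (fun s => y s i)) -> forall i, (i < d)%N -> L1 (fun s => G s (y s) i)) ->
  exists y, solves b d c (fun s => G s (y s)) y.
Proof.
move=> sk k0 A0 kA HL HI.
pose Y := fix Y (m : nat) : R -> E := if m is m'.+1 then fun t i => c i + vol b (fun s => G s (Y m' s) i) t else fun=> c.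
have cY m : forall i, (i < d)%N -> cont (fun s => Y m s i).
  elim: m => [|m IH] i id /=; first exact: cont_cst.
  by apply: contD; [exact: cont_cst|apply: vol_cont; exact: HI].
pose D m t := l1 d (fun i => Y m.+1 t i - Y m t i).
have cD m : cont (D m).
  by apply: (@cont_l1 d (fun t i => Y m.+1 t i - Y m t i)) => i id; apply: contB; exact: cY.
have [B [B0 HB]] := cont_bounded (cD 0%N).
set e := ew b (2 * A).
have l0 : 0 <= 2 * A by rewrite mulr_ge0// ltW.
have p2 m : 0 < 2 ^+ m :> R by rewrite exprn_gt0.
have De m t : 0 <= t <= 1 -> D m t <= B / 2 ^+ m * e t.
  elim: m t => [|m IH] t t01.
    rewrite expr0 divr1; have /I01P/HB := t01; rewrite ger0_norm ?l1_ge0// => h.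
    by apply: le_trans h _; rewrite ler_peMr//; exact: ew_ge1.
  have LG p i : (i < d)%N -> L1 (fun s => G s (Y p s) i) by move=> id; apply: HI => //; exact: cY.
  have LGd i : (i < d)%N -> L1 (fun s => G s (Y m.+1 s) i - G s (Y m s) i) by move=> id; apply: L1B; exact: LG.
  have se : sq e by apply: sq_cont; exact: cont_ew.
  have -> : D m.+1 t = l1 d (fun i => vol b (fun s => G s (Y m.+1 s) i - G s (Y m s) i) t).
    apply: eq_bigr => i _; rewrite volB//; [|exact: (LG m.+1)|exact: LG].
    by rewrite [Y m.+2 t i]/= [Y m.+1 t i]/=; congr `|_|; ring.
  apply: le_trans (@l1_vol b d t (fun s i => G s (Y m.+1 s) i - G s (Y m s) i) t01 LGd) _.
  apply: (@le_trans _ _ (vol b (fun s => B / 2 ^+ m * (k s * e s)) t)).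
    apply: vol_le => //; [exact: (@L1_l1 d (fun s i => G s (Y m.+1 s) i - G s (Y m s) i))|by apply: L1Z; exact: sq_mul|].
    move=> s /(seg_sub t01) Is; apply: le_trans (HL s _ _ Is) _.
    by rewrite mulrCA; apply: ler_wpM2l; [exact: k0|apply: IH; exact/I01P].
  rewrite volZ//; last exact: sq_mul.
  have Bm : 0 <= B / 2 ^+ m by rewrite divr_ge0// ltW.
  have := ler_wpM2l Bm (kernel_bound b sk A0 kA t01); rewrite -/e => h; apply: le_trans h _.
  by rewrite exprS invfM; lra.
pose C := B * expR (2 * A).
have C0 : 0 <= C by rewrite mulr_ge0// expR_ge0.
have lm t i : exists l, 0 <= t <= 1 -> (i < d)%N -> forall m, `|Y m t i - l| <= 2 * C / 2 ^+ m.
  have [[t01 id]|nt] := pselect (0 <= t <= 1 /\ (i < d)%N); last first.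
    by exists 0 => t01 id; exfalso; apply: nt.
  have [m|l hl] := @geometric_cauchy (fun m => Y m t i) C; last by exists l.
  apply: (@le_trans _ _ (D m t)); first exact: (@l1_coord _ d (fun i => Y m.+1 t i - Y m t i)).
  apply: le_trans (De m t t01) _; rewrite mulrAC /C; apply: ler_wpM2r; first by rewrite invr_ge0 ltW.
  by apply: ler_wpM2l => //; exact: ew_le.
have /choice[y {}lm] : forall t, exists y : E, 0 <= t <= 1 -> forall i, (i < d)%N -> forall m, `|Y m t i - y i| <= 2 * C / 2 ^+ m.
  by move=> t; have /choice[y hy] := lm t; exists y => t01 i id; exact: hy.
have small (e' : R) : 0 < e' -> exists m, 2 * C / 2 ^+ m <= e'.
  move=> e'0; have q01 : 0 <= (2^-1 : R) < 1 by lra.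
  by have [m mP] := geometric_small (2 * C) q01 e'0; exists m; rewrite -exprVn.
have cy i : (i < d)%N -> cont (fun s => y s i).
  move=> id; apply/contP => s0 Is e' e'0.
  have [m mP] := small (e' / 3) (divr_gt0 e'0 (ltr0Sn R 2)).
  have /contP/(_ _ Is (e' / 3) (divr_gt0 e'0 (ltr0Sn R 2))) [dl [dl0 dP]] := cY m i id.
  exists dl; split=> // s Is' ss; have h1 := dP s Is' ss.
  have /I01P h2 := Is; have /I01P h3 := Is'.
  have := lm s0 h2 i id m; have := lm s h3 i id m => h4 h5.
  have -> : y s0 i - y s i = (Y m s0 i - Y m s i) - (Y m s0 i - y s0 i) + (Y m s i - y s i) by ring.
  apply: le_trans (ler_normD _ _) _; have := ler_normB (Y m s0 i - Y m s i) (Y m s0 i - y s0 i).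
  lra.
have LG : forall i, (i < d)%N -> L1 (fun s => G s (y s) i) by apply: HI.
exists y; split=> // t i t01 id.
apply/eqP; rewrite -subr_eq0 -normr_le0; apply/ler_addgt0Pr => e' e'0; rewrite add0r.
have Ik0 : 0 <= Int k by exact: Int_ge0.
pose K := 2 * C * (1 + d%:R * Int k) + 1.
have K0 : 0 < K by rewrite /K ltr_wpDl// !mulr_ge0// ler_wpDl// mulr_ge0.
have q01 : 0 <= (2^-1 : R) < 1 by lra.
have [m mP] := geometric_small K q01 e'0.
have tE : Y m.+1 t i = c i + vol b (fun s => G s (Y m s) i) t by [].
have -> : y t i - (c i + vol b (fun s => G s (y s) i) t) =
   - (Y m.+1 t i - y t i) + (vol b (fun s => G s (Y m s) i) t - vol b (fun s => G s (y s) i) t).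
  by rewrite tE; ring.
have LGm : forall i, (i < d)%N -> L1 (fun s => G s (Y m s) i) by apply: HI; exact: cY.
rewrite -volB//; [|exact: LGm|exact: LG].
apply: le_trans (ler_normD _ _) _; rewrite normrN.
have h1 : `|Y m.+1 t i - y t i| <= 2 * C / 2 ^+ m.
  apply: le_trans (lm t t01 i id m.+1) _; apply: ler_wpM2l; first by rewrite mulr_ge0.
  by rewrite lef_pV2 ?posrE// ler_weXn2l// ler1n.
have h2 : `|vol b (fun s => G s (Y m s) i - G s (y s) i) t| <= d%:R * (2 * C / 2 ^+ m) * Int k.
  have LGd : L1 (fun s => G s (Y m s) i - G s (y s) i) by apply: L1B; [exact: LGm|exact: LG].
  apply: le_trans (vol_abs b t01 LGd) _.
  apply: le_trans (vol_le_Int b t01 (L1_abs LGd) _) _; first by move=> s _.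
  rewrite -IntZ; last exact: sq_L1.
  apply: Int_le; [exact: L1_abs|by apply: L1Z; exact: sq_L1|move=> s Is].
  apply: le_trans (@l1_coord _ d (fun i => G s (Y m s) i - G s (y s) i) i id) _.
  apply: le_trans (HL s _ _ Is) _; rewrite mulrC; apply: ler_wpM2r; first exact: k0.
  by apply: l1_le => j jd; apply: lm => //; exact/I01P.
apply: le_trans (lerD h1 h2) _; apply: le_trans mP.
rewrite exprVn /K -subr_ge0.
have -> : (2 * C * (1 + d%:R * Int k) + 1) / 2 ^+ m - (2 * C / 2 ^+ m + d%:R * (2 * C / 2 ^+ m) * Int k) = (2 ^+ m)^-1.
  by field; rewrite gt_eqF.
by rewrite invr_ge0 ltW.
Qed.

End Curves.

(** * Integration by parts through Fubini's theorem *)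

Section ProductRule.
Variable R : realType.
Notation E := (nat -> R).
Local Notation mu := (@lebesgue_measure R).
Local Notation I01 := (@I01 R).

Lemma integral_EFin_Rintegral (A : set R) (k : R -> R) : measurable A -> mu.-integrable A (EFin \o k) ->
  (\int[mu]_(x in A) (k x)%:E)%E = (Rintegral mu A k)%:E.
Proof. by move=> mA ik; rewrite /Rintegral fineK//; exact: (@integrable_fin_num _ _ _ mu _ mA _ ik). Qed.

Lemma integrable_restrict_setT (A : set R) (f : R -> R) : measurable A ->
  mu.-integrable A (EFin \o f) -> mu.-integrable setT (EFin \o (f \_ A)).
Proof.
move=> mA Lf; rewrite -restrict_EFin; apply/integrable_restrict => //.
by rewrite setTI.
Qed.

Lemma integralZ_EFin (c : R) (k : R -> R) : mu.-integrable setT (EFin \o k) ->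
  (\int[mu]_s (c * k s)%:E)%E = (c * Rintegral mu setT k)%:E.
Proof.
move=> ik; rewrite -(@RintegralZl _ _ _ mu _ _ _ measurableT ik).
by apply: integral_EFin_Rintegral => //; exact: (@integrableZl _ _ _ mu _ measurableT c _ ik).
Qed.

Lemma mem_seg_I01 b (t s : R) : I01 t ->
  (s \in seg b t) = (if b then t <= s else s <= t) && (s \in I01).
Proof.
move=> /I01P/andP[t0 t1].
have -> : (s \in I01) = (0 <= s <= 1) by apply/idP/idP => [/set_mem/I01P|h] //; apply/mem_set/I01P.
case: b; (apply/idP/idP => [/set_mem|h]; [|apply/mem_set; move: h]); rewrite /seg/= in_itv/=.
- by move=> /andP[ts ->]; rewrite ts (le_trans t0 ts).
- by move=> /and3P[-> _ ->].
- by move=> /andP[-> st]; rewrite st (le_trans st t1).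
- by move=> /and3P[-> -> _].
Qed.

(** Extending both functions by 0 outside the unit interval turns the inner Volterra integral into
    an integral over the line, as Fubini's theorem wants it. *)
Lemma iterated_vol b (g h : R -> R) (f : R -> R -> R) : L1 g -> L1 h ->
  (forall t s, f t s = if (if b then t <= s else s <= t) then (h \_ I01) t * (g \_ I01) s else 0) ->
  (\int[mu]_t \int[mu]_s (f t s)%:E)%E = (Int (fun t => h t * vol b g t))%:E.
Proof.
move=> Lg Lh fE.
have Lp : L1 (fun t => h t * vol b g t).
  have [M [M0 HM]] := cont_bounded (@vol_cont _ b _ Lg).
  apply: (L1_dom _ _ (L1Z M (L1_abs Lh))).
    by apply: measurable_funM; [exact: L1_meas|apply: meas_cont; exact: vol_cont].
  move=> t It; rewrite normrM mulrC; apply: ler_wpM2r; first exact: normr_ge0.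
  exact: HM.
rewrite /Int -(integral_EFin_Rintegral (@mI01 R) Lp) [RHS]integral_mkcond.
apply: eq_integral => t _; rewrite patchE; case: ifPn => [/set_mem It|nt]; last first.
  by apply: integral0_eq => s _; rewrite fE patchE (negbTE nt) mul0r if_same.
have /I01P t01 := It.
have ig' := integrable_restrict_setT (mseg b t) (L1seg b t01 Lg).
rewrite /vol Rintegral_mkcond; apply: etrans (integralZ_EFin (h t) ig').
apply: eq_integral => s _; congr EFin; rewrite fE !patchE mem_set// mem_seg_I01//.
by case: ifP => //= _; rewrite mulr0.
Qed.

(** Both sides integrate h(t) g(s) over the triangle t <= s. This is integration by parts for the
    primitives of g and h. *)
Lemma fubini_triangle (g h : R -> R) : L1 g -> L1 h ->
  Int (fun t => h t * vol true g t) = Int (fun s => g s * vol false h s).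
Proof.
move=> Lg Lh; set g0 := g \_ I01; set h0 := h \_ I01.
have ig : mu.-integrable setT (EFin \o g0) := integrable_restrict_setT (@mI01 R) Lg.
have ih : mu.-integrable setT (EFin \o h0) := integrable_restrict_setT (@mI01 R) Lh.
have mg : measurable_fun setT g0 by apply/measurable_EFinP; exact: measurable_int ig.
have mh : measurable_fun setT h0 by apply/measurable_EFinP; exact: measurable_int ih.
pose p (z : R * R) := h0 z.1 * g0 z.2.
pose f (z : R * R) : R := if z.1 <= z.2 then p z else 0.
have mp : measurable_fun setT p.
  by apply: measurable_funM; [exact: (measurableT_comp mh measurable_fst)|exact: (measurableT_comp mg measurable_snd)].
have mf : measurable_fun setT f.
  apply: measurable_fun_ifT => //; apply: measurable_fun_ler; [exact: measurable_fst|exact: measurable_snd].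
have iabs (k : R -> R) : mu.-integrable setT (EFin \o k) -> mu.-integrable setT (EFin \o (fun x => `|k x|)).
  by move=> ik; exact: (@integrable_abse _ _ _ mu _ _ ik).
have ip : (mu \x mu)%E.-integrable setT (EFin \o p).
  apply/integrable12ltyP; first exact/measurable_EFinP.
  set G := Rintegral mu setT (fun s => `|g0 s|).
  rewrite (_ : (\int[mu]_x _)%E = (\int[mu]_x (G * `|h0 x|)%:E)%E).
    by rewrite (integralZ_EFin G (iabs _ ih)) ltry.
  apply: eq_integral => x _ /=.
  rewrite mulrC /G; apply: etrans (integralZ_EFin `|h0 x| (iabs _ ig)).
  by apply: eq_integral => s _; rewrite /p/= normrM.
have if_ : (mu \x mu)%E.-integrable setT (EFin \o f).
  apply: le_integrable ip => //; first exact/measurable_EFinP.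
  by move=> z _ /=; rewrite lee_fin /f; case: ifP => //; rewrite normr0.
have E1 := @iterated_vol true g h (fun t s => f (t, s)) Lg Lh (fun _ _ => erefl).
have E2 : (\int[mu]_s \int[mu]_t (f (t, s))%:E)%E = (Int (fun s => g s * vol false h s))%:E.
  by apply: iterated_vol Lh Lg _ => s t; rewrite [(g \_ I01) s * _]mulrC.
exact: EFin_inj (etrans (esym E1) (etrans (Fubini if_) E2)).
Qed.

End ProductRule.

(** * Uniform first and second order bounds *)

Section Smooth.
Variable R : realType.
Notation E := (nat -> R).

(** An analytic function with its derivative and a local second-order estimate. Invariance under
    [res n] allows evaluation at states with further coordinates. *)
Definition C2 (n : nat) (f : E -> R) (Df : nat -> E -> R) : Prop :=
  [/\ gan n f, forall i, (i < n)%N -> gan n (Df i), forall z, f (res n z) = f z,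
    forall i z, Df i (res n z) = Df i z &
    forall z, exists K r : R, [/\ 0 < r, 0 <= K & forall h k, dom (wt n r) h -> dom (wt n r) k ->
    `|f (fun i => z i + h i + k i) - f (fun i => z i + h i) -
      \sum_(i < n) k i * Df i (fun i => z i + h i)| <= K * l1 n k ^+ 2]].

Lemma gan_C2 n (f : E -> R) : gan n f -> (forall z, f (res n z) = f z) -> exists Df, C2 n f Df.
Proof.
move=> af fr; have [Df [aD HD]] := gan_derive af.
exists (fun i z => Df i (res n z)); split=> //.
- by move=> i ni; apply: gan_res; exact: aD.
- by move=> i z; rewrite res_res.
move=> z; have [K [r [r0 K0 H]]] := HD (res n z); exists K, r; split=> // h k dh dk.
have s0 (w : E) : dom (wt n r) w -> forall i, (n <= i)%N -> w i = 0.
  by move=> dw i ni; apply/eqP; rewrite -normr_le0; have := dw i; rewrite /wt ltnNge ni.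
have e1 (w : E) : dom (wt n r) w -> res n (fun i => z i + w i) = (fun i => res n z i + w i).
  by move=> dw; apply/funext => i; rewrite /res; case: ltnP => // ni; rewrite (s0 w dw)// addr0.
have := H h k dh dk.
rewrite -(fr (fun i => z i + h i + k i)) -(fr (fun i => z i + h i)) e1//.
have -> : res n (fun i => z i + h i + k i) = (fun i => res n z i + h i + k i).
  apply/funext => i; rewrite /res; case: ltnP => // ni.
  by rewrite (s0 h dh)// (s0 k dk)// !addr0.
by [].
Qed.

Definition smooth (n : nat) (K rho : R) (f : E -> R) (Df : nat -> E -> R) : Prop :=
  forall z z', l1 n z <= rho -> l1 n z' <= rho ->
  [/\ `|f z| <= K, forall i, (i < n)%N -> `|Df i z| <= K,
    `|f z' - f z| <= K * l1 n (fun i => z' i - z i),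
    forall i, (i < n)%N -> `|Df i z' - Df i z| <= K * l1 n (fun i => z' i - z i) &
    `|f z' - f z - \sum_(i < n) (z' i - z i) * Df i z| <= K * l1 n (fun i => z' i - z i) ^+ 2].

Lemma smooth_le n K K' rho f Df : K <= K' -> smooth n K rho f Df -> smooth n K' rho f Df.
Proof.
move=> KK H z z' hz hz'; have [h1 h2 h3 h4 h5] := H z z' hz hz'.
have l0 := l1_ge0 n (fun i => z' i - z i).
split; [exact: le_trans h1 KK|by move=> i ni; exact: le_trans (h2 i ni) KK|..].
- by apply: le_trans h3 _; exact: ler_wpM2r.
- by move=> i ni; apply: le_trans (h4 i ni) _; exact: ler_wpM2r.
- by apply: le_trans h5 _; apply: ler_wpM2r => //; exact: sqr_ge0.
Qed.

Lemma C2_smooth n f Df rho : C2 n f Df -> exists K : R, 0 < K /\ smooth n K rho f Df.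
Proof.
move=> [af aD fr Dr HD].
have [K1 [K10 H1]] := gan_unif af aD HD rho.
have lipD d : (d <= n)%N -> exists K : R, 0 < K /\ forall i z k, (i < d)%N -> dom (wt n rho) z ->
    dom (wt n rho) (fun i => z i + k i) -> `|Df i (fun i => z i + k i) - Df i z| <= K * l1 n k.
  elim: d => [|d IH] dn; first by exists 1.
  have [K [K0 HK]] := IH (ltnW dn).
  have [DD [aDD HDD]] := gan_derive (aD d dn).
  have [K' [K'0 HK']] := gan_unif (aD d dn) aDD HDD rho.
  exists (K + K'); split; first exact: addr_gt0.
  have l0 := @l1_ge0 R n; move=> i z k; rewrite ltnS leq_eqVlt => /orP[/eqP->|id] dz dk.
    have [_ _ h _] := HK' z k dz dk; apply: le_trans h _.
    by apply: ler_wpM2r => //; rewrite lerDr ltW.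
  apply: le_trans (HK i z k id dz dk) _; apply: ler_wpM2r => //.
  by rewrite lerDl ltW.
have [K2 [K20 H2]] := lipD n (leqnn n).
exists (K1 + K2); split; first exact: addr_gt0.
have db z : l1 n z <= rho -> dom (wt n rho) (res n z).
  move=> hz i; rewrite /res /wt; case: ltnP => ni; last by rewrite normr0.
  exact: le_trans (l1_coord _ ni) hz.
move=> z z' hz hz'; set k : E := fun i => z' i - z i.
have kr : (fun i => res n z i + res n k i) = res n z'.
  by apply/funext => i; rewrite /res /k; case: ifP => // _; rewrite ?addr0// addrC subrK.
have lr : l1 n (res n k) = l1 n k.
  by apply: eq_bigr => i _; rewrite /res ltn_ord.
have dz := db z hz; have dz' := db z' hz'; rewrite -kr in dz'.
have [h1 h2 h3 h4] := H1 _ _ dz dz'; rewrite kr lr in h3 h4; rewrite (fr z) in h1; rewrite (fr z) (fr z') in h3; rewrite (fr z) (fr z') in h4.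
have l0 := l1_ge0 n k; have l20 := sqr_ge0 (l1 n k).
split.
- by apply: le_trans h1 _; rewrite lerDl ltW.
- by move=> i ni; have := h2 i ni; rewrite (Dr i z) => h; apply: le_trans h _; rewrite lerDl ltW.
- by apply: le_trans h3 _; apply: ler_wpM2r => //; rewrite lerDl ltW.
- move=> i ni; have := H2 i _ _ ni dz dz'; rewrite kr lr (Dr i z) (Dr i z') => h; apply: le_trans h _.
  by apply: ler_wpM2r => //; rewrite lerDr ltW.
- apply: (le_trans _ (le_trans h4 _)); last by apply: ler_wpM2r => //; rewrite lerDl ltW.
  rewrite le_eqVlt; apply/orP; left; apply/eqP; congr (`|_ - _|).
  by apply: eq_bigr => i _; rewrite (Dr i z) /res ltn_ord.
Qed.

Lemma C2_smooth_fam n m k (f : nat -> nat -> E -> R) (Df : nat -> nat -> nat -> E -> R) rho :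
  (forall i j, (i < m)%N -> (j < k)%N -> C2 n (f i j) (Df i j)) ->
  exists K : R, 0 < K /\ forall i j, (i < m)%N -> (j < k)%N -> smooth n K rho (f i j) (Df i j).
Proof.
move=> H.
have row i : (i < m)%N -> forall d, (d <= k)%N -> exists K : R, 0 < K /\ forall j, (j < d)%N -> smooth n K rho (f i j) (Df i j).
  move=> im; elim=> [|d IH] dk; first by exists 1.
  have [K [K0 HK]] := IH (ltnW dk); have [K' [K'0 HK']] := C2_smooth rho (H i d im dk).
  exists (K + K'); split; first exact: addr_gt0.
  move=> j; rewrite ltnS leq_eqVlt => /orP[/eqP->|jd].
    by apply: smooth_le HK'; rewrite lerDr ltW.
  by apply: smooth_le (HK j jd); rewrite lerDl ltW.
suff U d : (d <= m)%N -> exists K : R, 0 < K /\ forall i j, (i < d)%N -> (j < k)%N -> smooth n K rho (f i j) (Df i j) by exact: U.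
elim: d => [|d IH] dm; first by exists 1.
have [K [K0 HK]] := IH (ltnW dm); have [K' [K'0 HK']] := row d dm k (leqnn k).
exists (K + K'); split; first exact: addr_gt0.
move=> i j; rewrite ltnS leq_eqVlt => /orP[/eqP->|id] jk.
  by apply: smooth_le (HK' j jk); rewrite lerDr ltW.
by apply: smooth_le (HK i j id jk); rewrite lerDl ltW.
Qed.

End Smooth.

(** * Square integrable controls *)

Section Controls.
Variable R : realType.
Notation E := (nat -> R).

Definition ctrl (k : nat) (u : R -> E) : Prop := forall j, (j < k)%N -> sq (fun s => u s j).
Definition n2 (k : nat) (u : R -> E) : R := Int (fun s => \sum_(j < k) u s j ^+ 2).

Lemma ctrl_L1 k u : ctrl k u -> L1 (fun s => \sum_(j < k) u s j ^+ 2).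
Proof. by move=> cu; apply: L1_sum => j _; exact: (cu j (ltn_ord j)).2. Qed.

Lemma n2_ge0 k u : 0 <= n2 k u.
Proof. by apply: Int_ge0 => s _; apply: sumr_ge0 => j _; exact: sqr_ge0. Qed.

Lemma ctrl_sq k u : ctrl k u -> sq (fun s => l1 k (u s)).
Proof. by move=> cu; apply: sq_sum => j _; apply: sq_abs; exact: cu. Qed.

Lemma ctrlB k u v : ctrl k u -> ctrl k v -> ctrl k (fun s j => u s j - v s j).
Proof. by move=> cu cv j jk; apply: sqB; [exact: cu|exact: cv]. Qed.

Lemma sum_sqr_le k (x : E) : l1 k x ^+ 2 <= k%:R * \sum_(j < k) x j ^+ 2.
Proof.
elim: k => [|k IH]; first by rewrite /l1 !big_ord0 expr0n mulr0.
have h (y : R) m : 2 * `|y| * l1 m x <= \sum_(j < m) x j ^+ 2 + m%:R * y ^+ 2.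
  elim: m => [|m IHm]; first by rewrite /l1 !big_ord0 mulr0 mul0r addr0.
  rewrite /l1 !big_ord_recr/= -/(l1 m x) -[m.+1%:R]natr1.
  have := sqr_ge0 (`|y| - `|x m|); rewrite sqrrB !real_normK ?num_real// => h.
  have -> : 2 * `|y| * (l1 m x + `|x m|) = 2 * `|y| * l1 m x + `|y| * `|x m| *+ 2 by ring.
  rewrite mulrDl mul1r; lra.
have e1 : l1 k.+1 x = l1 k x + `|x k| by rewrite /l1 big_ord_recr.
have := h (x k) k; rewrite e1 big_ord_recr/= -[k.+1%:R]natr1 sqrrD real_normK ?num_real// mulrDl mul1r mulrDr.
have -> : l1 k x * `|x k| *+ 2 = 2 * `|x k| * l1 k x by ring.
lra.
Qed.

Lemma Int_l1_sqr k u (B : R) : ctrl k u -> n2 k u <= B ^+ 2 -> Int (fun s => l1 k (u s) ^+ 2) <= k%:R * B ^+ 2.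
Proof.
move=> cu uB; apply: (@le_trans _ _ (k%:R * n2 k u)); last exact: ler_wpM2l.
rewrite /n2 -IntZ; last exact: ctrl_L1.
apply: Int_le; [exact: (ctrl_sq cu).2|by apply: L1Z; exact: ctrl_L1|move=> s _].
exact: sum_sqr_le.
Qed.

Lemma Int_l1 k u (B : R) : ctrl k u -> 0 <= B -> n2 k u <= B ^+ 2 -> Int (fun s => l1 k (u s)) <= k%:R * B.
Proof.
move=> cu B0 uB.
have I0 : 0 <= Int (fun s => l1 k (u s)) by apply: Int_ge0 => s _; exact: l1_ge0.
have h : Int (fun s => l1 k (u s)) ^+ 2 <= (k%:R * B) ^+ 2.
  apply: le_trans (Int_sqr_le (ctrl_sq cu)) _; apply: le_trans (Int_l1_sqr cu uB) _.
  rewrite exprMn; apply: ler_wpM2r; first exact: sqr_ge0.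
  case: (k) => [|k']; first by rewrite expr0n.
  by rewrite expr2 ler_peMr// ler1n.
by rewrite ler_sqr ?nnegrE ?mulr_ge0// in h.
Qed.

End Controls.

(** * Trajectories and adjoint states *)

Section System.
Variable R : realType.
Notation E := (nat -> R).
Local Notation I01 := (@I01 R).

Lemma l1D n (x y : E) : l1 n (fun i => x i + y i) <= l1 n x + l1 n y.
Proof. by rewrite /l1 -big_split; apply: ler_sum => i _; exact: ler_normD. Qed.

Lemma l1N n (x y : E) : l1 n (fun i => x i - y i) = l1 n (fun i => y i - x i).
Proof. by apply: eq_bigr => i _; rewrite distrC. Qed.

Lemma l1_mx n k (c : nat -> nat -> R) (w : E) K : (forall i j, (i < n)%N -> (j < k)%N -> `|c i j| <= K) ->
  l1 n (fun i => \sum_(j < k) c i j * w j) <= n%:R * K * l1 k w.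
Proof.
move=> cK; rewrite -mulrA; apply: l1_le => i ni; apply: le_trans (ler_norm_sum _ _ _) _.
rewrite /l1 mulr_sumr; apply: ler_sum => j _; rewrite normrM; apply: ler_wpM2r => //.
exact: cK.
Qed.

Lemma l1_mx3 n k (c : nat -> nat -> nat -> R) (p w : E) K :
  (forall i j l, (i < n)%N -> (j < k)%N -> (l < n)%N -> `|c i j l| <= K) ->
  l1 n (fun l => \sum_(i < n) \sum_(j < k) p i * c i j l * w j) <= n%:R * K * l1 k w * l1 n p.
Proof.
move=> cK; rewrite -!mulrA; apply: l1_le => l nl; apply: le_trans (ler_norm_sum _ _ _) _.
rewrite mulrA mulrC /l1 mulr_suml; apply: ler_sum => i _.
apply: le_trans (ler_norm_sum _ _ _) _; rewrite !mulr_sumr; apply: ler_sum => j _.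
rewrite !normrM -mulrA; apply: ler_wpM2l => //; apply: ler_wpM2r => //; exact: cK.
Qed.

(** The kernel is the l1-norm of the control times a constant. The added 1 keeps the bound positive
    even for k = 0 or B = 0, as the Volterra lemmas require. *)
Lemma kap_bound k u (c B : R) : ctrl k u -> n2 k u <= B ^+ 2 ->
  Int (fun s => (c * l1 k (u s)) ^+ 2) <= c ^+ 2 * (k%:R * B ^+ 2) + 1.
Proof.
move=> cu uB; under [X in Int X]eq_fun do rewrite exprMn.
rewrite IntZ; last exact: (ctrl_sq cu).2.
apply: (@le_trans _ _ (c ^+ 2 * (k%:R * B ^+ 2))); last by rewrite lerDl.
by apply: ler_wpM2l; [exact: sqr_ge0|exact: Int_l1_sqr].
Qed.

Lemma kap_gt0 k (c B : R) : 0 < c ^+ 2 * (k%:R * B ^+ 2) + 1.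
Proof. by rewrite ltr_wpDl// mulr_ge0 ?sqr_ge0// mulr_ge0 ?sqr_ge0. Qed.

Lemma Int_const_l1 k u (c B : R) : ctrl k u -> 0 <= B -> 0 <= c -> n2 k u <= B ^+ 2 ->
  Int (fun s => c * l1 k (u s)) <= c * (k%:R * B).
Proof.
move=> cu B0 c0 uB; rewrite IntZ; last exact: sq_L1 (ctrl_sq cu).
by apply: ler_wpM2l => //; exact: Int_l1.
Qed.

Variables (n k : nat) (F : nat -> nat -> E -> R) (DF : nat -> nat -> nat -> E -> R) (x0 : E).
Variables (a : E -> R) (Da : nat -> E -> R) (beta L : R).
Hypothesis hF : forall i j, (i < n)%N -> (j < k)%N -> C2 n (F i j) (DF i j).
Hypothesis ha : C2 n a Da.
Hypothesis L0 : 0 <= L.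
Hypothesis hL : forall i j z z', (i < n)%N -> (j < k)%N -> `|F i j z - F i j z'| <= L * l1 n (fun l => z l - z' l).
Hypothesis b0 : 0 <= beta.

Definition is_traj (u x : R -> E) : Prop :=
  solves false n x0 (fun s i => \sum_(j < k) F i j (x s) * u s j) x.

(** Integral form, backward from time 1, of - p' = p DF(x) u with p(1) = beta Da(x(1)). *)
Definition is_adj (u x p : R -> E) : Prop :=
  solves true n (fun l => beta * Da l (x 1))
    (fun s l => \sum_(i < n) \sum_(j < k) p s i * DF i j l (x s) * u s j) p.

Lemma C2_cont f Df (x : R -> E) : C2 n f Df -> (forall i, (i < n)%N -> cont (fun s => x s i)) ->
  cont (fun s => f (x s)) /\ forall l, (l < n)%N -> cont (fun s => Df l (x s)).
Proof.
move=> [af aD fr Dr _] cx; split; first exact: (@gan_cont R n f).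
by move=> l ln; apply: (@gan_cont R n (Df l)) => //; exact: aD.
Qed.

Lemma traj_exists u : ctrl k u -> exists x, is_traj u x.
Proof.
move=> cu; pose B := 1 + n2 k u.
have uB : n2 k u <= B ^+ 2 by have := n2_ge0 k u; rewrite /B; nra.
apply: (@picard R false n x0 (fun s y i => \sum_(j < k) F i j y * u s j) (fun s => n%:R * L * l1 k (u s))
   _ (sqZ _ (ctrl_sq cu)) _ (kap_gt0 k (n%:R * L) B) (kap_bound _ cu uB)).
- by move=> s _; rewrite !mulr_ge0// l1_ge0.
- move=> s y y' _; rewrite -mulrA (mulrC (l1 k _)) mulrA -(mulrA _ L).
  have -> : (fun i => \sum_(j < k) F i j y * u s j - \sum_(j < k) F i j y' * u s j) =
            (fun i => \sum_(j < k) (F i j y - F i j y') * u s j).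
    by apply/funext => i; rewrite -sumrB; apply: eq_bigr => j _; rewrite mulrBl.
  by apply: (@l1_mx n k (fun i j => F i j y - F i j y')) => i j ni jk; exact: hL.
- move=> y cy i ni; apply: L1_sum => j _; apply: sq_mul; last exact: cu.
  by apply: sq_cont; exact: (C2_cont (hF ni (ltn_ord j)) cy).1.
Qed.

Lemma adj_exists u x : ctrl k u -> is_traj u x -> exists p, is_adj u x p.
Proof.
move=> cu tx; have cx := solves_cont tx.
have [rho [r0 Hr]] := cont_bounded (cont_l1 cx).
have xr s : I01 s -> l1 n (x s) <= rho by move=> Is; have := Hr s Is; rewrite ger0_norm// l1_ge0.
have [K [K0 HK]] := C2_smooth_fam rho hF.
pose B := 1 + n2 k u.
have uB : n2 k u <= B ^+ 2 by have := n2_ge0 k u; rewrite /B; nra.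
have DK s i j l : I01 s -> (i < n)%N -> (j < k)%N -> (l < n)%N -> `|DF i j l (x s)| <= K.
  by move=> Is ni jk ln; have [_ h _ _ _] := HK i j ni jk _ _ (xr s Is) (xr s Is); exact: h.
apply: (@picard R true n _ (fun s y l => \sum_(i < n) \sum_(j < k) y i * DF i j l (x s) * u s j) (fun s => n%:R * K * l1 k (u s))
   _ (sqZ _ (ctrl_sq cu)) _ (kap_gt0 k (n%:R * K) B) (kap_bound _ cu uB)).
- by move=> s _; rewrite !mulr_ge0 ?(ltW K0)// l1_ge0.
- move=> s y y' Is.
  have -> : (fun l => \sum_(i < n) \sum_(j < k) y i * DF i j l (x s) * u s j - \sum_(i < n) \sum_(j < k) y' i * DF i j l (x s) * u s j) =
            (fun l => \sum_(i < n) \sum_(j < k) (y i - y' i) * DF i j l (x s) * u s j).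
    apply/funext => l; rewrite -sumrB; apply: eq_bigr => i _; rewrite -sumrB; apply: eq_bigr => j _.
    by rewrite !mulrBl.
  by apply: (@l1_mx3 n k (fun i j l => DF i j l (x s)) (fun i => y i - y' i)) => i j l; exact: DK.
- move=> y cy l ln; apply: L1_sum => i _; apply: L1_sum => j _; apply: sq_mul; last exact: cu.
  by apply: sq_cont; apply: contM; [exact: cy|exact: (C2_cont (hF (ltn_ord i) (ltn_ord j)) cx).2].
Qed.

(** Compare with the constant curve [x0], which solves the zero equation; the defect is F(x0) u. *)
Lemma traj_bounded B : 0 <= B -> exists rho : R, 0 <= rho /\ forall u x, ctrl k u -> n2 k u <= B ^+ 2 ->
  is_traj u x -> forall t, 0 <= t <= 1 -> l1 n (x t) <= rho.
Proof.
move=> B0; pose C0 := \sum_(i < n) \sum_(j < k) `|F i j x0|.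
have C00 : 0 <= C0 by apply: sumr_ge0 => i _; apply: sumr_ge0.
pose A := (n%:R * L) ^+ 2 * (k%:R * B ^+ 2) + 1.
exists (l1 n x0 + 2 * (n%:R * C0 * (k%:R * B)) * expR (2 * A)); split.
  by rewrite addr_ge0 ?l1_ge0// mulr_ge0 ?expR_ge0// !mulr_ge0.
move=> u x cu uB tx t t01.
have sc : solves false n x0 (fun _ _ => 0) (fun _ => x0).
  split; first by move=> i _; exact: L1_cst.
  move=> s i s01 _; have := volB false s01 (L1_cst 0) (L1_cst (0 : R)); rewrite subrr => h.
  by rewrite -[LHS]addr0; congr (_ + _); rewrite -[LHS](subrr (vol false (fun=> 0) s)).
have cu1 := ctrl_sq cu.
have nC : 0 <= n%:R * C0 by rewrite mulr_ge0.
have := @stability R false n x0 x0 _ (fun _ _ => 0) x (fun=> x0) (fun s => n%:R * L * l1 k (u s)) (fun s => n%:R * C0 * l1 k (u s)) A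
  tx sc (sqZ _ cu1) _ (kap_gt0 k (n%:R * L) B) (kap_bound _ cu uB) (L1Z _ (sq_L1 cu1)) _ _ t t01.
have -> : l1 n (fun i => x0 i - x0 i) = 0 by rewrite /l1 big1// => i _; rewrite subrr normr0.
rewrite add0r => H.
have -> : l1 n (x t) = l1 n (fun i => x0 i + (x t i - x0 i)).
  by apply: eq_bigr => i _; rewrite addrC subrK.
apply: le_trans (l1D _ _ _) _; apply: lerD => //.
apply: (le_trans (H _ _ _)).
- by move=> s _; rewrite !mulr_ge0// l1_ge0.
- by move=> s _; rewrite mulr_ge0// l1_ge0.
- move=> s Is.
  have -> : (fun i => \sum_(j < k) F i j (x s) * u s j - 0) =
    (fun i => \sum_(j < k) (F i j (x s) - F i j x0) * u s j + \sum_(j < k) F i j x0 * u s j).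
    by apply/funext => i; rewrite subr0 -big_split; apply: eq_bigr => j _ /=; rewrite mulrBl subrK.
  apply: le_trans (l1D _ _ _) _; apply: lerD.
    rewrite -mulrA (mulrC (l1 k _)) mulrA -(mulrA _ L).
    by apply: (@l1_mx n k (fun i j => F i j (x s) - F i j x0)) => i j ni jk; exact: hL.
  apply: (@l1_mx n k (fun i j => F i j x0)) => i j ni jk.
  rewrite /C0 (bigD1 (Ordinal ni))//= (bigD1 (Ordinal jk))//= -addrA lerDl.
  by rewrite addr_ge0// sumr_ge0// => *; rewrite sumr_ge0.
- apply: ler_wpM2r; first exact: expR_ge0.
  by apply: ler_wpM2l => //; exact: Int_const_l1.
Qed.

End System.

(** * Lipschitz dependence on the control *)

Section Estimates.
Variable R : realType.
Notation E := (nat -> R).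
Local Notation I01 := (@I01 R).
Variables (n k : nat) (F : nat -> nat -> E -> R) (DF : nat -> nat -> nat -> E -> R) (x0 : E).
Variables (a : E -> R) (Da : nat -> E -> R) (beta L : R).
Hypothesis hF : forall i j, (i < n)%N -> (j < k)%N -> C2 n (F i j) (DF i j).
Hypothesis ha : C2 n a Da.
Hypothesis L0 : 0 <= L.
Hypothesis hL : forall i j z z', (i < n)%N -> (j < k)%N -> `|F i j z - F i j z'| <= L * l1 n (fun l => z l - z' l).
Hypothesis b0 : 0 <= beta.
Local Notation is_traj := (is_traj n k F x0).
Local Notation is_adj := (is_adj n k DF Da beta).

Lemma solves0 b m (c : E) : solves b m c (fun _ _ => 0) (fun _ => c).
Proof.
split; first by move=> i _; exact: L1_cst.
move=> s i s01 _; have h := @volB R b s (fun=> 0) (fun=> 0) s01 (L1_cst 0) (L1_cst 0).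
by rewrite subrr in h; rewrite -[LHS]addr0; congr (_ + _); rewrite -[LHS](subrr (vol b (fun=> 0) s)).
Qed.

Lemma trajectories_lipschitz B : 0 <= B -> exists rho K C : R, [/\ 0 <= rho, 0 < K, 0 <= C,
  (forall i j, (i < n)%N -> (j < k)%N -> smooth n K rho (F i j) (DF i j)) /\ smooth n K rho a Da &
  (forall u x, ctrl k u -> n2 k u <= B ^+ 2 -> is_traj u x -> forall t, 0 <= t <= 1 -> l1 n (x t) <= rho) /\
  forall u x v y e, ctrl k u -> n2 k u <= B ^+ 2 -> is_traj u x -> ctrl k v -> n2 k v <= B ^+ 2 -> is_traj v y ->
    0 <= e -> n2 k (fun s j => u s j - v s j) <= e ^+ 2 ->
    forall t, 0 <= t <= 1 -> l1 n (fun i => x t i - y t i) <= C * e].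
Proof.
move=> B0; have [rho [r0 Hr]] := traj_bounded x0 L0 hL B0.
have [K1 [K10 HK1]] := C2_smooth_fam rho hF.
have [K2 [K20 HK2]] := C2_smooth rho ha.
pose K := K1 + K2; have K0 : 0 < K by exact: addr_gt0.
have HK i j : (i < n)%N -> (j < k)%N -> smooth n K rho (F i j) (DF i j).
  by move=> ni jk; apply: smooth_le (HK1 i j ni jk); rewrite lerDl ltW.
pose A := (n%:R * L) ^+ 2 * (k%:R * B ^+ 2) + 1.
exists rho, K, (2 * (n%:R * K * k%:R) * expR (2 * A)); split=> //.
- by rewrite mulr_ge0 ?expR_ge0// !mulr_ge0// ltW.
- by split=> //; apply: smooth_le HK2; rewrite lerDr ltW.
split=> // u x v y e cu uB tx cv vB ty e0 ue t t01.
have cw := ctrlB cu cv.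
have nK : 0 <= n%:R * K by rewrite mulr_ge0// ltW.
have cu1 := ctrl_sq cu; have cw1 := ctrl_sq cw.
have := @stability R false n x0 x0 _ _ x y (fun s => n%:R * L * l1 k (u s))
  (fun s => n%:R * K * l1 k (fun j => u s j - v s j)) A
  tx ty (sqZ _ cu1) _ (kap_gt0 k (n%:R * L) B) (kap_bound _ cu uB) (L1Z _ (sq_L1 cw1)) _ _ t t01.
have -> : l1 n (fun i => x0 i - x0 i) = 0 by rewrite /l1 big1// => i _; rewrite subrr normr0.
rewrite add0r => H; apply: (le_trans (H _ _ _)).
- by move=> s _; rewrite !mulr_ge0// l1_ge0.
- by move=> s _; rewrite mulr_ge0// l1_ge0.
- move=> s Is; have /I01P s01 := Is.
  have -> : (fun i => \sum_(j < k) F i j (x s) * u s j - \sum_(j < k) F i j (y s) * v s j) =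
    (fun i => \sum_(j < k) (F i j (x s) - F i j (y s)) * u s j + \sum_(j < k) F i j (y s) * (u s j - v s j)).
    apply/funext => i; rewrite -sumrB -big_split; apply: eq_bigr => j _ /=; ring.
  apply: le_trans (l1D _ _ _) _; apply: lerD.
    rewrite -mulrA (mulrC (l1 k _)) mulrA -(mulrA _ L).
    by apply: (@l1_mx R n k (fun i j => F i j (x s) - F i j (y s))) => i j ni jk; exact: hL.
  apply: (@l1_mx R n k (fun i j => F i j (y s)) (fun j => u s j - v s j)) => i j ni jk.
  have hy := Hr v y cv vB ty s s01.
  by have [h _ _ _ _] := HK i j ni jk _ _ hy hy.
- rewrite [leRHS]mulrAC; apply: ler_wpM2r; first exact: expR_ge0.
  rewrite -(mulrA 2) -(mulrA _ k%:R); apply: ler_wpM2l => //.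
  exact: (@Int_const_l1 R k (fun s j => u s j - v s j)).
Qed.

(** The adjoint equation is linear, so comparison with 0 bounds p. The difference of two adjoint
    states is driven by the change of DF along the trajectories ([c1]), the change of the control
    ([c2]) and the change of the final value. *)
Lemma adjoint_estimates B : 0 <= B -> exists C : R, 0 < C /\ forall u x p, ctrl k u -> n2 k u <= B ^+ 2 ->
  is_traj u x -> is_adj u x p ->
  (forall t, 0 <= t <= 1 -> l1 n (x t) <= C /\ l1 n (p t) <= C) /\
  forall v y q e, ctrl k v -> n2 k v <= B ^+ 2 -> is_traj v y -> is_adj v y q ->
    0 <= e -> n2 k (fun s j => u s j - v s j) <= e ^+ 2 ->
    forall t, 0 <= t <= 1 -> l1 n (fun i => x t i - y t i) <= C * e /\ l1 n (fun i => p t i - q t i) <= C * e.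
Proof.
move=> B0; have [rho [K [Cx [r0 K0 Cx0 [HK Ka] [Hr Hx]]]]] := trajectories_lipschitz B0.
pose A := (n%:R * K) ^+ 2 * (k%:R * B ^+ 2) + 1.
have nK : 0 <= n%:R * K by rewrite mulr_ge0// ltW.
have eA : 0 <= expR (2 * A) by exact: expR_ge0.
pose P := 2 * (n%:R * (beta * K)) * expR (2 * A).
have P0 : 0 <= P by rewrite mulr_ge0// mulr_ge0// mulr_ge0// mulr_ge0// ltW.
pose c1 := n%:R * K * Cx * P; have c10 : 0 <= c1 by apply: mulr_ge0 => //; apply: mulr_ge0.
pose c2 := n%:R * K * P; have c20 : 0 <= c2 by apply: mulr_ge0.
pose C4 := 2 * (n%:R * (beta * (K * Cx)) + (c1 * (k%:R * B) + c2 * k%:R)) * expR (2 * A).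
have C40 : 0 <= C4.
  have h1 : 0 <= n%:R * (beta * (K * Cx)) by rewrite !mulr_ge0// ltW.
  have h2 : 0 <= c1 * (k%:R * B) by apply: mulr_ge0 => //; apply: mulr_ge0.
  have h3 : 0 <= c2 * k%:R by apply: mulr_ge0.
  apply: mulr_ge0 => //; apply: mulr_ge0 => //; lra.
have DK u x s i j l : ctrl k u -> n2 k u <= B ^+ 2 -> is_traj u x -> I01 s -> (i < n)%N -> (j < k)%N -> (l < n)%N -> `|DF i j l (x s)| <= K.
  move=> cu uB tx /I01P s01 ni jk ln; have h := Hr u x cu uB tx s s01.
  by have [_ h2 _ _ _] := HK i j ni jk _ _ h h; exact: h2.
have one : 0 <= (1 : R) <= 1 by rewrite ler01 lexx.
have HP u x p : ctrl k u -> n2 k u <= B ^+ 2 -> is_traj u x -> is_adj u x p -> forall t, 0 <= t <= 1 -> l1 n (p t) <= P.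
  move=> cu uB tx ap t t01; have cu1 := ctrl_sq cu.
  have := @stability R true n _ (fun=> 0) _ (fun _ _ => 0) p (fun _ _ => 0) (fun s => n%:R * K * l1 k (u s)) (fun=> 0) A
    ap (solves0 true n (fun=> 0)) (sqZ _ cu1) _ (kap_gt0 k (n%:R * K) B) (kap_bound _ cu uB) (L1_cst 0) (fun _ _ => lexx 0) _ t t01.
  have s0 (w : E) : l1 n (fun i => w i - 0) = l1 n w by apply: eq_bigr => i _; rewrite subr0.
  rewrite s0 s0 Int_cst addr0 => H; apply: (le_trans (H _ _)).
  - by move=> s _; rewrite mulr_ge0// l1_ge0.
  - move=> s Is; rewrite s0 s0 addr0.
    by apply: (@l1_mx3 R n k (fun i j l => DF i j l (x s))) => i j l; exact: (DK u x).
  - apply: ler_wpM2r => //; apply: ler_wpM2l => //; apply: l1_le => l ln.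
    rewrite normrM ger0_norm//; apply: ler_wpM2l => //.
    by have h := Hr u x cu uB tx 1 one; have [_ h2 _ _ _] := Ka _ _ h h; exact: h2.
exists (rho + P + Cx + C4 + 1); split; first by rewrite ltr_wpDl// !addr_ge0.
move=> u x p cu uB tx ap; split.
  move=> t t01; have h1 := Hr u x cu uB tx t t01; have h2 := HP u x p cu uB tx ap t t01.
  by split; [apply: le_trans h1 _|apply: le_trans h2 _]; lra.
move=> v y q e cv vB ty aq e0 ue t t01.
have Hxy s : 0 <= s <= 1 -> l1 n (fun i => x s i - y s i) <= Cx * e by exact: (Hx u x v y e).
split.
  by apply: le_trans (Hxy t t01) _; apply: ler_wpM2r => //; lra.
have cu1 := ctrl_sq cu; have cw := ctrlB cu cv; have cw1 := ctrl_sq cw.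
have le1 : L1 (fun s => c1 * e * l1 k (u s)) by exact: L1Z (sq_L1 cu1).
have le2 : L1 (fun s => c2 * l1 k (fun j => u s j - v s j)) by exact: L1Z (sq_L1 cw1).
have := @stability R true n _ _ _ _ p q (fun s => n%:R * K * l1 k (u s))
  (fun s => c1 * e * l1 k (u s) + c2 * l1 k (fun j => u s j - v s j)) A
  ap aq (sqZ _ cu1) _ (kap_gt0 k (n%:R * K) B) (kap_bound _ cu uB) (L1D le1 le2) _ _ t t01.
move=> H; apply: (le_trans (H _ _ _)).
- by move=> s _; rewrite mulr_ge0// l1_ge0.
- by move=> s _; apply: addr_ge0; apply: mulr_ge0; rewrite ?l1_ge0//; apply: mulr_ge0.
- move=> s Is; have /I01P s01 := Is.
  have -> : (fun l => \sum_(i < n) \sum_(j < k) p s i * DF i j l (x s) * u s j -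
                      \sum_(i < n) \sum_(j < k) q s i * DF i j l (y s) * v s j) =
    (fun l => \sum_(i < n) \sum_(j < k) (p s i - q s i) * DF i j l (x s) * u s j +
       (\sum_(i < n) \sum_(j < k) q s i * (DF i j l (x s) - DF i j l (y s)) * u s j +
        \sum_(i < n) \sum_(j < k) q s i * DF i j l (y s) * (u s j - v s j))).
    apply/funext => l; rewrite -sumrB -!big_split; apply: eq_bigr => i _ /=.
    by rewrite -sumrB -!big_split; apply: eq_bigr => j _ /=; ring.
  have qP := HP v y q cv vB ty aq s s01.
  have lu0 := l1_ge0 k (u s); have lw0 := l1_ge0 k (fun j => u s j - v s j).
  apply: le_trans (l1D _ _ _) _; apply: lerD.
    by apply: (@l1_mx3 R n k (fun i j l => DF i j l (x s)) (fun i => p s i - q s i)) => i j l; exact: (DK u x).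
  apply: le_trans (l1D _ _ _) _; apply: lerD.
    apply: (@le_trans _ _ (n%:R * (K * (Cx * e)) * l1 k (u s) * l1 n (q s))).
      apply: (@l1_mx3 R n k (fun i j l => DF i j l (x s) - DF i j l (y s)) (q s)) => i j l ni jk ln.
      have hx := Hr u x cu uB tx s s01; have hy := Hr v y cv vB ty s s01.
      have [_ _ _ h _] := HK i j ni jk _ _ hy hx; apply: le_trans (h l ln) _.
      by apply: ler_wpM2l; [exact: ltW|exact: Hxy].
    have -> : c1 * e * l1 k (u s) = n%:R * (K * (Cx * e)) * l1 k (u s) * P by rewrite /c1; ring.
    by apply: ler_wpM2l => //; rewrite !mulr_ge0// ltW.
  apply: (@le_trans _ _ (n%:R * K * l1 k (fun j => u s j - v s j) * l1 n (q s))).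
    by apply: (@l1_mx3 R n k (fun i j l => DF i j l (y s)) (q s) (fun j => u s j - v s j)) => i j l; exact: (DK v y).
  have -> : c2 * l1 k (fun j => u s j - v s j) = n%:R * K * l1 k (fun j => u s j - v s j) * P by rewrite /c2; ring.
  by apply: ler_wpM2l => //; rewrite !mulr_ge0// ltW.
- apply: (@le_trans _ _ (C4 * e)); last by apply: ler_wpM2r => //; lra.
  have -> : C4 * e = 2 * ((n%:R * (beta * (K * Cx)) + (c1 * (k%:R * B) + c2 * k%:R)) * e) * expR (2 * A) by rewrite /C4; ring.
  apply: ler_wpM2r => //; apply: ler_wpM2l => //.
  rewrite IntD// mulrDl; apply: lerD.
    rewrite -mulrA; apply: l1_le => l ln; rewrite -mulrBr normrM ger0_norm// -!mulrA; apply: ler_wpM2l => //.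
    have hx := Hr u x cu uB tx 1 one; have hy := Hr v y cv vB ty 1 one.
    have [_ _ _ h _] := Ka _ _ hy hx; apply: le_trans (h l ln) _.
    by apply: ler_wpM2l; [exact: ltW|exact: Hxy].
  rewrite mulrDl; apply: lerD.
    apply: le_trans (Int_const_l1 cu B0 _ uB) _; first by rewrite mulr_ge0.
    by rewrite mulrAC.
  by rewrite -mulrA; exact: (@Int_const_l1 R k (fun s j => u s j - v s j)).
Qed.

End Estimates.

(** * The gradient of the cost and the second-order expansion *)

Section SecondOrder.
Variable R : realType.
Notation E := (nat -> R).
Variables (n k : nat) (F : nat -> nat -> E -> R) (DF : nat -> nat -> nat -> E -> R) (x0 : E).
Variables (a : E -> R) (Da : nat -> E -> R) (beta L : R).
Hypothesis hF : forall i j, (i < n)%N -> (j < k)%N -> C2 n (F i j) (DF i j).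
Hypothesis ha : C2 n a Da.
Hypothesis L0 : 0 <= L.
Hypothesis hL : forall i j z z', (i < n)%N -> (j < k)%N -> `|F i j z - F i j z'| <= L * l1 n (fun l => z l - z' l).
Hypothesis b0 : 0 <= beta.
Local Notation is_traj := (is_traj n k F x0).
Local Notation is_adj := (is_adj n k DF Da beta).

(** The Riesz representative in L2 of the differential of the cost; [cost_differentiable] confirms
    it. *)
Definition grad (u x p : R -> E) : R -> E := fun s j => u s j + \sum_(i < n) p s i * F i j (x s).

Lemma L1_cmul (f g : R -> R) : cont f -> L1 g -> L1 (fun s => f s * g s).
Proof.
move=> cf Lg; have [M [M0 HM]] := cont_bounded cf.
apply: (L1_dom _ _ (L1Z M (L1_abs Lg))).
  by apply: measurable_funM; [exact: meas_cont|exact: L1_meas].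
by move=> t It; rewrite normrM; apply: ler_wpM2r => //; exact: HM.
Qed.

Lemma grad_ctrl u x p : ctrl k u -> is_traj u x -> is_adj u x p -> ctrl k (grad u x p).
Proof.
move=> cu tx ap j jk; apply: sqD; first exact: cu.
apply: sq_cont; apply: cont_sum => i _; apply: contM; first exact: (solves_cont ap).
by have [] := @C2_cont R n _ _ x (hF (ltn_ord i) jk) (solves_cont tx).
Qed.

(** Pairing the adjoint state with y - x and integrating by parts trades the linearised final cost
    for an integral. After subtraction of the gradient term, everything left is quadratic in the
    difference of the controls. *)
Lemma second_order B : 0 <= B -> exists C : R, 0 < C /\ forall u x p v y e,
  ctrl k u -> n2 k u <= B ^+ 2 -> is_traj u x -> is_adj u x p ->
  ctrl k v -> n2 k v <= B ^+ 2 -> is_traj v y -> 0 <= e -> n2 k (fun s j => v s j - u s j) <= e ^+ 2 ->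
  `|(2^-1 * n2 k v + beta * a (y 1)) - (2^-1 * n2 k u + beta * a (x 1))
    - Int (fun s => \sum_(j < k) grad u x p s j * (v s j - u s j))| <= C * e ^+ 2.
Proof.
move=> B0; have [C0 [C00 H0]] := adjoint_estimates x0 hF ha L0 hL b0 B0.
have [K1 [K10 HK1]] := C2_smooth_fam C0 hF.
have [K2 [K20 HK2]] := C2_smooth C0 ha.
pose c1 := C0 * K1 * C0 ^+ 2; pose c2 := C0 * K1 * C0.
have c10 : 0 < c1 by rewrite mulr_gt0 ?exprn_gt0 ?mulr_gt0.
have c20 : 0 < c2 by rewrite mulr_gt0 ?mulr_gt0.
pose C := 2^-1 + beta * (K2 * C0 ^+ 2) + (c1 * (k%:R * B) + c2 * k%:R) + 1.
have h1 : 0 <= beta * (K2 * C0 ^+ 2) by rewrite mulr_ge0// mulr_ge0 ?exprn_ge0 ?ltW.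
have kB : 0 <= k%:R * B by rewrite mulr_ge0.
have h2 : 0 <= c1 * (k%:R * B) := mulr_ge0 (ltW c10) kB.
have h3 : 0 <= c2 * k%:R := mulr_ge0 (ltW c20) (ler0n R k).
exists C; split; first by rewrite /C; lra.
move=> u x p v y e cu uB tx ap cv vB ty e0 ve.
have one : 0 <= (1 : R) <= 1 by rewrite ler01 lexx.
have cw := ctrlB cv cu; have [q aq] := adj_exists Da beta hF cv ty.
have uv : n2 k (fun s j => u s j - v s j) <= e ^+ 2.
  apply: le_trans ve; rewrite le_eqVlt; apply/orP; left; apply/eqP; congr Int; apply/funext => s.
  by apply: eq_bigr => j _; rewrite -sqrrN opprB.
have [bx bd] := H0 u x p cu uB tx ap.
have [by_ _] := H0 v y q cv vB ty aq.
have dxy s : 0 <= s <= 1 -> l1 n (fun i => y s i - x s i) <= C0 * e.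
  by move=> s01; rewrite l1N; have [] := bd v y q e cv vB ty aq e0 uv s s01.
pose h s l := \sum_(j < k) F l j (y s) * v s j - \sum_(j < k) F l j (x s) * u s j.
pose g s l := \sum_(i < n) \sum_(j < k) p s i * DF i j l (x s) * u s j.
pose d s l := y s l - x s l.
have Lh l : (l < n)%N -> L1 (fun s => h s l) by move=> ln; apply: L1B; [exact: ty.1|exact: tx.1].
have Lg l : (l < n)%N -> L1 (fun s => g s l) by move=> ln; exact: ap.1.
have cp l : (l < n)%N -> cont (fun s => p s l) by exact: (solves_cont ap).
have cd l : (l < n)%N -> cont (fun s => d s l) by move=> ln; apply: contB; [exact: (solves_cont ty)|exact: (solves_cont tx)].
have dE s l : 0 <= s <= 1 -> (l < n)%N -> d s l = vol false (fun s => h s l) s.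
  move=> s01 ln; rewrite /d (ty.2 s l s01 ln) (tx.2 s l s01 ln) /h volB//; [|exact: ty.1|exact: tx.1].
  by rewrite opprD addrACA subrr add0r.
have Lph l : (l < n)%N -> L1 (fun s => p s l * h s l - g s l * d s l).
  move=> ln; apply: L1B; first by apply: L1_cmul; [exact: cp|exact: Lh].
  by under eq_fun do rewrite mulrC; apply: L1_cmul; [exact: cd|exact: Lg].
(* The integral of d/ds (p_l d_l), written with the Volterra form of p and of d = y - x;
   [fubini_triangle] cancels the double integrals. *)
have key l : (l < n)%N -> Int (fun s => p s l * h s l - g s l * d s l) = beta * Da l (x 1) * d 1 l.
  move=> ln.
  have L2 : L1 (fun s => h s l * vol true (fun s => g s l) s).
    by under eq_fun do rewrite mulrC; apply: L1_cmul; [apply: vol_cont; exact: Lg|exact: Lh].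
  have L3 : L1 (fun s => g s l * vol false (fun s => h s l) s).
    by under eq_fun do rewrite mulrC; apply: L1_cmul; [apply: vol_cont; exact: Lh|exact: Lg].
  rewrite (@Int_eq _ _ (fun s => (beta * Da l (x 1) * h s l + h s l * vol true (fun s => g s l) s) -
     g s l * vol false (fun s => h s l) s)); last first.
    move=> s /I01P s01; rewrite (ap.2 s l s01 ln) (dE s l s01 ln) -/(g _ l); congr (_ - _).
    by rewrite mulrDl; congr (_ + _); rewrite mulrC.
  rewrite IntB//; last by apply: L1D => //; apply: L1Z; exact: Lh.
  rewrite IntD//; last by apply: L1Z; exact: Lh.
  rewrite IntZ; last exact: Lh.
  rewrite (fubini_triangle (Lg l ln) (Lh l ln)) addrK (dE 1 l one ln).
  by rewrite -(vol_full false).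
have Lsum : L1 (fun s => \sum_(l < n) (p s l * h s l - g s l * d s l)).
  by apply: L1_sum => l _; exact: Lph.
have cg := grad_ctrl cu tx ap.
have Lgw : L1 (fun s => \sum_(j < k) grad u x p s j * (v s j - u s j)).
  by apply: L1_sum => j _; apply: sq_mul; [exact: cg|exact: cw].
have Lv := ctrl_L1 cv; have Lu := ctrl_L1 cu.
(* The integrand of the remainder, apart from the Taylor remainder of the final cost. *)
pose T s := 2^-1 * \sum_(j < k) v s j ^+ 2 - 2^-1 * \sum_(j < k) u s j ^+ 2 +
  \sum_(l < n) (p s l * h s l - g s l * d s l) - \sum_(j < k) grad u x p s j * (v s j - u s j).
have Lvu : L1 (fun s => 2^-1 * \sum_(j < k) v s j ^+ 2 - 2^-1 * \sum_(j < k) u s j ^+ 2).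
  by apply: L1B; apply: L1Z.
have LT : L1 T by apply: L1B => //; apply: L1D.
have IT : Int T = 2^-1 * n2 k v - 2^-1 * n2 k u + beta * \sum_(l < n) (y 1 l - x 1 l) * Da l (x 1)
    - Int (fun s => \sum_(j < k) grad u x p s j * (v s j - u s j)).
  rewrite IntB//; last exact: L1D.
  have IS : Int (fun s => \sum_(l < n) (p s l * h s l - g s l * d s l)) = \sum_(l < n) Int (fun s => p s l * h s l - g s l * d s l).
    by apply: Int_sum => l _; exact: Lph.
  rewrite IntD// IntB; [|exact: L1Z|exact: L1Z]; rewrite !IntZ// IS.
  congr (_ + _ - _); rewrite mulr_sumr; apply: eq_bigr => l _; rewrite key// /d; ring.
have -> : 2^-1 * n2 k v + beta * a (y 1) - (2^-1 * n2 k u + beta * a (x 1)) -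
    Int (fun s => \sum_(j < k) grad u x p s j * (v s j - u s j)) =
    beta * (a (y 1) - a (x 1) - \sum_(l < n) (y 1 l - x 1 l) * Da l (x 1)) + Int T.
  by rewrite IT; ring.
apply: le_trans (ler_normD _ _) _.
have -> : C * e ^+ 2 = beta * (K2 * (C0 * e) ^+ 2) + (2^-1 * e ^+ 2 + (c1 * e ^+ 2 * (k%:R * B) + c2 * e * (k%:R * e)) + e ^+ 2).
  by rewrite /C; ring.
apply: lerD.
  rewrite normrM ger0_norm//; apply: ler_wpM2l => //.
  have [_ _ _ _ hh] := HK2 _ _ (bx 1 one).1 (by_ 1 one).1; apply: le_trans hh _.
  apply: ler_wpM2l; first exact: ltW.
  by apply: lerXn2r; rewrite ?nnegrE ?l1_ge0 ?mulr_ge0 ?(ltW C00)//; exact: dxy.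
have cw1 := ctrl_sq cw; have cu1 := ctrl_sq cu.
have Lb1 : L1 (fun s => 2^-1 * \sum_(j < k) (v s j - u s j) ^+ 2) by apply: L1Z; exact: (ctrl_L1 cw).
have Lb2 : L1 (fun s => c1 * e ^+ 2 * l1 k (u s)) by apply: L1Z; exact: sq_L1.
have Lb3 : L1 (fun s => c2 * e * l1 k (fun j => v s j - u s j)) by apply: L1Z; exact: (sq_L1 cw1).
apply: (@le_trans _ _ (Int (fun s => 2^-1 * \sum_(j < k) (v s j - u s j) ^+ 2 +
   (c1 * e ^+ 2 * l1 k (u s) + c2 * e * l1 k (fun j => v s j - u s j))))); last first.
  apply: (@le_trans _ _ (2^-1 * e ^+ 2 + (c1 * e ^+ 2 * (k%:R * B) + c2 * e * (k%:R * e)))); last first.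
    by rewrite lerDl sqr_ge0.
  rewrite IntD//; last exact: L1D.
  apply: lerD; first by rewrite IntZ; [exact: ler_wpM2l|exact: (ctrl_L1 cw)].
  rewrite IntD//; apply: lerD; apply: Int_const_l1 => //.
    exact: mulr_ge0 (ltW c10) (sqr_ge0 e).
  exact: mulr_ge0 (ltW c20) e0.
apply: le_trans (Int_abs LT) _; apply: Int_le; [exact: L1_abs|by apply: L1D => //; exact: L1D|].
move=> s Is; have /I01P s01 := Is.
pose r i j := F i j (y s) - F i j (x s) - \sum_(l < n) (y s l - x s l) * DF i j l (x s).
have gd : \sum_(l < n) g s l * d s l = \sum_(i < n) \sum_(j < k) p s i * (\sum_(l < n) (y s l - x s l) * DF i j l (x s)) * u s j.
  rewrite /g /d; under eq_bigr do rewrite mulr_suml; rewrite exchange_big; apply: eq_bigr => i _.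
  under eq_bigr do rewrite mulr_suml; rewrite exchange_big; apply: eq_bigr => j _.
  by rewrite mulr_sumr mulr_suml; apply: eq_bigr => l _; ring.
have ph : \sum_(l < n) p s l * h s l = \sum_(i < n) \sum_(j < k) p s i * (F i j (y s) * v s j - F i j (x s) * u s j).
  by apply: eq_bigr => i _; rewrite /h -sumrB mulr_sumr.
have gw : \sum_(j < k) grad u x p s j * (v s j - u s j) = \sum_(j < k) u s j * (v s j - u s j) +
    \sum_(i < n) \sum_(j < k) p s i * F i j (x s) * (v s j - u s j).
  rewrite [X in _ + X]exchange_big -big_split; apply: eq_bigr => j _ /=.
  by rewrite /grad mulrDl mulr_suml.
(* Three quadratic terms: the square of v - u, the Taylor remainder of F against u, and the product
   of the differences of F and of the controls. *)
have -> : T s = 2^-1 * \sum_(j < k) (v s j - u s j) ^+ 2 +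
   (\sum_(i < n) \sum_(j < k) p s i * r i j * u s j +
    \sum_(i < n) \sum_(j < k) p s i * (F i j (y s) - F i j (x s)) * (v s j - u s j)).
  rewrite /T sumrB gd ph gw.
  rewrite -mulrBr -sumrB opprD addrACA; congr (_ + _).
    by rewrite !mulr_sumr -sumrB; apply: eq_bigr => j _; field.
  rewrite -big_split -!sumrB; apply: eq_bigr => i _ /=.
  by rewrite -big_split -!sumrB; apply: eq_bigr => j _ /=; rewrite /r; ring.
have S0 : 0 <= 2^-1 * \sum_(j < k) (v s j - u s j) ^+ 2.
  by rewrite mulr_ge0// sumr_ge0// => j _; exact: sqr_ge0.
apply: le_trans (ler_normD _ _) _; rewrite ger0_norm//; apply: lerD => //.
have dbl (c : nat -> nat -> R) (w : E) M : 0 <= M -> (forall i j, (i < n)%N -> (j < k)%N -> `|c i j| <= M) ->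
    `|\sum_(i < n) \sum_(j < k) p s i * c i j * w j| <= C0 * M * l1 k w.
  move=> M0 cM; have [_ ps] := bx s s01.
  apply: (@le_trans _ _ (l1 n (p s) * M * l1 k w)); last first.
    by apply: ler_wpM2r; [exact: l1_ge0|exact: ler_wpM2r].
  apply: le_trans (ler_norm_sum _ _ _) _; rewrite {1}/l1 !mulr_suml; apply: ler_sum => i _.
  apply: le_trans (ler_norm_sum _ _ _) _; rewrite /l1 mulr_sumr; apply: ler_sum => j _.
  rewrite !normrM; apply: ler_wpM2r => //; apply: ler_wpM2l => //; exact: cM.
apply: le_trans (ler_normD _ _) _; apply: lerD.
  have -> : c1 * e ^+ 2 = C0 * (K1 * (C0 * e) ^+ 2) by rewrite /c1; ring.
  apply: dbl => [|i j ni jk]; first by rewrite mulr_ge0 ?sqr_ge0 ?(ltW K10).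
  have [_ _ _ _ hh] := HK1 i j ni jk _ _ (bx s s01).1 (by_ s s01).1; apply: le_trans hh _.
  apply: ler_wpM2l; first exact: ltW.
  by apply: lerXn2r; rewrite ?nnegrE ?l1_ge0 ?mulr_ge0 ?(ltW C00)//; exact: dxy.
have -> : c2 * e = C0 * (K1 * (C0 * e)) by rewrite /c2; ring.
apply: (dbl (fun i j => F i j (y s) - F i j (x s)) (fun j => v s j - u s j)) => [|i j ni jk]; first by rewrite mulr_ge0 ?mulr_ge0 ?(ltW K10) ?(ltW C00).
have [_ _ hh _ _] := HK1 i j ni jk _ _ (bx s s01).1 (by_ s s01).1; apply: le_trans hh _.
by apply: ler_wpM2l; [exact: ltW|exact: dxy].
Qed.

Lemma gradient_lipschitz B : 0 <= B -> exists C : R, 0 < C /\ forall u x p v y q e,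
  ctrl k u -> n2 k u <= B ^+ 2 -> is_traj u x -> is_adj u x p ->
  ctrl k v -> n2 k v <= B ^+ 2 -> is_traj v y -> is_adj v y q ->
  0 <= e -> n2 k (fun s j => u s j - v s j) <= e ^+ 2 ->
  n2 k (fun s j => grad u x p s j - grad v y q s j) <= (C * e) ^+ 2.
Proof.
move=> B0; have [C0 [C00 H0]] := adjoint_estimates x0 hF ha L0 hL b0 B0.
have [K [K0 HK]] := C2_smooth_fam C0 hF.
pose c := K * C0 + C0 * (K * C0).
have c0 : 0 <= c by rewrite /c addr_ge0 ?mulr_ge0 ?(ltW K0) ?(ltW C00).
have kc : 0 <= k%:R * c ^+ 2 := mulr_ge0 (ler0n R k) (sqr_ge0 c).
(* From (d + r)^2 <= 2 d^2 + 2 r^2 with |r| <= c e; the constant exceeds 1 and is therefore below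
   its own square. *)
exists (2 + 2 * (k%:R * c ^+ 2)); split; first lra.
move=> u x p v y q e cu uB tx ap cv vB ty aq e0 ue.
have [bx bd] := H0 u x p cu uB tx ap; have [by_ _] := H0 v y q cv vB ty aq.
have cw := ctrlB cu cv.
have cg := ctrlB (grad_ctrl cu tx ap) (grad_ctrl cv ty aq).
have Lw := ctrl_L1 cw.
apply: (@le_trans _ _ (Int (fun s => 2 * \sum_(j < k) (u s j - v s j) ^+ 2 + 2 * (k%:R * c ^+ 2) * e ^+ 2))); last first.
  rewrite IntD; [|exact: L1Z|exact: L1_cst]; rewrite IntZ// Int_cst.
  apply: (@le_trans _ _ (2 * e ^+ 2 + 2 * (k%:R * c ^+ 2) * e ^+ 2)).
    by rewrite lerD2r; exact: ler_wpM2l.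
  rewrite -mulrDl exprMn; apply: ler_wpM2r; first exact: sqr_ge0.
  by rewrite expr2 ler_peMr//; lra.
apply: Int_le; [exact: (ctrl_L1 cg)|apply: L1D; [exact: L1Z|exact: L1_cst]|].
move=> s /I01P s01.
have rj (j : 'I_k) : `|\sum_(i < n) p s i * F i j (x s) - \sum_(i < n) q s i * F i j (y s)| <= c * e.
  rewrite -sumrB (eq_bigr (fun i : 'I_n => (p s i - q s i) * F i j (x s) + q s i * (F i j (x s) - F i j (y s)))); last by move=> i _; ring.
  rewrite big_split /=; apply: le_trans (ler_normD _ _) _.
  have [dx dp] := bd v y q e cv vB ty aq e0 ue s s01.
  rewrite /c mulrDl; apply: lerD.
    apply: (@le_trans _ _ (l1 n (fun i => p s i - q s i) * K)).
      apply: le_trans (ler_norm_sum _ _ _) _; rewrite /l1 mulr_suml; apply: ler_sum => i _.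
      rewrite normrM; apply: ler_wpM2l => //.
      by have [h _ _ _ _] := HK i j (ltn_ord i) (ltn_ord j) _ _ (bx s s01).1 (bx s s01).1.
    by rewrite mulrC -mulrA; apply: ler_wpM2l => //; exact: ltW.
  apply: (@le_trans _ _ (l1 n (q s) * (K * (C0 * e)))).
    apply: le_trans (ler_norm_sum _ _ _) _; rewrite /l1 mulr_suml; apply: ler_sum => i _.
    rewrite normrM; apply: ler_wpM2l => //.
    have [_ _ h _ _] := HK i j (ltn_ord i) (ltn_ord j) _ _ (by_ s s01).1 (bx s s01).1.
    by apply: le_trans h _; apply: ler_wpM2l => //; exact: ltW.
  rewrite -(mulrA C0) -(mulrA K); apply: ler_wpM2r; last exact: (by_ s s01).2.
  by rewrite mulr_ge0 ?mulr_ge0 ?(ltW K0) ?(ltW C00).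
have -> : 2 * (k%:R * c ^+ 2) * e ^+ 2 = \sum_(j < k) 2 * (c * e) ^+ 2.
  by rewrite sumr_const card_ord -mulr_natl exprMn; ring.
rewrite mulr_sumr -big_split; apply: ler_sum => j _ /=.
have := rj j; set r := \sum_(i < n) _ - _ => hr.
have -> : grad u x p s j - grad v y q s j = (u s j - v s j) + r by rewrite /grad /r; ring.
have r2 : r ^+ 2 <= (c * e) ^+ 2.
  by rewrite -(real_normK (num_real r)); apply: lerXn2r; rewrite ?nnegrE ?mulr_ge0.
by have := sqr_ge0 ((u s j - v s j) - r); nra.
Qed.

End SecondOrder.

(** * Analytic dependence on the initial value *)

Section Flow.
Variable R : realType.
Notation E := (nat -> R).

Lemma vol_is_derive (phi : R -> R) (s : R) : cont phi -> 0 < s < 1 -> is_derive s (1 : R) (vol false phi) (phi s).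
Proof.
move=> cphi /andP[s0 s1].
have [|d1 d2] := @continuous_FTC1_closed R phi 0 s 1 s1 (L1_cont cphi) s0.
  by have /(continuous_within_itvP _ ltr01)[h _ _] := cphi; apply: h; rewrite in_itv/= s0 s1.
by apply: DeriveDef; [exact: d1|rewrite -derive1E; exact: d2].
Qed.

Lemma wcontD (A : set R) (f g : R -> R) : {within A, continuous f} -> {within A, continuous g} ->
  {within A, continuous (fun s => f s + g s)}.
Proof. by move=> cf cg x; apply: continuousD; [exact: cf|exact: cg]. Qed.

Lemma wcontB (A : set R) (f g : R -> R) : {within A, continuous f} -> {within A, continuous g} ->
  {within A, continuous (fun s => f s - g s)}.
Proof. by move=> cf cg x; apply: continuousB; [exact: cf|exact: cg]. Qed.

(** At a maximum of the l1-distance the mean value theorem bounds the distance by half of itself.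
    This identifies solutions of the integral equation with the power series flow on short
    intervals. *)
Lemma local_unique m (f : nat -> E -> R) (W V : R -> E) (K t t' : R) : t <= t' -> 0 <= K ->
  (forall i, (i < m)%N -> {within `[t, t'], continuous (fun s => W s i)}) ->
  (forall i, (i < m)%N -> {within `[t, t'], continuous (fun s => V s i)}) ->
  (forall s i, t < s < t' -> (i < m)%N -> is_derive s (1 : R) (fun s => W s i) (f i (W s))) ->
  (forall s i, t < s < t' -> (i < m)%N -> is_derive s (1 : R) (fun s => V s i) (f i (V s))) ->
  (forall s i, t < s < t' -> (i < m)%N -> `|f i (W s) - f i (V s)| <= K * l1 m (fun j => W s j - V s j)) ->
  m%:R * K * (t' - t) <= 2^-1 -> (forall i, (i < m)%N -> W t i = V t i) ->
  forall i, (i < m)%N -> W t' i = V t' i.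
Proof.
move=> tt K0 cW cV dW dV fL small W0 i im.
pose D s := l1 m (fun j => W s j - V s j).
have cD : {within `[t, t'], continuous D}.
  rewrite /D /l1; elim: (m) cW cV => [|d IH] cW cV.
    have -> : (fun s => \sum_(j < 0) `|W s j - V s j|) = (fun=> 0) by apply/funext => s; rewrite big_ord0.
    by move=> x; exact: cvg_cst.
  have -> : (fun s => \sum_(j < d.+1) `|W s j - V s j|) = (fun s => \sum_(j < d) `|W s j - V s j| + `|W s d - V s d|).
    by apply/funext => s; rewrite big_ord_recr.
  apply: wcontD; first by apply: IH => j jd; [apply: cW|apply: cV]; rewrite ltnS ltnW.
  have cWV := wcontB (cW d (ltnSn d)) (cV d (ltnSn d)).
  by move=> x; exact: cvg_norm (cWV x).
have [c cin cM] := EVT_max tt cD.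
have Dc : D c <= m%:R * (K * D c * (t' - t)).
  apply: l1_le => j jm.
  move: cin; rewrite in_itv/= => /andP[tc ct].
  have KD : 0 <= K * D c by rewrite mulr_ge0// l1_ge0.
  move: tc; rewrite le_eqVlt => /predU1P[<-|tc].
    by rewrite W0// subrr normr0; apply: mulr_ge0; rewrite ?subr_ge0// mulr_ge0// l1_ge0.
  have sub : `[t, c] `<=` `[t, t'].
    by move=> s /=; rewrite !in_itv/= => /andP[-> sc]; exact: le_trans ct.
  have [||e] := @MVT R (fun s => W s j - V s j) (fun s => f j (W s) - f j (V s)) t c tc.
  - move=> s; rewrite in_itv/= => /andP[ts sc]; have st : t < s < t' by rewrite ts (lt_le_trans sc ct).
    by apply: is_deriveB; [exact: dW|exact: dV].
  - by apply: wcontB; [exact: continuous_subspaceW sub (cW j jm)|exact: continuous_subspaceW sub (cV j jm)].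
  rewrite in_itv/= => /andP[te ec]; rewrite W0// subrr subr0 => ->.
  have et : t < e < t' by rewrite te (lt_le_trans ec ct).
  rewrite normrM [X in _ * X]gtr0_norm ?subr_gt0//.
  apply: ler_pM => //; [by rewrite subr_ge0 ltW| |by rewrite lerD2r].
  apply: le_trans (fL e j et jm) _; apply: ler_wpM2l => //; apply: cM.
  by rewrite in_itv/= !ltW//; case/andP: et.
have D0 : D c <= 0.
  have := ler_wpM2r (l1_ge0 m (fun j => W c j - V c j)) small; rewrite -/(D c) => h.
  have e : m%:R * (K * D c * (t' - t)) = m%:R * K * (t' - t) * D c by ring.
  by rewrite e in Dc; lra.
have := cM t'; rewrite in_itv/= tt lexx => /(_ isT) /le_trans /(_ D0) h.
apply/eqP; rewrite -subr_eq0 -normr_le0; apply: le_trans h.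
exact: (@l1_coord R m (fun j => W t' j - V t' j)).
Qed.

(* Clipping the coordinates makes a field globally Lipschitz and leaves it
   unchanged near the reference solution. *)
Definition clip (rho x : R) : R := Num.max (- rho) (Num.min rho x).

Lemma clip_id (rho x : R) : `|x| <= rho -> clip rho x = x.
Proof. by rewrite ler_norml /clip => /andP[h1 h2]; rewrite min_r// max_r. Qed.

Lemma clip_le (rho x : R) : 0 <= rho -> `|clip rho x| <= rho.
Proof.
move=> r0; rewrite /clip ler_norml le_max lexx/= ge_max.
by rewrite ge_min lexx andbT; lra.
Qed.

Lemma clip_lip (rho x y : R) : `|clip rho x - clip rho y| <= `|x - y|.
Proof.
have n1 := ler_norm (x - y); have n2 := ler_norm (y - x); rewrite (distrC y) in n2.
rewrite /clip; case: (leP rho x) => h1; case: (leP rho y) => h2.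
- by rewrite subrr normr0.
- case: (leP (- rho) rho) => h3; case: (leP (- rho) y) => h4; rewrite ?subrr ?normr0// ler_norml; lra.
- case: (leP (- rho) x) => h3; case: (leP (- rho) rho) => h4; rewrite ?subrr ?normr0// ler_norml; lra.
- case: (leP (- rho) x) => h3; case: (leP (- rho) y) => h4; rewrite ?subrr ?normr0// ler_norml; lra.
Qed.

Lemma cont_clip rho (y : R -> R) : cont y -> cont (fun s => clip rho (y s)).
Proof.
move=> /contP cy; apply/contP => x Ix e e0; have [d [d0 dP]] := cy x Ix e e0.
by exists d; split=> // z Iz xz; apply: le_trans (clip_lip _ _ _) _; exact: dP.
Qed.

(** The clipped field has a solution for every parameter h. Once C |h| <= 1 the solution stays
    within distance 1 of the reference, where clipping acts trivially, so it solves the original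
    equation. *)
Lemma clipped_flow n m (f : nat -> E -> R) (Df : nat -> nat -> E -> R) (zb : R -> E) (z0 : E) (iota : nat -> E -> R) :
  (forall i, (i < m)%N -> C2 m (f i) (Df i)) ->
  solves false m z0 (fun s i => f i (zb s)) zb ->
  (forall h h', l1 m (fun i => iota i h - iota i h') <= l1 n (fun i => h i - h' i)) ->
  (forall i, iota i (fun=> 0) = 0) ->
  exists (C : R) (Z : E -> R -> E), 0 < C /\ [/\
    (forall h, C * l1 n h <= 1 -> solves false m (fun i => z0 i + iota i h) (fun s i => f i (Z h s)) (Z h)),
    (forall h h' t, 0 <= t <= 1 -> l1 m (fun i => Z h t i - Z h' t i) <= C * l1 n (fun i => h i - h' i)) &
    (forall h t, 0 <= t <= 1 -> l1 m (fun i => Z h t i - zb t i) <= C * l1 n h)].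
Proof.
move=> hf sz il i0.
have cz := solves_cont sz.
have [rho0 [r00 Hr]] := cont_bounded (cont_l1 cz).
(* The margin 1 around the reference matches the condition C |h| <= 1. *)
pose rho := rho0 + 1; have r0 : 0 <= rho by rewrite addr_ge0.
pose cl (z : E) : E := fun i => if (i < m)%N then clip rho (z i) else 0.
have cll z : l1 m (cl z) <= m%:R * rho.
  by apply: l1_le => i im; rewrite /cl im; exact: clip_le.
have [K [K0 HK]] := @C2_smooth_fam R m m 1 (fun i _ => f i) (fun i _ => Df i) (m%:R * rho) (fun i _ im _ => hf i im).
have clD z z' : l1 m (fun i => cl z i - cl z' i) <= l1 m (fun i => z i - z' i).
  by apply: ler_sum => i _; rewrite /cl ltn_ord; exact: clip_lip.
have fL z z' : l1 m (fun i => f i (cl z) - f i (cl z')) <= m%:R * K * l1 m (fun i => z i - z' i).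
  rewrite -mulrA; apply: l1_le => i im.
  have [_ _ h _ _] := HK i 0%N im isT _ _ (cll z') (cll z); apply: le_trans h _.
  by apply: ler_wpM2l; [exact: ltW|exact: clD].
pose A := (m%:R * K) ^+ 2 + 1.
have A0 : 0 < A by rewrite ltr_wpDl// sqr_ge0.
have kA : Int (fun s : R => (m%:R * K) ^+ 2) <= A by rewrite Int_cst lerDl.
have mK0 : 0 <= m%:R * K by rewrite mulr_ge0// ltW.
have ex h : exists y, solves false m (fun i => z0 i + iota i h) (fun s i => f i (cl (y s))) y.
  apply: (@picard R false m _ (fun _ y i => f i (cl y)) (fun=> m%:R * K) A (sq_cst _) _ A0 kA) => //.
  move=> y cy i im; apply: L1_cont.
  have [] := @C2_cont R m (f i) (Df i) (fun s => cl (y s)) (hf i im) _ => //.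
  by move=> j jm; rewrite /cl jm; apply: cont_clip; exact: cy.
have /choice[Z HZ] := ex.
pose C := 2 * expR (2 * A) + 1.
have e0 : 0 < expR (2 * A) by exact: expR_gt0.
have C0 : 0 < C by rewrite /C; lra.
have stab h h' c c' t : solves false m c (fun s i => f i (cl (h s))) h -> solves false m c' (fun s i => f i (cl (h' s))) h' ->
    0 <= t <= 1 -> l1 m (fun i => h t i - h' t i) <= C * l1 m (fun i => c i - c' i).
  move=> s1 s2 t01.
  have := @stability R false m c c' _ _ h h' (fun=> m%:R * K) (fun=> 0) A s1 s2 (sq_cst _) (fun _ _ => mK0) A0 kA
    (L1_cst 0) (fun _ _ => lexx 0) _ t t01.
  rewrite Int_cst addr0 => H; apply: le_trans (H _) _; first by move=> s _; rewrite addr0.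
  by rewrite mulrAC; apply: ler_wpM2r; [exact: l1_ge0|rewrite /C; lra].
have clzb s : 0 <= s <= 1 -> cl (zb s) = res m (zb s).
  move=> /I01P Is; apply/funext => i; rewrite /cl /res; case: ifP => // im; apply: clip_id.
  apply: le_trans (l1_coord (zb s) im) _; have := Hr s Is; rewrite ger0_norm ?l1_ge0// => h.
  by apply: le_trans h _; rewrite lerDl.
have szc : solves false m z0 (fun s i => f i (cl (zb s))) zb.
  have fe i s : (i < m)%N -> 0 <= s <= 1 -> f i (cl (zb s)) = f i (zb s).
    by move=> im s01; rewrite clzb//; have [_ _ fr _ _] := hf i im; exact: fr.
  split.
    move=> i im; apply: (L1_eq _ (sz.1 i im)) => s /I01P s01; exact/esym/fe.
  move=> t i t01 im; rewrite (sz.2 t i t01 im); congr (_ + _); apply: vol_eq => s /(seg_sub t01)/I01P s01.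
  exact/esym/fe.
have close h t : 0 <= t <= 1 -> l1 m (fun i => Z h t i - zb t i) <= C * l1 n h.
  move=> t01; apply: le_trans (stab _ _ _ _ t (HZ h) szc t01) _; apply: ler_wpM2l; first exact: ltW.
  have := il h (fun=> 0).
  have -> : l1 n (fun i => h i - 0) = l1 n h by apply: eq_bigr => i _; rewrite subr0.
  apply: le_trans; rewrite le_eqVlt; apply/orP; left; apply/eqP; apply: eq_bigr => i _.
  by rewrite i0 subr0 addrC addKr.
exists C, Z; split=> //; split=> //.
- move=> h hC.
  have fe i s : (i < m)%N -> 0 <= s <= 1 -> f i (cl (Z h s)) = f i (Z h s).
    move=> im s01; have [_ _ fr _ _] := hf i im; rewrite -[RHS]fr; congr (f i _).
    apply/funext => j; rewrite /cl /res; case: ifP => // jm; apply: clip_id.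
    have -> : Z h s j = (Z h s j - zb s j) + zb s j by rewrite subrK.
    apply: le_trans (ler_normD _ _) _; rewrite addrC; apply: lerD.
      apply: le_trans (l1_coord (zb s) jm) _; have /I01P Is := s01; have := Hr s Is.
      by rewrite ger0_norm// l1_ge0.
    apply: le_trans (@l1_coord R m (fun j => Z h s j - zb s j) j jm) _.
    exact: le_trans (close h s s01) hC.
  have [HZ1 HZ2] := HZ h; split.
    by move=> i im; apply: (L1_eq _ (HZ1 i im)) => s /I01P s01; exact: fe.
  move=> t i t01 im; rewrite HZ2//; congr (_ + _); apply: vol_eq => s /(seg_sub t01)/I01P s01.
  exact: fe.
- move=> h h' t t01; apply: le_trans (stab _ _ _ _ t (HZ h) (HZ h') t01) _.
  apply: ler_wpM2l; first exact: ltW.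
  apply: le_trans (il h h'); rewrite le_eqVlt; apply/orP; left; apply/eqP; apply: eq_bigr => i _.
  by rewrite opprD addrACA subrr add0r.
Qed.

End Flow.

(** * Analyticity of the global flow in the initial value *)

Section FlowGerm.
Variable R : realType.
Notation E := (nat -> R).
Local Notation nb := (@nb R).
Local Notation I01 := (@I01 R).

Lemma near_l1 n (e : R) : 0 < e -> \forall h \near nb n, l1 n h <= e.
Proof.
move=> e0; have n0 : 0 < n%:R + 1 :> R by rewrite ltr_wpDl.
apply: filterS (@near_small R n (e / (n%:R + 1)) (divr_gt0 e0 n0)) => h hs.
apply: le_trans (@l1_le R n h _ (fun i _ => hs i)) _.
by rewrite mulrA ler_pdivrMr// mulrC ler_wpM2l ?(ltW e0)// lerDl.
Qed.

(** Take the supremum of the times in [0,1] where P holds; the local step carries P beyond it unless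
    it is 1. *)
Lemma real_induction (P : R -> Prop) : P 0 ->
  (forall T, 0 <= T <= 1 -> exists e : R, 0 < e /\ forall t t', 0 <= t -> t <= t' -> t' <= 1 ->
     `|t - T| < e -> `|t' - T| < e -> P t -> P t') -> P 1.
Proof.
move=> P0 step; pose S := [set t | 0 <= t <= 1 /\ P t].
have S0 : S 0 by split=> //; rewrite lexx ler01.
have hs : has_sup S by split; [exists 0|exists 1 => t [/andP[]]].
have T0 : 0 <= sup S by apply: ub_le_sup => //; exists 1 => t [/andP[]].
have T1 : sup S <= 1 by apply: ge_sup => [|t [/andP[]]//]; exists 0.
have T01 : 0 <= sup S <= 1 by rewrite T0.
have [e [e0 H]] := step _ T01.
have [t [/andP[t0 t1] Pt] tS] := sup_adherent e0 hs.
have tT : t <= sup S by apply: ub_le_sup; [exists 1 => s [/andP[]]|split; rewrite ?t0].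
pose t' := Num.min 1 (sup S + e / 2).
have t'1 : t' <= 1 by rewrite ge_min lexx.
have tt' : t <= t' by rewrite le_min t1/=; lra.
have t'T : sup S <= t' by rewrite le_min T1/=; lra.
have t'e : t' <= sup S + e / 2 by rewrite ge_min lexx orbT.
have Pt' : P t'.
  by apply: (H t t') => //; rewrite ltr_norml; apply/andP; split; lra.
have : t' <= sup S by apply: ub_le_sup; [exists 1 => s [/andP[]]|split=> //; rewrite t'1 (le_trans t0)].
move=> h; have [h1|h1] := leP 1 (sup S + e / 2); first by move: Pt'; rewrite /t' min_l.
by rewrite /t' min_r ?(ltW h1)// in h; lra.
Qed.

(** Real induction on time. Near T the solution at t' is the analytic local flow around [zb T]
    applied to the solution at t, so analyticity in h passes from t to t'. *)
Lemma flow_germ n m (f : nat -> E -> R) (Df : nat -> nat -> E -> R) (zb : R -> E) (z0 : E) (iota : nat -> E -> R)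
  (C : R) (Z : E -> R -> E) :
  (forall i, (i < m)%N -> C2 m (f i) (Df i)) ->
  solves false m z0 (fun s i => f i (zb s)) zb ->
  (forall i, (i < m)%N -> germ n (iota i)) -> 0 < C ->
  (forall h, C * l1 n h <= 1 -> solves false m (fun i => z0 i + iota i h) (fun s i => f i (Z h s)) (Z h)) ->
  (forall h t, 0 <= t <= 1 -> l1 m (fun i => Z h t i - zb t i) <= C * l1 n h) ->
  forall i, (i < m)%N -> germ n (fun h => Z h 1 i).
Proof.
move=> hf sz gi C0 HZ close.
have cz := solves_cont sz.
have [rho0 [r00 Hr]] := cont_bounded (cont_l1 cz).
have nearC (e : R) : 0 < e -> \forall h \near nb n, C * l1 n h <= e.
  move=> e0; apply: filterS (near_l1 n (divr_gt0 e0 C0)) => h hh.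
  by rewrite mulrC -ler_pdivlMr.
apply: (@real_induction (fun t => forall i, (i < m)%N -> germ n (fun h => Z h t i))).
  move=> i im; apply: germ_eq (germ_add (germ_cst n (z0 i)) (gi i im)) _.
  apply: filterS (nearC 1 ltr01) => h hC; have [_ HZ2] := HZ h hC.
  have h01 : 0 <= (0 : R) <= 1 by rewrite lexx ler01.
  by rewrite (HZ2 0 i h01 im) (vol0 false) addr0.
move=> T T01; set c := zb T.
have gf i : (i < m)%N -> germ m (fun h => f i (fun j => c j + h j)) by move=> im; have [af _ _ _ _] := hf i im; exact: af.
have [tau [eta [rho [Psi [tau0 [eta0 rho0'] [AP _] P0 Pd]]]]] := local_flow gf.
(* A ball containing both the true solution and the local power series flow. *)
pose R2 := l1 m c + m%:R * rho + rho0 + 1.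
have [K [K0 HK]] := @C2_smooth_fam R m m 1 (fun i _ => f i) (fun i _ => Df i) R2 (fun i _ im _ => hf i im).
have IT : I01 T by apply/I01P.
have [d [d0 Hd]] : exists d : R, 0 < d /\ forall s, 0 <= s <= d -> forall i, (i < m)%N ->
    forall y, I01 y -> `|T - y| < s -> `|zb T i - zb y i| <= eta / 4%:R.
  apply: (@common_radius R m (fun i s => forall y, I01 y -> `|T - y| < s -> `|zb T i - zb y i| <= eta / 4%:R)) => i im.
  have /contP/(_ T IT (eta / 4%:R)) := cz i im; case; first by rewrite divr_gt0.
  move=> d [d0 dP]; exists d; split=> // s /andP[s0 sd] y Iy Ty; apply: dP => //.
  exact: lt_le_trans sd.
have {}Hd i y : (i < m)%N -> I01 y -> `|T - y| < d -> `|zb T i - zb y i| <= eta / 4%:R.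
  by move=> im Iy Ty; apply: (Hd d) => //; rewrite (ltW d0) lexx.
have mK0 : 0 <= m%:R * K by rewrite mulr_ge0// ltW.
(* Within e of T the reference moves by at most eta / 4, the time step is below [tau], and it is
   short enough for [local_unique]. *)
pose e := Num.min d (Num.min (tau / 4%:R) (4%:R * (m%:R * K + 1))^-1).
have mK1 : 0 < 4%:R * (m%:R * K + 1) by rewrite mulr_gt0// ltr_wpDl.
exists e; split; first by rewrite !lt_min d0 divr_gt0//= invr_gt0.
move=> t t' t0 tt' t'1; rewrite /e !lt_min => /and3P[td ttau tK] /and3P[td' ttau' tK'] St i im.
have t01 : 0 <= t <= 1 by rewrite t0 (le_trans tt').
have It : I01 t by apply/I01P.
have step : t' - t < tau /\ m%:R * K * (t' - t) <= 2^-1.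
  move: ttau ttau' tK tK'; rewrite !ltr_norml => /andP[a1 a2] /andP[a3 a4] /andP[a5 a6] /andP[a7 a8].
  split; first by clear -a1 a2 a3 a4; lra.
  set X := (4 * (m%:R * K + 1))^-1 in a5 a6 a7 a8.
  have X0 : 0 < X by rewrite invr_gt0.
  have XE : X * (m%:R * K + 1) = 1 / 4%:R by rewrite /X; field; rewrite gt_eqF// ltr_wpDl.
  have : m%:R * K * (t' - t) <= m%:R * K * (2 * X) by apply: (ler_wpM2l mK0); clear -a5 a6 a7 a8; lra.
  lra.
pose G h := res m (fun j => Z h t j - c j).
have w0 : forall j, 0 <= wt m rho j by apply: wt_ge0; exact: ltW.
have VE : \forall h \near nb n, Z h t' i = c i + Psi i (upd (G h) m (t' - t)).
  apply: filterS (nbI (nearC 1 ltr01) (nearC (eta / 2) (divr_gt0 eta0 (ltr0Sn R 1)))) => h [hC he].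
  have sZ := HZ h hC; have cZ := solves_cont sZ.
  have dG : dom (wt m eta) (G h).
    move=> j; rewrite /G /res /wt; case: ltnP => jm; last by rewrite normr0.
    have -> : Z h t j - c j = (Z h t j - zb t j) - (zb T j - zb t j) by rewrite /c; ring.
    apply: le_trans (ler_normB _ _) _.
    have h1 := le_trans (@l1_coord R m (fun j => Z h t j - zb t j) j jm) (close h t t01).
    have h2 : `|zb T j - zb t j| <= eta / 4%:R by apply: Hd => //; rewrite distrC.
    by clear -h1 h2 he eta0; lra.
  pose V s j := c j + Psi j (upd (G h) m (s - t)).
  have dV s j : t <= s <= t' -> (j < m)%N -> is_derive s (1 : R) (fun s => V s j) (f j (V s)).
    move=> /andP[ts st'] jm.
    have s0 : 0 <= s - t < tau by rewrite subr_ge0 ts/=; have [h1 _] := step; clear -h1 st'; lra.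
    have dP := Pd (G h) (s - t) j dG s0 jm.
    have ds : is_derive s (1 : R) (fun s => s - t) 1.
      by apply: is_derive_eq; rewrite subr0.
    have := @is_derive1_comp R _ (fun s => s - t) s _ _ dP ds; rewrite mulr1 => dc.
    have := is_deriveD (is_derive_cst (c j) s 1) dc; rewrite add0r; exact.
  apply: (@local_unique R m f (Z h) V K t t' tt' (ltW K0)) => //.
  - move=> j jm; apply: continuous_subspaceW (cZ j jm) => s /=; rewrite in_itv/= => /andP[h1 h2].
    by apply/I01P; rewrite (le_trans t0 h1) (le_trans h2 t'1).
  - move=> j jm; apply: derivable_within_continuous => s; rewrite in_itv/= => st.
    by have [] := dV s j st jm.
  - move=> s j /andP[ts st'] jm.
    have s01 : 0 < s < 1 by rewrite (le_lt_trans t0 ts) (lt_le_trans st' t'1).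
    have cf : cont (fun s => f j (Z h s)) by have [] := @C2_cont R m (f j) (Df j) (Z h) (hf j jm) cZ.
    have dv := vol_is_derive cf s01.
    apply: (@near_eq_is_derive _ _ _ (fun x => (z0 j + iota j h) + vol false (fun s => f j (Z h s)) x)).
      near=> x; apply/esym/(sZ.2 x j) => //; apply/andP; split; apply: ltW; near: x.
        by apply: lt_nbhsr; case/andP: s01.
      by apply: lt_nbhsl; case/andP: s01.
    by have := is_deriveD (is_derive_cst (z0 j + iota j h) s 1) dv; rewrite add0r; exact.
  - by move=> s j /andP[ts st'] jm; apply: dV => //; rewrite !ltW.
  - move=> s j /andP[ts st'] jm.
    have s01 : 0 <= s <= 1 by rewrite (le_trans t0 (ltW ts)) (le_trans (ltW st') t'1).
    have /I01P Is := s01.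
    have bW : l1 m (Z h s) <= R2.
      have -> : l1 m (Z h s) = l1 m (fun j => (Z h s j - zb s j) + zb s j).
        by apply: eq_bigr => l _; rewrite subrK.
      apply: le_trans (l1D _ _ _) _; have h1 := le_trans (close h s s01) hC.
      have := Hr s Is; rewrite ger0_norm ?l1_ge0// => h2.
      have h3 := l1_ge0 m c; have h4 : 0 <= m%:R * rho by rewrite mulr_ge0// ltW.
      by rewrite /R2; clear -h1 h2 h3 h4; lra.
    have bV : l1 m (V s) <= R2.
      apply: le_trans (l1D _ _ _) _; rewrite /R2 -!addrA lerD2l.
      have h1 : l1 m (fun l => Psi l (upd (G h) m (s - t))) <= m%:R * rho.
        apply: l1_le => l lm; have := An_bound (AP l) (_ : dom _ (upd (G h) m (s - t))).
        rewrite /wt lm; apply; move=> q; rewrite /upd; case: eqP => _; last exact: dG.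
        rewrite ger0_norm ?subr_ge0 ?(ltW ts)//; have [h2 _] := step; clear -h2 st'; lra.
      by apply: le_trans h1 _; rewrite lerDl addr_ge0.
    have [_ _ hh _ _] := HK j 0%N jm isT _ _ bV bW; exact: hh.
  - by have [] := step.
  - move=> j jm; rewrite /V subrr P0// /G /res jm; ring.
apply: (@germ_eq R n (fun h => c i + Psi i (upd (G h) m (t' - t)))); last by apply: filterS VE => h ->.
apply: germ_add; first exact: germ_cst.
have [r [r0 Hr']] := @common_radius R m (fun j s => An (wt n s) (fun h => Z h t j - Z (fun=> 0) t j) (eta / 2))
  (fun j jm => germ_small (St j jm) (divr_gt0 eta0 (ltr0Sn R 1))).
exists r, (wt m rho i); split=> //.
have wn := wt_ge0 n (ltW r0).
have wm : forall j, 0 <= upd (wt m eta) m tau j.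
  by move=> j; rewrite /upd; case: eqP => _; [exact: ltW|apply: wt_ge0; exact: ltW].
apply: (@An_comp R (upd (wt m eta) m tau) (wt n r) (Psi i) _ (fun j h => upd (G h) m (t' - t) j) wm wn (AP i)) => j.
rewrite /upd; case: eqP => [_|_].
  by apply: An_cst; rewrite ger0_norm ?subr_ge0//; have [] := step; lra.
rewrite /G /res /wt; case: ltnP => jm; last by apply: An_cst; rewrite normr0.
have rr : 0 <= r <= r by rewrite (ltW r0) lexx.
have A1 := Hr' r rr j jm.
have A2 : An (wt n r) (fun _ : E => Z (fun=> 0) t j - c j) (eta / 2).
  apply: An_cst.
  have z0' : l1 n (fun=> 0 : R) = 0 by rewrite /l1 big1// => q _; rewrite normr0.
  have h1 := le_trans (@l1_coord R m (fun j => Z (fun=> 0) t j - zb t j) j jm) (close (fun=> 0) t t01).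
  rewrite z0' mulr0 in h1.
  have -> : Z (fun=> 0) t j - c j = (Z (fun=> 0) t j - zb t j) - (zb T j - zb t j) by rewrite /c; ring.
  apply: le_trans (ler_normB _ _) _.
  have h2 : `|zb T j - zb t j| <= eta / 4%:R by apply: Hd => //; rewrite distrC.
  by clear -h1 h2 eta0; lra.
apply: (@An_eq R _ wn _ _ _ _ (An_add A1 A2)); first by rewrite -splitr.
by move=> h _; ring.
Unshelve. all: by end_near. Qed.

End FlowGerm.

(** * Reduction to the Hamiltonian flow *)

Section L2norm.
Variable R : realType.
Notation E := (nat -> R).
Local Notation I01 := (@I01 R).
Implicit Types u v w : R -> E.

Definition ip (k : nat) u w : R := Int (fun s => \sum_(j < k) u s j * w s j).
Definition nu (k : nat) u : R := Num.sqrt (n2 k u).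

Lemma ip_L1 k u w : ctrl k u -> ctrl k w -> L1 (fun s => \sum_(j < k) u s j * w s j).
Proof. by move=> cu cw; apply: L1_sum => j _; apply: sq_mul; [exact: cu|exact: cw]. Qed.

Lemma nu_ge0 k u : 0 <= nu k u.
Proof. exact: sqrtr_ge0. Qed.

Lemma nu_sqr k u : nu k u ^+ 2 = n2 k u.
Proof. by rewrite sqr_sqrtr// n2_ge0. Qed.

Lemma ctrlZ k c u : ctrl k u -> ctrl k (fun s j => c * u s j).
Proof. by move=> cu j jk; apply: sqZ; exact: cu. Qed.

Lemma nu_le k u (B : R) : 0 <= B -> (nu k u <= B) = (n2 k u <= B ^+ 2).
Proof. by move=> B0; rewrite -nu_sqr ler_sqr ?nnegrE ?nu_ge0. Qed.

Lemma n2_lin k u w (t : R) : ctrl k u -> ctrl k w ->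
  n2 k (fun s j => u s j + t * w s j) = n2 k u + 2 * t * ip k u w + t ^+ 2 * n2 k w.
Proof.
move=> cu cw; have Lu := ctrl_L1 cu; have Lw := ctrl_L1 cw; have Li := ip_L1 cu cw.
rewrite /n2 /ip -!IntZ// -!IntD//; [|exact: L1D Lu (L1Z _ Li)|exact: L1Z|exact: L1Z].
apply: Int_eq => s _; rewrite !mulr_sumr -!big_split; apply: eq_bigr => j _ /=; ring.
Qed.

Lemma ip_le k u w : ctrl k u -> ctrl k w -> `|ip k u w| <= nu k u * nu k w.
Proof.
move=> cu cw; set c := ip k u w.
have H t : 0 <= n2 k u + 2 * t * c + t ^+ 2 * n2 k w by rewrite -n2_lin//; exact: n2_ge0.
have a0 := n2_ge0 k u; have b0 := n2_ge0 k w.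
have cc : c ^+ 2 <= n2 k u * n2 k w.
  have [b00|bn0] := eqVneq (n2 k w) 0.
    have [->|cn0] := eqVneq c 0; first by rewrite expr0n mulr_ge0.
    exfalso; have := H (- (n2 k u + 1) / (2 * c)); rewrite b00 mulr0 addr0.
    have -> : 2 * (- (n2 k u + 1) / (2 * c)) * c = - (n2 k u + 1) by field.
    lra.
  have bp : 0 < n2 k w by rewrite lt_neqAle eq_sym bn0.
  have := H (- c / n2 k w).
  have -> : n2 k u + 2 * (- c / n2 k w) * c + (- c / n2 k w) ^+ 2 * n2 k w = n2 k u - c ^+ 2 / n2 k w by field.
  by rewrite subr_ge0 ler_pdivrMr.
rewrite -ler_sqr ?nnegrE ?mulr_ge0 ?nu_ge0// exprMn !nu_sqr real_normK ?num_real//.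
Qed.

Lemma nuD k u w : ctrl k u -> ctrl k w -> nu k (fun s j => u s j + w s j) <= nu k u + nu k w.
Proof.
move=> cu cw; rewrite nu_le ?addr_ge0 ?nu_ge0//.
have -> : (fun s j => u s j + w s j) = (fun s j => u s j + 1 * w s j).
  by apply/funext => s; apply/funext => j; rewrite mul1r.
rewrite n2_lin// expr1n mul1r mulr1 sqrrD !nu_sqr.
have := le_trans (ler_norm _) (ip_le cu cw); lra.
Qed.

Lemma n2_eq k u w : (forall s j, I01 s -> (j < k)%N -> u s j = w s j) -> n2 k u = n2 k w.
Proof. by move=> uw; apply: Int_eq => s Is; apply: eq_bigr => j _; rewrite uw. Qed.

Lemma nuN k u w : nu k (fun s j => u s j - w s j) = nu k (fun s j => w s j - u s j).
Proof.
congr Num.sqrt; apply: Int_eq => s _; apply: eq_bigr => j _.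
by rewrite -sqrrN opprB.
Qed.

Lemma nu_sub_le k u w : ctrl k u -> ctrl k w -> nu k u <= nu k w + nu k (fun s j => u s j - w s j).
Proof.
move=> cu cw; apply: le_trans (nuD cw (ctrlB cu cw)); rewrite le_eqVlt; apply/orP; left; apply/eqP.
congr Num.sqrt; apply: n2_eq => s j _ _; rewrite addrC subrK//.
Qed.

Lemma nu_pointwise k u w (M : R) : ctrl k u -> ctrl k w -> 0 <= M ->
  (forall s j, I01 s -> (j < k)%N -> `|u s j| <= `|w s j| + M) ->
  nu k u <= 2 * (nu k w + k%:R * M).
Proof.
move=> cu cw M0 uw; have kM : 0 <= k%:R * M by rewrite mulr_ge0.
rewrite nu_le ?mulr_ge0 ?addr_ge0 ?nu_ge0//.
apply: (@le_trans _ _ (2 * n2 k w + 2 * (k%:R * M ^+ 2))).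
  rewrite /n2 -(IntZ _ (ctrl_L1 cw)) -[X in _ + X]Int_cst -IntD; [|exact: L1Z (ctrl_L1 cw)|exact: L1_cst].
  apply: Int_le; [exact: ctrl_L1|by apply: L1D; [exact: L1Z (ctrl_L1 cw)|exact: L1_cst]|move=> s Is].
  have -> : 2 * (k%:R * M ^+ 2) = \sum_(j < k) 2 * M ^+ 2.
    by rewrite sumr_const card_ord -mulr_natl; ring.
  rewrite mulr_sumr -big_split; apply: ler_sum => j _ /=.
  have := uw s j Is (ltn_ord j).
  rewrite -(real_normK (num_real (u s j))) -(real_normK (num_real (w s j))).
  have := normr_ge0 (u s j); have := normr_ge0 (w s j).
  move: (`|u s j|) (`|w s j|) => A B B0 A0 h.
  apply: (@le_trans _ _ ((B + M) ^+ 2)); first by apply: lerXn2r => //; rewrite nnegrE addr_ge0.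
  by have := sqr_ge0 (B - M); nra.
have h1 : k%:R * M ^+ 2 <= (k%:R * M) ^+ 2.
  rewrite exprMn; apply: ler_wpM2r; first exact: sqr_ge0.
  case: (k) => [|k']; first by rewrite expr0n.
  by rewrite expr2 ler_peMr// ler1n.
have h2 : 0 <= nu k w * (k%:R * M) by rewrite mulr_ge0// nu_ge0.
have -> : (2 * (nu k w + k%:R * M)) ^+ 2 =
  4%:R * nu k w ^+ 2 + 8%:R * (nu k w * (k%:R * M)) + 4%:R * (k%:R * M) ^+ 2 by ring.
by rewrite nu_sqr; have := n2_ge0 k w; have := sqr_ge0 (k%:R * M); lra.
Qed.

End L2norm.

(** * The Hamiltonian vector field *)

Section Hamiltonian.
Variable R : realType.
Notation E := (nat -> R).
Variables (n k : nat) (F : nat -> nat -> E -> R) (DF : nat -> nat -> nat -> E -> R).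
Hypothesis hF : forall i j, (i < n)%N -> (j < k)%N -> C2 n (F i j) (DF i j).

(* The state of the Hamiltonian system is [z = (x, p, c)]: position, adjoint
   state and running cost [c' = |v|^2 / 2], for the control [v = - p F(x)]. *)
Definition hctl (z : E) : E := fun j => - \sum_(i < n) z (n + i)%N * F i j z.

Definition hfield (l : nat) (z : E) : R :=
  if (l < n)%N then \sum_(j < k) F l j z * hctl z j
  else if (l < n + n)%N then - \sum_(i < n) \sum_(j < k) z (n + i)%N * DF i j (l - n)%N z * hctl z j
  else 2^-1 * \sum_(j < k) hctl z j ^+ 2.

Lemma res_le_gan m (f : E -> R) : gan n f -> (forall z, f (res n z) = f z) -> gan m f.
Proof. by move=> af fr; have := @gan_res R n m f af; have -> : (fun z => f (res n z)) = f by apply/funext. Qed.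

Lemma res_le_inv m (f : E -> R) : (n <= m)%N -> (forall z, f (res n z) = f z) -> forall z, f (res m z) = f z.
Proof. by move=> nm fr z; rewrite -fr res_res. Qed.

Lemma hctl_gan j : (j < k)%N -> gan (n + n).+1 (fun z => hctl z j) /\ forall z, hctl (res (n + n).+1 z) j = hctl z j.
Proof.
move=> jk; split.
  apply: gan_opp; apply: gan_sum => i _; apply: gan_mul; first exact: gan_var.
  by have [af _ fr _ _] := hF (ltn_ord i) jk; exact: res_le_gan.
move=> z; congr (- _); apply: eq_bigr => i _; congr (_ * _).
  by rewrite /res ltnS ltnW// ltn_add2l.
have [_ _ fr _ _] := hF (ltn_ord i) jk; apply: res_le_inv => //.
by rewrite -addnS leq_addr.
Qed.

Lemma hfield_C2 : exists Df, forall l, (l < (n + n).+1)%N -> C2 (n + n).+1 (hfield l) (Df l).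
Proof.
have nm : (n <= (n + n).+1)%N by rewrite -addnS leq_addr.
have ex l : exists Df, (l < (n + n).+1)%N -> C2 (n + n).+1 (hfield l) Df.
  have [lm|lm] := boolP (l < (n + n).+1)%N; last by exists (fun _ _ => 0).
  have [|| Df H] := @gan_C2 R (n + n).+1 (hfield l); last by exists Df.
  - rewrite /hfield; case: (ltnP l n) => ln.
      apply: gan_sum => j _; apply: gan_mul; last by have [] := hctl_gan (ltn_ord j).
      by have [af _ fr _ _] := hF ln (ltn_ord j); exact: res_le_gan.
    case: (ltnP l (n + n)) => lnn.
      apply: gan_opp; apply: gan_sum => i _; apply: gan_sum => j _.
      apply: gan_mul; last by have [] := hctl_gan (ltn_ord j).
      apply: gan_mul; first exact: gan_var.
      have [_ aD _ Dr _] := hF (ltn_ord i) (ltn_ord j); apply: res_le_gan => //; apply: aD; lia.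
    apply: gan_mul; first exact: gan_cst.
    apply: gan_sum => j _; have [h _] := hctl_gan (ltn_ord j).
    by under eq_fun do rewrite expr2; exact: (gan_mul h h).
  - move=> z; rewrite /hfield; case: (ltnP l n) => ln.
      apply: eq_bigr => j _; have [_ ->] := hctl_gan (ltn_ord j); congr (_ * _).
      by have [_ _ fr _ _] := hF ln (ltn_ord j); exact: res_le_inv.
    case: (ltnP l (n + n)) => lnn.
      congr (- _); apply: eq_bigr => i _; apply: eq_bigr => j _; have [_ ->] := hctl_gan (ltn_ord j).
      congr (_ * _ * _); first by rewrite /res ltnS ltnW// ltn_add2l.
      have [_ _ _ Dr _] := hF (ltn_ord i) (ltn_ord j).
      by apply: (res_le_inv nm (f := DF i j (l - n)%N)).
    by congr (_ * _); apply: eq_bigr => j _; have [_ ->] := hctl_gan (ltn_ord j).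
by have /choice[Df H] := ex; exists Df.
Qed.

Lemma hctl_C2 : exists Dw, forall j, (j < k)%N -> C2 (n + n).+1 (fun z => hctl z j) (Dw j).
Proof.
have ex j : exists Dw, (j < k)%N -> C2 (n + n).+1 (fun z => hctl z j) Dw.
  have [jk|jk] := boolP (j < k)%N; last by exists (fun _ _ => 0).
  have [h1 h2] := hctl_gan jk.
  by have [Dw H] := gan_C2 h1 h2; exists Dw.
by have /choice[Dw H] := ex; exists Dw.
Qed.

Lemma l1_split (z : E) : l1 (n + n) z = l1 n z + l1 n (fun i => z (n + i)%N).
Proof. by rewrite /l1 big_split_ord. Qed.

(** The adjoint state runs backward from time 1, whereas the Hamiltonian flow is parametrised by its
    value at time 0. *)
Lemma solves_reverse d (c : E) (g : R -> E) (p : R -> E) : solves true d c g p ->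
  solves false d (p 0) (fun s i => - g s i) p.
Proof.
move=> [Lg pE]; split.
  by move=> i id; apply: (L1_eq _ (L1Z (-1) (Lg i id))) => s _; rewrite mulN1r.
move=> t i t01 id; have h0 : 0 <= (0 : R) <= 1 by rewrite lexx ler01.
rewrite (pE t i t01 id) (pE 0 i h0 id) (vol_full true) (vol_split t01 (Lg i id)).
have -> : vol false (fun s => - g s i) t = - vol false (fun s => g s i) t.
  rewrite -mulN1r -volZ//; last exact: Lg.
  by apply: vol_eq => s _; rewrite mulN1r.
by ring.
Qed.

End Hamiltonian.

(** * Extremals as approximate Hamiltonian orbits *)

Section Reduction.
Variable R : realType.
Notation E := (nat -> R).
Variables (n k : nat) (F : nat -> nat -> E -> R) (DF : nat -> nat -> nat -> E -> R) (x0 : E).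
Variables (a : E -> R) (Da : nat -> E -> R) (beta L : R).
Hypothesis hF : forall i j, (i < n)%N -> (j < k)%N -> C2 n (F i j) (DF i j).
Hypothesis ha : C2 n a Da.
Hypothesis L0 : 0 <= L.
Hypothesis hL : forall i j z z', (i < n)%N -> (j < k)%N -> `|F i j z - F i j z'| <= L * l1 n (fun l => z l - z' l).
Hypothesis b0 : 0 <= beta.
Local Notation is_traj := (is_traj n k F x0).
Local Notation is_adj := (is_adj n k DF Da beta).
Local Notation gradu := (grad n F).
Local Notation hctlF := (hctl n F).
Local Notation hfieldF := (hfield n k F DF).
Local Notation m := (n + n).+1.

Definition extremal (u x p : R -> E) : Prop := [/\ ctrl k u, is_traj u x & is_adj u x p].
Definition J (u x : R -> E) : R := 2^-1 * n2 k u + beta * a (x 1).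

Definition xpc (x p : E) (c : R) : E :=
  fun l => if (l < n)%N then x l else if (l < n + n)%N then p (l - n)%N else c.

Lemma xpc_x x p c l : (l < n)%N -> xpc x p c l = x l.
Proof. by rewrite /xpc => ->. Qed.

Lemma xpc_p x p c l : (l < n)%N -> xpc x p c (n + l)%N = p l.
Proof. by move=> ln; rewrite /xpc ltnNge leq_addr/= ltn_add2l ln addKn. Qed.

Lemma xpc_c x p c : xpc x p c (n + n)%N = c.
Proof. by rewrite /xpc ltnNge leq_addr/= ltnn. Qed.

Lemma res_eq (z z' : E) : (forall l, (l < n)%N -> z l = z' l) -> res n z = res n z'.
Proof. by move=> e; apply/funext => i; rewrite /res; case: ifP => // /e. Qed.

Lemma F_ext i j z z' : (i < n)%N -> (j < k)%N -> (forall l, (l < n)%N -> z l = z' l) ->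
  F i j z = F i j z' /\ forall l, DF i j l z = DF i j l z'.
Proof.
move=> ni jk e; have [_ _ fr Dr _] := hF ni jk.
by split=> [|l]; [rewrite -fr -[RHS]fr|rewrite -Dr -[RHS]Dr]; rewrite (res_eq e).
Qed.

Lemma hctl_xpc x p c j : (j < k)%N -> hctlF (xpc x p c) j = - \sum_(i < n) p i * F i j x.
Proof.
move=> jk; congr (- _); apply: eq_bigr => i _; rewrite xpc_p//; congr (_ * _).
by have [] := F_ext (ltn_ord i) jk (fun l ln => xpc_x x p c ln).
Qed.

Lemma ctrl_grad (u x p : R -> E) (s : R) j (c : R) : (j < k)%N -> u s j = gradu u x p s j + hctlF (xpc (x s) (p s) c) j.
Proof. by move=> jk; rewrite hctl_xpc// /grad addrK. Qed.

(* A pair (trajectory, adjoint state) solves the Hamiltonian system up to a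
   defect that is linear in the gradient. *)
Lemma hfield_defect_x (u x p : R -> E) (c s : R) l : (l < n)%N ->
  \sum_(j < k) F l j (x s) * u s j = hfieldF l (xpc (x s) (p s) c) + \sum_(j < k) F l j (x s) * gradu u x p s j.
Proof.
move=> ln; rewrite /hfield ln -big_split; apply: eq_bigr => j _ /=.
have [-> _] := F_ext ln (ltn_ord j) (fun l' ln' => xpc_x (x s) (p s) c ln').
by rewrite -mulrDr addrC -ctrl_grad.
Qed.

Lemma hfield_defect_p (u x p : R -> E) (c s : R) l : (l < n)%N ->
  - \sum_(i < n) \sum_(j < k) p s i * DF i j l (x s) * u s j = hfieldF (n + l) (xpc (x s) (p s) c)
    + - \sum_(i < n) \sum_(j < k) p s i * DF i j l (x s) * gradu u x p s j.
Proof.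
move=> ln; rewrite /hfield ltnNge leq_addr/= ltn_add2l ln addKn -opprD -big_split; congr (- _).
apply: eq_bigr => i _; rewrite -big_split; apply: eq_bigr => j _ /=.
have [_ ->] := F_ext (ltn_ord i) (ltn_ord j) (fun l' ln' => xpc_x (x s) (p s) c ln').
by rewrite xpc_p// -mulrDr addrC -ctrl_grad.
Qed.

(** A control of norm 0 vanishes only up to a null set; its integrals against continuous functions
    are exactly 0. *)
Lemma vol_null b (t : R) (f : R -> R) (w : R -> E) : 0 <= t <= 1 -> cont f -> ctrl k w -> nu k w = 0 ->
  forall j, (j < k)%N -> vol b (fun s => f s * w s j) t = 0.
Proof.
move=> t01 cf cw w0 j jk; have [M [M0 HM]] := cont_bounded cf.
have Lf : L1 (fun s => f s * w s j) by apply: sq_mul; [exact: sq_cont|exact: cw].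
apply/eqP; rewrite -normr_le0; apply: le_trans (vol_abs b t01 Lf) _.
apply: le_trans (vol_le_Int b t01 (L1_abs Lf) _) _; first by move=> s _.
have cw1 := sq_L1 (ctrl_sq cw).
apply: (@le_trans _ _ (Int (fun s => M * l1 k (w s)))).
  apply: Int_le; [exact: L1_abs|exact: L1Z|move=> s Is].
  by rewrite normrM; apply: ler_pM => //; [exact: HM|exact: l1_coord].
have w00 : n2 k w <= 0 ^+ 2 by rewrite -nu_sqr w0.
by apply: le_trans (Int_const_l1 cw (lexx 0) M0 w00) _; rewrite !mulr0.
Qed.

Definition zinit (p : E) : E := xpc x0 p 0.

(** With zero gradient the defects integrate to 0, so (x, p), completed by its running cost, is an
    exact Hamiltonian orbit around which the flow can be expanded. *)
Lemma reference_flow u x p : extremal u x p -> nu k (gradu u x p) = 0 -> exists c : R -> R,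
  solves false m (zinit (p 0)) (fun s l => hfieldF l (xpc (x s) (p s) (c s))) (fun s => xpc (x s) (p s) (c s)).
Proof.
move=> [cu tx ap] g0.
have cx := solves_cont tx; have cp := solves_cont ap; have cg := grad_ctrl hF cu tx ap.
have rp := solves_reverse ap.
have cF i j : (i < n)%N -> (j < k)%N -> cont (fun s => F i j (x s)) /\ forall l, (l < n)%N -> cont (fun s => DF i j l (x s)).
  by move=> ni jk; exact: (C2_cont (hF ni jk) cx).
have cw j : (j < k)%N -> cont (fun s => hctlF (xpc (x s) (p s) 0) j).
  move=> jk; have h : cont (fun s => -1 * \sum_(i < n) p s i * F i j (x s)).
    apply: contM; first exact: cont_cst.
    by apply: cont_sum => i _; apply: contM; [exact: cp|exact: (cF i j (ltn_ord i) jk).1].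
  have -> : (fun s => hctlF (xpc (x s) (p s) 0) j) = (fun s => -1 * \sum_(i < n) p s i * F i j (x s)).
    by apply/funext => s; rewrite hctl_xpc// mulN1r.
  exact: h.
(* The running cost of the continuous feedback - p F(x), which agrees with u only up to a null set.
   The cost component 0 is a placeholder: [hctl] reads x and p alone. *)
pose e s := 2^-1 * \sum_(j < k) hctlF (xpc (x s) (p s) 0) j ^+ 2.
have ce : cont e.
  apply: contM; first exact: cont_cst.
  apply: cont_sum => j _; have h := contM (cw j (ltn_ord j)) (cw j (ltn_ord j)).
  by under eq_fun do rewrite expr2.
pose c := vol false e; exists c.
have ee s : hfieldF (n + n) (xpc (x s) (p s) (c s)) = e s.
  rewrite /hfield ltnNge leq_addr/= ltnn; congr (_ * _); apply: eq_bigr => j _.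
  by rewrite !hctl_xpc.
have cz l : (l < m)%N -> cont (fun s => xpc (x s) (p s) (c s) l).
  move=> lm; rewrite /xpc; case: (ltnP l n) => ln; first exact: cx.
  case: (ltnP l (n + n)) => lnn; first by apply: cp; lia.
  by apply: vol_cont; exact: L1_cont.
have [Dh Hh] := hfield_C2 hF.
have Lh l : (l < m)%N -> L1 (fun s => hfieldF l (xpc (x s) (p s) (c s))).
  by move=> lm; apply: L1_cont; have [] := @C2_cont R m _ _ (fun s => xpc (x s) (p s) (c s)) (Hh l lm) cz.
split=> // t l t01 lm; rewrite /zinit.
have [ln|nl] := ltnP l n.
  rewrite !xpc_x// (tx.2 t l t01 ln); congr (_ + _).
  have LF : L1 (fun s => \sum_(j < k) F l j (x s) * gradu u x p s j).
    by apply: L1_sum => j _; apply: sq_mul; [apply: sq_cont; exact: (cF l j ln (ltn_ord j)).1|exact: cg].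
  rewrite (@vol_eq _ _ _ _ (fun s => hfieldF l (xpc (x s) (p s) (c s)) + \sum_(j < k) F l j (x s) * gradu u x p s j)); last first.
    by move=> s _; exact: hfield_defect_x.
  rewrite volD//; last exact: Lh.
  rewrite [X in _ + X](_ : _ = 0) ?addr0// vol_sum//; last first.
    by move=> j _; apply: sq_mul; [apply: sq_cont; exact: (cF l j ln (ltn_ord j)).1|exact: cg].
  by apply: big1 => j _; apply: (vol_null _ t01 _ cg g0) => //; exact: (cF l j ln (ltn_ord j)).1.
have [lnn|nnl] := ltnP l (n + n); last first.
  have -> : l = (n + n)%N by lia.
  by rewrite !xpc_c add0r; apply: vol_eq => s _; rewrite ee.
pose l' := (l - n)%N; have l'n : (l' < n)%N by rewrite /l'; lia.
have -> : l = (n + l')%N by rewrite /l'; lia.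
rewrite !xpc_p// (rp.2 t l' t01 l'n); congr (_ + _).
have cD i j : (i < n)%N -> (j < k)%N -> cont (fun s => p s i * DF i j l' (x s)).
  by move=> ni jk; apply: contM; [exact: cp|exact: (cF i j ni jk).2].
have LF1 i : (i < n)%N -> L1 (fun s => \sum_(j < k) p s i * DF i j l' (x s) * gradu u x p s j).
  by move=> ni; apply: L1_sum => j _; apply: sq_mul; [apply: sq_cont; exact: cD|exact: cg].
have LF : L1 (fun s => \sum_(i < n) \sum_(j < k) p s i * DF i j l' (x s) * gradu u x p s j).
  by apply: L1_sum => i _; exact: LF1.
rewrite (@vol_eq _ _ _ _ (fun s => hfieldF (n + l') (xpc (x s) (p s) (c s)) + -1 * \sum_(i < n) \sum_(j < k) p s i * DF i j l' (x s) * gradu u x p s j)); last first.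
  by move=> s _; rewrite mulN1r; exact: hfield_defect_p.
rewrite volD//; [|by apply: Lh; lia|exact: L1Z].
rewrite [X in _ + X](_ : _ = 0) ?addr0// volZ// vol_sum//; last by move=> i _; exact: LF1.
rewrite big1 ?mulr0// => i _; rewrite vol_sum//; last first.
  by move=> j _; apply: sq_mul; [apply: sq_cont; exact: cD|exact: cg].
by apply: big1 => j _; apply: (vol_null _ t01 _ cg g0) => //; exact: cD.
Qed.

End Reduction.

(** * Shadowing of extremals by exact Hamiltonian orbits *)

Section Critical.
Variable R : realType.
Notation E := (nat -> R).
Variables (n k : nat) (F : nat -> nat -> E -> R) (DF : nat -> nat -> nat -> E -> R) (x0 : E).
Variables (a : E -> R) (Da : nat -> E -> R) (beta L : R).
Hypothesis hF : forall i j, (i < n)%N -> (j < k)%N -> C2 n (F i j) (DF i j).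
Hypothesis ha : C2 n a Da.
Hypothesis L0 : 0 <= L.
Hypothesis hL : forall i j z z', (i < n)%N -> (j < k)%N -> `|F i j z - F i j z'| <= L * l1 n (fun l => z l - z' l).
Hypothesis b0 : 0 <= beta.
Local Notation gradu := (grad n F).
Local Notation hctlF := (hctl n F).
Local Notation hfieldF := (hfield n k F DF).
Local Notation m := (n + n).+1.
Local Notation extremal := (extremal n k F DF x0 Da beta).
Local Notation xpcn := (xpc n).

Lemma l1_last (z : E) : l1 m z = l1 (n + n) z + `|z (n + n)%N|.
Proof. by rewrite /l1 big_ord_recr. Qed.

(** The parameter h perturbs the adjoint block of the initial state and nothing else. *)
Definition emb (l : nat) (h : E) : R := if (n <= l < n + n)%N then h (l - n)%N else 0.

Lemma emb_l1 h h' : l1 m (fun i => emb i h - emb i h') <= l1 n (fun i => h i - h' i).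
Proof.
rewrite l1_last l1_split [X in X + _ + _](_ : _ = 0); last first.
  by apply: big1 => i _; rewrite /emb leqNgt ltn_ord/= subrr normr0.
rewrite add0r [X in _ + X](_ : _ = 0); last by rewrite /emb ltnn andbF subrr normr0.
rewrite addr0 le_eqVlt; apply/orP; left; apply/eqP; apply: eq_bigr => i _.
by rewrite /emb leq_addr/= ltn_add2l ltn_ord addKn.
Qed.

(* Extremals close to [u] are compared with the solution of the Hamiltonian
   system that has the same initial adjoint state. *)
Lemma shadowing (B Rz : R) : 0 <= B -> 0 <= Rz -> exists C : R, 0 < C /\
  forall v y q (Zs : R -> E) (w : R -> E), extremal v y q -> n2 k v <= B ^+ 2 ->
  solves false m (xpcn x0 (q 0) 0) (fun s i => hfieldF i (Zs s)) Zs ->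
  (forall s, 0 <= s <= 1 -> l1 m (Zs s) <= Rz) ->
  (forall s j, (j < k)%N -> w s j = hctlF (Zs s) j) -> ctrl k w ->
  nu k (fun s j => v s j - w s j) <= C * nu k (gradu v y q).
Proof.
move=> B0 Rz0; have [C0 [C00 H0]] := adjoint_estimates x0 hF ha L0 hL b0 B0.
have [Dh Hh] := hfield_C2 hF; have [Dw Hw] := hctl_C2 hF.
pose R1 := C0 + C0 + Rz.
have [K1 [K10 HK1]] := @C2_smooth_fam R m m 1 (fun i _ => hfieldF i) (fun i _ => Dh i) R1 (fun i _ im _ => Hh i im).
have [K2 [K20 HK2]] := @C2_smooth_fam R m k 1 (fun j _ z => hctlF z j) (fun j _ => Dw j) R1 (fun j _ jk _ => Hw j jk).
have [KF [KF0 HKF]] := C2_smooth_fam C0 hF.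
pose kap : R := (n + n)%:R * K1.
have kap0 : 0 <= kap by rewrite mulr_ge0// ltW.
pose A := kap ^+ 2 + 1; have A0 : 0 < A by rewrite ltr_wpDl// sqr_ge0.
have kA : Int (fun s : R => kap ^+ 2) <= A by rewrite Int_cst lerDl.
pose c := n%:R * KF * (1 + C0).
have c0 : 0 <= c by rewrite /c !mulr_ge0 ?addr_ge0 ?(ltW KF0) ?(ltW C00).
have eA : 0 <= expR (2 * A) by exact: expR_ge0.
pose C3 := 2 * (c * k%:R) * expR (2 * A).
have C30 : 0 <= C3 by apply: mulr_ge0 => //; apply: mulr_ge0 => //; apply: mulr_ge0.
have C40 : 0 <= k%:R * (K2 * C3) by apply: mulr_ge0 => //; apply: mulr_ge0 => //; exact: ltW.
exists (2 * (1 + k%:R * (K2 * C3))); split; first lra.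
move=> v y q Zs w [cv ty aq] vB sZ Zb wE cw.
have cg := grad_ctrl hF cv ty aq; set om := gradu v y q in cg *.
have [byq _] := H0 v y q cv vB ty aq.
pose G s l := if (l < n)%N then \sum_(j < k) F l j (y s) * v s j
  else - \sum_(i < n) \sum_(j < k) q s i * DF i j (l - n)%N (y s) * v s j.
(* The cost component is borrowed from the orbit [Zs] itself, so the difference lives in the first 2
   n coordinates. *)
pose zeta s := xpcn (y s) (q s) (Zs s (n + n)%N).
have rq := solves_reverse aq.
have sG : solves false (n + n) (xpcn x0 (q 0) 0) G zeta.
  split=> [l lnn|t l t01 lnn].
    rewrite /G; case: (ltnP l n) => ln; first exact: (ty.1 l ln).
    have ln' : (l - n < n)%N by rewrite ltn_subLR.
    exact: (rq.1 _ ln').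
  rewrite /zeta; case: (ltnP l n) => ln.
    by rewrite !xpc_x// (ty.2 t l t01 ln); congr (_ + _); apply: vol_eq => s _; rewrite /G ln.
  have ln' : (l - n < n)%N by rewrite ltn_subLR.
  rewrite -(subnKC ln); move: (l - n)%N ln' => l' ln'.
  rewrite !xpc_p// (rq.2 t _ t01 ln'); congr (_ + _); apply: vol_eq => s _.
  by rewrite /G ltnNge leq_addr/= addKn.
have sZ' : solves false (n + n) (xpcn x0 (q 0) 0) (fun s i => hfieldF i (Zs s)) Zs.
  by split=> [i im|t i t01 im]; [apply: sZ.1|apply: sZ.2 => //]; exact: leqW.
have zb s : 0 <= s <= 1 -> l1 m (zeta s) <= R1.
  move=> s01; have [h1 h2] := byq s s01; rewrite l1_last l1_split /zeta xpc_c /R1.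
  apply: lerD; last by apply: le_trans (Zb s s01); exact: (@l1_coord R m (Zs s)).
  apply: lerD.
    by apply: le_trans h1; rewrite le_eqVlt; apply/orP; left; apply/eqP; apply: eq_bigr => i _; rewrite xpc_x.
  by apply: le_trans h2; rewrite le_eqVlt; apply/orP; left; apply/eqP; apply: eq_bigr => i _; rewrite xpc_p.
have Zb1 s : 0 <= s <= 1 -> l1 m (Zs s) <= R1.
  by move=> s01; apply: le_trans (Zb s s01) _; rewrite /R1 lerDr; lra.
have dm s : l1 m (fun i => zeta s i - Zs s i) = l1 (n + n) (fun i => zeta s i - Zs s i).
  by rewrite l1_last {2}/zeta xpc_c subrr normr0 addr0.
have om0 := nu_ge0 k om.
have close t : 0 <= t <= 1 -> l1 (n + n) (fun i => zeta t i - Zs t i) <= C3 * nu k om.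
  move=> t01.
  have := @stability R false (n + n) _ _ G _ zeta Zs (fun=> kap) (fun s => c * l1 k (om s)) A sG sZ' (sq_cst _)
    (fun _ _ => kap0) A0 kA (L1Z _ (sq_L1 (ctrl_sq cg))) _ _ t t01.
  have -> : l1 (n + n) (fun i => xpcn x0 (q 0) 0 i - xpcn x0 (q 0) 0 i) = 0.
    by apply: big1 => i _; rewrite subrr normr0.
  rewrite add0r => H; apply: (le_trans (H _ _)).
  - by move=> s _; apply: mulr_ge0 => //; exact: l1_ge0.
  - move=> s /I01P s01.
    pose d l := if (l < n)%N then \sum_(j < k) F l j (y s) * om s j
      else - \sum_(i < n) \sum_(j < k) q s i * DF i j (l - n)%N (y s) * om s j.
    have Gd l : (l < n + n)%N -> G s l = hfieldF l (zeta s) + d l.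
      move=> lnn; rewrite /G /d; case: (ltnP l n) => ln; first exact: hfield_defect_x.
      have ln' : (l - n < n)%N by rewrite ltn_subLR.
      by rewrite -[in hfieldF l](subnKC ln); exact: hfield_defect_p.
    have -> : l1 (n + n) (fun i => G s i - hfieldF i (Zs s)) = l1 (n + n) (fun i => (hfieldF i (zeta s) - hfieldF i (Zs s)) + d i).
      by apply: eq_bigr => i _; rewrite Gd//; congr `|_|; ring.
    apply: le_trans (l1D _ _ _) _; apply: lerD.
      rewrite /kap -mulrA -dm; apply: l1_le => i im.
      by have [_ _ h _ _] := HK1 i 0%N (leqW im) isT _ _ (Zb1 s s01) (zb s s01).
    have [yb qb] := byq s s01.
    have lo := l1_ge0 k (om s).
    rewrite l1_split /c mulrDr mulr1 mulrDl; apply: lerD.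
      have -> : l1 n d = l1 n (fun l => \sum_(j < k) F l j (y s) * om s j).
        by apply: eq_bigr => i _; rewrite /d ltn_ord.
      apply: (@l1_mx R n k (fun i j => F i j (y s))) => i j ni jk.
      by have [h _ _ _ _] := HKF i j ni jk _ _ yb yb.
    have -> : l1 n (fun i => d (n + i)%N) = l1 n (fun l => \sum_(i < n) \sum_(j < k) q s i * DF i j l (y s) * om s j).
      by apply: eq_bigr => i _; rewrite /d ltnNge leq_addr/= addKn normrN.
    apply: (@le_trans _ _ (n%:R * KF * l1 k (om s) * l1 n (q s))).
      apply: (@l1_mx3 R n k (fun i j l => DF i j l (y s)) (q s)) => i j l ni jk ln.
      by have [_ h _ _ _] := HKF i j ni jk _ _ yb yb; exact: h.
    rewrite [leRHS]mulrAC; apply: ler_wpM2l => //; rewrite !mulr_ge0//; exact: ltW.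
  - rewrite /C3 [leRHS]mulrAC; apply: ler_wpM2r => //; rewrite -(mulrA 2) -(mulrA c); apply: ler_wpM2l => //.
    by apply: Int_const_l1 => //; rewrite nu_sqr.
have M0 : 0 <= K2 * (C3 * nu k om) := mulr_ge0 (ltW K20) (mulr_ge0 C30 om0).
have := nu_pointwise (ctrlB cv cw) cg M0.
move=> H; apply: le_trans (H _) _; last first.
  by rewrite -mulrA ler_wpM2l// mulrDl mul1r -!mulrA.
move=> s j /I01P s01 jk; rewrite (ctrl_grad hF v y q s (Zs s (n + n)%N) jk) wE//.
rewrite -/(zeta s) -addrA; apply: le_trans (ler_normD _ _) _; rewrite lerD2l.
have [_ _ h _ _] := HK2 j 0%N jk isT _ _ (Zb1 s s01) (zb s s01); apply: le_trans h _.
by rewrite dm; apply: ler_wpM2l; [exact: ltW|exact: close].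
Qed.

End Critical.

(** * Reduction of a critical control to finitely many parameters *)

Section CriticalReduction.
Variable R : realType.
Notation E := (nat -> R).
Local Notation I01 := (@I01 R).
Variables (n k : nat) (F : nat -> nat -> E -> R) (DF : nat -> nat -> nat -> E -> R) (x0 : E).
Variables (a : E -> R) (Da : nat -> E -> R) (beta L : R).
Hypothesis hF : forall i j, (i < n)%N -> (j < k)%N -> C2 n (F i j) (DF i j).
Hypothesis ha : C2 n a Da.
Hypothesis L0 : 0 <= L.
Hypothesis hL : forall i j z z', (i < n)%N -> (j < k)%N -> `|F i j z - F i j z'| <= L * l1 n (fun l => z l - z' l).
Hypothesis b0 : 0 <= beta.
Local Notation is_traj := (is_traj n k F x0).
Local Notation gradu := (grad n F).
Local Notation hctlF := (hctl n F).
Local Notation m := (n + n).+1.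
Local Notation extremal := (extremal n k F DF x0 Da beta).
Local Notation Jb := (J k a beta).
Local Notation xpcn := (xpc n).
Local Notation embn := (emb n).

Lemma germ_gan_comp (f : E -> R) (z : E -> E) : gan n f -> (forall y, f (res n y) = f y) ->
  (forall i, (i < n)%N -> germ n (fun h => z h i)) -> germ n (fun h => f (z h)).
Proof.
move=> af fr gz; set c := z (fun=> 0).
have gp : gmap n n (fun i h => z h i - c i).
  by move=> i ni; split; [apply: germ_sub; [exact: gz|exact: germ_cst]|rewrite subrr].
have := germ_comp (af c) gp; congr germ; apply/funext => h.
rewrite -fr -[RHS]fr; congr f; apply/funext => i; rewrite /res /sub; case ni: (i < n)%N => //.
by rewrite addrC subrK.
Qed.

(** For v near u the parameter is h = q(0) - p(0), and g(h) is the cost of the shadowing control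
    [w h]. Both the error of the cost and the slope of g at h are controlled by the gradient at v,
    because v and [w h] differ by a multiple of its norm. *)
Lemma critical_reduction u x p : extremal u x p -> nu k (gradu u x p) = 0 ->
  exists g, germ n g /\ exists D r : R, [/\ 0 < D, 0 < r & forall v y q, extremal v y q ->
    nu k (fun s j => v s j - u s j) < r -> exists h,
    [/\ dom (wt n (D * nu k (fun s j => v s j - u s j))) h,
        nu k (gradu v y q) <= D * nu k (fun s j => v s j - u s j),
        `|Jb v y - g h| <= D * nu k (gradu v y q) ^+ 2 &
        slope_le n g h (D * nu k (gradu v y q))]].
Proof.
move=> eu g0; have [cu tx ap] := eu.
have [c Hc] := reference_flow hF L0 b0 eu g0.
have [Dh Hh] := hfield_C2 hF; have [Dw Hw] := hctl_C2 hF.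
have emb0 i : embn i (fun=> 0 : R) = 0 by rewrite /emb; case: ifP.
have [C0 [Z [C00 [HZ HZlip Hclose]]]] := clipped_flow Hh Hc (@emb_l1 R n) emb0.
have gemb i : (i < m)%N -> germ n (embn i : E -> R).
  move=> _; rewrite /emb; case ii: (n <= i < n + n)%N; last exact: germ_cst.
  exact: germ_var.
have gZ := flow_germ Hh Hc gemb C00 HZ Hclose.
have [rho0 [r00 Hr]] := cont_bounded (cont_l1 (solves_cont Hc)).
pose Rz := rho0 + 1.
have Rz0 : 0 <= Rz by rewrite addr_ge0.
have Zb h s : C0 * l1 n h <= 1 -> 0 <= s <= 1 -> l1 m (Z h s) <= Rz.
  move=> hC s01; have /I01P Is := s01; have := Hr s Is; rewrite ger0_norm ?l1_ge0// => h1.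
  have h2 := le_trans (Hclose h s s01) hC.
  have -> : l1 m (Z h s) = l1 m (fun i => xpcn (x s) (p s) (c s) i + (Z h s i - xpcn (x s) (p s) (c s) i)).
    by apply: eq_bigr => i _; rewrite addrC subrK.
  by apply: le_trans (l1D _ _ _) _; exact: lerD.
have [K [K0 HK]] := @C2_smooth_fam R m k 1 (fun j _ z => hctlF z j) (fun j _ => Dw j) Rz (fun j _ jk _ => Hw j jk).
pose w h s j := hctlF (Z h s) j.
have cw h : C0 * l1 n h <= 1 -> ctrl k (w h).
  move=> hC j jk; apply: sq_cont.
  by have [] := @C2_cont R m _ _ (Z h) (Hw j jk) (solves_cont (HZ h hC)).
have tw h : C0 * l1 n h <= 1 -> is_traj (w h) (Z h).
  move=> hC; have [H1 H2] := HZ h hC; split=> [i ni|t i t01 ni].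
    have := H1 i (leqW (leq_trans ni (leq_addr n n))); rewrite /hfield ni; exact.
  rewrite (H2 t i t01 (leqW (leq_trans ni (leq_addr n n)))) /zinit xpc_x// /emb leqNgt ni/= addr0.
  by congr (_ + _); apply: vol_eq => s _; rewrite /hfield ni.
(* Accumulated running cost plus final cost: by [Jg] this is the cost of the control [w h], as a
   function of the endpoint of the flow. *)
pose g h := Z h 1 (n + n)%N + beta * a (Z h 1).
have one : 0 <= (1 : R) <= 1 by rewrite ler01 lexx.
have Jg h : C0 * l1 n h <= 1 -> Jb (w h) (Z h) = g h.
  move=> hC; rewrite /J /g; congr (_ + _); have [_ H2] := HZ h hC.
  rewrite (H2 1 _ one (ltnSn _)) /zinit xpc_c /emb ltnn andbF !add0r (vol_full false).
  rewrite /n2 -IntZ; last exact: ctrl_L1 (cw h hC).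
  by apply: Int_eq => s _; rewrite /hfield ltnNge leq_addr/= ltnn.
have gg : germ n g.
  apply: germ_add; first exact: gZ.
  apply: germ_mul; first exact: germ_cst.
  have [aa _ ar _ _] := ha; apply: (@germ_gan_comp a (fun h => Z h 1)) => // i ni.
  by apply: gZ; rewrite ltnS ltnW// (leq_trans ni (leq_addr n n)).
exists g; split=> //.
have wK h s j : C0 * l1 n h <= 1 -> I01 s -> (j < k)%N -> `|w h s j| <= K.
  move=> hC /I01P s01 jk; have hb := Zb h s hC s01.
  by have [hh _ _ _ _] := HK j 0%N jk isT _ _ hb hb.
have kK : 0 <= k%:R * K ^+ 2 by rewrite mulr_ge0// sqr_ge0.
have nu0 := nu_ge0 k u.
(* One radius for u, for all v within distance 1 and for all [w h]; B >= 1 gives k K^2 <= B <=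
   B^2. *)
pose B := nu k u + 1 + k%:R * K ^+ 2.
have B1 : 1 <= B by rewrite /B; lra.
have B0 : 0 <= B by lra.
have wB h : C0 * l1 n h <= 1 -> n2 k (w h) <= B ^+ 2.
  move=> hC; apply: (@le_trans _ _ (k%:R * K ^+ 2)); last first.
    by apply: (@le_trans _ _ B); [rewrite /B; lra|rewrite expr2 ler_peMr].
  rewrite -[leRHS]Int_cst; apply: Int_le; [exact: ctrl_L1 (cw h hC)|exact: L1_cst|move=> s Is].
  rewrite -[k in leRHS]card_ord mulr_natl -sumr_const; apply: ler_sum => j _.
  rewrite -(real_normK (num_real (w h s j))); apply: lerXn2r; rewrite ?nnegrE ?(ltW K0)//.
  exact: wK.
have [Ce [Ce0 HCe]] := adjoint_estimates x0 hF ha L0 hL b0 B0.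
have [C2 [C20 HC2]] := second_order x0 hF ha L0 hL b0 B0.
have [Cg [Cg0 HCg]] := gradient_lipschitz x0 hF ha L0 hL b0 B0.
have [Cs [Cs0 HCs]] := shadowing x0 hF ha L0 hL b0 B0 Rz0.
pose La := 2 * (k%:R * (K * C0)).
have La0 : 0 <= La by rewrite /La !mulr_ge0 ?(ltW K0) ?(ltW C00).
have wlip h h' : C0 * l1 n h <= 1 -> C0 * l1 n h' <= 1 ->
    nu k (fun s j => w h s j - w h' s j) <= La * l1 n (fun i => h i - h' i).
  move=> hC hC'; set l := l1 n (fun i => h i - h' i).
  have M0 : 0 <= K * (C0 * l) := mulr_ge0 (ltW K0) (mulr_ge0 (ltW C00) (l1_ge0 _ _)).
  have c0 : ctrl k (fun _ _ => 0 : R) by move=> j _; exact: sq_cst.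
  apply: le_trans (nu_pointwise (ctrlB (cw h hC) (cw h' hC')) c0 M0 _) _.
    move=> s j /I01P s01 jk; rewrite normr0 add0r.
    have [_ _ hh _ _] := HK j 0%N jk isT _ _ (Zb h' s hC' s01) (Zb h s hC s01); apply: le_trans hh _.
    by apply: ler_wpM2l; [exact: ltW|exact: HZlip].
  have -> : nu k (fun _ _ => 0 : R) = 0.
    rewrite /nu /n2; have -> : (fun s : R => \sum_(j < k) (0 : R) ^+ 2) = (fun=> 0).
      by apply/funext => s; apply: big1 => j _; rewrite expr0n.
    by rewrite Int_cst sqrtr0.
  by rewrite add0r /La -!mulrA.
have nla : 0 <= n%:R * La by rewrite mulr_ge0.
have S0 : 0 <= n%:R * La * (1 + Cg * Cs).
  by apply: mulr_ge0 => //; rewrite addr_ge0// mulr_ge0// ltW.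
have CC0 : 0 <= C2 * Cs ^+ 2 by rewrite mulr_ge0 ?sqr_ge0// ltW.
(* One constant above those of the four conclusions: size of h, size of the gradient, error of the
   cost, slope. *)
pose D := 1 + Ce + Cg + (Cs + C2 * Cs ^+ 2) + n%:R * La * (1 + Cg * Cs).
have [DCe DCg DCs DLa D0] : [/\ Ce <= D, Cg <= D, Cs + C2 * Cs ^+ 2 <= D, n%:R * La * (1 + Cg * Cs) <= D & 0 < D].
  by rewrite /D; clear -n k F DF x0 a Da beta L hF ha L0 hL b0 Ce0 Cg0 Cs0 CC0 S0; split; lra.
have CCe : 0 < 2 * (C0 * Ce) by rewrite !mulr_gt0.
(* The radius forces C0 |h| <= 1/2, leaving the other half for the increment in the slope
   estimate. *)
exists D, (Num.min 1 (2 * (C0 * Ce))^-1); split=> //; first by rewrite lt_min ltr01 invr_gt0.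
move=> v y q ev; have [cv ty aq] := ev.
have cvu := ctrlB cv cu.
set e := nu k (fun s j => v s j - u s j); have e0 : 0 <= e by exact: nu_ge0.
rewrite lt_min => /andP[e1]; rewrite -[_^-1]mul1r ltr_pdivlMr// => eC.
have uB : n2 k u <= B ^+ 2 by rewrite -nu_le// /B; clear -n k F DF x0 a Da beta L hF ha L0 hL b0 kK; lra.
have vB : n2 k v <= B ^+ 2.
  by rewrite -nu_le//; apply: le_trans (nu_sub_le cv cu) _; rewrite -/e /B; clear -n k F DF x0 a Da beta L hF ha L0 hL b0 e1 kK; lra.
have ve : n2 k (fun s j => v s j - u s j) <= e ^+ 2 by rewrite nu_sqr.
have h01 : 0 <= (0 : R) <= 1 by rewrite lexx ler01.
have [_ /(_ u x p e cu uB tx ap e0 ve 0 h01)[_ hqp]] := HCe v y q cv vB ty aq.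
pose h : E := fun i => if (i < n)%N then q 0 i - p 0 i else 0.
have hl : l1 n h = l1 n (fun i => q 0 i - p 0 i).
  by apply: eq_bigr => i _; rewrite /h ltn_ord.
have hle : l1 n h <= Ce * e by rewrite hl.
have hC2 : C0 * l1 n h <= 2^-1.
  by have h1 := ler_wpM2l (ltW C00) hle; clear -n k F DF x0 a Da beta L hF ha L0 hL b0 h1 eC; lra.
have hC : C0 * l1 n h <= 1 by clear -n k F DF x0 a Da beta L hF ha L0 hL b0 hC2; lra.
set om := nu k (gradu v y q); have om0 : 0 <= om by exact: nu_ge0.
have cgv := grad_ctrl hF cv ty aq; have cgu := grad_ctrl hF cu tx ap.
have ome : om <= Cg * e.
  apply: le_trans (nu_sub_le cgv cgu) _; rewrite g0 add0r nu_le; last by rewrite mulr_ge0// ltW.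
  exact: (HCg v y q u x p e).
have vw : nu k (fun s j => v s j - w h s j) <= Cs * om.
  apply: (HCs v y q (Z h) (w h)) => //; [|by move=> s s01; exact: Zb|exact: cw].
  have [H1 H2] := HZ h hC; split=> // t i t01 im; rewrite (H2 t i t01 im); congr (_ + _).
  rewrite /zinit /emb; case: (ltnP i n) => ni /=; first by rewrite !xpc_x// addr0.
  rewrite /xpc ltnNge ni/=; case: (ltnP i (n + n)) => inn; last by rewrite addr0.
  by rewrite /h ltn_subLR// inn addrC subrK.
have Cso : 0 <= Cs * om by rewrite mulr_ge0// ltW.
have wv2 : n2 k (fun s j => w h s j - v s j) <= (Cs * om) ^+ 2 by rewrite -nu_le// nuN.
exists h; split.
- move=> i; rewrite /wt; case: ltnP => ni; last by rewrite /h ltnNge ni/= normr0.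
  apply: le_trans (l1_coord h ni) _; apply: le_trans hle _.
  exact: ler_wpM2r e0 _ _ DCe.
- by apply: le_trans ome _; exact: ler_wpM2r e0 _ _ DCg.
- rewrite -(Jg h hC) distrC.
  have := HC2 v y q (w h) (Z h) (Cs * om) cv vB ty aq (cw h hC) (wB h hC) (tw h hC) Cso wv2.
  rewrite -/(Jb v y) -/(Jb (w h) (Z h)) -/(ip k (gradu v y q) (fun s j => w h s j - v s j)) => h1.
  have h2 := ip_le cgv (ctrlB (cw h hC) cv).
  have h3 : nu k (gradu v y q) * nu k (fun s j => w h s j - v s j) <= om * (Cs * om).
    by apply: (ler_wpM2l om0); rewrite nuN.
  have h4 := le_trans h2 h3.
  set A := Jb (w h) (Z h) - Jb v y in h1 *; set I := ip _ _ _ in h1 h4.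
  have -> : A = (A - I) + I by rewrite subrK.
  apply: le_trans (ler_normD _ _) _; apply: le_trans (lerD h1 h4) _.
  have -> : C2 * (Cs * om) ^+ 2 + om * (Cs * om) = (Cs + C2 * Cs ^+ 2) * om ^+ 2 by ring.
  by apply: ler_wpM2r DCs; exact: sqr_ge0.
(* The second-order expansion is applied once more, now based at [w h], whose gradient is at most (1
   + Cg Cs) times that of v because the gradient is Lipschitz. *)
- have [ph aph] := adj_exists Da beta hF (cw h hC) (tw h hC).
  have cgw := grad_ctrl hF (cw h hC) (tw h hC) aph.
  have gw : nu k (gradu (w h) (Z h) ph) <= (1 + Cg * Cs) * om.
    apply: le_trans (nu_sub_le cgw cgv) _; rewrite mulrDl mul1r lerD2l -mulrA.
    rewrite nu_le; last by rewrite mulr_ge0// ltW.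
    exact: (HCg (w h) (Z h) ph v y q (Cs * om) (cw h hC) (wB h hC) (tw h hC) aph cv vB ty aq Cso wv2).
  exists (C2 * (n%:R * La) ^+ 2), (2 * (C0 * (n%:R + 1)))^-1.
  have n1 : 0 < 2 * (C0 * (n%:R + 1)) by rewrite !mulr_gt0// ltr_wpDl.
  split; first by rewrite invr_gt0.
  move=> h' m' /andP[m0 md] dh'.
  have md' : m' * (2 * (C0 * (n%:R + 1))) <= 1 by rewrite -ler_pdivlMr// mul1r.
  have l' : l1 n h' <= n%:R * m' by apply: l1_le => i ni; have := dh' i; rewrite /wt ni.
  have hC' : C0 * l1 n (fun i => h i + h' i) <= 1.
    have h1 := ler_wpM2l (ltW C00) (l1D n h h').
    have h2 := ler_wpM2l (ltW C00) l'; have h3 := mulr_ge0 (ltW C00) m0.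
    by rewrite mulrDr in h1; clear -n k F DF x0 a Da beta L hF ha L0 hL b0 h1 h2 h3 hC2 md'; lra.
  have ww : nu k (fun s j => w (fun i => h i + h' i) s j - w h s j) <= n%:R * La * m'.
    apply: le_trans (wlip _ _ hC' hC) _.
    have -> : l1 n (fun i => h i + h' i - h i) = l1 n h' by apply: eq_bigr => i _; rewrite addrC addKr.
    by rewrite [leRHS]mulrAC mulrC; apply: ler_wpM2r.
  have nm : 0 <= n%:R * La * m' by exact: mulr_ge0.
  rewrite -(Jg _ hC') -(Jg h hC).
  have ww2 : n2 k (fun s j => w (fun i => h i + h' i) s j - w h s j) <= (n%:R * La * m') ^+ 2 by rewrite -nu_le.
  have := HC2 (w h) (Z h) ph _ (Z (fun i => h i + h' i)) (n%:R * La * m') (cw h hC) (wB h hC) (tw h hC) aph (cw _ hC') (wB _ hC') (tw _ hC') nm ww2.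
  set I := Int _ => h1.
  have h2 : `|I| <= (1 + Cg * Cs) * om * (n%:R * La * m').
    apply: le_trans (ip_le cgw (ctrlB (cw _ hC') (cw h hC))) _.
    by apply: ler_pM gw ww; exact: nu_ge0.
  rewrite -/(Jb _ (Z (fun i => h i + h' i))) -/(Jb _ (Z h)) in h1.
  set A := Jb _ _ - Jb _ _ in h1 *.
  have -> : A = (A - I) + I by rewrite subrK.
  apply: le_trans (ler_normD _ _) _; apply: le_trans (lerD h1 h2) _; rewrite addrC; apply: lerD.
    have -> : (1 + Cg * Cs) * om * (n%:R * La * m') = n%:R * La * (1 + Cg * Cs) * (om * m') by ring.
    by rewrite -(mulrA D); apply: ler_wpM2r DLa; exact: mulr_ge0.
  by rewrite exprMn mulrA.
Qed.

End CriticalReduction.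

(** * The gradient inequality for extremals *)

Section Core.
Variable R : realType.
Notation E := (nat -> R).
Variables (n k : nat) (F : nat -> nat -> E -> R) (DF : nat -> nat -> nat -> E -> R) (x0 : E).
Variables (a : E -> R) (Da : nat -> E -> R) (beta L : R).
Hypothesis hF : forall i j, (i < n)%N -> (j < k)%N -> C2 n (F i j) (DF i j).
Hypothesis ha : C2 n a Da.
Hypothesis L0 : 0 <= L.
Hypothesis hL : forall i j z z', (i < n)%N -> (j < k)%N -> `|F i j z - F i j z'| <= L * l1 n (fun l => z l - z' l).
Hypothesis b0 : 0 <= beta.
Local Notation gradu := (grad n F).
Local Notation extremal := (extremal n k F DF x0 Da beta).
Local Notation Jb := (J k a beta).

Definition gradient_inequality (u x p : R -> E) : Prop :=
  exists r C gamma : R, [/\ 0 < r, 0 < C, 1 < gamma <= 2 & forall v y q, extremal v y q ->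
    nu k (fun s j => v s j - u s j) < r -> `|Jb v y - Jb u x| <= C * powR (nu k (gradu v y q)) gamma].

(** Where the gradient stays above G / 2, its power is bounded below and any bounded cost difference
    is dominated; gamma = 2 serves. *)
Lemma regular_gradient_inequality u x p : extremal u x p -> 0 < nu k (gradu u x p) ->
  gradient_inequality u x p.
Proof.
move=> [cu tx ap] g0; set G := nu k (gradu u x p) in g0 *.
pose B := nu k u + 1; have nu0 := nu_ge0 k u.
have B0 : 0 <= B by rewrite /B; lra.
have [C2 [C20 HC2]] := second_order x0 hF ha L0 hL b0 B0.
have [Cg [Cg0 HCg]] := gradient_lipschitz x0 hF ha L0 hL b0 B0.
have cgu := grad_ctrl hF cu tx ap.
have M0 : 0 < G + C2 by exact: addr_gt0.
have G2 : 0 < (G / 2) ^+ 2 by rewrite exprn_gt0// divr_gt0.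
(* The radius keeps the gradient above G / 2; the constant is the bound G + C2 of the cost
   difference divided by (G / 2)^2. *)
exists (Num.min 1 (G / (2 * Cg))), ((G + C2) / (G / 2) ^+ 2), 2; split.
- by rewrite lt_min ltr01 divr_gt0// mulr_gt0.
- exact: divr_gt0.
- lra.
move=> v y q [cv ty aq]; set e := nu k (fun s j => v s j - u s j).
have e0 : 0 <= e by exact: nu_ge0.
rewrite lt_min => /andP[e1 eG].
have uB : n2 k u <= B ^+ 2 by rewrite -nu_le// /B; lra.
have vB : n2 k v <= B ^+ 2.
  by rewrite -nu_le//; apply: le_trans (nu_sub_le cv cu) _; rewrite -/e /B; lra.
have ve : n2 k (fun s j => v s j - u s j) <= e ^+ 2 by rewrite nu_sqr.
have uv : n2 k (fun s j => u s j - v s j) <= e ^+ 2 by rewrite -nu_le// nuN.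
have cgv := grad_ctrl hF cv ty aq; set om := nu k (gradu v y q).
have hG : G / 2 <= om.
  have h1 := nu_sub_le cgu cgv.
  have h2 : nu k (fun s j => gradu u x p s j - gradu v y q s j) <= Cg * e.
    by rewrite nu_le; [exact: (HCg u x p v y q e)|rewrite mulr_ge0// ltW].
  have : Cg * e <= G / 2.
    by have := ltW eG; rewrite ler_pdivlMr ?mulr_gt0// => h3; lra.
  by rewrite -/G -/om in h1; lra.
have om0 : 0 <= om by exact: nu_ge0.
have -> : powR om 2 = om ^+ 2 by rewrite -powR_mulrn.
apply: (@le_trans _ _ (G + C2)); last first.
  rewrite mulrAC ler_pdivlMr//; apply: ler_wpM2l; first exact: ltW.
  by apply: lerXn2r; rewrite ?nnegrE ?divr_ge0 ?(ltW g0).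
have := HC2 u x p v y e cu uB tx ap cv vB ty e0 ve.
set I := Int _ => h1.
have h2 : `|I| <= G * e := ip_le cgu (ctrlB cv cu).
rewrite -/(Jb v y) -/(Jb u x) in h1; set A := Jb v y - Jb u x in h1 *.
have -> : A = (A - I) + I by rewrite subrK.
apply: le_trans (ler_normD _ _) _; apply: le_trans (lerD h1 h2) _; rewrite addrC; apply: lerD.
  by rewrite ler_piMr ?(ltW g0)// ltW.
by rewrite ler_piMr ?(ltW C20)// exprn_ile1// ltW.
Qed.

(** The (N-1)-st root of the Łojasiewicz inequality for g gives the exponent N / (N-1) = 1 + 1 /
    (N-1). The quadratic error of the reduction is of smaller order. *)
Lemma critical_gradient_inequality u x p : extremal u x p -> nu k (gradu u x p) = 0 ->
  gradient_inequality u x p.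
Proof.
move=> eu g0; have [cu _ _] := eu.
have [g [gg [D [r1 [D0 r10 H]]]]] := critical_reduction hF ha L0 hL b0 eu g0.
have [N [Cl [rl [N2 Cl0 rl0 Loj]]]] := lojasiewicz gg.
(* The reduction applied to u itself gives h = 0 and error 0. *)
have Ju : Jb u x = g (fun=> 0).
  have z0 : nu k (fun s j => u s j - u s j) = 0.
    apply/eqP; rewrite eq_le nu_ge0 andbT nu_le// expr0n /n2.
    have -> : (fun s => \sum_(j < k) (u s j - u s j) ^+ 2) = (fun=> 0).
      by apply/funext => s; apply: big1 => j _; rewrite subrr expr0n.
    by rewrite Int_cst.
  have [|h [dh _ hJ _]] := H u x p eu; first by rewrite z0.
  have h0 : h = (fun=> 0).
    apply/funext => i; apply/eqP; rewrite -normr_le0; apply: le_trans (dh i) _.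
    by rewrite z0 mulr0 /wt; case: ifP.
  apply/eqP; rewrite -subr_eq0 -normr_le0 -h0; apply: le_trans hJ _.
  by rewrite g0 expr0n mulr0.
have N1 : (0 < N.-1)%N by case: (N) N2 => [|[]].
have N10 : 0 < N.-1%:R :> R by rewrite ltr0n.
have NE : N%:R = N.-1%:R + 1 :> R by rewrite natr1 prednK// (leq_trans _ N2).
pose gamma : R := N%:R / N.-1%:R.
have gE : gamma = 1 + N.-1%:R^-1 by rewrite /gamma NE mulrDl mul1r divff ?gt_eqF.
have i1 : N.-1%:R^-1 <= 1 :> R by rewrite invf_le1// ler1n.
have i0 : 0 < N.-1%:R^-1 :> R by rewrite invr_gt0.
pose C1 := powR (Cl * D ^+ N) N.-1%:R^-1.
have C10 : 0 <= C1 by exact: powR_ge0.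
(* The entry rl / D puts h into the domain of the Łojasiewicz inequality; the entry 1 / D makes the
   gradient at most 1. *)
exists (Num.min r1 (Num.min (rl / D) D^-1)), (D + C1), gamma; split.
- by rewrite !lt_min r10 divr_gt0//= invr_gt0.
- by rewrite ltr_wpDr.
- by rewrite gE; lra.
move=> v y q ev; rewrite !lt_min => /and3P[e1 e2 e3].
have [h [dh ome hJ hs]] := H v y q ev e1.
set e := nu k _ in e1 e2 e3 dh ome; set om := nu k (gradu v y q) in ome hJ hs *.
have om0 : 0 <= om by exact: nu_ge0.
have om1 : om <= 1.
  by apply: le_trans ome _; move: e3; rewrite -[_^-1]mul1r ltr_pdivlMr// mulrC => /ltW.
have dh' : dom (wt n rl) h.
  by apply: dom_wt_le dh; rewrite mulrC -ler_pdivlMr// ltW.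
have Dom : 0 <= D * om by rewrite mulr_ge0// ltW.
have L1 := Loj h _ dh' Dom hs.
have h1 : `|g h - g (fun=> 0)| <= C1 * powR om gamma.
  set A := `|_| in L1 *; have A0 : 0 <= A by exact: normr_ge0.
  have -> : A = powR (A ^+ N.-1) N.-1%:R^-1.
    by rewrite -powR_mulrn// -powRrM mulfV ?gt_eqF// powRr1.
  have -> : C1 * powR om gamma = powR (Cl * (D * om) ^+ N) N.-1%:R^-1.
    rewrite exprMn mulrA powRM ?mulr_ge0 ?exprn_ge0 ?(ltW D0) ?(ltW Cl0)//; congr (_ * _).
    by rewrite -powR_mulrn// -powRrM.
  apply: ge0_ler_powR; rewrite ?nnegrE ?(ltW i0) ?exprn_ge0//.
  by rewrite mulr_ge0 ?exprn_ge0// ltW.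
(* Here the gradient is at most 1 and gamma <= 2. *)
have h2 : om ^+ 2 <= powR om gamma.
  have [->|on0] := eqVneq om 0; first by rewrite expr0n powR_ge0.
  rewrite -powR_mulrn//; apply: ger_powR.
    by rewrite lt_neqAle eq_sym on0 om0 om1.
  by rewrite gE; lra.
have -> : Jb v y - Jb u x = (Jb v y - g h) + (g h - g (fun=> 0)) by rewrite Ju; ring.
apply: le_trans (ler_normD _ _) _; rewrite mulrDl; apply: lerD => //.
by apply: le_trans hJ _; apply: ler_wpM2l => //; exact: ltW.
Qed.

Lemma lojasiewicz_gradient_inequality u x p : extremal u x p -> gradient_inequality u x p.
Proof.
move=> eu; have [g0|gn0] := eqVneq (nu k (gradu u x p)) 0; first exact: critical_gradient_inequality.
by apply: regular_gradient_inequality => //; rewrite lt_neqAle eq_sym gn0 nu_ge0.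
Qed.

End Core.

(** * The cost of a control in L2 *)

Section Interface.
Variable R : realType.
Notation E := (nat -> R).
Local Notation mu := (@lebesgue_measure R).
Local Notation I01 := (@I01 R).

Lemma mx_coord_le p q (M : 'M[R]_(p, q)) i j : `|M i j| <= `|M|.
Proof. by rewrite [leRHS]/Num.norm/= mx_normrE; apply/bigmax_geP; right => /=; exists (i, j). Qed.

Section VectorControls.
Variable k : nat.
Implicit Types U V W : R -> 'rV[R]_k.
Local Notation vc U := (fun s => vr (U s)).

Lemma sqnorm_ptE U s : sqnorm_pt U s = \sum_(j < k) vr (U s) j ^+ 2.
Proof. by apply: eq_bigr => j _; rewrite vrE. Qed.

Lemma inL2_ctrl U : inL2 U <-> ctrl k (vc U).
Proof.
split=> [[mU iU] j jk|cU].
  have mj (i : 'I_k) : measurable_fun I01 (fun t => vr (U t) i).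
    by under eq_fun do rewrite vrE; exact: mU.
  have ms : measurable_fun I01 (sqnorm_pt U).
    have -> : sqnorm_pt U = (fun t => \sum_(i < k) vr (U t) i * vr (U t) i).
      by apply/funext => t; rewrite sqnorm_ptE; apply: eq_bigr => i _; rewrite expr2.
    by apply: measurable_sum => i; exact: measurable_funM.
  have s0 t : 0 <= sqnorm_pt U t by apply: sumr_ge0 => i _; exact: sqr_ge0.
  have Ls : L1 (sqnorm_pt U).
    apply/integrableP; split; first exact/measurable_EFinP.
    by under eq_integral do rewrite /= ger0_norm//.
  split; first exact: (mj (Ordinal jk)).
  apply: (L1_dom _ _ Ls).
    under eq_fun do rewrite expr2.
    by apply: measurable_funM; exact: (mj (Ordinal jk)).
  move=> t _; rewrite ger0_norm ?sqr_ge0// sqnorm_ptE (bigD1 (Ordinal jk))//= lerDl.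
  by apply: sumr_ge0 => i _; exact: sqr_ge0.
split=> [i|].
  by have [h _] := cU i (ltn_ord i); under eq_fun do rewrite -vrE.
have -> : sqnorm_pt U = (fun s => \sum_(j < k) vr (U s) j ^+ 2) by apply/funext => s; exact: sqnorm_ptE.
exact: (@integrable_lty _ _ _ mu _ (@mI01 R) _ (ctrl_L1 cU)).
Qed.

Lemma L2normE U : L2norm U = nu k (vc U).
Proof.
rewrite /L2norm /nu /n2 /Int /Rintegral; congr (Num.sqrt (fine _)).
by apply: eq_integral => s _; rewrite sqnorm_ptE.
Qed.

Lemma vr_lin (c d : R) (v w : 'rV[R]_k) j : vr (c *: v + d *: w) j = c * vr v j + d * vr w j.
Proof.
have [jk|kj] := ltnP j k; last by rewrite !vr_out// !mulr0 addr0.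
by rewrite -[j]/(nat_of_ord (Ordinal jk)) !vrE !mxE.
Qed.

Lemma vrD (v w : 'rV[R]_k) j : vr (v + w) j = vr v j + vr w j.
Proof. by rewrite -[v]scale1r -[w]scale1r vr_lin !scale1r !mul1r. Qed.

Lemma vr_rv (w : E) j : (j < k)%N -> vr (rv k w) j = w j.
Proof. by move=> jk; rewrite rvK /res jk. Qed.

Lemma inL2_lin c d U V : inL2 U -> inL2 V -> inL2 (fun t => c *: U t + d *: V t).
Proof.
move=> /inL2_ctrl cU /inL2_ctrl cV; apply/inL2_ctrl => j jk.
under eq_fun do rewrite vr_lin.
by apply: sqD; apply: sqZ; [exact: cU|exact: cV].
Qed.

Lemma inL2_rv (w : R -> E) : ctrl k w -> inL2 (fun s => rv k (w s)).
Proof. by move=> cw; apply/inL2_ctrl => j jk; under eq_fun do rewrite vr_rv//; exact: cw. Qed.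

Lemma L2normZ c U : inL2 U -> 0 <= c -> L2norm (fun t => c *: U t + 0 *: U t) = c * L2norm U.
Proof.
move=> /inL2_ctrl cU c0; rewrite !L2normE /nu.
have -> : n2 k (vc (fun t => c *: U t + 0 *: U t)) = c ^+ 2 * n2 k (vc U).
  rewrite /n2 -IntZ; last exact: ctrl_L1 cU.
  apply: Int_eq => s _; rewrite mulr_sumr; apply: eq_bigr => j _.
  by rewrite vr_lin mul0r addr0 exprMn.
by rewrite sqrtrM ?sqr_ge0// sqrtr_sqr ger0_norm.
Qed.

(** Test both candidates on t W and let t tend to 0. The combination [t *: W + 0 *: W] matches the
    two-term linearity clause. Uniqueness identifies the differential picked by [xget]. *)
Lemma frechet_diff_unique (Jc : (R -> 'rV[R]_k) -> R) V D1 D2 :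
  is_frechet_diff Jc V D1 -> is_frechet_diff Jc V D2 -> forall W, inL2 W -> D1 W = D2 W.
Proof.
move=> [l1 [_ H1]] [l2 [_ H2]] W LW.
have W0 : 0 <= L2norm W by exact: sqrtr_ge0.
apply/eqP; rewrite -subr_eq0 -normr_le0; apply: (@limit0_le _ _ _ (2 * L2norm W) 1 ltr01) => e /andP[e0 _].
rewrite add0r; have [d1 [d10 {}H1]] := H1 e e0; have [d2 [d20 {}H2]] := H2 e e0.
pose t := Num.min d1 d2 / (L2norm W + 1).
have m0 : 0 < Num.min d1 d2 by rewrite lt_min d10.
have t0 : 0 < t by rewrite divr_gt0// ltr_wpDl.
have tW : t * L2norm W < Num.min d1 d2.
  by rewrite /t mulrAC ltr_pdivrMr ?ltr_wpDl// ltr_pM2l// ltrDl.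
have LtW := inL2_lin t 0 LW LW; have nt := L2normZ LW (ltW t0).
move: tW; rewrite lt_min => /andP[t1 t2].
have := H1 _ LtW; rewrite nt => /(_ t1); have := H2 _ LtW; rewrite nt => /(_ t2).
rewrite l1// l2// !mul0r !addr0; set A := Jc _ - _ => h2 h1.
rewrite -(ler_pM2l t0).
have -> : t * `|D1 W - D2 W| = `|(A - t * D2 W) - (A - t * D1 W)|.
  by rewrite -[X in X * _](gtr0_norm t0) -normrM; congr `|_|; ring.
apply: le_trans (ler_normB _ _) _; apply: le_trans (lerD h2 h1) _.
by rewrite le_eqVlt; apply/orP; left; apply/eqP; ring.
Qed.

End VectorControls.

(** * Translation of the cost, its differential and the dual norm *)

Section Cost.
Variables (n k : nat) (F : 'rV[R]_n -> 'M[R]_(n, k)) (x0 : 'rV[R]_n) (a : 'rV[R]_n -> R) (beta : R).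

(** Indices outside the matrix give 0, which frees the estimates from dependent index types. *)
Definition Fnat (i j : nat) (z : E) : R :=
  if insub i is Some i' then if insub j is Some j' then F (rv n z) i' j' else 0 else 0.

Definition anat (z : E) : R := a (rv n z).

Lemma FnatE (i : 'I_n) (j : 'I_k) (z : E) : Fnat i j z = F (rv n z) i j.
Proof. by rewrite /Fnat !valK. Qed.

Lemma rv_res (z : E) : rv n (res n z) = rv n z.
Proof. by apply/rowP => i; rewrite !mxE /res ltn_ord. Qed.

Lemma Fnat_C2 : (forall i j, real_analytic (fun x => F x i j)) ->
  exists DF : nat -> nat -> nat -> E -> R, forall i j, (i < n)%N -> (j < k)%N -> C2 n (Fnat i j) (DF i j).
Proof.
move=> aF; have ex (ij : nat * nat) : exists D, (ij.1 < n)%N -> (ij.2 < k)%N -> C2 n (Fnat ij.1 ij.2) D.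
  case: ij => i j /=; have [ni|ni] := boolP (i < n)%N; last by exists (fun _ _ => 0).
  have [jk|jk] := boolP (j < k)%N; last by exists (fun _ _ => 0).
  have e : Fnat i j = (fun z => F (rv n z) (Ordinal ni) (Ordinal jk)).
    by apply/funext => z; exact: (FnatE (Ordinal ni) (Ordinal jk)).
  have [|z|D H] := @gan_C2 R n (Fnat i j); last by exists D.
    by rewrite e; exact: (real_analytic_gan (aF (Ordinal ni) (Ordinal jk))).
  by rewrite e rv_res.
have /choice[D H] := ex; exists (fun i j => D (i, j)) => i j ni jk; exact: (H (i, j)).
Qed.

Lemma anat_C2 : real_analytic a -> exists Da, C2 n anat Da.
Proof.
move=> aa; apply: gan_C2; first exact: real_analytic_gan.
by move=> z; rewrite /anat rv_res.
Qed.

Lemma Fnat_lipschitz : (exists L : R, forall x y : 'rV[R]_n, `|F x - F y| <= L * `|x - y|) ->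
  exists L : R, 0 <= L /\ forall i j z z', (i < n)%N -> (j < k)%N ->
    `|Fnat i j z - Fnat i j z'| <= L * l1 n (fun l => z l - z' l).
Proof.
move=> [L HL]; exists `|L|; split=> // i j z z' ni jk.
rewrite -[i]/(nat_of_ord (Ordinal ni)) -[j]/(nat_of_ord (Ordinal jk)) !FnatE.
have -> : F (rv n z) (Ordinal ni) (Ordinal jk) - F (rv n z') (Ordinal ni) (Ordinal jk) =
  (F (rv n z) - F (rv n z')) (Ordinal ni) (Ordinal jk) by rewrite !mxE.
apply: le_trans (mx_coord_le _ _ _) _; apply: le_trans (HL _ _) _.
apply: (@le_trans _ _ (`|L| * `|rv n z - rv n z'|)); first by apply: ler_wpM2r => //; exact: ler_norm.
apply: ler_wpM2l => //.
have -> : rv n z - rv n z' = rv n (fun l => z l - z' l) by apply/rowP => l; rewrite !mxE.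
by apply: rv_norm_le => [|l ln]; [exact: l1_ge0|exact: (@l1_coord R n (fun l => z l - z' l))].
Qed.

Local Notation vc U := (fun s => vr (U s)).

Lemma field_sumE (U : R -> 'rV[R]_k) (z : E) s (i : 'I_n) :
  \sum_(j < k) Fnat i j z * vr (U s) j = \sum_(j < k) F (rv n z) i j * U s 0 j.
Proof. by apply: eq_bigr => j _; rewrite FnatE vrE. Qed.

Lemma traj_is_solution U x : is_traj n k Fnat (vr x0) (vc U) x -> is_solution F x0 U (fun s => rv n (x s)).
Proof.
move=> tx; have cx := solves_cont tx; have [H1 H2] := tx; split.
  apply/subspace_continuousP => s Is; apply/cvgrPdist_le => e e0.
  have [d [d0 Hd]] : exists d : R, 0 < d /\ forall t, 0 <= t <= d -> forall i, (i < n)%N ->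
      forall y, I01 y -> `|s - y| < t -> `|x s i - x y i| <= e.
    apply: (@common_radius R n (fun i t => forall y, I01 y -> `|s - y| < t -> `|x s i - x y i| <= e)) => i ni.
    have /contP/(_ s Is e e0)[d [d0 dP]] := cx i ni.
    by exists d; split=> // t /andP[_ td] y Iy sy; apply: dP => //; exact: lt_le_trans td.
  exists d => // y sy Iy /=.
  have -> : rv n (x s) - rv n (x y) = rv n (fun l => x s l - x y l) by apply/rowP => l; rewrite !mxE.
  apply: rv_norm_le => [|i ni]; first exact: ltW.
  by apply: (Hd d) => //; rewrite (ltW d0) lexx.
move=> i; split.
  have := H1 i (ltn_ord i); apply: eq_integrable => //; first exact: mI01.
  by move=> s _ /=; rewrite field_sumE.
move=> t t01; rewrite !mxE (H2 t i t01 (ltn_ord i)) vrE; congr (_ + _).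
by apply: eq_Rintegral => s _; rewrite field_sumE.
Qed.

Lemma solution_is_traj U X : is_solution F x0 U X -> is_traj n k Fnat (vr x0) (vc U) (vc X).
Proof.
move=> [_ H]; split=> [i ni|t i t01 ni].
  have [h _] := H (Ordinal ni); move: h; apply: eq_integrable => //; first exact: mI01.
  by move=> s _ /=; rewrite (@field_sumE U (vr (X s)) s (Ordinal ni)) vrK.
have [_ /(_ t t01) h] := H (Ordinal ni).
rewrite -[i]/(nat_of_ord (Ordinal ni)) !vrE h; congr (_ + _).
by apply: eq_Rintegral => s _; rewrite field_sumE vrK.
Qed.

Variables (DF : nat -> nat -> nat -> E -> R) (Da : nat -> E -> R) (L : R).
Hypothesis hF : forall i j, (i < n)%N -> (j < k)%N -> C2 n (Fnat i j) (DF i j).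
Hypothesis ha : C2 n anat Da.
Hypothesis L0 : 0 <= L.
Hypothesis hL : forall i j z z', (i < n)%N -> (j < k)%N ->
  `|Fnat i j z - Fnat i j z'| <= L * l1 n (fun l => z l - z' l).
Hypothesis b0 : 0 <= beta.
Local Notation extremal := (extremal n k Fnat DF (vr x0) Da beta).
Local Notation gradu := (grad n Fnat).
Local Notation cost := (cost F x0 a beta).

Lemma traj_is_traj U : inL2 U -> is_traj n k Fnat (vr x0) (vc U) (vc (traj F x0 U)).
Proof.
move=> /inL2_ctrl cU; apply: solution_is_traj.
have [x tx] := traj_exists (vr x0) hF L0 hL cU.
have := xgetPex (fun=> x0) (ex_intro [set x | is_solution F x0 U x] _ (traj_is_solution tx)).
exact.
Qed.

Lemma costE U : cost U = J k anat beta (vc U) (vc (traj F x0 U)).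
Proof. by rewrite /Defs.cost /J L2normE nu_sqr /anat vrK. Qed.

Lemma extremal_exists U : inL2 U -> exists p, extremal (vc U) (vc (traj F x0 U)) p.
Proof.
move=> LU; have tU := traj_is_traj LU; have /inL2_ctrl cU := LU.
by have [p ap] := adj_exists Da beta hF cU tU; exists p.
Qed.

Lemma cost_differentiable V q : inL2 V -> extremal (vc V) (vc (traj F x0 V)) q ->
  is_frechet_diff cost V (fun W => ip k (gradu (vc V) (vc (traj F x0 V)) q) (vc W)).
Proof.
move=> LV [cV tV aV]; set y := vc (traj F x0 V); set G := gradu _ _ _.
have cG : ctrl k G by exact: (grad_ctrl hF cV tV aV).
split; [|split].
- move=> w1 w2 c d /inL2_ctrl c1 /inL2_ctrl c2.
  have I1 := ip_L1 cG c1; have I2 := ip_L1 cG c2.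
  rewrite /ip -(IntZ c I1) -(IntZ d I2) -(IntD (L1Z c I1) (L1Z d I2)).
  apply: Int_eq => s _; rewrite !mulr_sumr -big_split; apply: eq_bigr => j _ /=.
  by rewrite vr_lin; ring.
- exists (nu k G) => w /inL2_ctrl cw; rewrite L2normE; exact: ip_le.
- move=> e e0; pose B := nu k (vc V) + 1; have nu0 := nu_ge0 k (vc V).
  have B0 : 0 <= B by rewrite /B; lra.
  have [C2 [C20 HC2]] := second_order (vr x0) hF ha L0 hL b0 B0.
  exists (Num.min 1 (e / C2)); split; first by rewrite lt_min ltr01 divr_gt0.
  move=> W LW; rewrite L2normE lt_min => /andP[W1 We]; have /inL2_ctrl cW := LW.
  have LVW : inL2 (fun t => V t + W t).
    by have := inL2_lin 1 1 LV LW; congr inL2; apply/funext => t; rewrite !scale1r.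
  have /inL2_ctrl cVW := LVW.
  have W0 := nu_ge0 k (vc W).
  have VWE : n2 k (vc (fun t => V t + W t)) = n2 k (fun s j => vr (V s) j + vr (W s) j).
    by apply: n2_eq => s j _ _; rewrite vrD.
  have VB : n2 k (vc V) <= B ^+ 2 by rewrite -nu_le// /B; lra.
  have VWB : n2 k (vc (fun t => V t + W t)) <= B ^+ 2.
    rewrite VWE -nu_le//; apply: le_trans (nuD cV cW) _; rewrite /B; lra.
  have dW : n2 k (fun s j => vr (V s + W s) j - vr (V s) j) = n2 k (vc W).
    by apply: n2_eq => s j _ _; rewrite vrD addrC addKr.
  have dWe : n2 k (fun s j => vr (V s + W s) j - vr (V s) j) <= nu k (vc W) ^+ 2 by rewrite dW nu_sqr.
  have := HC2 (vc V) y q (vc (fun t => V t + W t)) (vc (traj F x0 (fun t => V t + W t))) (nu k (vc W))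
     cV VB tV aV cVW VWB (traj_is_traj LVW) W0 dWe.
  rewrite !costE -/y -/G => h.
  have -> : ip k G (vc W) = Int (fun s => \sum_(j < k) G s j * (vr (V s + W s) j - vr (V s) j)).
    by apply: Int_eq => s _; apply: eq_bigr => j _; rewrite vrD addrC addKr.
  apply: le_trans h _; rewrite expr2 mulrA; apply: ler_wpM2r => //.
  by rewrite mulrC -ler_pdivlMr// ltW.
Qed.

(** Evaluate the differential at the normalised gradient, or at 0 if the gradient vanishes.
    Cauchy-Schwarz bounds the set, so that the supremum dominates this value. *)
Lemma dual_norm_ge V q : inL2 V -> extremal (vc V) (vc (traj F x0 V)) q ->
  nu k (gradu (vc V) (vc (traj F x0 V)) q) <= dual_norm (frechet_diff cost V).
Proof.
move=> LV eV; have cd := cost_differentiable LV eV; have [cV tV aV] := eV.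
set G := gradu _ _ _ in cd *.
have cG : ctrl k G by exact: (grad_ctrl hF cV tV aV).
have fd : is_frechet_diff cost V (frechet_diff cost V).
  exact: (xgetPex (fun _ => 0) (ex_intro [set D | is_frechet_diff cost V D] _ cd)).
have DE W : inL2 W -> frechet_diff cost V W = ip k G (vc W).
  by move=> LW; exact: (frechet_diff_unique fd cd LW).
have ub : has_ubound [set `|frechet_diff cost V w| | w in [set w | inL2 w /\ L2norm w <= 1]].
  exists (nu k G) => _ [w [Lw w1] <-]; rewrite DE//; have /inL2_ctrl cw := Lw.
  apply: le_trans (ip_le cG cw) _; rewrite -L2normE ler_piMr//; exact: nu_ge0.
have [G0|Gn0] := eqVneq (nu k G) 0.
  have L0' : inL2 (fun _ : R => 0 : 'rV[R]_k).
    have := inL2_lin 0 0 LV LV; congr inL2; apply/funext => t; by rewrite !scale0r addr0.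
  rewrite G0; apply: le_trans (normr_ge0 (frechet_diff cost V (fun=> 0))) _.
  apply: ub_le_sup => //; exists (fun=> 0) => //; split=> //.
  have := L2normZ LV (lexx 0); rewrite mul0r.
  have -> : (fun t => 0 *: V t + 0 *: V t) = (fun=> 0) by apply/funext => t; rewrite !scale0r addr0.
  by move=> ->.
have Gp : 0 < nu k G by rewrite lt_neqAle eq_sym Gn0 nu_ge0.
pose c := (nu k G)^-1.
have cw : ctrl k (fun s j => c * G s j) by exact: ctrlZ.
pose W s := rv k (fun j => c * G s j).
have LW : inL2 W by exact: inL2_rv.
have ipW : ip k G (vc W) = nu k G.
  have -> : ip k G (vc W) = c * n2 k G.
    rewrite /ip /n2 -IntZ; last exact: ctrl_L1.
    apply: Int_eq => s _; rewrite mulr_sumr; apply: eq_bigr => j _.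
    by rewrite vr_rv//; ring.
  by rewrite -nu_sqr /c expr2 mulrA mulVf ?mul1r.
have nW : L2norm W <= 1.
  rewrite L2normE nu_le// expr1n.
  have -> : n2 k (vc W) = c ^+ 2 * n2 k G.
    rewrite /n2 -IntZ; last exact: ctrl_L1.
    apply: Int_eq => s _; rewrite mulr_sumr; apply: eq_bigr => j _.
    by rewrite vr_rv// exprMn.
  by rewrite -nu_sqr -exprMn /c mulVf// expr1n.
apply: le_trans (ler_norm _) _; rewrite -[X in `|X|]ipW -DE//.
by apply: ub_le_sup => //; exists W.
Qed.

End Cost.
End Interface.

Theorem mainTheorem13 (R : realType) (n k : nat)
  (F : 'rV[R]_n -> 'M[R]_(n, k)) (x0 : 'rV[R]_n) (a : 'rV[R]_n -> R) :
  (exists L : R, forall x y : 'rV[R]_n, `|F x - F y| <= L * `|x - y|) ->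
  (forall x, 0 <= a x) ->
  (forall (i : 'I_n) (j : 'I_k), real_analytic (fun x => F x i j)) ->
  real_analytic a ->
  forall beta : R, 0 < beta ->
  forall u : R -> 'rV[R]_k, inL2 u ->
  exists r : R, 0 < r /\ exists C : R, 0 < C /\ exists gamma : R,
    1 < gamma <= 2 /\
    forall v : R -> 'rV[R]_k, inL2 v -> L2norm (fun t => v t - u t) < r ->
      `|cost F x0 a beta v - cost F x0 a beta u|
        <= C * powR (dual_norm (frechet_diff (cost F x0 a beta) v)) gamma.
Proof.
move=> lF _ aF aa beta b0 u Lu.
have [L [L0 hL]] := Fnat_lipschitz lF.
have [DF hF] := Fnat_C2 aF; have [Da ha] := anat_C2 aa.
have [p eu] := extremal_exists x0 beta Da hF L0 hL Lu.
have [r [C [gamma [r0 C0 g12 H]]]] := lojasiewicz_gradient_inequality hF ha L0 hL (ltW b0) eu.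
exists r; split=> //; exists C; split=> //; exists gamma; split=> // v Lv vr.
have [q ev] := extremal_exists x0 beta Da hF L0 hL Lv.
rewrite !costE; apply: le_trans (H _ _ _ ev _) _.
  move: vr; rewrite L2normE; congr (_ < _); congr Num.sqrt; apply: n2_eq => s j _ _.
  by rewrite vrB.
(* The dual norm dominates the norm of the gradient, and the power gamma > 0 is monotone. *)
apply: ler_wpM2l; first exact: ltW.
have hd := dual_norm_ge hF ha L0 hL (ltW b0) Lv ev.
case/andP: g12 => g1 _; apply: ge0_ler_powR; rewrite ?nnegrE//; first by apply: ltW; apply: lt_trans g1.
  exact: nu_ge0.
by apply: le_trans hd; exact: nu_ge0.
Qed.
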